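(* Let $p$ be $\infty$ or a prime number, $K$ a number field, and $\Omega=(\omega_{ij})$ an $n\times n$ matrix with nonnegative integer entries. Let $f_{ij}(\mathbf{z}),g_h(\mathbf{z})\in K[[z_1,\ldots,z_n]]$ ($1\leq i\leq l$, $1\leq j\leq n(i)$, $1\leq h\leq m$) with $g_h(\mathbf{0})\neq0$ converge in an $n$-polydisc $U$ around the origin of $\mathbb{C}_p^n$, and suppose that $$\mathbf{f}_i(\mathbf{z})=A_i\mathbf{f}_i(\Omega\mathbf{z})+\mathbf{b}_i(\mathbf{z})\ (1\leq i\leq l),\qquad g_h(\mathbf{z})=e_h(\mathbf{z})g_h(\Omega\mathbf{z})\ (1\leq h\leq m),$$ where $\mathbf{f}_i(\mathbf{z})={}^t(f_{i1}(\mathbf{z}),\ldots,f_{in(i)}(\mathbf{z}))$, $\mathbf{b}_i(\mathbf{z})={}^t(b_{i1}(\mathbf{z}),\ldots,b_{in(i)}(\mathbf{z}))\in\overline{\mathbb{Q}}(z_1,\ldots,z_n)^{n(i)}$, $e_h(\mathbf{z})\in\overline{\mathbb{Q}}(z_1,\ldots,z_n)$, and $A_i\in GL_{n(i)}(\overline{\mathbb{Q}})$ is lower triangular with all diagonal entries equal to $a_i\neq0$, with entries $a^{(i)}_{st}$ ($s>t$) below the diagonal, and with $a^{(i)}_{s\,s-1}\neq0$ for $2\leq s\leq n(i)$. Let $\boldsymbol{\alpha}=(\alpha_1,\ldots,\alpha_n)\in U$ have nonzero algebraic components, and assume $\Omega$ and $\boldsymbol{\alpha}$ satisfy conditions (I),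 (II), (III)$_p$, (IV)$_p$ (defined in the context). Assume further that $b_{ij}(\Omega^k\boldsymbol{\alpha})$ and $e_h(\Omega^k\boldsymbol{\alpha})$ are defined and $e_h(\Omega^k\boldsymbol{\alpha})\neq0$ for all $i,j,h$ and all $k\geq0$. If the numbers $f_{ij}(\boldsymbol{\alpha})$ ($1\leq i\leq l$, $1\leq j\leq n(i)$) and $g_h(\boldsymbol{\alpha})$ ($1\leq h\leq m$) are algebraically dependent over $\mathbb{Q}$, then at least one of the following holds: (i) there exist a nonempty subset $\{i_1,\ldots,i_r\}\subseteq\{1,\ldots,l\}$ and nonzero algebraic numbers $c_1,\ldots,c_r$ such that $a_{i_1}=\cdots=a_{i_r}$ and $R(\mathbf{z}):=c_1f_{i_11}(\mathbf{z})+\cdots+c_rf_{i_r1}(\mathbf{z})\in\overline{\mathbb{Q}}(z_1,\ldots,z_n)$; here $R(\mathbf{z})=a_{i_1}R(\Omega\mathbf{z})+c_1b_{i_11}(\mathbf{z})+\cdots+c_rb_{i_r1}(\mathbf{z})$; (ii) there exist integers $d_1,\ldots,d_m$, not all zero, and $S(\mathbf{z})\in\overline{\mathbb{Q}}(z_1,\ldots,z_n)\setminus\{0\}$ such that $S(\mathbf{z})=S(\Omega\mathbf{z})\prod_{h=1}^me_h(\mathbf{z})^{d_h}$.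
   Context: $|\cdot|_p$ is the usual absolute value ($p=\infty$) or standard $p$-adic absolute value; $\mathbb{C}_p$ is the completion of the algebraic closure $\overline{\mathbb{Q}}_p$ of $\mathbb{Q}_p$ ($\mathbb{C}_\infty=\mathbb{C}$); $\overline{\mathbb{Q}}$ is embedded in $\mathbb{C}_p$. A number field is a finite extension of $\mathbb{Q}$ inside $\overline{\mathbb{Q}}$. For $\mathbf{z}\in\mathbb{C}_p^n$, $\Omega\mathbf{z}:=\left(\prod_{j}z_j^{\omega_{1j}},\ldots,\prod_jz_j^{\omega_{nj}}\right)$, iterated as $\Omega^k\mathbf{z}$; write $\Omega^k\boldsymbol{\alpha}=(\alpha_1^{(k)},\ldots,\alpha_n^{(k)})$. Let $\rho$ be the maximum of the archimedean absolute values of the eigenvalues of $\Omega$. (I): $\Omega$ is nonsingular and none of its eigenvalues is a root of unity. (II): every entry of $\Omega^k$ is $O(\rho^k)$ as $k\to\infty$. (III)$_p$: there is $c>0$ with $\log|\alpha_i^{(k)}|_p\leq-c\rho^k$ for $1\leq i\leq n$ and all sufficiently large $k$. (IV)$_\infty$ (for $p=\infty$): for every nonzero $f\in\mathbb{C}[[z_1,\ldots,z_n]]$ convergent near the origin, $f(\Omega^k\boldsymbol{\alpha})\neq0$ for infinitely many positive integers $k$. (IV)$_p$ (for $p$ prime): for every nonzero $f\in\mathbb{C}_p[[z_1,\ldots,z_n]]$ convergent near the origin and every positive integer $a$, $f(\Omega^{ak}\boldsymbol{\alpha})\neq0$ for infinitely many positive integers $k$. *)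

(* Defs.v *)
From HB Require Import structures.
From mathcomp Require Import all_boot all_order all_algebra all_field.
From mathcomp Require Import fraction mxpoly complex.
From mathcomp Require Import finmap mpoly.
From mathcomp Require Import reals.
(* [classical_sets] and [exp] are only required: importing them clashes with
   the notations of [mpoly]. *)
From mathcomp Require classical_sets exp.

Set Implicit Arguments.
Unset Strict Implicit.
Unset Printing Implicit Defensive.

Import Order.TTheory GRing.Theory Num.Theory.
Local Open Scope ring_scope.
Local Notation "x %:F" := (tofrac x) : ring_scope.

Inductive place : Type :=
| Infinite
| Finite (p : nat) of prime p.

Section AbsoluteValues.

Variable R : realType.

Definition is_absolute_value (F : fieldType) (v : F -> R) : Prop :=
  [/\ forall x, 0 <= v x,
      forall x, v x = 0 <-> x = 0,
      forall x y, v (x * y) = v x * v y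
    & forall x y, v (x + y) <= v x + v y].

Definition complete_for (F : fieldType) (v : F -> R) : Prop :=
  forall u : nat -> F,
    (forall eps : R, 0 < eps -> exists N : nat, forall i j : nat,
       (N <= i)%N -> (N <= j)%N -> v (u i - u j) < eps) ->
    exists x : F, forall eps : R, 0 < eps -> exists N : nat, forall i : nat,
       (N <= i)%N -> v (u i - x) < eps.

Definition is_completion (F E : fieldType) (vF : F -> R) (vE : E -> R)
    (h : {rmorphism F -> E}) : Prop :=
  [/\ is_absolute_value vE,
      forall x, vE (h x) = vF x,
      forall (y : E) (eps : R), 0 < eps -> exists x : F, vE (y - h x) < eps
    & complete_for vE].

Definition is_algebraic_closure (F E : fieldType)
    (h : {rmorphism F -> E}) : Prop :=
  (forall y : E, algebraicOver h y) /\ GRing.closed_field_axiom E.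

(* |q|_p = p ^ (v_p (denominator) - v_p (numerator)) *)
Definition padic_abs (p : nat) (q : rat) : R :=
  if q == 0 then 0
  else p%:R ^+ logn p `|denq q|%N / p%:R ^+ logn p `|numq q|%N.

(* (C, v) is, up to isomorphism, the completion C_p of an algebraic closure
   L of the completion Q_p of (rat, |.|_p); the absolute value vL is the
   (unique) extension to L of the one of Q_p. *)
Definition is_padic_Cp (p : nat) (C : fieldType) (v : C -> R) : Prop :=
  exists (Qp : fieldType) (vQp : Qp -> R) (jQ : {rmorphism rat -> Qp})
         (L : fieldType) (vL : L -> R) (jL : {rmorphism Qp -> L})
         (jC : {rmorphism L -> C}),
    [/\ is_completion (padic_abs p) vQp jQ,
        is_algebraic_closure jL,
        is_absolute_value vL,
        forall x, vL (jL x) = vQp x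
      & is_completion vL v jC].

Definition is_complex_field (C : fieldType) (v : C -> R) : Prop :=
  exists phi : {rmorphism C -> R[i]},
    bijective phi /\ forall x, v x = ComplexField.Normc.normc (phi x).

Definition is_Cp (p : place) (C : fieldType) (v : C -> R) : Prop :=
  match p with
  | Infinite => is_complex_field v
  | Finite q _ => is_padic_Cp q v
  end.

End AbsoluteValues.

(* A formal power series in n variables is its family of coefficients. *)
Definition mpseries (F : Type) (n : nat) : Type := 'X_{1..n} -> F.

Definition mps_map (F E : Type) (n : nat) (h : F -> E) (u : mpseries F n) :
    mpseries E n := fun k => h (u k).

Section PowerSeries.

Variables (F : fieldType) (n : nat).

Definition mps_of_mpoly (P : {mpoly F[n]}) : mpseries F n := fun k => P@_k.

Definition mps_mul (u w : mpseries F n) : mpseries F n := fun k =>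
  \sum_(h : 'X_{1..n < (mdeg k).+1, (mdeg k).+1} | k == (h.1 + h.2)%MM)
     u h.1 * w h.2.

(* The exponent of the monomial obtained from z^k by substituting
   prod_j z_j ^ omega_ij for z_i. *)
Definition mnm_act (Omega : 'M[nat]_n) (k : 'X_{1..n}) : 'X_{1..n} :=
  [multinom (\sum_(i < n) k i * Omega i j)%N | j < n].

(* The series u(Omega z).  If no row of Omega is zero (in particular if Omega
   is nonsingular), then mdeg k <= mdeg (mnm_act Omega k), so that the sum
   below runs over all exponents k with mnm_act Omega k = h. *)
Definition mps_subst (Omega : 'M[nat]_n) (u : mpseries F n) : mpseries F n :=
  fun h => \sum_(k : 'X_{1..n < (mdeg h).+1} | mnm_act Omega k == h) u k.

(* The equality u = q * w, in the field of fractions of the ring of power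
   series, with the denominator of q cleared. *)
Definition mps_eq_ratfun_mul (u : mpseries F n) (q : {fraction {mpoly F[n]}})
    (w : mpseries F n) : Prop :=
  exists P Q : {mpoly F[n]},
    [/\ Q != 0, q = P%:F / Q%:F
      & mps_mul (mps_of_mpoly Q) u =1 mps_mul (mps_of_mpoly P) w].

Definition mps_eq_ratfun (u : mpseries F n) (q : {fraction {mpoly F[n]}}) :
    Prop :=
  mps_eq_ratfun_mul u q (mps_of_mpoly 1).

Definition mpoly_subst (Omega : 'M[nat]_n) (P : {mpoly F[n]}) :
    {mpoly F[n]} :=
  P \mPo [tuple \prod_(j < n) 'X_j ^+ Omega i j | i < n].

(* The rational function q(Omega z).  For nonsingular Omega, mpoly_subst is
   injective and the choice of representative is irrelevant. *)
Definition ratfun_subst (Omega : 'M[nat]_n) (q : {fraction {mpoly F[n]}}) :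
    {fraction {mpoly F[n]}} :=
  (mpoly_subst Omega \n_(repr q))%:F / (mpoly_subst Omega \d_(repr q))%:F.

Definition ratfun_const (c : F) : {fraction {mpoly F[n]}} := (c%:MP)%:F.

(* q is defined at x, with value y. *)
Definition ratfun_value (q : {fraction {mpoly F[n]}}) (x : 'I_n -> F) (y : F) :
    Prop :=
  exists P Q : {mpoly F[n]},
    [/\ Q.@[x] != 0, q = P%:F / Q%:F & y = P.@[x] / Q.@[x]].

Definition pt_act (Omega : 'M[nat]_n) (z : 'I_n -> F) : 'I_n -> F :=
  fun i => \prod_(j < n) z j ^+ Omega i j.

End PowerSeries.

Section Convergence.

Variables (R : realType) (C : fieldType) (v : C -> R) (n : nat).

(* Unconditional convergence of the multiple series u(z), with sum s. *)
Definition mps_sum (u : mpseries C n) (z : 'I_n -> C) (s : C) : Prop :=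
  forall eps : R, 0 < eps -> exists J0 : {fset 'X_{1..n}},
    forall J : {fset 'X_{1..n}}, (J0 `<=` J)%fset ->
      v (\sum_(k <- J) u k * (\prod_(j < n) z j ^+ k j) - s) < eps.

(* The value u(z); it is 0 by convention if the series does not converge. *)
Definition mps_eval (u : mpseries C n) (z : 'I_n -> C) : C :=
  classical_sets.xget 0 (mps_sum u z).

Definition in_polydisc (r : 'I_n -> R) (z : 'I_n -> C) : Prop :=
  forall j, v (z j) < r j.

Definition mps_converges_on (r : 'I_n -> R) (u : mpseries C n) : Prop :=
  forall z, in_polydisc r z -> exists s, mps_sum u z s.

Definition mps_converges_near0 (u : mpseries C n) : Prop :=
  exists2 r : 'I_n -> R, (forall j, 0 < r j) & mps_converges_on r u.

Definition infinitely_many (P : nat -> Prop) : Prop :=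
  forall N : nat, exists2 k : nat, (N < k)%N & P k.

End Convergence.

Section Conditions.

Variables (R : realType) (n : nat) (Omega : 'M[nat]_n).

Definition cmatrix : 'M[R[i]]_n := map_mx (fun k : nat => k%:R) Omega.

Definition max_eigenvalue_modulus (rho : R) : Prop :=
  (exists2 x : R[i], eigenvalue cmatrix x
                   & ComplexField.Normc.normc x = rho) /\
  (forall x : R[i], eigenvalue cmatrix x ->
     ComplexField.Normc.normc x <= rho).

Definition condI : Prop :=
  cmatrix \in unitmx /\
  (forall x : R[i], eigenvalue cmatrix x ->
     forall k : nat, (0 < k)%N -> x ^+ k != 1).

Definition condII (rho : R) : Prop :=
  forall i j : 'I_n, exists (B : R) (k0 : nat), forall k : nat, (k0 <= k)%N ->
    ((Omega ^+ k) i j)%:R <= B * rho ^+ k.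

Variables (C : fieldType) (v : C -> R) (alpha : 'I_n -> C).

Definition condIII (rho : R) : Prop :=
  exists2 c : R, 0 < c &
    exists k0 : nat, forall (k : nat) (i : 'I_n), (k0 <= k)%N ->
      exp.ln (v (iter k (pt_act Omega) alpha i)) <= - c * rho ^+ k.

Definition nonvanishing_along (a : nat) : Prop :=
  forall u : mpseries C n, (exists h, u h <> 0) -> mps_converges_near0 v u ->
    infinitely_many (fun k =>
      exists2 s, mps_sum v u (iter (a * k) (pt_act Omega) alpha) s & s <> 0).

Definition condIV (p : place) : Prop :=
  match p with
  | Infinite => nonvanishing_along 1
  | Finite _ _ => forall a : nat, (0 < a)%N -> nonvanishing_along a
  end.

End Conditions.

Definition alg_dependent_over_Q (C : fieldType) (emb : {rmorphism algC -> C})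
    (T : finType) (x : T -> C) : Prop :=
  exists2 P : {mpoly rat[#|T|]}, P != 0 &
    mmap (fun q : rat => emb (ratr q)) (fun k => x (enum_val k)) P = 0.

(* Main.v *)
(* Mahler's method.  Iterating the functional equations k times expresses
   f(alpha) and g(alpha) through f(Omega^k alpha), g(Omega^k alpha) and a
   sequence s_k of algebraic points (k, powers of multiplicatively independent
   numbers, and the partial sums and products of the b's and e's).  An algebraic
   relation at alpha thus makes an auxiliary series F(z, s) vanish at
   (Omega^k alpha, s_k) for all k in an arithmetic progression.  A combination
   sum_h P_h F^h of high order at z = 0 exists by linear algebra; dividing by a
   power of F, its lowest coefficient P_r takes very small values at these
   points, against Liouville's inequality, unless P_r vanishes there.  The
   polynomials vanishing along the sequence form an ideal stable under the
   induced difference operator; its elements of least leading monomial are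
   eigenvectors and yield rational solutions of the linear or multiplicative
   difference equations, which comparison of power series identifies with the
   two alternatives. *)
Require Import Defs.
From HB Require Import structures.
From mathcomp Require Import all_boot all_order all_algebra all_field.
From mathcomp Require Import perm fraction generic_quotient mxpoly complex.
From mathcomp Require Import finmap mpoly.
From mathcomp Require Import reals.
From mathcomp Require Import ring lra zify.
From mathcomp Require classical_sets sequences exp boolp.

Set Implicit Arguments.
Unset Strict Implicit.
Unset Printing Implicit Defensive.

Import Order.TTheory GRing.Theory Num.Theory.
Local Open Scope ring_scope.
Local Notation "x %:F" := (tofrac x) : ring_scope.

(** The series converge only in U, and Omega^k(alpha) may leave U before it tends to 0. Hence the
    iterated equations are kept as identities between formal series with cleared denominators,
    evaluated only at alpha and at Omega^k(alpha) for large k. Next, F must not be the zero series.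
    The algebraic criterion is therefore used twice: with the values of f and g at Omega^k(alpha) as
    the sequence, to show that the given relation cannot hold identically between the series, and
    with s_k, to show that P_r is nonzero at infinitely many points. Next, all heights must be
    measured in one number field, although a rational function may need a different denominator at
    each point of the orbit; a Dickson argument leaves finitely many of them. The a_i are monomials
    in multiplicatively independent numbers only up to roots of unity, whose order dictates the
    arithmetic progression. Finally, the degree bound q is fixed before k grows, so factors
    independent of k do not matter; what counts is that every exponent of exp(rho^k) is linear in q,
    with a gain that can be enlarged independently of the losses. *)

(** * The ring of formal power series *)

(** A record, not a bare function, so that the convolution product can be its canonical ring
    structure; equality and choice are the classical ones. *)
Record mps (R : Type) (n : nat) := MPS { mpsf :> 'X_{1..n} -> R }.

HB.instance Definition _ R n := boolp.gen_eqMixin (mps R n).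
HB.instance Definition _ R n := boolp.gen_choiceMixin (mps R n).

Lemma mpsP R n (u w : mps R n) : u =1 w -> u = w.
Proof. by case: u w => u [w] /= /boolp.funext ->. Qed.

Section Ring.
Variables (R : comNzRingType) (n : nat).
Implicit Types (u w : mps R n) (p q : {mpoly R[n]}) (m k : 'X_{1..n}).

(** Congruence modulo terms of degree at least [d]. Since it is compatible with products, each ring
    law for series follows, coefficient by coefficient, from the law for truncations, which are
    polynomials. *)
Definition eqd d p q := forall m, (mdeg m < d)%N -> p@_m = q@_m.

Lemma eqdM d p q p' q' : eqd d p p' -> eqd d q q' -> eqd d (p * q) (p' * q').
Proof.
move=> hp hq m hm; rewrite !mcoeffM; apply: eq_bigr => h /eqP E.
have := congr1 mdeg E; rewrite mdegD => Ed.
by rewrite hp ?hq //; lia.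
Qed.

Definition trunc d u : {mpoly R[n]} := \sum_(m : 'X_{1..n < d}) u m *: 'X_[m].

Lemma truncE d u m : (mdeg m < d)%N -> (trunc d u)@_m = u m.
Proof. exact: mcoeff_mpoly. Qed.

Definition mps_addr u w : mps R n := MPS (fun m => u m + w m).
Definition mps_oppr u : mps R n := MPS (fun m => - u m).
Definition mps_zero : mps R n := MPS (fun _ => 0).
Definition mps_one : mps R n := MPS (fun m => (m == 0%MM)%:R).
Definition mps_mulr u w : mps R n := MPS (fun k =>
  \sum_(h : 'X_{1..n < (mdeg k).+1, (mdeg k).+1} | k == (h.1 + h.2)%MM)
     u h.1 * w h.2).

Lemma mps_mulrE d u w k : (mdeg k < d)%N ->
  mps_mulr u w k = (trunc d u * trunc d w)@_k.
Proof.
move=> h; rewrite mcoeffM; apply: eq_bigr => -[a b] /= /eqP E.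
have := congr1 mdeg E; rewrite mdegD => Ed.
by rewrite !truncE //; lia.
Qed.

Lemma eqd_truncM d u w : eqd d (trunc d (mps_mulr u w)) (trunc d u * trunc d w).
Proof. by move=> m hm; rewrite truncE // (mps_mulrE _ _ hm). Qed.

Lemma mps_addA : associative mps_addr.
Proof. by move=> u v w; apply: mpsP => m /=; rewrite addrA. Qed.
Lemma mps_addC : commutative mps_addr.
Proof. by move=> u v; apply: mpsP => m /=; rewrite addrC. Qed.
Lemma mps_add0 : left_id mps_zero mps_addr.
Proof. by move=> u; apply: mpsP => m /=; rewrite add0r. Qed.
Lemma mps_addN : left_inverse mps_zero mps_oppr mps_addr.
Proof. by move=> u; apply: mpsP => m /=; rewrite addNr. Qed.

HB.instance Definition _ := GRing.isZmodule.Build (mps R n)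
  mps_addA mps_addC mps_add0 mps_addN.

Lemma mps_mulA : associative mps_mulr.
Proof.
move=> u v w; apply: mpsP => m; have hm := ltnSn (mdeg m).
rewrite !(mps_mulrE _ _ hm).
transitivity ((trunc (mdeg m).+1 u * (trunc (mdeg m).+1 v * trunc (mdeg m).+1 w))@_m).
  by apply: (@eqdM _ _ _ _ _ (fun _ _ => erefl)) hm; apply: eqd_truncM.
rewrite mulrA; apply/esym.
by apply: (@eqdM _ _ _ _ _ _ (fun _ _ => erefl)) hm; apply: eqd_truncM.
Qed.

Lemma mps_mulC : commutative mps_mulr.
Proof.
move=> u v; apply: mpsP => m; have hm := ltnSn (mdeg m).
by rewrite !(mps_mulrE _ _ hm) mulrC.
Qed.

Lemma mps_mul1 : left_id mps_one mps_mulr.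
Proof.
move=> u; apply: mpsP => m; have hm := ltnSn (mdeg m).
rewrite !(mps_mulrE _ _ hm) -(truncE u hm) -[in RHS](mul1r (trunc _ u)).
apply: (@eqdM _ _ _ _ _ _ (fun _ _ => erefl)) hm => k hk.
by rewrite truncE // mcoeff1.
Qed.

Lemma mps_mulD : left_distributive mps_mulr mps_addr.
Proof.
move=> u v w; apply: mpsP => m /=; rewrite -big_split /=.
by apply: eq_bigr => h _; rewrite mulrDl.
Qed.

Lemma mps_one_neq0 : mps_one != mps_zero.
Proof.
apply/eqP => /(congr1 (fun u : mps R n => u 0%MM)) /= /eqP.
by rewrite eqxx oner_eq0.
Qed.

HB.instance Definition _ := GRing.Zmodule_isComNzRing.Build (mps R n)
  mps_mulA mps_mulC mps_mul1 mps_mulD mps_one_neq0.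

Lemma mpsD u w m : (u + w) m = u m + w m. Proof. by []. Qed.
Lemma mpsB u w m : (u - w) m = u m - w m. Proof. by []. Qed.
Lemma mps0E m : (0 : mps R n) m = 0. Proof. by []. Qed.
Lemma mps1E m : (1 : mps R n) m = (m == 0%MM)%:R. Proof. by []. Qed.
Lemma mpsM u w k : (u * w) k =
  \sum_(h : 'X_{1..n < (mdeg k).+1, (mdeg k).+1} | k == (h.1 + h.2)%MM)
     u h.1 * w h.2.
Proof. by []. Qed.
Lemma mpsM_trunc d u w k : (mdeg k < d)%N ->
  (u * w) k = (trunc d u * trunc d w)@_k.
Proof. exact: mps_mulrE. Qed.

Lemma mps_sumE (I : Type) (r : seq I) (P : pred I) (F : I -> mps R n) m :
  (\sum_(i <- r | P i) F i) m = \sum_(i <- r | P i) F i m.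
Proof. by elim/big_rec2: _ => // i y1 y2 _ <-. Qed.

Lemma mps_neq0 u : u <> 0 -> exists m, u m != 0.
Proof.
move=> h; apply: boolp.contrapT => /boolp.forallNP h'; apply: h; apply: mpsP => m.
by apply/eqP; apply: boolp.contrapT => /negP; apply: h'.
Qed.

Definition ofp p : mps R n := MPS (fun m => p@_m).

Lemma ofp_is_zmod_morphism : zmod_morphism ofp.
Proof. by move=> p q; apply: mpsP => m /=; rewrite mcoeffB. Qed.
Lemma ofp_is_monoid_morphism : monoid_morphism ofp.
Proof.
split; first by apply: mpsP => m /=; rewrite mcoeff1.
by move=> p q; apply: mpsP => m; rewrite /= mcoeffM.
Qed.
HB.instance Definition _ := GRing.isZmodMorphism.Build {mpoly R[n]} (mps R n) ofp
  ofp_is_zmod_morphism.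
HB.instance Definition _ := GRing.isMonoidMorphism.Build {mpoly R[n]} (mps R n) ofp
  ofp_is_monoid_morphism.

Lemma ofp_inj : injective ofp.
Proof. by move=> p q /(congr1 (@mpsf _ _)) E; apply/mpolyP => m; exact: (congr1 (@^~ m) E). Qed.

Lemma ofp_eq0 p : (ofp p == 0) = (p == 0).
Proof. by rewrite -(inj_eq ofp_inj) raddf0. Qed.

Lemma ofpCM c u m : (ofp c%:MP * u) m = c * u m.
Proof.
rewrite (mpsM_trunc _ _ (ltnSn _)) -(truncE u (ltnSn _)) -mcoeffCM.
apply: (@eqdM _ _ _ _ _ _ (fun _ _ => erefl)) (ltnSn _) => k hk.
by rewrite truncE.
Qed.

(* The low-order part of a product, for any monomial order given by an
   injective additive reindexing of the exponents. *)
Lemma mps_lowM (t : 'X_{1..n} -> 'X_{1..n}) u w a b :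
  {morph t : x y / (x + y)%MM >-> (x + y)%MM} -> injective t ->
  (forall m, (t m < t a)%O -> u m = 0) -> (forall m, (t m < t b)%O -> w m = 0) ->
  (u * w) (a + b)%MM = u a * w b.
Proof.
move=> tD tI hu hw; rewrite mpsM.
have ha : (mdeg a < (mdeg (a + b)).+1)%N by rewrite mdegD; lia.
have hb : (mdeg b < (mdeg (a + b)).+1)%N by rewrite mdegD; lia.
rewrite (bigD1 (BMultinom ha, BMultinom hb)) //= big1 ?addr0 // => -[x y] /= /andP[/eqP E ne].
have Et : (t a + t b = t x + t y)%MM by have := congr1 t E; rewrite !tD.
case: (ltgtP (t x) (t a)) => [lt|lt|/tI Ex].
- by rewrite hu ?mul0r.
- case: (ltP (t y) (t b)) => [lt2|le2]; first by rewrite hw ?mulr0.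
  by have := ltmc_le_add lt le2; rewrite Et ltxx.
move: ne E; rewrite Ex => ne /addmI Ey; case/negP: ne; apply/eqP.
by congr pair; apply: val_inj => /=; rewrite ?Ex ?Ey.
Qed.
End Ring.

Section Domain.
Variables (R : idomainType) (n : nat).
Implicit Types (u w : mps R n).

(** Well-foundedness of the monomial order, by induction on [t m]. *)
Lemma exists_low (t : 'X_{1..n} -> 'X_{1..n}) u : u <> 0 -> exists a, u a != 0 /\ forall m, (t m < t a)%O -> u m = 0.
Proof.
move=> /mps_neq0 [m0 h0].
suff: forall x : 'X_{1..n}, forall m, t m = x -> u m != 0 ->
  exists a, u a != 0 /\ forall m, (t m < t a)%O -> u m = 0 by move/(_ _ m0 erefl h0).
apply: (well_founded_ind (@ltom_wf n)) => x IH m tm um.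
case: (boolp.EM (exists m', (t m' < t m)%O /\ u m' != 0)) => [[m' [lt um']]|/boolp.forallNP h].
  by apply: (IH (t m')) um' => //; rewrite -tm.
exists m; split=> // m' lt; apply/eqP; apply: boolp.contrapT => /negP um'.
by apply: (h m').
Qed.

Lemma mps_mulf u w : u * w = 0 -> u = 0 \/ w = 0.
Proof.
move=> E; case: (boolp.EM (u = 0)) => [|/(@exists_low id)[a [ua la]]]; first by left.
case: (boolp.EM (w = 0)) => [|/(@exists_low id)[b [wb lb]]]; first by right.
have := @mps_lowM _ _ id u w a b (fun _ _ => erefl) (fun _ _ => id) la lb.
by rewrite E => /esym/eqP; rewrite mps0E mulf_eq0 (negbTE ua) (negbTE wb).
Qed.

Lemma mps_mulfI u v w : u <> 0 -> u * v = u * w -> v = w.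
Proof.
move=> nz E; have : u * (v - w) = 0 by rewrite mulrBr E subrr.
by case/mps_mulf => // /eqP; rewrite subr_eq0 => /eqP.
Qed.
End Domain.

(* Exponent maps behaving like k |-> k Omega: condition (I) enters only through
   the last two clauses. *)
Definition expo_map n (act : 'X_{1..n} -> 'X_{1..n}) : Prop :=
  [/\ {morph act : x y / (x + y)%MM >-> (x + y)%MM},
      injective act,
      forall k, (mdeg k <= mdeg (act k))%N
    & forall t, (0 < t)%N -> forall a b,
        (iter t act a + b = a + iter t act b)%MM -> a = b].

Lemma iter_addm n (act : 'X_{1..n} -> 'X_{1..n}) t :
  {morph act : x y / (x + y)%MM >-> (x + y)%MM} ->
  {morph iter t act : x y / (x + y)%MM >-> (x + y)%MM}.
Proof. by move=> actD x y; elim: t => //= t ->; rewrite actD. Qed.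

Lemma iter_inj (T : Type) (f : T -> T) t : injective f -> injective (iter t f).
Proof. by move=> fI; elim: t => //= t IH x y /fI/IH. Qed.

Lemma expo_map_iter n (act : 'X_{1..n} -> 'X_{1..n}) t :
  expo_map act -> (0 < t)%N -> expo_map (iter t act).
Proof.
move=> [aD aI ad aE] t0; split.
- exact: iter_addm.
- exact: iter_inj.
- by move=> k; elim: t {t0} => //= t IH; apply: leq_trans IH (ad _).
- move=> s s0 a b; rewrite -!iterM; apply: aE; by rewrite muln_gt0 s0.
Qed.

Record expoMap n := ExpoMap { act_fun :> 'X_{1..n} -> 'X_{1..n}; expoMapP : expo_map act_fun }.

(** * The substitution z -> Omega z on series and polynomials *)

Section Subst.
Variables (R : comNzRingType) (n : nat) (act : expoMap n).
Implicit Types (u w : mps R n) (p q : {mpoly R[n]}).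

Definition sub u : mps R n := MPS (fun h =>
  \sum_(k : 'X_{1..n < (mdeg h).+1} | act k == h) u k).

Definition psub p : {mpoly R[n]} :=
  p \mPo [tuple 'X_[act U_(i)%MM] | i < n].

HB.instance Definition _ := GRing.RMorphism.copy psub (comp_mpoly [tuple 'X_[act U_(i)%MM] | i < n]).

Let actD : {morph act : x y / (x + y)%MM >-> (x + y)%MM}. Proof. by case: (expoMapP act). Qed.
Let actI : injective act. Proof. by case: (expoMapP act). Qed.
Let actd k : (mdeg k <= mdeg (act k))%N. Proof. by case: (expoMapP act). Qed.

Lemma act0 : act 0%MM = 0%MM.
Proof. by apply: (@addmI _ (act 0%MM)); rewrite -actD !addm0. Qed.

Lemma act_prod (m : 'X_{1..n}) : \prod_(i < n) 'X_[act U_(i)%MM] ^+ m i = 'X_[act m] :> {mpoly R[n]}.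
Proof.
rewrite [in RHS](multinomUE_id m).
rewrite (big_morph act actD act0) mprodXnE; congr mpolyX.
apply: eq_bigr => i _; elim: (m i) => [|k IH]; first by rewrite !mulm0n act0.
by rewrite !mulmS actD IH.
Qed.

Lemma psubX m : psub 'X_[m] = 'X_[act m].
Proof. rewrite /psub comp_mpolyX -act_prod; apply: eq_bigr => i _; by rewrite tnth_mktuple. Qed.

Lemma psubC (c : R) : psub c%:MP = c%:MP.
Proof. exact: comp_mpolyC. Qed.

Lemma psubE p : psub p = \sum_(m <- msupp p) p@_m *: 'X_[act m].
Proof. by rewrite /psub comp_mpolyEX; apply: eq_bigr => m _; rewrite -psubX. Qed.

Lemma psub_coef p k : (psub p)@_(act k) = p@_k.
Proof.
rewrite psubE [in RHS](mpolyE p) !raddf_sum /=; apply: eq_bigr => m _.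
by rewrite !mcoeffZ !mcoeffX (inj_eq actI).
Qed.

Lemma psub_coef0 p h : (forall k, act k <> h) -> (psub p)@_h = 0.
Proof.
move=> hh; rewrite psubE raddf_sum big1 //= => m _.
by rewrite mcoeffZ mcoeffX; case: eqP => [/hh|]; rewrite ?mulr0.
Qed.

Lemma sub_coef u k : sub u (act k) = u k.
Proof.
have hk : (mdeg k < (mdeg (act k)).+1)%N by rewrite ltnS.
rewrite /sub /= (bigD1 (BMultinom hk)) //= big1 ?addr0 // => i /andP[/eqP/actI E].
by case/negP; apply/eqP; apply: val_inj.
Qed.

Lemma sub_coef0 u h : (forall k, act k <> h) -> sub u h = 0.
Proof. by move=> hh; rewrite /sub /= big1 // => k /eqP /hh. Qed.

Lemma act_cases h : (exists k, h = act k) \/ (forall k, act k <> h).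
Proof.
case: (boolp.EM (exists k, h = act k)) => [|h']; first by left.
by right => k E; apply: h'; exists k.
Qed.

Lemma sub_ofp p : sub (ofp p) = ofp (psub p).
Proof.
apply: mpsP => h; case: (act_cases h) => [[k ->]|hh].
  by rewrite sub_coef /= psub_coef.
by rewrite sub_coef0 //= psub_coef0.
Qed.

(** [act] does not lower degrees, so a coefficient of [sub u] of degree below [d] comes from a
    coefficient of [u] of degree below [d]. *)
Lemma sub_trunc d u h : (mdeg h < d)%N -> sub u h = (psub (trunc d u))@_h.
Proof.
case: (act_cases h) => [[k ->]|hh] hd; last by rewrite sub_coef0 //= psub_coef0.
rewrite sub_coef psub_coef truncE //; exact: leq_ltn_trans (actd k) hd.
Qed.

Lemma sub_is_zmod_morphism : zmod_morphism sub.
Proof.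
move=> u w; apply: mpsP => h; rewrite mpsB /sub /= -sumrB.
exact: eq_bigr.
Qed.

Lemma sub_is_monoid_morphism : monoid_morphism sub.
Proof.
split; first by rewrite -[in LHS](rmorph1 (@ofp R n)) sub_ofp !rmorph1.
move=> u w; apply: mpsP => h; have hd := ltnSn (mdeg h).
rewrite (mpsM_trunc _ _ hd).
transitivity ((psub (trunc (mdeg h).+1 u * trunc (mdeg h).+1 w))@_h).
  case: (act_cases h) => [[k Ek]|hh]; last by rewrite sub_coef0 //= psub_coef0.
  by rewrite {h}Ek in hd *; rewrite sub_coef psub_coef (mpsM_trunc _ _ (d := (mdeg (act k)).+1)) // ltnS.
rewrite rmorphM /=; apply: eqdM hd => m hm;
  by rewrite -sub_trunc // truncE.
Qed.

HB.instance Definition _ := GRing.isZmodMorphism.Build (mps R n) (mps R n) sub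
  sub_is_zmod_morphism.
HB.instance Definition _ := GRing.isMonoidMorphism.Build (mps R n) (mps R n) sub
  sub_is_monoid_morphism.

Lemma sub_inj : injective sub.
Proof.
move=> u w E; apply: mpsP => k.
by rewrite -(sub_coef u) -(sub_coef w) E.
Qed.
End Subst.

Arguments sub : simpl never.

(** * Dickson's lemma and lowest exponents for a family of orders *)

(** Each new index minimises [f] on the tail that follows the previous one. *)
Lemma nondecreasing_subseq (f : nat -> nat) : exists phi : nat -> nat,
  (forall i j, (i < j)%N -> (phi i < phi j)%N) /\
  (forall i j, (i < j)%N -> (f (phi i) <= f (phi j))%N).
Proof.
have minP : forall k, exists m, (k <= m)%N /\ forall j, (k <= j)%N -> (f m <= f j)%N.
  move=> k.
  suff: forall v m, (k <= m)%N -> f m = v ->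
      exists m, (k <= m)%N /\ forall j, (k <= j)%N -> (f m <= f j)%N.
    by move/(_ (f k) k (leqnn _) erefl).
  elim/ltn_ind => v IH m km fm.
  case: (boolp.EM (exists j, (k <= j)%N /\ (f j < v)%N)) => [[j [kj lt]]|/boolp.forallNP h].
    exact: (IH (f j) lt j).
  by exists m; split=> // j kj; rewrite fm leqNgt; apply/negP => lt; apply: (h j).
have [g gP] := boolp.choice minP.
pose p i := iter i (fun x => g x.+1) (g 0%N).
have pS i : (p i < p i.+1)%N by have [] := gP (p i).+1.
have p_lt i j : (i < j)%N -> (p i < p j)%N.
  elim: j => // j IH; rewrite ltnS leq_eqVlt => /orP[/eqP ->|/IH lt] //.
  exact: ltn_trans lt (pS j).
exists p; split=> // i j ij; case: i ij => [|i] ij.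
  by have [_ h] := gP 0%N; apply: h.
have [_ h] := gP (p i).+1; apply: h; apply: p_lt; exact: ltn_trans ij.
Qed.

(** The sequence is thinned out one coordinate at a time, along a list of coordinates. *)
Lemma dickson N (s : nat -> 'I_N -> nat) :
  exists i j : nat, (i < j)%N /\ forall x, (s i x <= s j x)%N.
Proof.
suff: forall A : seq 'I_N, exists phi : nat -> nat,
    (forall i j, (i < j)%N -> (phi i < phi j)%N) /\
    forall i j, (i < j)%N -> forall x, x \in A -> (s (phi i) x <= s (phi j) x)%N.
  move/(_ (enum 'I_N)) => [phi [h1 h2]]; exists (phi 0%N), (phi 1%N).
  by split=> [|x]; [apply: h1|apply: h2; rewrite ?mem_enum].
elim=> [|x A [phi [h1 h2]]]; first by exists id.
have [psi [h3 h4]] := nondecreasing_subseq (fun i => s (phi i) x).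
exists (phi \o psi); split=> [i j /h3/h1 //|i j ij y].
rewrite inE => /orP[/eqP ->|yA]; first exact: h4.
by apply: h2 => //; apply: h3.
Qed.

Section LowExponents.
Variables (R : idomainType) (n : nat) (t : 'X_{1..n} -> 'X_{1..n}).
Hypothesis tD : {morph t : x y / (x + y)%MM >-> (x + y)%MM}.
Hypothesis tI : injective t.
Implicit Types (u w : mps R n).

(** [t] re-indexes the exponents before they are compared. Below it is an iterate of the exponent
    map, so that one series has a lowest exponent for each of infinitely many orders. *)
Definition vanish_below u a := forall m, (t m < t a)%O -> u m = 0.
Definition lowest u a := u a != 0 /\ vanish_below u a.

Lemma lowest_unique u a b : lowest u a -> lowest u b -> a = b.
Proof.
move=> [ua la] [ub lb]; case: (ltgtP (t a) (t b)) => [/lb E|/la E|/tI //].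
  by rewrite E eqxx in ua.
by rewrite E eqxx in ub.
Qed.

Lemma vanish_belowM u w a b : vanish_below u a -> vanish_below w b ->
  vanish_below (u * w) (a + b)%MM.
Proof.
move=> hu hw m; rewrite mpsM => lt; rewrite big1 // => -[x y] /= /eqP E.
have Et : (t m = t x + t y)%MM by have := congr1 t E; rewrite tD.
case: (ltP (t x) (t a)) => [/hu ->|lex]; first by rewrite mul0r.
case: (ltP (t y) (t b)) => [/hw ->|ley]; first by rewrite mulr0.
by have := lem_add lex ley; rewrite -tD -Et leNgt lt.
Qed.

Lemma lowestM u w a b : lowest u a -> lowest w b -> lowest (u * w) (a + b)%MM.
Proof.
move=> [ua la] [wb lb]; split; last exact: vanish_belowM.
by rewrite (mps_lowM tD tI la lb) mulf_neq0.
Qed.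

(** An additive [t] respects divisibility of monomials, so the lowest exponents of one series for
    the various orders form an antichain; this is what makes Dickson's lemma applicable. *)
Lemma lowest_le u a b : lowest u b -> (a <= b)%MM -> u a != 0 -> a = b.
Proof.
move=> [_ lb] le ua; have E : (b = (b - a) + a)%MM by rewrite submK.
have : (t a <= t b)%O by rewrite {1}E tD lemc_addl.
rewrite le_eqVlt => /orP[/eqP/tI //|/lb E']; by rewrite E' eqxx in ua.
Qed.
End LowExponents.

(** * Difference equations of first order whose solutions are constants *)

Section Constants.
Variables (n : nat) (act : expoMap n).
Let actD : {morph act : x y / (x + y)%MM >-> (x + y)%MM}. Proof. by case: (expoMapP act). Qed.
Let actI : injective act. Proof. by case: (expoMapP act). Qed.
Let itD j := iter_addm j actD.
Let itI j := @iter_inj _ act j actI.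

(** Comparing [act m] after [j] steps is comparing [m] after [j.+1] steps, so substitution moves
    lowest exponents from one order of the family to the preceding one. *)
Lemma vanish_below_sub (R : idomainType) (u : mps R n) j a :
  vanish_below (iter j.+1 act) u a -> vanish_below (iter j act) (sub act u) (act a).
Proof.
move=> h m; case: (act_cases act m) => [[k ->]|hh]; last by rewrite sub_coef0.
by rewrite sub_coef -!iterSr; apply: h.
Qed.

Lemma lowest_sub (R : idomainType) (u : mps R n) j a :
  lowest (iter j.+1 act) u a -> lowest (iter j act) (sub act u) (act a).
Proof. by move=> [ua /vanish_below_sub h]; split; rewrite ?sub_coef. Qed.

Lemma lowest_exists (R : idomainType) (u : mps R n) : u <> 0 ->
  exists e : nat -> 'X_{1..n}, forall j, lowest (iter j act) u (e j).
Proof.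
move=> nz; have h j : exists a, lowest (iter j act) u a by exact: exists_low.
by have [e he] := boolp.choice h; exists e.
Qed.

(** The hypothesis says that [act] sends the formal difference of [a i.+1] and [b i.+1] to that of
    [a i] and [b i]; it is written with sums because exponents have no negatives. *)
Lemma balanced_iter (a b : nat -> 'X_{1..n}) :
  (forall i, act (a i.+1) + b i = a i + act (b i.+1))%MM ->
  forall i s, (iter s act (a (s + i)%N) + b i = a i + iter s act (b (s + i)%N))%MM.
Proof.
move=> bal i; elim=> //= s IH.
have := congr1 (iter s act) (bal (s + i)%N); rewrite !itD -!iterS !iterSr.
move=> /mnmP E; move/mnmP: IH => IH; apply/mnmP => x.
move: (E x) (IH x); rewrite !mnmDE -!iterSr /=; lia.
Qed.

(* Dickson's lemma leaves only finitely many lowest exponents, so their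
   difference is fixed by a power of [act], hence zero. *)
Lemma balanced_eq (R : idomainType) (g h : mps R n) j0 (a b : nat -> 'X_{1..n}) :
  (forall i, lowest (iter (j0 + i) act) g (a i)) ->
  (forall i, lowest (iter (j0 + i) act) h (b i)) ->
  (forall i, act (a i.+1) + b i = a i + act (b i.+1))%MM ->
  exists i s, [/\ (0 < s)%N, a i = b i, a (s + i)%N = a i & b (s + i)%N = b i].
Proof.
move=> la lb bal.
have [i [j [ij le]]] := dickson (fun j (x : 'I_(n + n)) =>
  match split x with inl y => a j y | inr y => b j y end).
have Ea : a i = a j.
  apply: (lowest_le (@itD _) (@itI _) (la j)); last by case: (la i).
  by apply/mnm_lepP => x; have := le (lshift n x); rewrite (unsplitK (inl x)).
have Eb : b i = b j.
  apply: (lowest_le (@itD _) (@itI _) (lb j)); last by case: (lb i).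
  by apply/mnm_lepP => x; have := le (rshift n x); rewrite (unsplitK (inr x)).
have s0 : (0 < j - i)%N by rewrite subn_gt0.
have := balanced_iter bal i (j - i)%N; rewrite subnK ?(ltnW ij) // -Ea -Eb => E.
exists i, (j - i)%N; rewrite subnK ?(ltnW ij) //; split=> //.
by case: (expoMapP act) => _ _ _ ex; exact: ex s0 _ _ E.
Qed.

End Constants.

Definition cst (R : comNzRingType) n (c : R) : mps R n := ofp c%:MP.

Lemma cst_is_zmod_morphism (R : comNzRingType) n : zmod_morphism (@cst R n).
Proof. by move=> x y; rewrite /cst mpolyCB rmorphB. Qed.
Lemma cst_is_monoid_morphism (R : comNzRingType) n : monoid_morphism (@cst R n).
Proof. by split=> [|x y]; rewrite /cst ?mpolyC1 ?rmorph1 // mpolyCM rmorphM. Qed.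
HB.instance Definition _ (R : comNzRingType) n := GRing.isZmodMorphism.Build R (mps R n) (@cst R n)
  (@cst_is_zmod_morphism R n).
HB.instance Definition _ (R : comNzRingType) n := GRing.isMonoidMorphism.Build R (mps R n) (@cst R n)
  (@cst_is_monoid_morphism R n).

Lemma cstM (R : comNzRingType) n (c : R) (u : mps R n) m : (cst n c * u) m = c * u m.
Proof. exact: ofpCM. Qed.

Lemma sub_cst (R : comNzRingType) n (act : expoMap n) (c : R) : sub act (cst n c) = cst n c.
Proof. by rewrite /cst sub_ofp psubC. Qed.

Section Constants2.
Variables (K : numFieldType) (n : nat).
Implicit Types (g h : mps K n) (act : expoMap n).

Let itD act j : {morph iter j act : x y / (x + y)%MM >-> (x + y)%MM}.
Proof. by apply: iter_addm; case: (expoMapP act). Qed.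
Let itI act j : injective (iter j act).
Proof. by apply: iter_inj; case: (expoMapP act). Qed.

(** Equating the lowest exponents of both sides for all orders gives a balanced pair of sequences,
    which Dickson's lemma makes coincide and recur. In the lowest coefficients each step contributes
    a factor [kappa]; when the exponents recur after [s] steps, the product of these factors must be
    1. *)
Lemma eigen_lowest act g h (kappa : K) : g <> 0 -> h <> 0 ->
  sub act g * h = cst n kappa * (g * sub act h) ->
  kappa != 0 ->
  (exists a, lowest id g a /\ lowest id h a) /\ exists2 s, (0 < s)%N & kappa ^+ s = 1.
Proof.
move=> g0 h0 E k0.
have [a la] := lowest_exists act g0; have [b lb] := lowest_exists act h0.
have L1 i : lowest (iter i act) (sub act g * h) (act (a i.+1) + b i)%MM.
  by apply: (lowestM (@itD _ _) (@itI _ _)) => //; apply: lowest_sub; apply: la.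
have L2 i : lowest (iter i act) (g * sub act h) (a i + act (b i.+1))%MM.
  by apply: (lowestM (@itD _ _) (@itI _ _)) => //; apply: lowest_sub; apply: lb.
have L3 i : lowest (iter i act) (sub act g * h) (a i + act (b i.+1))%MM.
  have [x y] := L2 i; split; rewrite E; first by rewrite cstM mulf_neq0.
  by move=> m /y; rewrite cstM => ->; rewrite mulr0.
have bal i := lowest_unique (@itI act i) (L1 i) (L3 i).
have [i [s [s0 ab Ea Eb]]] := balanced_eq (j0 := 0) la lb bal.
split.
  exists (a 0%N); split; first exact: (la 0%N).
  (* The coincidence at stage [i] is carried back to stage 0, that is, to the ordinary monomial
     order. *)
  suff -> : a 0%N = b 0%N by exact: (lb 0%N).
  have /esym := balanced_iter bal 0%N i; rewrite addn0 ab addmC => /addmI //.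
exists s => //.
have coef i' : g (a i'.+1) * h (b i') = kappa * (g (a i') * h (b i'.+1)).
  have Va m := vanish_below_sub (la m.+1).2; have Vb m := vanish_below_sub (lb m.+1).2.
  have e1 : (sub act g * h) (act (a i'.+1) + b i')%MM = g (a i'.+1) * h (b i').
    by rewrite (mps_lowM (@itD act i') (@itI act i') (Va i') (lb i').2) sub_coef.
  have e2 : (g * sub act h) (a i' + act (b i'.+1))%MM = g (a i') * h (b i'.+1).
    by rewrite (mps_lowM (@itD act i') (@itI act i') (la i').2 (Vb i')) sub_coef.
  by rewrite -e1 E cstM bal e2.
have ratio s' : g (a (s' + i)%N) * h (b i) = kappa ^+ s' * (g (a i) * h (b (s' + i)%N)).
  elim: s' => [|s' IH]; first by rewrite expr0 mul1r.
  have hb : h (b (s' + i)%N) != 0 by case: (lb (s' + i)%N).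
  apply: (mulfI hb); rewrite addSn mulrCA mulrA [_ * h (b (s' + i)%N)]mulrC.
  rewrite [_ * g _]mulrC coef exprS.
  transitivity (kappa * h (b (s' + i).+1) * (g (a (s' + i)%N) * h (b i))); first by ring.
  by rewrite IH; ring.
have := ratio s; rewrite Ea Eb => /eqP; rewrite -subr_eq0 -{1}[_ * _]mul1r -mulrBl mulf_eq0.
case/orP; first by rewrite subr_eq0 eq_sym => /eqP.
by rewrite mulf_eq0 (negbTE (la i).1) (negbTE (lb i).1).
Qed.

Lemma iter_sub act s (s0 : (0 < s)%N) (u : mps K n) :
  iter s (sub act) u = sub (ExpoMap (expo_map_iter (expoMapP act) s0)) u.
Proof.
set act' := ExpoMap _; apply: mpsP => h.
case: (act_cases act' h) => [[k ->]|hh].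
  rewrite [RHS]sub_coef /= {act' s0}; elim: s => [//|s IH].
  by rewrite !iterS [LHS]sub_coef.
rewrite [RHS]sub_coef0 //; move: hh; rewrite /act' /= => hh {act'}.
elim: s {s0} h hh => [|s IH] h hh; first by case: (hh h).
rewrite iterS; case: (act_cases act h) => [[k Ek]|hh']; last by rewrite sub_coef0.
by rewrite Ek sub_coef; apply: IH => k' E; apply: (hh k'); rewrite /= E.
Qed.

(** Pass to the power of [act] that turns [kappa] into 1, then subtract the multiple of [h] that
    kills the coefficient of [g] at the common lowest exponent: a nonzero difference would still
    have to share that exponent with [h]. *)
Lemma eigen_const act g h (kappa : K) : h <> 0 -> kappa != 0 ->
  sub act g * h = cst n kappa * (g * sub act h) -> exists gam, g = cst n gam * h.
Proof.
move=> h0 k0 E; case: (boolp.EM (g = 0)) => [->|g0].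
  by exists 0; rewrite rmorph0 mul0r.
have [[a [[ga la] [hna lb]]] [s s0 ks]] := eigen_lowest g0 h0 E k0.
pose act' := ExpoMap (expo_map_iter (expoMapP act) s0).
have nz i : iter i (sub act) h <> 0.
  elim: i => //= i IH E'; apply: IH; apply: (@sub_inj _ _ act).
  by rewrite E' rmorph0.
have Es i : iter i (sub act) g * h = cst n (kappa ^+ i) * (g * iter i (sub act) h).
  elim: i => [|i IH]; first by rewrite expr0 rmorph1 mul1r.
  have h1 : sub act h <> 0 by exact: (nz 1%N).
  apply: (mps_mulfI h1); rewrite !iterS.
  have := congr1 (sub act) IH; rewrite !rmorphM /= sub_cst => E1.
  rewrite mulrCA mulrA [X in X * h]mulrC [sub act h * _]mulrC E1.
  rewrite exprS rmorphM /=.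
  transitivity (cst n (kappa ^+ i) * sub act (iter i (sub act) h) * (sub act g * h)); first by ring.
  by rewrite E; ring.
have {}Es : sub act' g * h = cst n 1 * (g * sub act' h).
  by rewrite -!iter_sub Es ks.
pose gam := g a / h a; exists gam; apply/eqP; rewrite -subr_eq0.
apply/eqP; apply: boolp.contrapT => g'0.
have E' : sub act' (g - cst n gam * h) * h = cst n 1 * ((g - cst n gam * h) * sub act' h).
  rewrite rmorphB rmorphM /= sub_cst mulrBl Es rmorph1; ring.
have [[a' [[ga' _] hb]] _] := eigen_lowest g'0 h0 E' (oner_neq0 _).
have Ea := lowest_unique (t := id) (fun _ _ => id) hb (conj hna lb).
by move: ga'; rewrite Ea mpsB cstM divfK // subrr eqxx.
Qed.

(** The quotient of [g] by [h] would grow by [c] at each substitution. If [g] starts strictly below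
    [h] for some order, the term with [c] does not reach the lowest exponent and the strict
    inequality persists, against the coincidence given by [balanced_eq]. Otherwise the quotients
    [g (b j) / h (b j)] form an arithmetic progression of step [c], whereas the exponents [b j]
    repeat. *)
Lemma unipotent_const act g h (c : K) : h <> 0 ->
  sub act g * h = g * sub act h + cst n c * (h * sub act h) -> c = 0.
Proof.
move=> h0 E; apply/eqP; apply: boolp.contrapT => /negP c0.
have [b lb] := lowest_exists act h0.
have Vb j := vanish_below_sub (lb j.+1).2.
case: (boolp.EM (exists j m, g m <> 0 /\ (iter j act m < iter j act (b j))%O)) => [|/boolp.forallNP H].
  move=> [j0 [m [gm ltm]]].
  have g0 : g <> 0 by move=> Z; apply: gm; rewrite Z.
  have [a la] := lowest_exists act g0.
  have step j : (iter j act (a j) < iter j act (b j))%O ->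
     (act (a j.+1) + b j = a j + act (b j.+1))%MM /\
     (iter j.+1 act (a j.+1) < iter j.+1 act (b j.+1))%O.
    move=> lt.
    have lgc : lowest (iter j act) (g + cst n c * h) (a j).
      split; first by rewrite mpsD cstM ((lb j).2 _ lt) mulr0 addr0; case: (la j).
      by move=> x ltx; rewrite mpsD cstM (la j).2 // (lb j).2 ?mulr0 ?addr0 //; apply: lt_trans ltx lt.
    have L1 : lowest (iter j act) (sub act g * h) (act (a j.+1) + b j)%MM.
      by apply: (lowestM (@itD act j) (@itI act j)) => //; apply: lowest_sub.
    have L2 : lowest (iter j act) ((g + cst n c * h) * sub act h) (a j + act (b j.+1))%MM.
      by apply: (lowestM (@itD act j) (@itI act j)) => //; apply: lowest_sub.
    have E2 : sub act g * h = (g + cst n c * h) * sub act h by rewrite E; ring.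
    rewrite E2 in L1; have bal := lowest_unique (@itI act j) L1 L2; split=> //.
    rewrite !iterSr ltNge; apply/negP => le.
    have := ltmc_le_add lt le; rewrite -!itD -bal addmC ltxx; by [].
  have lt0 : (iter j0 act (a j0) < iter j0 act (b j0))%O.
    apply: le_lt_trans ltm; rewrite leNgt; apply/negP => lt.
    by apply: gm; apply: (la j0).2.
  have lt i : (iter (j0 + i) act (a (j0 + i)%N) < iter (j0 + i) act (b (j0 + i)%N))%O.
    by elim: i => [|i IH]; rewrite ?addn0 // addnS; case: (step _ IH).
  have bal i : (act (a (j0 + i.+1)%N) + b (j0 + i)%N = a (j0 + i)%N + act (b (j0 + i.+1)%N))%MM.
    by rewrite addnS; case: (step _ (lt i)).
  have [i [s [_ ab _ _]]] := balanced_eq (j0 := j0) (a := fun i => a (j0 + i)%N)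
     (b := fun i => b (j0 + i)%N) (fun i => la _) (fun i => lb _)
     bal.
  by have := lt i; rewrite ab ltxx.
have Vg j : vanish_below (iter j act) g (b j).
  move=> m ltm; apply: boolp.contrapT => gm; apply: (H j); by exists m.
have hb j : h (b j) != 0 by case: (lb j).
have rat j : g (b j.+1) / h (b j.+1) = g (b j) / h (b j) + c.
  have e1 : (sub act g * h) (act (b j.+1) + b j)%MM = g (b j.+1) * h (b j).
    rewrite (mps_lowM (@itD act j) (@itI act j) (vanish_below_sub (Vg j.+1)) (lb j).2).
    by rewrite sub_coef.
  have e2 : (g * sub act h) (b j + act (b j.+1))%MM = g (b j) * h (b j.+1).
    by rewrite (mps_lowM (@itD act j) (@itI act j) (Vg j) (Vb j)) sub_coef.
  have e3 : (h * sub act h) (b j + act (b j.+1))%MM = h (b j) * h (b j.+1).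
    by rewrite (mps_lowM (@itD act j) (@itI act j) (lb j).2 (Vb j)) sub_coef.
  move: e1; rewrite E mpsD cstM addmC e2 e3 => e1.
  have H1 := hb j; have H2 := hb j.+1.
  by apply: (mulIf H2); apply: (mulIf H1); rewrite divfK // -e1; field.
have [i [j [ij le]]] := dickson (fun j x => b j x).
have Eb : b i = b j.
  by apply: (lowest_le (@itD act j) (@itI act j) (lb j)) => //; apply/mnm_lepP.
have sum s : g (b (s + i)%N) / h (b (s + i)%N) = g (b i) / h (b i) + s%:R * c.
  by elim: s => [|s IH]; rewrite ?mul0r ?addr0 // addSn rat IH -natr1; ring.
have := sum (j - i)%N; rewrite subnK ?(ltnW ij) // -Eb -[LHS]addr0 => /addrI /esym/eqP.
by rewrite mulf_eq0 pnatr_eq0 subn_eq0 leqNgt ij (negbTE c0).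
Qed.

(** For [kappa] other than 1 the affine map has the fixed point [c / (1 - kappa)], and translating
    by it removes [c]. *)
Lemma affine_const act g h (kappa c : K) : h <> 0 -> kappa != 0 ->
  sub act g * h = cst n kappa * (g * sub act h) + cst n c * (h * sub act h) ->
  exists gam, g = cst n gam * h.
Proof.
move=> h0 k0 E; have [k1|k1] := eqVneq kappa 1.
  have c0 : c = 0 by apply: (@unipotent_const act g h c h0); rewrite E k1 rmorph1 mul1r.
  by apply: (@eigen_const act g h kappa h0 k0); rewrite E c0 rmorph0 mul0r addr0.
pose del := c / (1 - kappa).
have [|gam Eg] := @eigen_const act (g - cst n del * h) h kappa h0 k0.
  have -> : sub act (g - cst n del * h) = sub act g - cst n del * sub act h.
    by rewrite rmorphB rmorphM /= sub_cst.
  rewrite [LHS]mulrBl E; have -> : cst n c = cst n (1 - kappa) * cst n del.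
    by rewrite -rmorphM /= mulrC divfK // subr_eq0 eq_sym.
  by rewrite rmorphB rmorph1; ring.
exists (gam + del); by rewrite rmorphD mulrDl -Eg subrK.
Qed.
End Constants2.

(** * The difference operator on polynomials over a difference field *)

Lemma mderiv_const (F : fieldType) N (P : {mpoly F[N]}) :
  (forall j, j.+1%:R != 0 :> F) -> (forall v, P^`M(v) = 0) -> P = (P@_0%MM)%:MP.
Proof.
move=> ch dP; apply/mpolyP => m; rewrite mcoeffC.
have [->|/eqP nz] := eqVneq m 0%MM; first by rewrite mulr1.
have [v mv] : exists v, m v != 0%N.
  apply: boolp.contrapT => /boolp.forallNP h; apply: nz; apply/mnmP => v.
  by rewrite mnm0E; apply/eqP; apply: boolp.contrapT => /negP; apply: h.
have := mcoeff_deriv v (m - U_(v))%MM P; rewrite dP mcoeff0 submK; last first.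
  by apply/mnm_lepP => w; rewrite mnm1E; case: eqP => [<-|//]; rewrite lt0n.
move/esym/eqP; rewrite -[X in X == 0]mulr_natr mulf_eq0 (negbTE (ch _)) orbF => /eqP ->.
by rewrite mulr0.
Qed.

Lemma msize_mderiv (F : fieldType) N (P : {mpoly F[N]}) v : P^`M(v) != 0 ->
  (msize P^`M(v) < msize P)%N.
Proof.
move=> nz; rewrite -(mlead_deg nz).
have := mlead_supp nz; rewrite mcoeff_msupp mcoeff_deriv => h.
have /msize_mdeg_lt : (mlead P^`M(v) + U_(v))%MM \in msupp P.
  by rewrite mcoeff_msupp; apply: contraNneq h => ->; rewrite mul0rn.
by rewrite mdegD mdeg1 addn1.
Qed.

Lemma submm N (m : 'X_{1..N}) : (m - m = 0)%MM.
Proof. by apply/mnmP => i; rewrite mnmBE subnn mnm0E. Qed.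

Lemma mpoly_ring_ind (R : comNzRingType) N (Pr : {mpoly R[N]} -> Prop) :
  (forall c, Pr c%:MP) -> (forall v, Pr 'X_v) ->
  (forall p q, Pr p -> Pr q -> Pr (p + q)) ->
  (forall p q, Pr p -> Pr q -> Pr (p * q)) -> forall p, Pr p.
Proof.
move=> hC hX hD hM p; rewrite [p]mpolyE; elim/big_ind: _ => //; first by rewrite -mpolyC0.
move=> m _; rewrite -mul_mpolyC mpolyXE_id; apply: (hM) => //.
elim/big_ind: _ => // [|v _]; first by rewrite -mpolyC1.
by elim: (m v) => [|j IH]; rewrite ?expr0 -?mpolyC1 // exprS; apply: hM.
Qed.

Section Alg.
Variables (k : numFieldType) (F : fieldType) (io : {rmorphism k -> F}).
Variables (sg : {rmorphism F -> F}).
Hypothesis sg_io : forall c, sg (io c) = io c.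
Hypothesis sg_affine : forall q (kap c : k), kap != 0 -> sg q = io kap * q + io c ->
  exists gam, q = io gam.
Variables (N : nat) (lin : pred 'I_N) (x0 : 'I_N) (M : 'M[k]_N).
Variables (be e : 'I_N -> F).
Hypothesis M_tri : forall v w : 'I_N, (w < v)%N -> M v w = 0.
Hypothesis M_diag : forall v, lin v -> M v v != 0.
Hypothesis M_lin : forall v w, M v w != 0 -> lin v && lin w.
Hypothesis lin_x0 : lin x0.
Hypothesis M_x0 : forall v, M v x0 = (v == x0)%:R.
Hypothesis M_x0' : forall v, M x0 v = (v == x0)%:R.
Hypothesis be_x0 : be x0 = 1.
Hypothesis e_neq0 : forall v, e v != 0.

Implicit Types (P Q : {mpoly F[N]}) (m : 'X_{1..N}).

Let ch j : j.+1%:R != 0 :> F.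
Proof. by rewrite -(rmorph_nat io) fmorph_eq0 pnatr_eq0. Qed.

(** [lin] marks the variables moved by an affine map with constant matrix [M]; the others are
    multiplied by [e v]. The variable [x0] stands for the number of iterations and is moved by
    adding 1. *)
Definition thv v : {mpoly F[N]} :=
  if lin v then \sum_w io (M v w) *: 'X_w + (be v)%:MP else e v *: 'X_v.
Definition theta P : {mpoly F[N]} := mmap (@mpolyC N F \o sg) thv P.
HB.instance Definition _ := GRing.RMorphism.copy theta (mmap (@mpolyC N F \o sg) thv).

Lemma thetaC c : theta c%:MP = (sg c)%:MP.
Proof. exact: mmapC. Qed.
Lemma thetaX v : theta 'X_v = thv v.
Proof. by rewrite /theta mmapX mmap1U. Qed.
Lemma thetaZ c P : theta (c *: P) = sg c *: theta P.
Proof. by rewrite -mul_mpolyC rmorphM /= thetaC mul_mpolyC. Qed.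
Lemma thetaXm m : theta 'X_[m] = \prod_v thv v ^+ m v.
Proof. by rewrite /theta mmapX. Qed.

Lemma thetaE P : theta P = \sum_(m <- msupp P) sg P@_m *: theta 'X_[m].
Proof.
by rewrite {1}/theta /mmap; apply: eq_bigr => m _; rewrite mul_mpolyC thetaXm.
Qed.

Definition mu v := if lin v then io (M v v) else e v.
Lemma mu_neq0 v : mu v != 0.
Proof. by rewrite /mu; case: ifP => [/M_diag h|//]; rewrite fmorph_eq0. Qed.

(** Variables of smaller index are larger monomials, so the triangular shape of [M] makes ['X_v] the
    leading monomial of its image. *)
Lemma ltU (v w : 'I_N) : (v < w)%N -> (U_(w)%MM < U_(v)%MM :> 'X_{1..N})%O.
Proof.
move=> vw; apply/ltmcP; first by rewrite !mdeg1.
exists v; last by rewrite !mnm1E eqxx; case: eqP => // E; rewrite E ltnn in vw.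
move=> j jv; rewrite !mnm1E; have -> : (v == j) = false by apply: contraTF jv => /eqP ->; rewrite ltnn.
have jw := ltn_trans jv vw.
by have -> : (w == j) = false by apply: contraTF jw => /eqP ->; rewrite ltnn.
Qed.

Lemma thv_coef v : (thv v)@_U_(v) = mu v.
Proof.
rewrite /thv /mu; case: ifP => _; last by rewrite mcoeffZ mcoeffX eqxx mulr1.
rewrite mcoeffD mcoeffC mnm1_eq0 mulr0 addr0 raddf_sum (bigD1 v) //= mcoeffZ mcoeffX eqxx mulr1.
rewrite big1 ?addr0 // => w nw; rewrite mcoeffZ mcoeffX eq_mnm1 (negbTE nw) mulr0 //.
Qed.

Lemma thv_gt v m : (U_(v)%MM < m)%O -> (thv v)@_m = 0.
Proof.
move=> lt; rewrite /thv; case: ifP => _; last first.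
  by rewrite mcoeffZ mcoeffX; case: eqP => [E|_]; [rewrite E ltxx in lt|rewrite mulr0].
rewrite mcoeffD mcoeffC; have -> : (m == 0%MM) = false.
  by apply: contraTF lt => /eqP ->; rewrite -leNgt le0m.
rewrite mulr0 addr0 raddf_sum big1 //= => w _; rewrite mcoeffZ mcoeffX.
case: eqP => [E|]; last by rewrite mulr0.
case: (ltngtP w v) => [wv|vw|/val_inj Ew]; last by rewrite -E Ew ltxx in lt.
  by rewrite M_tri // rmorph0 mul0r.
by have := lt_trans lt (eq_ind _ (fun x => (x < U_(v)%MM)%O) (ltU vw) _ E); rewrite ltxx.
Qed.

Lemma thv_neq0 v : thv v != 0.
Proof. by apply: contraTneq (mu_neq0 v) => E; rewrite -thv_coef E mcoeff0 eqxx. Qed.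

Lemma mlead_thv v : mlead (thv v) = U_(v)%MM.
Proof.
apply/eqP; rewrite eq_le; apply/andP; split; last first.
  by apply: msupp_le_mlead; rewrite mcoeff_msupp thv_coef mu_neq0.
rewrite leNgt; apply/negP => /thv_gt /eqP; rewrite mleadc_eq0 (negbTE (thv_neq0 v)) //.
Qed.

Lemma mlead_thetaXm m : mlead (theta 'X_[m]) = m.
Proof.
rewrite thetaXm mlead_prod; last by move=> v _ _; rewrite expf_neq0 // thv_neq0.
rewrite [RHS](multinomUE_id m); apply: eq_bigr => v _.
by rewrite mleadX ?thv_neq0 // mlead_thv.
Qed.

Definition mum m := \prod_v mu v ^+ m v.

Lemma mleadc_thetaXm m : (theta 'X_[m])@_m = mum m.
Proof.
rewrite -[X in _@_X](mlead_thetaXm m) thetaXm.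
rewrite mlead_prod; last by move=> v _ _; rewrite expf_neq0 // thv_neq0.
rewrite mleadc_prod; apply: eq_bigr => v _.
rewrite mleadX ?thv_neq0 // mleadcX mlead_thv thv_coef //.
Qed.

Lemma theta_gt P m : (mlead P < m)%O -> (theta P)@_m = 0.
Proof.
move=> lt; rewrite thetaE raddf_sum big_seq big1 //= => x xP.
rewrite mcoeffZ [(theta _)@_ _]mcoeff_gt_mlead ?mulr0 // mlead_thetaXm.
exact: le_lt_trans (msupp_le_mlead xP) lt.
Qed.

Lemma theta_lead P : (theta P)@_(mlead P) = sg (mleadc P) * mum (mlead P).
Proof.
have [->|nz] := eqVneq P 0; first by rewrite rmorph0 !mcoeff0 rmorph0 mul0r.
rewrite thetaE raddf_sum (bigD1_seq (mlead P)) ?mlead_supp ?msupp_uniq //=.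
rewrite mcoeffZ mleadc_thetaXm big_seq_cond big1 ?addr0 // => x /andP[xP nx].
rewrite mcoeffZ [(theta _)@_ _]mcoeff_gt_mlead ?mulr0 // mlead_thetaXm lt_neqAle nx.
exact: msupp_le_mlead.
Qed.

Lemma mum_neq0 m : mum m != 0.
Proof. by apply/prodf_neq0 => v _; rewrite expf_neq0 // mu_neq0. Qed.

Lemma theta_eq0 P : theta P = 0 -> P = 0.
Proof.
move=> E; apply/eqP; rewrite -mleadc_eq0 -(fmorph_eq0 sg).
by have := theta_lead P; rewrite E mcoeff0 => /esym/eqP; rewrite mulf_eq0 (negbTE (mum_neq0 _)) orbF.
Qed.

Lemma mderiv_theta w P : (theta P)^`M(w) = \sum_v theta P^`M(v) * (thv v)^`M(w).
Proof.
elim/mpoly_ring_ind: P => [c|v|p q Hp Hq|p q Hp Hq].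
- by rewrite thetaC mderivC big1 // => v _; rewrite mderivC rmorph0 mul0r.
- rewrite thetaX (bigD1 v) //= big1 ?addr0 => [|u nu]; rewrite mderivX mnm1E.
    by rewrite eqxx scale1r submm mpolyX0 rmorph1 mul1r.
  by rewrite eq_sym (negbTE nu) scale0r rmorph0 mul0r.
- rewrite rmorphD mderivD Hp Hq -big_split; apply: eq_bigr => v _.
  by rewrite mderivD rmorphD mulrDl.
- rewrite rmorphM mderivM Hp Hq mulr_suml mulr_sumr -big_split; apply: eq_bigr => v _.
  by rewrite mderivM rmorphD !rmorphM /=; ring.
Qed.

Lemma dthv_lin v w : lin w -> (thv v)^`M(w) = (io (M v w))%:MP.
Proof.
move=> lw; rewrite /thv; case: ifP => lv.
  rewrite mderivD mderivC addr0 raddf_sum (bigD1 w) //= big1 => [|u nu].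
    by rewrite mderivZ mderivX mnm1E eqxx scale1r submm mpolyX0 addr0 -mul_mpolyC mulr1.
  by rewrite mderivZ mderivX mnm1E (negbTE nu) scale0r scaler0.
have -> : M v w = 0 by apply/eqP; apply/negPn/negP => /M_lin; rewrite lv.
rewrite rmorph0 mpolyC0 mderivZ mderivX mnm1E; case: eqP => [E|_]; last by rewrite scale0r scaler0.
by rewrite E lw in lv.
Qed.

(** Chain rule: the derivatives by linear variables obey a triangular system with constant
    coefficients, which allows a descent from [P] to polynomials of smaller size. *)
Lemma dtheta_lin w P : lin w ->
  (theta P)^`M(w) = \sum_v io (M v w) *: theta P^`M(v).
Proof.
move=> lw; rewrite mderiv_theta; apply: eq_bigr => v _.
by rewrite dthv_lin // mulrC mul_mpolyC.
Qed.

Lemma dtheta_x0 P : (theta P)^`M(x0) = theta P^`M(x0).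
Proof.
rewrite dtheta_lin // (bigD1 x0) //= big1 => [|v nv].
  by rewrite M_x0 eqxx rmorph1 scale1r addr0.
by rewrite M_x0 (negbTE nv) rmorph0 scale0r.
Qed.

(** By induction the derivative has derivative zero, so [P] is [r] times [x0] plus [q]. Comparing
    coefficients forces the eigenvalue to be 1 and [sg q] to be [q - r]; such a [q] is a constant,
    whence [r] is 0. *)
Lemma eigen_x0 P kap : (forall v, v != x0 -> P^`M(v) = 0) -> kap != 0 ->
  theta P = io kap *: P -> P^`M(x0) = 0.
Proof.
move: {2}(msize P).+1 (ltnSn (msize P)) => s; elim: s P => // s IH P; rewrite ltnS => sP dP k0 E.
apply/eqP; apply/negPn/negP => nz.
have dR v : v != x0 -> P^`M(x0)^`M(v) = 0 by move=> nv; rewrite mderiv_comm dP // mderiv0.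
have ER : theta P^`M(x0) = io kap *: P^`M(x0) by rewrite -dtheta_x0 E mderivZ.
have RR := IH _ (leq_trans (msize_mderiv nz) sP) dR k0 ER.
have Rc : P^`M(x0) = (P^`M(x0)@_0%MM)%:MP.
  by apply: mderiv_const => // v; have [->|/dR] := eqVneq v x0.
set r := (P^`M(x0))@_0%MM in Rc.
have [r' Er] : exists r', r = io r'.
  apply: (@sg_affine r kap 0 k0); rewrite rmorph0 addr0.
  move: ER; rewrite Rc thetaC -mul_mpolyC -mpolyCM => /(congr1 (mcoeff 0%MM)).
  by rewrite !mcoeffC eqxx !mulr1.
have Ec : P - r *: 'X_x0 = ((P - r *: 'X_x0)@_0%MM)%:MP.
  apply: mderiv_const => // v; rewrite mderivB mderivZ mderivX mnm1E.
  have [->|nv] := eqVneq v x0; first by rewrite scale1r submm mpolyX0 Rc -mul_mpolyC mulr1 subrr.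
  by rewrite dP // scale0r scaler0 subrr.
set q := (_)@_0%MM in Ec.
have EP : P = r *: 'X_x0 + q%:MP by rewrite -Ec addrC subrK.
have Et : thv x0 = 'X_x0 + 1.
  rewrite /thv lin_x0 be_x0 mpolyC1 (bigD1 x0) //= big1 => [|v nv].
    by rewrite M_x0' eqxx rmorph1 scale1r addr0.
  by rewrite M_x0' (negbTE nv) rmorph0 scale0r.
move: E; rewrite EP rmorphD /= thetaZ thetaX thetaC Et Er sg_io -Er => E.
have r0 : r != 0 by apply: contraNneq nz => r0; rewrite Rc r0.
have E1 := congr1 (mcoeff U_(x0)) E.
rewrite !mcoeffD !mcoeffZ !mcoeffD mcoeffZ mcoeffX eqxx mcoeff1 !mcoeffC mnm1_eq0 !mulr0 !addr0 !mulr1 in E1.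
have k1 : io kap = 1 by apply: (mulIf r0); rewrite mul1r.
have E0 := congr1 (mcoeff 0%MM) E.
rewrite k1 scale1r !mcoeffD !mcoeffZ !mcoeffD mcoeffX mcoeff1 !mcoeffC eqxx mnm1_eq0 !mulr0 !add0r !mulr1 in E0.
have [g Eg] : exists g, q = io g.
  apply: (@sg_affine q 1 (- r') (oner_neq0 _)).
  by rewrite rmorph1 mul1r rmorphN -Er -[X in X - r]E0 addrC addKr.
by move: E0; rewrite Eg sg_io => /eqP; rewrite -subr_eq0 addrK (negbTE r0).
Qed.

Definition linpoly P := forall v, ~~ lin v -> P^`M(v) = 0.
(** An additive constant is allowed so that the class survives differentiation, where it comes from
    derivatives already known to be constant. A variable other than [x0] must occur, since [x0]
    alone gives no relation between functions. *)
Definition affine_class P := [/\ linpoly P, exists2 v, v != x0 & P^`M(v) != 0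
  & exists kap c, kap != 0 /\ theta P = io kap *: P + (io c)%:MP].

(** It expresses that [theta] multiplies the polynomial with linear coefficients [q] and constant
    term [R] by [kap] and adds [c]. *)
Definition linear_alternative := exists (q : 'I_N -> k) (kap c : k) (R : F),
  [/\ kap != 0, exists2 v, v != x0 & q v != 0, forall v, ~~ lin v -> q v = 0,
      forall w, \sum_v q v * M v w = kap * q w
    & sg R + \sum_v io (q v) * be v = io kap * R + io c].

(** Differentiating the equation by [v] gives [M v v * sg r = kap * r - S], with [S] a constant
    built from the derivatives of smaller index, so that [sg_affine] applies to [r]. *)
Lemma const_derivs P kap c (w : nat) : kap != 0 -> theta P = io kap *: P + (io c)%:MP ->
  linpoly P -> (exists r, P^`M(x0) = (io r)%:MP) ->
  (forall v : 'I_N, (v < w)%N -> v != x0 -> exists r, P^`M(v) = r%:MP) ->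
  forall v : 'I_N, (v < w)%N -> exists r, P^`M(v) = (io r)%:MP.
Proof.
move=> k0 E lP Px h v; move: {2}(val v).+1 (ltnSn v) => s; elim: s v => // s IH v; rewrite ltnS => vs vw.
have [->|nv] := eqVneq v x0; first exact: Px.
case lv: (lin v); last by exists 0; rewrite rmorph0 lP ?lv.
have [r Er] := h v vw nv.
have [q Eq] : exists q : 'I_N -> k, forall u : 'I_N, (u < v)%N -> P^`M(u) = (io (q u))%:MP.
  have hu (u : 'I_N) : exists r, (u < v)%N -> P^`M(u) = (io r)%:MP.
    case: (ltnP u v) => [uv|_]; last by exists 0.
    by have [r' Er'] := IH u (leq_trans uv vs) (ltn_trans uv vw); exists r'.
  by have [q hq] := boolp.choice hu; exists q.
have := dtheta_lin P lv; rewrite E mderivD mderivC addr0 mderivZ Er.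
rewrite (bigD1 v) //= Er thetaC.
have -> : \sum_(i < N | i != v) io (M i v) *: theta P^`M(i) =
    (io (\sum_(i < N | i != v) M i v * (if (i < v)%N then q i else 0)))%:MP.
  rewrite rmorph_sum /= (raddf_sum (@mpolyC N F)); apply: eq_bigr => u nu.
  case: (ltngtP u v) => [uv|vu|/val_inj E']; last by rewrite E' eqxx in nu.
    by rewrite Eq // thetaC sg_io -mul_mpolyC -mpolyCM rmorphM.
  by rewrite M_tri // mul0r !rmorph0 scale0r.
set S := \sum_(i < N | _) _; rewrite -!mul_mpolyC -!mpolyCM -mpolyCD => /(congr1 (mcoeff 0%MM)).
rewrite !mcoeffC eqxx !mulr1 => E2.
have [g Eg] : exists g, r = io g.
  apply: (@sg_affine r (kap / M v v) (- S / M v v)).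
    by rewrite mulf_neq0 // invr_eq0 M_diag.
  have nz : io (M v v) != 0 by rewrite fmorph_eq0 M_diag.
  by apply: (mulfI nz); rewrite !rmorphM !fmorphV rmorphN /= mulrDr; move: E2 => E2;
     rewrite [X in X = _](_ : _ = io kap * r - io S); [field|rewrite E2 addrK].
by exists g; rewrite -Eg.
Qed.

(** Descent on the size. As long as some first derivative of [P] is not constant, a well chosen one
    is again in the class; once all of them are constants, [P] itself is the wanted affine form. *)
Lemma affine_class_linear P : affine_class P -> linear_alternative.
Proof.
move: {2}(msize P).+1 (ltnSn (msize P)) => s; elim: s P => // s IH P; rewrite ltnS => sP.
move=> [lP [v0 nv0 dv0] [kap [c [k0 E]]]].
have dR v w : ~~ lin v -> P^`M(w)^`M(v) = 0 by move=> lv; rewrite mderiv_comm lP // mderiv0.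
have ER : theta P^`M(x0) = io kap *: P^`M(x0).
  by rewrite -dtheta_x0 E mderivD mderivC addr0 mderivZ.
have small w Q : Q = P^`M(w) -> affine_class Q -> linear_alternative.
  move=> -> cQ; have [_ [v _ nz] _] := cQ.
  apply: (IH P^`M(w)) (cQ); apply: leq_trans sP; apply: msize_mderiv.
  by apply: contraNneq nz => ->; rewrite mderiv0.
case: (boolp.EM (exists2 v, v != x0 & P^`M(x0)^`M(v) != 0)) => [H|Hx].
  apply: (small x0 _ erefl); split=> //; first by move=> v lv; exact: dR.
  by exists kap, 0; rewrite rmorph0 mpolyC0 addr0.
have {}Hx v : v != x0 -> P^`M(x0)^`M(v) = 0.
  by move=> nv; apply/eqP; apply/negPn/negP => nz; apply: Hx; exists v.
have Hxx := eigen_x0 Hx k0 ER.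
have Px : exists r, P^`M(x0) = (io r)%:MP.
  have Rc : P^`M(x0) = (P^`M(x0)@_0%MM)%:MP.
    by apply: mderiv_const => // v; have [->|/Hx] := eqVneq v x0.
  move: ER; rewrite Rc; set r := _@_0%MM; rewrite thetaC -mul_mpolyC -mpolyCM.
  move=> /(congr1 (mcoeff 0%MM)); rewrite !mcoeffC eqxx !mulr1 => Er.
  have [r' ->] : exists r', r = io r'.
    by apply: (@sg_affine r kap 0 k0); rewrite rmorph0 addr0.
  by exists r'.
case: (boolp.EM (forall v, v != x0 -> exists r, P^`M(v) = r%:MP)) => [all|Hn].
  have allc (v : 'I_N) : exists r, P^`M(v) = (io r)%:MP.
    by apply: (const_derivs (w := N) k0 E lP Px) => // u _; apply: all.
  have [q hq] := boolp.choice allc.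
  have Ec : P - \sum_v io (q v) *: 'X_v = ((P - \sum_v io (q v) *: 'X_v)@_0%MM)%:MP.
    apply: mderiv_const => // v; rewrite mderivB hq (raddf_sum (mderiv v)) (bigD1 v) //= big1 => [|u nu].
      by rewrite mderivZ mderivX mnm1E eqxx scale1r submm mpolyX0 addr0 -mul_mpolyC mulr1 subrr.
    by rewrite mderivZ mderivX mnm1E (negbTE nu) scale0r scaler0.
  move: Ec; set R := _@_0%MM => Ec.
  have q0 v : ~~ lin v -> q v = 0.
    move=> lv; have := hq v; rewrite lP // => /esym/eqP.
    by rewrite mpolyC_eq0 fmorph_eq0 => /eqP.
  have EP : P = \sum_v io (q v) *: 'X_v + R%:MP by rewrite -Ec addrC subrK.
  have Et : theta P = \sum_w io (\sum_v q v * M v w) *: 'X_w +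
      (sg R + \sum_v io (q v) * be v)%:MP.
    rewrite EP rmorphD /= thetaC (raddf_sum (theta : {rmorphism _ -> _})) /=.
    transitivity (\sum_v (\sum_w io (q v * M v w) *: 'X_w + (io (q v) * be v)%:MP) + (sg R)%:MP : {mpoly F[N]}).
      congr (_ + _); apply: eq_bigr => v _; rewrite thetaZ sg_io thetaX /thv.
      case: ifP => [lv|/negbT lv].
        rewrite scalerDr scaler_sumr -!mul_mpolyC -mpolyCM; congr (_ + _).
        by apply: eq_bigr => w _; rewrite rmorphM /= -!mul_mpolyC mpolyCM mulrA.
      rewrite q0 // rmorph0 scale0r mul0r mpolyC0 addr0 big1 // => w _.
      by rewrite mul0r rmorph0 scale0r.
    rewrite big_split /= exchange_big /= mpolyCD (raddf_sum (@mpolyC N F)) /= -addrA [_ + (sg R)%:MP]addrC.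
    congr (_ + _); apply: eq_bigr => w _; rewrite rmorph_sum /= scaler_suml //.
  have Es : \sum_v io kap *: (io (q v) *: 'X_v) = \sum_v io (kap * q v) *: 'X_v :> {mpoly F[N]}.
    by apply: eq_bigr => v _; rewrite scalerA rmorphM.
  rewrite {}Et EP scalerDr scaler_sumr Es -addrA in E.
  have cU (f : 'I_N -> F) w : (\sum_v f v *: 'X_v : {mpoly F[N]})@_U_(w) = f w.
    rewrite raddf_sum (bigD1 w) //= mcoeffZ mcoeffX eqxx mulr1 big1 ?addr0 // => u nu.
    by rewrite mcoeffZ mcoeffX eq_mnm1 (negbTE nu) mulr0.
  have c0 (f : 'I_N -> F) : (\sum_v f v *: 'X_v : {mpoly F[N]})@_0%MM = 0.
    rewrite raddf_sum big1 //= => u _.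
    by rewrite mcoeffZ mcoeffX mnm1_eq0 mulr0.
  exists q, kap, c, R; split=> //.
  - exists v0 => //; apply: contraNneq dv0 => Z; by rewrite hq Z rmorph0 mpolyC0.
  - move=> w; have := congr1 (mcoeff U_(w)) E.
    by rewrite !mcoeffD !cU mcoeffZ !mcoeffC mnm1_eq0 !mulr0 !addr0 => /fmorph_inj.
  have := congr1 (mcoeff 0%MM) E.
  by rewrite !mcoeffD !c0 !add0r mcoeffZ !mcoeffC eqxx !mulr1.
have [w0 [nw0 Hw0]] : exists w, w != x0 /\ ~ exists r, P^`M(w) = r%:MP.
  apply: boolp.contrapT => /boolp.forallNP H; apply: Hn => v nv.
  by apply: boolp.contrapT => H'; apply: (H v).
(* Minimality of [w] makes the derivatives of smaller index constants, so that differentiating the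
   equation by [w] leaves an affine equation for this derivative alone. *)
have [w [nw Hw minw]] : exists w, [/\ w != x0, ~ (exists r, P^`M(w) = r%:MP) &
   forall v : 'I_N, (v < w)%N -> v != x0 -> exists r, P^`M(v) = r%:MP].
  move: {2}(val w0).+1 (ltnSn w0) => t; elim: t w0 nw0 Hw0 => // t IHt w0 nw0 Hw0; rewrite ltnS => wt.
  case: (boolp.EM (forall v : 'I_N, (v < w0)%N -> v != x0 -> exists r, P^`M(v) = r%:MP)) => [H|/boolp.existsNP[v H]].
    by exists w0.
  move/boolp.not_implyP: H => [vw /boolp.not_implyP[nv H]].
  by apply: (IHt v) => //; apply: leq_trans vw wt.
have lw : lin w.
  by apply/negPn/negP => /lP Z; apply: Hw; exists 0; rewrite Z mpolyC0.
apply: (small w _ erefl); split; first by move=> v lv; exact: dR.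
  apply: boolp.contrapT => H; apply: Hw; exists (P^`M(w)@_0%MM).
  apply: mderiv_const => // v; have [->|nv] := eqVneq v x0; first by rewrite mderiv_comm Hx.
  by apply/eqP/negPn/negP => nz; apply: H; exists v.
have lower := const_derivs k0 E lP Px minw.
have [q hq] : exists q : 'I_N -> k, forall v : 'I_N, (v < w)%N -> P^`M(v) = (io (q v))%:MP.
  have hu (u : 'I_N) : exists r, (u < w)%N -> P^`M(u) = (io r)%:MP.
    case: (ltnP u w) => [uv|_]; last by exists 0.
    by have [r' Er'] := lower u uv; exists r'.
  by have [q hq] := boolp.choice hu; exists q.
have := dtheta_lin P lw; rewrite E mderivD mderivC addr0 mderivZ.
rewrite (bigD1 w) //=.
have -> : \sum_(i < N | i != w) io (M i w) *: theta P^`M(i) =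
    (io (\sum_(i < N | i != w) M i w * (if (i < w)%N then q i else 0)))%:MP.
  rewrite rmorph_sum /= (raddf_sum (@mpolyC N F)); apply: eq_bigr => u nu.
  case: (ltngtP u w) => [uw|wu|/val_inj E']; last by rewrite E' eqxx in nu.
    by rewrite hq // thetaC sg_io -mul_mpolyC -mpolyCM rmorphM.
  by rewrite M_tri // mul0r !rmorph0 scale0r.
set S := \sum_(i < N | _) _ => E2.
have nz : io (M w w) != 0 by rewrite fmorph_eq0 M_diag.
exists (kap / M w w), (- S / M w w); split; first by rewrite mulf_neq0 // invr_eq0 M_diag.
apply: (scalerI nz); rewrite scalerDr scalerA -[RHS]/(_ + _).
have -> : io (M w w) * io (kap / M w w) = io kap by rewrite -rmorphM mulrC divfK // M_diag.
rewrite E2 -!mul_mpolyC -mpolyCM -rmorphM [M w w * _]mulrC divfK ?M_diag //.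
by rewrite rmorphN mpolyCN addrK.
Qed.

Definition mult_alternative := exists (d : 'I_N -> int) (q : F),
  [/\ q != 0, exists v, d v != 0, forall v, lin v -> d v = 0
    & q = sg q * \prod_(v < N) e v ^ d v].

Definition linpart m : 'X_{1..N} := [multinom if lin v then m v else 0%N | v < N].
Definition multpart m : 'X_{1..N} := [multinom if lin v then 0%N else m v | v < N].

Lemma partsE m : (linpart m + multpart m)%MM = m.
Proof. by apply/mnmP => v; rewrite mnmDE !mnmE; case: (lin v); rewrite ?addn0. Qed.

Lemma multpartD m1 m2 : multpart (m1 + m2)%MM = (multpart m1 + multpart m2)%MM.
Proof. by apply/mnmP => v; rewrite !(mnmDE, mnmE); case: (lin v). Qed.

(** Homogeneity for the grading by the exponents of the multiplicative variables. [theta] respects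
    it, because it scales each of these variables and mixes linear variables only among
    themselves. *)
Definition multhom P nu := forall m, m \in msupp P -> multpart m = nu.

Lemma multhom0 nu : multhom 0 nu.
Proof. by move=> m; rewrite mcoeff_msupp mcoeff0 eqxx. Qed.

Lemma multhomD P Q nu : multhom P nu -> multhom Q nu -> multhom (P + Q) nu.
Proof. by move=> hP hQ m /msuppD_le; rewrite mem_cat => /orP[/hP|/hQ]. Qed.

Lemma multhomZ c P nu : multhom P nu -> multhom (c *: P) nu.
Proof. by move=> hP m /msuppZ_le /hP. Qed.

Lemma multhomM P Q nu nu' : multhom P nu -> multhom Q nu' -> multhom (P * Q) (nu + nu')%MM.
Proof.
by move=> hP hQ m /msuppM_le /allpairsP[[m1 m2] [/= /hP <- /hQ <- ->]]; rewrite multpartD.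
Qed.

Lemma multhomX m : multhom 'X_[m] (multpart m).
Proof. by move=> m'; rewrite msuppX inE => /eqP ->. Qed.

Lemma multpart0 : multpart 0%MM = 0%MM.
Proof. by apply/mnmP => v; rewrite mnmE mnm0E; case: ifP. Qed.

Lemma multhom_thv v : multhom (thv v) (multpart U_(v)%MM).
Proof.
rewrite /thv; case: ifP => lv; last by apply: multhomZ; exact: multhomX.
have -> : multpart U_(v)%MM = 0%MM.
  by apply/mnmP => w; rewrite mnmE mnm0E mnm1E; case: ifP => // lw; case: eqP => // E; rewrite -E lv in lw.
apply: multhomD; last by move=> m; rewrite msuppC; case: ifP => // _; rewrite inE => /eqP ->; exact: multpart0.
apply: (big_ind (multhom^~ 0%MM)) => [|P Q|w _]; [exact: multhom0|exact: multhomD|].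
case lw: (lin w); last first.
  have -> : M v w = 0 by apply/eqP/negPn/negP => /M_lin; rewrite lw andbF.
  by rewrite rmorph0 scale0r; exact: multhom0.
apply: multhomZ => m; rewrite msuppX inE => /eqP ->.
by apply/mnmP => u; rewrite mnmE mnm0E mnm1E; case: ifP => // lu; case: eqP => // E; rewrite -E lw in lu.
Qed.

Lemma multhom_theta m : multhom (theta 'X_[m]) (multpart m).
Proof.
rewrite thetaXm [in multpart m](multinomUE_id m).
rewrite (big_morph multpart multpartD multpart0).
elim/big_rec2: _ => [|v nu P _ IH]; first by move=> m'; rewrite msupp1 inE => /eqP ->; exact: multpart0.
apply: multhomM IH; elim: (m v) => [|j IH].
  by move=> m'; rewrite msupp1 inE mulm0n => /eqP ->.
rewrite exprS mulmS multpartD; apply: multhomM => //; exact: multhom_thv.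
Qed.

Definition component nu P : {mpoly F[N]} := \sum_(m <- msupp P | multpart m == nu) P@_m *: 'X_[m].

Lemma component_coef nu P m : (component nu P)@_m = if multpart m == nu then P@_m else 0.
Proof.
rewrite /component raddf_sum /=; under eq_bigr do rewrite mcoeffZ mcoeffX.
case: ifP => hm.
  rewrite big_mkcond [in RHS](mpolyE P) raddf_sum /=; apply: eq_bigr => x _.
  rewrite mcoeffZ mcoeffX; case: ifP => hx; first by [].
  by case: eqP => [E|_]; [rewrite -E hx in hm | rewrite mulr0].
by rewrite big1 // => x hx; case: eqP => [E|_]; [rewrite -E hx in hm | rewrite mulr0].
Qed.

Lemma component_theta nu P : component nu (theta P) = theta (component nu P).
Proof.
apply/mpolyP => x; rewrite component_coef thetaE.
pose f m := sg P@_m * (theta 'X_[m])@_x.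
have f0 m : multpart m != multpart x -> f m = 0.
  move=> ne; rewrite /f; case: (boolP (x \in msupp (theta 'X_[m]))) => [/multhom_theta E|/memN_msupp_eq0 ->].
    by rewrite E eqxx in ne.
  by rewrite mulr0.
have -> : (theta (component nu P))@_x = \sum_(m <- msupp P | multpart m == nu) f m.
  rewrite /component (raddf_sum (theta : {rmorphism _ -> _})) raddf_sum /=.
  by apply: eq_bigr => m _; rewrite thetaZ mcoeffZ.
rewrite raddf_sum /=; case: eqP => [<-|nx].
  rewrite [RHS]big_mkcond; apply: eq_bigr => m _; rewrite mcoeffZ.
  by case: ifP => // /negbT /f0 E; rewrite -[LHS]/(f m) E.
by rewrite big1 // => m /eqP E; apply: f0; apply/eqP; rewrite E => E'; apply: nx.
Qed.

Lemma component_neq0 P m : P@_m != 0 -> component (multpart m) P != 0.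
Proof.
by apply: contraNneq => E; have := component_coef (multpart m) P m; rewrite E mcoeff0 eqxx => <-.
Qed.

Lemma mpolyXm_dvd P nu : (forall m, m \in msupp P -> multpart m = nu) ->
  exists Q, P = 'X_[nu] * Q /\ linpoly Q.
Proof.
move=> hP; exists (\sum_(m <- msupp P) P@_m *: 'X_[linpart m]); split.
  rewrite [LHS]mpolyE mulr_sumr; apply: eq_big_seq => m mP.
  by rewrite -scalerAr -mpolyXD -(hP m mP) addmC partsE.
move=> v lv; rewrite (raddf_sum (mderiv v)) big1 //= => m _.
by rewrite mderivZ mderivX mnmE (negbTE lv) scale0r scaler0.
Qed.

Lemma theta_multX (nu : 'X_{1..N}) : (forall v, lin v -> nu v = 0%N) ->
  theta 'X_[nu] = mum nu *: 'X_[nu].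
Proof.
move=> h; rewrite thetaXm [in RHS]mpolyXE_id /mum -mul_mpolyC (big_morph (@mpolyC N F) (@mpolyCM N F) (@mpolyC1 N F)) -big_split.
apply: eq_bigr => v _ /=; rewrite (rmorphXn (@mpolyC N F)) -exprMn mul_mpolyC /thv /mu.
by case lv: (lin v) => //; rewrite h // !expr0.
Qed.

(** Once the leading coefficient is normalised to 1, the eigenvalue is [mum] of the leading
    monomial. Only linear variables occur in it, so it is a product of diagonal entries of [M] and
    lies in [k]. *)
Lemma eigen_linpoly P lam : P != 0 -> linpoly P -> (exists v, P^`M(v) != 0) ->
  theta P = lam *: P -> linear_alternative.
Proof.
move=> nz lP [v0 dv0] E.
pose P' := (mleadc P)^-1 *: P; pose m := mlead P.
have lc0 : mleadc P != 0 by rewrite mleadc_eq0.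
have P'm : P'@_m = 1 by rewrite mcoeffZ mulVf.
have mE : mlead P' = m by rewrite mleadZ // invr_eq0.
have mum_io : exists2 kap, kap != 0 & mum m = io kap.
  exists (\prod_v (if lin v then M v v else 1) ^+ m v).
    by apply/prodf_neq0 => v _; rewrite expf_neq0 //; case: ifP => [/M_diag|] //; rewrite oner_neq0.
  rewrite rmorph_prod; apply: eq_bigr => v _; rewrite rmorphXn /mu; case lv: (lin v) => //.
  suff -> : m v = 0%N by rewrite !expr0.
  apply/eqP/negPn/negP => mv; have := lP v (negbT lv) => /(congr1 (mcoeff (m - U_(v))%MM)).
  rewrite mcoeff_deriv mcoeff0 submK; last first.
    by apply/mnm_lepP => w; rewrite mnm1E; case: eqP => [<-|//]; rewrite lt0n.
  by move/eqP; rewrite -mulr_natr mulf_eq0 (negbTE (ch _)) orbF (negbTE lc0).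
have [kap k0 mumE] := mum_io.
have E' : theta P' = io kap *: P'.
  have E1 : theta P' = (sg (mleadc P)^-1 * lam * mleadc P) *: P'.
    by rewrite thetaZ E !scalerA mulfK.
  suff <- : sg (mleadc P)^-1 * lam * mleadc P = io kap by [].
  have := theta_lead P'; rewrite mE P'm rmorph1 mul1r mumE => <-.
  by rewrite E1 mcoeffZ P'm mulr1.
have lP' : linpoly P' by move=> v lv; rewrite mderivZ lP // scaler0.
have dP' v : P^`M(v) != 0 -> P'^`M(v) != 0.
  by move=> nzv; rewrite mderivZ mscalerI negb_or invr_eq0 lc0.
apply: (@affine_class_linear P'); split=> //; last first.
  by exists kap, 0; rewrite rmorph0 mpolyC0 addr0.
apply: boolp.contrapT => H.
have h v : v != x0 -> P'^`M(v) = 0.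
  by move=> nv; apply/eqP/negPn/negP => nzv; apply: H; exists v.
have := dP' _ dv0; have [->|/h ->] := eqVneq v0 x0; last by rewrite eqxx.
by rewrite (eigen_x0 h k0 E') eqxx.
Qed.

(** Stability of [I] under [theta P - c *: P] is enough to cancel the leading term of [theta P]. If
    linear variables occur in the eigenvector, one homogeneous component, divided by its
    multiplicative monomial, gives the first alternative. Otherwise the exclusion of monomials from
    [I] provides two terms, and the quotient of their coefficients gives the second. *)
Lemma ideal_alternative (I : {mpoly F[N]} -> Prop) P0 :
  (forall P c, I P -> I (theta P - c *: P)) ->
  (forall q (m : 'X_{1..N}), (forall v, lin v -> m v = 0%N) -> I (q *: 'X_[m]) -> q = 0) ->
  I P0 -> P0 != 0 -> linear_alternative \/ mult_alternative.
Proof.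
move=> I_comb I_mono IP0 nz0.
have [P [IP nzP minP]] : exists P, [/\ I P, P != 0 & forall Q, I Q -> Q != 0 -> (mlead P <= mlead Q)%O].
  move: {2}(mlead P0) (erefl (mlead P0)) => x.
  move: x P0 IP0 nz0; apply: (well_founded_ind (@ltom_wf N)) => x IH P IP nzP Ex.
  case: (boolp.EM (exists Q, [/\ I Q, Q != 0 & (mlead Q < mlead P)%O])) => [[Q [IQ nzQ lt]]|H].
    by apply: (IH (mlead Q)) IQ nzQ erefl; rewrite -Ex.
  exists P; split=> // Q IQ nzQ; rewrite leNgt; apply/negP => lt; apply: H; by exists Q.
pose lam := sg (mleadc P) * mum (mlead P) / mleadc P.
have lc0 : mleadc P != 0 by rewrite mleadc_eq0.
have E : theta P = lam *: P.
  apply/eqP; rewrite -subr_eq0; apply/negPn/negP => nz.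
  have le := minP _ (I_comb _ lam IP) nz.
  have := nz; rewrite -mleadc_eq0 mcoeffB mcoeffZ; move: le; rewrite le_eqVlt => /orP[/eqP <-|lt].
    by rewrite theta_lead /lam divfK // subrr eqxx.
  by rewrite (theta_gt lt) (mcoeff_gt_mlead lt) mulr0 subrr eqxx.
have Ec nu : theta (component nu P) = lam *: component nu P.
  rewrite -component_theta E; apply/mpolyP => x.
  by rewrite mcoeffZ !component_coef mcoeffZ; case: ifP; rewrite ?mulr0.
case: (boolp.EM (exists2 m, P@_m != 0 & linpart m != 0%MM)) => [[m Pm lm]|allm].
  left; pose nu := multpart m.
  have nzc : component nu P != 0 by exact: component_neq0.
  have [Q [EQ lQ]] : exists Q, component nu P = 'X_[nu] * Q /\ linpoly Q.
    apply: mpolyXm_dvd => x; rewrite mcoeff_msupp component_coef.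
    by case: ifP => [/eqP|]; rewrite ?eqxx.
  have nulin v : lin v -> nu v = 0%N by move=> lv; rewrite mnmE lv.
  have X0 : 'X_[nu] != 0 :> {mpoly F[N]} by rewrite -msize_poly_eq0 msizeX.
  have nzQ : Q != 0 by apply: contraNneq nzc => Z; rewrite EQ Z mulr0.
  apply: (@eigen_linpoly Q (lam / mum nu)) => //.
    apply: boolp.contrapT => H.
    have Qc : Q = (Q@_0%MM)%:MP.
      by apply: mderiv_const => // v; apply/eqP/negPn/negP => nzv; apply: H; exists v.
    have := component_coef nu P m; rewrite eqxx EQ Qc mulrC mul_mpolyC mcoeffZ mcoeffX.
    case: eqP => [Em|_]; last by rewrite mulr0 => /esym/eqP; rewrite (negbTE Pm).
    move=> _; case/negP: lm; apply/eqP; apply: (@addIm _ nu); rewrite add0m {2}Em.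
    exact: partsE.
  have := Ec nu; rewrite EQ rmorphM /= theta_multX // -scalerAl => Et.
  apply: (scalerI (mum_neq0 nu)); rewrite scalerA mulrC divfK ?mum_neq0 //.
  by apply: (mulfI X0); rewrite -scalerAr Et scalerAr.
right.
have multm m : P@_m != 0 -> multpart m = m.
  move=> Pm; rewrite -[RHS]partsE; suff -> : linpart m = 0%MM by rewrite add0m.
  by apply/eqP/negPn/negP => nz; apply: allm; exists m.
have eig m : P@_m != 0 -> sg P@_m * mum m = lam * P@_m.
  move=> Pm; rewrite -mcoeffZ -E thetaE raddf_sum (bigD1_seq m) ?msupp_uniq ?mcoeff_msupp //=.
  rewrite mcoeffZ mleadc_thetaXm big_seq_cond big1 ?addr0 // => x /andP[]; rewrite mcoeff_msupp => Px nx.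
  rewrite mcoeffZ theta_multX; last by move=> v lv; rewrite -(multm x Px) mnmE lv.
  by rewrite mcoeffZ mcoeffX (negbTE nx) !mulr0.
have lam0 : lam != 0 by rewrite !mulf_neq0 ?invr_eq0 ?fmorph_eq0 ?mum_neq0.
pose m2 := mlead P.
have mlin m : P@_m != 0 -> forall v, lin v -> m v = 0%N.
  by move=> Pm v lv; rewrite -(multm m Pm) mnmE lv.
have [m1 P1 ne] : exists2 m1, P@_m1 != 0 & m1 != m2.
  apply: boolp.contrapT => H; case/negP: (lc0); apply/eqP; apply: (I_mono _ m2).
    exact: (mlin m2 lc0).
  suff <- : P = mleadc P *: 'X_[m2] by [].
  apply/mpolyP => x; rewrite mcoeffZ mcoeffX; case: eqP => [<-|nx]; first by rewrite mulr1.
  rewrite mulr0; apply/eqP/negPn/negP => Px; apply: H; exists x => //.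
  by apply/eqP => E'; apply: nx.
exists (fun v => (m1 v)%:Z - (m2 v)%:Z), (P@_m1 / P@_m2); split.
- by rewrite mulf_neq0 // invr_eq0.
- apply: boolp.contrapT => /boolp.forallNP H; case/eqP: ne; apply/mnmP => v.
  by apply/eqP/negPn/negP => nz; apply: (H v); rewrite /= subr_eq0 eqz_nat.
- by move=> v lv; rewrite (mlin m1) // (mlin m2).
have -> : \prod_(v < N) e v ^ ((m1 v)%:Z - (m2 v)%:Z) = mum m1 / mum m2.
  rewrite /mum -prodfV -big_split; apply: eq_bigr => v _ /=.
  rewrite expfzDr // -exprnP -invr_expz -exprnP /mu; case lv: (lin v) => //.
  by rewrite (mlin m1) // (mlin m2) // !expr0.
rewrite rmorphM fmorphV.
have e1 := eig _ P1; have e2 := eig _ lc0.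
have -> : sg P@_m1 = lam * P@_m1 / mum m1 by rewrite -e1 mulfK ?mum_neq0.
have -> : sg P@_m2 = lam * P@_m2 / mum m2 by rewrite -e2 mulfK ?mum_neq0.
by have h1 := mum_neq0 m1; have h2 := mum_neq0 m2; field; rewrite h1 h2 lam0 lc0.
Qed.
End Alg.

(** * Consequences of conditions (I) and (II) *)

Section ActOmega.
Variables (n : nat) (Omega : 'M[nat]_n).

Lemma mnm_actD : {morph mnm_act Omega : x y / (x + y)%MM >-> (x + y)%MM}.
Proof.
move=> x y; apply/mnmP => j; rewrite mnmDE !mnmE -big_split /=.
by apply: eq_bigr => i _; rewrite mnmDE mulnDl.
Qed.

Lemma mnm_act0 : mnm_act Omega 0%MM = 0%MM.
Proof. by apply/mnmP => j; rewrite mnmE mnm0E big1 // => i _; rewrite mnm0E. Qed.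

Lemma mnm_actU i j : mnm_act Omega U_(i)%MM j = Omega i j.
Proof.
rewrite mnmE (bigD1 i) //= mnm1E eqxx mul1n big1 ?addn0 // => i' ne.
by rewrite mnm1E eq_sym (negbTE ne).
Qed.

Lemma mnm_act_exp k m j : iter k (mnm_act Omega) m j = (\sum_i m i * (Omega ^+ k) i j)%N.
Proof.
elim: k m => [|k IH] m.
  rewrite expr0 /= (bigD1 j) //= mxE eqxx big1 => [|i ne]; last by rewrite mxE (negbTE ne) muln0.
  by rewrite addn0 muln1.
rewrite iterSr IH exprS; under [RHS]eq_bigr do rewrite mxE big_distrr.
rewrite exchange_big /=; apply: eq_bigr => i _.
by rewrite mnmE big_distrl /=; apply: eq_bigr => i' _; rewrite mulnA.
Qed.

Variable R : realType.
Hypothesis hI : condI R Omega.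

Definition mrow (m : 'X_{1..n}) : 'rV[R[i]]_n := \row_j (m j)%:R.

Lemma mrow_act m : mrow (mnm_act Omega m) = mrow m *m cmatrix R Omega.
Proof.
apply/rowP => j; rewrite !mxE mnmE natr_sum; apply: eq_bigr => i _.
by rewrite !mxE natrM.
Qed.

Lemma mrow_inj : injective mrow.
Proof.
move=> a b /rowP E; apply/mnmP => j; have := E j; rewrite !mxE => /eqP.
by rewrite eqr_nat => /eqP.
Qed.

Lemma mnm_act_inj : injective (mnm_act Omega).
Proof.
move=> a b E; apply: mrow_inj; have := congr1 mrow E; rewrite !mrow_act.
by case: hI => U _; apply: (can_inj (mulmxK U)).
Qed.

Lemma mnm_act_deg k : (mdeg k <= mdeg (mnm_act Omega k))%N.
Proof.
rewrite !mdegE; under [leqRHS]eq_bigr do rewrite mnmE.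
rewrite exchange_big /=; apply: leq_sum => i _; rewrite -big_distrr /=.
apply: leq_pmulr; rewrite lt0n; apply/negP; rewrite sum_nat_eq0 => /forallP h.
have : mnm_act Omega U_(i)%MM = mnm_act Omega 0%MM.
  apply/mnmP => j; rewrite mnm_act0 mnm0E mnm_actU; apply/eqP; exact: h.
by move/mnm_act_inj/eqP; rewrite mnm1_eq0.
Qed.

Lemma mrow_iter t m : mrow (iter t (mnm_act Omega) m) = iter t (mulmx^~ (cmatrix R Omega)) (mrow m).
Proof. by elim: t => //= t <-; rewrite mrow_act. Qed.

(** Factor ['X^t - 1] over the algebraically closed field and apply the factors to [D] one at a
    time: the last nonzero vector obtained is an eigenvector, and its eigenvalue is a root of
    ['X^t - 1]. *)
Lemma iter_fixed_eigen t (D : 'rV[R[i]]_n) : (0 < t)%N -> D != 0 ->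
  iter t (mulmx^~ (cmatrix R Omega)) D = D -> False.
Proof.
move=> t0 D0 E; set Cm := cmatrix R Omega in E.
pose ev (q : {poly R[i]}) (v : 'rV[R[i]]_n) := \sum_(i < size q) q`_i *: iter i (mulmx^~ Cm) v.
have evE s (q : {poly R[i]}) (v : 'rV[R[i]]_n) : (size q <= s)%N -> ev q v = \sum_(i < s) q`_i *: iter i (mulmx^~ Cm) v.
  move=> le; rewrite /ev (big_ord_widen _ (fun i => q`_i *: iter i (mulmx^~ Cm) v) le) big_mkcond.
  by apply: eq_bigr => i _; case: ltnP => // h; rewrite nth_default // scale0r.
have itL i (v : 'rV[R[i]]_n) z : iter i (mulmx^~ Cm) (v *m Cm - z *: v) =
    iter i.+1 (mulmx^~ Cm) v - z *: iter i (mulmx^~ Cm) v.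
  rewrite iterSr; elim: i v => [//|i IH] v /=.
  by rewrite !IH mulmxBl scalemxAl.
have evM z (q : {poly R[i]}) (v : 'rV[R[i]]_n) : ev (('X - z%:P) * q) v = ev q (v *m Cm - z *: v).
  have le : (size (('X - z%:P) * q)%R <= (size q).+1)%N.
    by apply: leq_trans (size_polyMleq _ _) _; rewrite size_XsubC.
  rewrite (evE _ _ _ le) [RHS](evE (size q).+1) //.
  under [RHS]eq_bigr do rewrite itL scalerBr.
  rewrite sumrB; under eq_bigr do rewrite mulrBl coefB coefXM coefCM scalerBl.
  rewrite sumrB; congr (_ - _).
    rewrite big_ord_recl /= scale0r add0r [RHS]big_ord_recr /= nth_default // scale0r addr0 //.
  by apply: eq_bigr => i _; rewrite scalerA mulrC.
have main rs : forall v, v != 0 -> ev (\prod_(z <- rs) ('X - z%:P)) v = 0 ->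
    exists2 z, z \in rs & eigenvalue Cm z.
  elim: rs => [|z rs IH] v v0.
    by rewrite big_nil (evE 1%N) ?size_poly1 // big_ord1 coef1 scale1r => /eqP; rewrite (negbTE v0).
  rewrite big_cons evM; have [Z _|nz] := eqVneq (v *m Cm - z *: v) 0.
    exists z; first by rewrite mem_head.
    by apply/eigenvalueP; exists v => //; apply/eqP; rewrite -subr_eq0 Z.
  by move/(IH _ nz) => [z' z'rs ez']; exists z' => //; rewrite inE z'rs orbT.
case: t t0 E => // t _ E.
pose p : {poly R[i]} := 'X^(t.+1) - 1%:P.
have [rs Ep] := closed_field_poly_normal p.
have lp : lead_coef p = 1 by exact: lead_coefXnsubC.
rewrite lp scale1r in Ep.
have evp : ev p D = 0.
  rewrite (evE t.+2) ?size_XnsubC //; under eq_bigr do rewrite coefB coef1 coefXn scalerBl.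
  rewrite sumrB (bigD1 ord_max) //= [X in _ - X](bigD1 ord0) //= !big1.
  - by rewrite !addr0 /= eqxx !scale1r; move: E => /= ->; rewrite subrr.
  - by move=> i ni; rewrite -[(i == 0%N :> nat)]/(i == ord0) (negbTE ni) scale0r.
  - by move=> i ni; rewrite -[(i == t.+1 :> nat)]/(i == ord_max) (negbTE ni) scale0r.
rewrite Ep in evp; have [z zrs ez] := main rs D D0 evp.
case: hI => _ /(_ z ez t.+1 isT) /negP; apply.
have : root p z by rewrite Ep root_prod_XsubC.
by rewrite /root /p !hornerE subr_eq0.
Qed.

Lemma expo_map_act : expo_map (mnm_act Omega).
Proof.
split; [exact: mnm_actD|exact: mnm_act_inj|exact: mnm_act_deg|].
move=> t t0 a b E; apply: mrow_inj; apply/eqP; rewrite -subr_eq0; apply/negPn/negP => nz.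
apply: (iter_fixed_eigen t0 nz).
have mD x y : mrow (x + y)%MM = mrow x + mrow y.
  by apply/rowP => j; rewrite !mxE mnmDE natrD.
have itB i (x y : 'rV[R[i]]_n) : iter i (mulmx^~ (cmatrix R Omega)) (x - y) =
   iter i (mulmx^~ (cmatrix R Omega)) x - iter i (mulmx^~ (cmatrix R Omega)) y.
  by elim: i => //= i ->; rewrite mulmxBl.
have := congr1 mrow E; rewrite !mD !mrow_iter itB => E'.
by apply/eqP; rewrite subr_eq addrAC -E' addrK.
Qed.

(** If [rho] were at most 1, the late powers of [Omega] would be bounded, so two of them would
    coincide by the pigeonhole principle, and [expo_map] excludes that. *)
Lemma rho_gt1 (rho : R) : max_eigenvalue_modulus Omega rho -> condII Omega rho -> 1 < rho.
Proof.
move=> [[x ex nx] _] hII; rewrite ltNge; apply/negP => rho1.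
have n0 : (0 < n)%N.
  case/eigenvalueP: ex => v _; apply: contraNT; rewrite -eqn0Ngt => /eqP n0.
  by apply/eqP/rowP => j; have := ltn_ord j; rewrite [X in (_ < X)%N]n0.
have rho0 : 0 <= rho by rewrite -nx; case: (x) => a b; exact: sqrtr_ge0.
have bnd (ij : 'I_n * 'I_n) : exists Bk : nat * nat, forall k, (Bk.2 <= k)%N ->
    ((Omega ^+ k) ij.1 ij.2 <= Bk.1)%N.
  case: ij => i j; have [B [k0 h]] := hII i j; exists (Num.trunc `|B|, k0) => k /h /= le.
  have le' : ((Omega ^+ k) i j)%:R <= `|B|.
    apply: le_trans le _; apply: le_trans (ler_norm _) _; rewrite normrM.
    by rewrite -[leRHS]mulr1 ler_wpM2l // normrX ger0_norm // exprn_ile1.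
  by rewrite -(natrK (R := R) ((Omega ^+ k) i j)); apply: le_truncn.
have [Bf hB] := boolp.choice bnd.
pose B := \max_ij (Bf ij).1; pose k0 := \max_ij (Bf ij).2.
pose Z k : 'M['I_B.+1]_n := \matrix_(i, j) inord ((Omega ^+ (k0 + k)) i j).
have Zeq k k' : Z k = Z k' -> Omega ^+ (k0 + k) = Omega ^+ (k0 + k').
  move=> /matrixP E; apply/matrixP => i j; have := E i j; rewrite !mxE => /(congr1 val).
  have bd l : ((Omega ^+ (k0 + l)) i j <= B)%N.
    apply: leq_trans (leq_bigmax (i, j)); apply: (hB (i, j)).
    by apply: leq_trans (leq_addr _ _); apply: leq_bigmax.
  by rewrite /= !inordK // ltnS.
have [k [k' [ne E]]] : exists k k', (k < k')%N /\ Z k = Z k'.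
  apply: boolp.contrapT => H.
  have inj : injective (fun i : 'I_(#|{: 'M['I_B.+1]_n}|.+1) => Z i).
    move=> i j E; apply: val_inj; case: (ltngtP (val i) (val j)) => // lt; case: H.
      by exists (val i), (val j).
    by exists (val j), (val i).
  by have := leq_card _ inj; rewrite card_ord ltnn.
have {}E := Zeq _ _ E.
have Em m : iter (k0 + k) (mnm_act Omega) m = iter (k0 + k') (mnm_act Omega) m.
  by apply/mnmP => j; rewrite !mnm_act_exp E.
pose U := U_(Ordinal n0)%MM : 'X_{1..n}.
have [_ _ _ /(_ (k' - k)%N)] := expo_map_act; rewrite subn_gt0 => /(_ ne U 0%MM).
have -> : iter (k' - k) (mnm_act Omega) 0%MM = 0%MM.
  by elim: (k' - k)%N => //= i ->; rewrite mnm_act0.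
rewrite !addm0 => H; have : U = 0%MM.
  apply: H; apply: (@iter_inj _ _ (k0 + k) mnm_act_inj).
  by rewrite -iterD -addnA subnKC ?(ltnW ne) // Em.
by move/eqP; rewrite mnm1_eq0.
Qed.
End ActOmega.

(** * The difference field of rational functions *)

Section FracNumden.
Local Open Scope quotient_scope.
Lemma frac_numden (R : idomainType) (x : {fraction R}) :
  x = (\n_(repr x))%:F / (\d_(repr x))%:F.
Proof.
have d0 : (\d_(repr x))%:F != 0 :> {fraction R} by rewrite tofrac_eq0 denom_ratioP.
apply: (mulIf d0); rewrite divfK //.
rewrite -[X in X * _](reprK x); set r := repr x.
rewrite -[LHS]/(FracField.mul (\pi_(FracField.type R) r) (\d_r)%:F).
rewrite !piE; apply/eqmodP; rewrite /= FracField.equivfE.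
rewrite !numden_Ratio ?oner_eq0 ?mulf_neq0 ?denom_ratioP //; first by rewrite !mulr1 mulrC.
- exact: oner_neq0.
- exact: oner_neq0.
Qed.
End FracNumden.

Lemma fracP (R : idomainType) (x : {fraction R}) : exists p q : R, q != 0 /\ x = p%:F / q%:F.
Proof. by exists \n_(repr x), \d_(repr x); rewrite denom_ratioP -frac_numden. Qed.

Lemma tofrac_inj (R : idomainType) : injective (@tofrac R).
Proof. by move=> p q /eqP; rewrite tofrac_eq => /eqP. Qed.

Lemma frac_eq (R : idomainType) (p q p' q' : R) : q != 0 -> q' != 0 ->
  p%:F / q%:F = p'%:F / q'%:F <-> p * q' = p' * q.
Proof.
move=> q0 q0'; have f0 : q%:F != 0 by rewrite tofrac_eq0.
have f0' : q'%:F != 0 by rewrite tofrac_eq0.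
split=> [/eqP|E]; last by apply/eqP; rewrite eqr_div // -!tofracM E.
by rewrite eqr_div // -!tofracM tofrac_eq => /eqP.
Qed.

Lemma subf_div (F : fieldType) (a b c d : F) : b != 0 -> d != 0 ->
  a / b - c / d = (a * d - c * b) / (b * d).
Proof. by move=> b0 d0; field; rewrite b0 d0. Qed.

Lemma affine_div (F : fieldType) (k c p q q' : F) : q != 0 ->
  (k * (p / q) + c) * q' * q = k * (p * q') + c * (q * q').
Proof. by move=> q0; field. Qed.

Section FracMap.
Variables (R : idomainType) (f : {rmorphism R -> R}).
Hypothesis fI : injective f.

(** Defined through the chosen representative; injectivity of [f] keeps the denominator nonzero and
    makes the choice immaterial. *)
Definition fmap (q : {fraction R}) : {fraction R} := (f \n_(repr q))%:F / (f \d_(repr q))%:F.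

Lemma inj_eq0 (p : R) : (f p == 0) = (p == 0).
Proof. by rewrite -{1}(rmorph0 f) (inj_eq fI). Qed.

Lemma fmapE (p q : R) : q != 0 -> fmap (p%:F / q%:F) = (f p)%:F / (f q)%:F.
Proof.
move=> q0; rewrite /fmap; set x := p%:F / q%:F.
have d0 : \d_(repr x) != 0 by exact: denom_ratioP.
have /frac_eq : (\n_(repr x))%:F / (\d_(repr x))%:F = p%:F / q%:F by rewrite -frac_numden.
move=> /(_ d0 q0) E; apply/frac_eq; rewrite ?inj_eq0 //.
by rewrite -!rmorphM E.
Qed.

Lemma fmap_tofrac (p : R) : fmap p%:F = (f p)%:F.
Proof. by rewrite -[p%:F]divr1 -tofrac1 fmapE ?oner_neq0 // rmorph1 tofrac1 divr1. Qed.

Lemma fmap_is_zmod_morphism : zmod_morphism fmap.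
Proof.
move=> x y; have [p [q [q0 ->]]] := fracP x; have [p' [q' [q0' ->]]] := fracP y.
rewrite subf_div ?tofrac_eq0 // -!tofracM -tofracB !fmapE ?mulf_neq0 //.
by rewrite rmorphB !rmorphM tofracB !tofracM subf_div // tofrac_eq0 inj_eq0.
Qed.

Lemma fmap_is_monoid_morphism : monoid_morphism fmap.
Proof.
split; first by rewrite -tofrac1 fmap_tofrac rmorph1.
move=> x y; have [p [q [q0 ->]]] := fracP x; have [p' [q' [q0' ->]]] := fracP y.
by rewrite mulf_div -!tofracM !fmapE ?mulf_neq0 // !rmorphM mulf_div.
Qed.

Lemma fmap_affine (p q k c : R) : q != 0 ->
  fmap (p%:F / q%:F) = k%:F * (p%:F / q%:F) + c%:F ->
  f p * q = k * (p * f q) + c * (q * f q).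
Proof.
move=> q0; rewrite fmapE // => E.
have f0 : q%:F != 0 by rewrite tofrac_eq0.
have f1 : (f q)%:F != 0 by rewrite tofrac_eq0 inj_eq0.
have E2 : (f p)%:F = (k%:F * (p%:F / q%:F) + c%:F) * (f q)%:F by rewrite -E divfK.
by apply: tofrac_inj; rewrite tofracD !tofracM E2 affine_div.
Qed.
End FracMap.

Section Fsub.
Variables (K : numFieldType) (n : nat) (act : expoMap n).
Local Notation F := {fraction {mpoly K[n]}}.

Lemma psub_inj : injective (psub act : {mpoly K[n]} -> _).
Proof. by move=> p q E; apply/mpolyP => m; rewrite -(psub_coef act p) -(psub_coef act q) E. Qed.

Lemma psub_eq0 (p : {mpoly K[n]}) : (psub act p == 0) = (p == 0).
Proof. exact: inj_eq0 psub_inj p. Qed.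

Definition ratsub (q : F) : F := fmap (psub act) q.

Lemma ratsubE (p q : {mpoly K[n]}) : q != 0 ->
  ratsub (p%:F / q%:F) = (psub act p)%:F / (psub act q)%:F.
Proof. exact: (fmapE psub_inj). Qed.

Lemma ratsub_tofrac (p : {mpoly K[n]}) : ratsub p%:F = (psub act p)%:F.
Proof. exact: (fmap_tofrac psub_inj). Qed.

HB.instance Definition _ := GRing.isZmodMorphism.Build F F ratsub
  (fmap_is_zmod_morphism psub_inj).
HB.instance Definition _ := GRing.isMonoidMorphism.Build F F ratsub
  (fmap_is_monoid_morphism psub_inj).

Definition fcst (c : K) : F := (c%:MP)%:F.
Lemma fcst_is_zmod_morphism : zmod_morphism fcst.
Proof. by move=> x y; rewrite /fcst mpolyCB tofracB. Qed.
Lemma fcst_is_monoid_morphism : monoid_morphism fcst.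
Proof. by split=> [|x y]; rewrite /fcst ?mpolyC1 ?tofrac1 // mpolyCM tofracM. Qed.
HB.instance Definition _ := GRing.isZmodMorphism.Build K F fcst fcst_is_zmod_morphism.
HB.instance Definition _ := GRing.isMonoidMorphism.Build K F fcst fcst_is_monoid_morphism.

Lemma ratsub_cst c : ratsub (fcst c) = fcst c.
Proof. by rewrite ratsub_tofrac psubC. Qed.

(** Clearing denominators gives an equation between polynomials; read as power series, they fall
    under [affine_const]. *)
Lemma ratsub_affine (q : F) (kap c : K) : kap != 0 -> ratsub q = fcst kap * q + fcst c ->
  exists gam, q = fcst gam.
Proof.
have [P [Q [Q0 ->]]] := fracP q => k0 /(fmap_affine psub_inj Q0) E1.
have [||gam Eg] := @affine_const K n act (ofp P) (ofp Q) kap c _ k0.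
- by move=> /eqP; rewrite ofp_eq0 (negbTE Q0).
- by rewrite !sub_ofp /cst -!rmorphM -rmorphD E1.
exists gam; have -> : P = gam%:MP * Q by apply: (@ofp_inj _ n); rewrite rmorphM.
by rewrite tofracM mulfK // tofrac_eq0.
Qed.
End Fsub.

Local Close Scope quotient_scope.

(** * Polynomials that vanish along a sequence of points *)

Section SeqIdeal.
Variables (k : numFieldType) (R : idomainType) (f : {rmorphism R -> R}) (ioR : {rmorphism k -> R}).
Hypothesis fI : injective f.
Local Notation F := {fraction R}.
Variables (io : {rmorphism k -> F}) (sg : {rmorphism F -> F}).
Hypothesis ioE : forall c, io c = (ioR c)%:F.
Hypothesis sgE : forall c : R, sg c%:F = (f c)%:F.
Hypothesis sg_io : forall c, sg (io c) = io c.
Hypothesis sg_affine : forall q (kap c : k), kap != 0 -> sg q = io kap * q + io c ->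
  exists gam, q = io gam.
Variables (N : nat) (lin : pred 'I_N) (x0 : 'I_N) (M : 'M[k]_N).
Variables (be e : 'I_N -> F).
Hypothesis M_tri : forall v w : 'I_N, (w < v)%N -> M v w = 0.
Hypothesis M_diag : forall v, lin v -> M v v != 0.
Hypothesis M_lin : forall v w, M v w != 0 -> lin v && lin w.
Hypothesis lin_x0 : lin x0.
Hypothesis M_x0 : forall v, M v x0 = (v == x0)%:R.
Hypothesis M_x0' : forall v, M x0 v = (v == x0)%:R.
Hypothesis be_x0 : be x0 = 1.
Hypothesis e_neq0 : forall v, e v != 0.
Variables (C : fieldType) (emb : {rmorphism k -> C}) (E : nat -> {rmorphism R -> C}).
Hypothesis E_io : forall j c, E j (ioR c) = emb c.
Hypothesis E_f : forall j c, E j (f c) = E j.+1 c.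
Hypothesis E_neq0 : forall c, c != 0 -> forall j1, exists2 j, (j1 <= j)%N & E j c != 0.
Variables (bv ev s : nat -> 'I_N -> C) (j1 : nat).
Hypothesis bvE : forall v j p q, lin v -> (j1 <= j)%N -> q != 0 -> be v = p%:F / q%:F ->
  E j q * bv j v = E j p.
Hypothesis evE : forall v j p q, ~~ lin v -> (j1 <= j)%N -> q != 0 -> e v = p%:F / q%:F ->
  E j q * ev j v = E j p.
Hypothesis s_lin : forall v j, lin v -> (j1 <= j)%N ->
  s j.+1 v = \sum_w emb (M v w) * s j w + bv j v.
Hypothesis s_mult : forall v j, ~~ lin v -> (j1 <= j)%N -> s j.+1 v = ev j v * s j v.
Hypothesis s_neq0 : forall v j, ~~ lin v -> (j1 <= j)%N -> s j v != 0.

Local Notation th := (theta io sg lin M be e).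
Local Notation lift := (map_mpoly (@tofrac R)).
Let evp j : {mpoly R[N]} -> C := mmap (E j) (s j).

(** Up to a cleared denominator, evaluating [theta p] at step [j] is evaluating [p] at step [j.+1].
    The denominator picked here may vanish at the point, which is why [bvE] and [evE] are required
    of every representation. *)
Lemma lift_theta (p : {mpoly R[N]}) : exists Q p', [/\ Q != 0,
   lift p' = Q%:F *: th (lift p) &
   forall j, (j1 <= j)%N -> evp j p' = E j Q * evp j.+1 p].
Proof.
elim/mpoly_ring_ind: p => [c|v|p q [Q [p' [Q0 Hp Ep]]] [Q' [q' [Q0' Hq Eq]]]
  |p q [Q [p' [Q0 Hp Ep]]] [Q' [q' [Q0' Hq Eq]]]].
- exists 1, (f c)%:MP; split; first exact: oner_neq0.
    by rewrite !map_mpolyC /= thetaC sgE rmorph1 scale1r.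
  by move=> j _; rewrite /evp !mmapC /= E_f rmorph1 mul1r.
- case lv: (lin v).
    have [P [Q [Q0 EQ]]] := fracP (be v).
    exists Q, (\sum_w (Q * ioR (M v w)) *: 'X_w + P%:MP); split=> //.
      rewrite map_mpolyX thetaX /thv lv rmorphD /= map_mpolyC /= rmorph_sum /= scalerDr scaler_sumr.
      congr (_ + _).
        by apply: eq_bigr => w _; rewrite map_mpolyZ map_mpolyX scalerA ioE -tofracM.
      by rewrite -mul_mpolyC -mpolyCM EQ mulrC divfK // tofrac_eq0.
    move=> j jj; rewrite /evp rmorphD /= mmapC mmapX mmap1U s_lin // mulrDr.
    rewrite (bvE lv jj Q0 EQ) rmorph_sum mulr_sumr; congr (_ + _).
    by apply: eq_bigr => w _ /=; rewrite mmapZ mmapX mmap1U rmorphM E_io mulrA.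
  have [P [Q [Q0 EQ]]] := fracP (e v).
  exists Q, (P *: 'X_v); split=> //.
    rewrite map_mpolyZ !map_mpolyX thetaX /thv lv scalerA EQ mulrC divfK // tofrac_eq0 //.
  move=> j jj; rewrite /evp mmapZ !mmapX !mmap1U s_mult ?lv // mulrA.
  by rewrite (evE _ jj Q0 EQ) ?lv.
- exists (Q * Q'), (Q' *: p' + Q *: q'); split; first exact: mulf_neq0.
    rewrite !rmorphD /= !map_mpolyZ Hp Hq !scalerA -!tofracM scalerDr; congr (_ *: _ + _).
    by rewrite mulrC.
  move=> j jj; rewrite /evp !rmorphD /= !mmapZ -!/(evp _ _) Ep // Eq // rmorphM /=; ring.
- exists (Q * Q'), (p' * q'); split; first exact: mulf_neq0.
    by rewrite !rmorphM /= Hp Hq -scalerAl -scalerAr scalerA.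
  move=> j jj; rewrite /evp !rmorphM /= -!/(evp _ _) Ep // Eq //; ring.
Qed.

(** Coefficients are fractions whose denominators may vanish at points of the sequence, so
    membership is tested on a multiple with coefficients in [R]. *)
Definition seq_ideal (P : {mpoly F[N]}) := exists Q p, [/\ Q != 0, lift p = Q%:F *: P
  & exists j2, forall j, (j2 <= j)%N -> evp j p = 0].

Lemma lift_eq0 (p : {mpoly R[N]}) : lift p = 0 -> p = 0.
Proof.
move=> Z; apply/mpolyP => m; apply: tofrac_inj.
by rewrite -mcoeff_map_mpoly Z !mcoeff0 tofrac0.
Qed.

Lemma seq_ideal_alternative (p : {mpoly R[N]}) : p != 0 ->
  (exists j2, forall j, (j2 <= j)%N -> evp j p = 0) ->
  linear_alternative io sg lin x0 M be \/ mult_alternative sg lin e.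
Proof.
move=> p0 vp.
apply: (@ideal_alternative _ _ io sg sg_io sg_affine N lin x0 M be e _ _ _ _ _ _ _ _ seq_ideal (lift p)) => //.
- move=> P c [Q [p1 [Q0 Hp [j2 Ep]]]].
  have [Qd [p2 [Qd0 Hp2 Ep2]]] := lift_theta p1.
  have [a [b [b0 Ec]]] := fracP c.
  exists (Qd * f Q * Q * b), ((Q * b) *: p2 - (Qd * f Q * a) *: p1); split.
  + by rewrite !mulf_neq0 // inj_eq0.
  + rewrite rmorphB /= !map_mpolyZ Hp2 Hp thetaZ sgE !scalerA -!tofracM scalerBr !scalerA.
    congr (_ *: _ - _ *: _); first by rewrite -?tofracM; congr tofrac; ring.
    rewrite Ec mulrA; apply/eqP; rewrite -(inj_eq (mulIf (x := b%:F) _)) ?tofrac_eq0 // divfK ?tofrac_eq0 //.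
    by apply/eqP; rewrite -!tofracM; congr tofrac; ring.
  + exists (maxn j1 j2) => j; rewrite geq_max => /andP[jj1 jj2].
    rewrite /evp rmorphB /= !mmapZ -!/(evp _ _) Ep2 // !Ep ?mulr0 ?subrr //.
    exact: leq_trans jj2 (leqnSn _).
- move=> q m hm [Q [p1 [Q0 Hp [j2 Ep]]]].
  have [c Ep1] : exists c, p1 = c *: 'X_[m].
    exists p1@_m; apply/mpolyP => x; apply: tofrac_inj.
    rewrite mcoeffZ mcoeffX; have /(congr1 (mcoeff x)) := Hp; rewrite mcoeff_map_mpoly /= => ->.
    case: eqP => [<-|nx]; last by rewrite scalerA mcoeffZ mcoeffX; case: eqP => // _; rewrite !mulr0 tofrac0.
    rewrite mulr1; have /(congr1 (mcoeff m)) := Hp; by rewrite mcoeff_map_mpoly.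
  (* One monomial in multiplicative variables cannot vanish eventually: a nonzero coefficient is
     nonzero at arbitrarily late steps, and the late values [s j v] do not vanish. *)
  have c0 : c = 0.
    apply/eqP/negPn/negP => nz; have [j jj Ej] := E_neq0 nz (maxn j1 j2).
    move: jj; rewrite geq_max => /andP[jj1 jj2].
    have := Ep j jj2; rewrite Ep1 /evp mmapZ mmapX => /eqP; rewrite mulf_eq0 (negbTE Ej) /=.
    apply/negP; apply/prodf_neq0 => v _.
    case lv: (lin v); first by rewrite hm // expr0 oner_neq0.
    by rewrite expf_neq0 // s_neq0 // lv.
  move: Hp; rewrite Ep1 c0 scale0r rmorph0 => /esym/eqP; rewrite scalerA mscalerI mulf_eq0 tofrac_eq0 (negbTE Q0) /=.
  by rewrite -msize_poly_eq0 msizeX orbF => /eqP.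
- by exists 1, p; split; rewrite ?oner_neq0 // rmorph1 scale1r.
- by apply: contraNneq p0 => /lift_eq0 ->.
Qed.

(* Multiplying the shifts of p turns vanishing along the multiples of T into
   vanishing everywhere. *)
Lemma seq_alternative T (p : {mpoly R[N]}) : (0 < T)%N -> p != 0 ->
  (exists j2, forall j, (j2 <= j)%N -> (T %| j)%N -> evp j p = 0) ->
  linear_alternative io sg lin x0 M be \/ mult_alternative sg lin e.
Proof.
move=> T0 p0 [j2 vp].
have shift i : exists p', p' != 0 /\ exists c : nat -> C, forall j, (j1 <= j)%N -> evp j p' = c j * evp (i + j) p.
  elim: i => [|i [p1 [nz [c Ec]]]].
    by exists p; split=> //; exists (fun=> 1) => j _; rewrite mul1r.
  have [Q [p2 [Q0 Hp2 Ep2]]] := lift_theta p1.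
  exists p2; split.
    apply: contraNneq nz => Z; move: Hp2; rewrite Z rmorph0 => /esym/eqP.
    rewrite mscalerI tofrac_eq0 (negbTE Q0) /= => /eqP.
    by move/(theta_eq0 M_tri M_diag e_neq0)/lift_eq0 => ->.
  exists (fun j => E j Q * c j.+1) => j jj; rewrite Ep2 // Ec ?mulrA ?addSnnS //.
  exact: leq_trans jj (leqnSn _).
have [ps hps] := boolp.choice shift.
apply: (@seq_ideal_alternative (\prod_(i < T) ps i)).
  by apply/prodf_neq0 => i _; case: (hps i).
exists (maxn j1 j2) => j; rewrite geq_max => /andP[jj1 jj2].
rewrite /evp rmorph_prod /=.
have [i iT dv] : exists2 i, (i < T)%N & (T %| i + j)%N.
  exists ((T - j %% T) %% T)%N; first by rewrite ltn_mod.
  by rewrite /dvdn modnDml -modnDmr subnK ?modnn // ltnW // ltn_mod.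
have [_ [c Ec]] := hps i.
rewrite (bigD1 (Ordinal iT)) //= -/(evp _ _) Ec // vp ?mulr0 ?mul0r //.
exact: leq_trans jj2 (leq_addl _ _).
Qed.
End SeqIdeal.

(** * The operator attached to the functional equations, and the two alternatives *)

Section KeyedEnum.
Variables (T : finType) (key : T -> nat) (t0 : T).

(** Decreasing keys: with the row index of [f] as key, the inverses of the lower triangular matrices
    take the triangular shape that the leading monomials require. *)
Definition keyed_enum := sort (fun x y => key y <= key x)%N (enum T).
Definition vt (v : 'I_#|T|) : T := nth t0 keyed_enum v.

Lemma size_keyed_enum : size keyed_enum = #|T|.
Proof. by rewrite size_sort -cardE. Qed.
Lemma mem_keyed_enum x : x \in keyed_enum.
Proof. by rewrite mem_sort mem_enum. Qed.
Lemma uniq_keyed_enum : uniq keyed_enum.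
Proof. by rewrite sort_uniq enum_uniq. Qed.

Lemma tv_proof x : (index x keyed_enum < #|T|)%N.
Proof. by rewrite -size_keyed_enum index_mem mem_keyed_enum. Qed.
Definition tv x : 'I_#|T| := Ordinal (tv_proof x).

Lemma tvK : cancel tv vt.
Proof. by move=> x; rewrite /vt nth_index // mem_keyed_enum. Qed.
Lemma vtK : cancel vt tv.
Proof. by move=> v; apply: val_inj; rewrite /= index_uniq ?uniq_keyed_enum // size_keyed_enum. Qed.

Lemma vt_key (v w : 'I_#|T|) : (v <= w)%N -> (key (vt w) <= key (vt v))%N.
Proof.
move=> vw; apply: (@sorted_leq_nth _ (fun x y => key y <= key x)%N) => //; rewrite ?inE ?size_keyed_enum //.
- by move=> y x z h1 h2; apply: leq_trans h2 h1.
- by apply: sort_sorted => x y; rewrite leq_total.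
Qed.

Lemma big_vt (V : Type) (idx : V) (op : Monoid.com_law idx) (F : T -> V) :
  \big[op/idx]_(v : 'I_#|T|) F (vt v) = \big[op/idx]_(x : T) F x.
Proof.
rewrite [RHS](reindex vt) //; exists tv => x _; [exact: vtK|exact: tvK].
Qed.
End KeyedEnum.

Lemma frac_balance (R : idomainType) (p q p' q' c x y z w : R) :
  q != 0 -> q' != 0 -> y != 0 -> z != 0 -> w != 0 ->
  p%:F / q%:F = p'%:F / q'%:F * (c%:F * ((x%:F / y%:F) / (z%:F / w%:F))) ->
  p * q' * (y * z) = c * (p' * q) * (x * w).
Proof.
move=> q0 q0' y0 z0 w0; rewrite invf_div mulf_div [c%:F * (_ / _)]mulrA mulf_div -!tofracM.
move/frac_eq => /(_ q0 (mulf_neq0 q0' (mulf_neq0 y0 z0))) E.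
by transitivity (p * (q' * (y * z))); [|rewrite E]; ring.
Qed.

Lemma solve_affine (V : comNzRingType) (y x k B r c : V) :
  y + (x - k * B) = k * r + c -> y = k * (r + B) + (c - x).
Proof.
move=> E; have -> : y = k * r + c - (x - k * B) by rewrite -E addrK.
by ring.
Qed.

Lemma recombine (V : comNzRingType) (x k B r c g : V) : x * k = 1 -> g = k * g + c ->
  g - r = x * (g - (k * (r + B) + c)) + B.
Proof.
move=> E1 E2; have -> : g - (k * (r + B) + c) = k * (g - r - B) by rewrite {1}E2; ring.
by rewrite mulrA E1; ring.
Qed.

Lemma balance_linear (V : comNzRingType) (q qB sq k c p pB u su sp : V) :
  qB * (k * u - su) = k * pB ->
  sp * (q * qB) = k * (p * qB + pB * q) * sq + c * (q * qB * sq) ->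
  qB * ((sq * su + sp) * q) = qB * (k * ((q * u + p) * sq) + c * (q * sq)).
Proof.
move=> E1 E2.
transitivity (sq * q * (k * u * qB - qB * (k * u - su)) + sp * (q * qB)); first by ring.
by rewrite E1 E2; ring.
Qed.

Lemma affine_sum_div (F : fieldType) (k c p q x y q' : F) : q != 0 -> y != 0 ->
  (k * (p / q + x / y) + c) * q' * (q * y) = k * (p * y + x * q) * q' + c * (q * y * q').
Proof. by move=> q0 y0; field; rewrite q0 y0. Qed.

Lemma frac_affine_sum (R : idomainType) (p q p' q' x y k c : R) :
  q != 0 -> q' != 0 -> y != 0 ->
  p'%:F / q'%:F = k%:F * (p%:F / q%:F + x%:F / y%:F) + c%:F ->
  p' * (q * y) = k * (p * y + x * q) * q' + c * (q * y * q').
Proof.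
move=> q0 q0' y0 E; apply: tofrac_inj; rewrite !(tofracD, tofracM).
have f0 : q%:F != 0 by rewrite tofrac_eq0.
have f0' : q'%:F != 0 by rewrite tofrac_eq0.
have fy : y%:F != 0 by rewrite tofrac_eq0.
have -> : p'%:F = (k%:F * (p%:F / q%:F + x%:F / y%:F) + c%:F) * q'%:F by rewrite -E divfK.
exact: affine_sum_div.
Qed.

Lemma prodX_neq0 (F : fieldType) (I : finType) (x : I -> F) (j : I -> nat) :
  (forall i, x i != 0) -> \prod_i x i ^+ j i != 0.
Proof. by move=> h; apply/prodf_neq0 => i _; rewrite expf_neq0. Qed.

Lemma cst_eq0 (K : comNzRingType) n (c : K) : (cst n c == 0) = (c == 0).
Proof. by rewrite /cst ofp_eq0 mpolyC_eq0. Qed.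

Section RelSeries.
Variables (K : numFieldType) (n : nat) (act : expoMap n).
Local Notation F := {fraction {mpoly K[n]}}.
Implicit Types (u w : mps K n) (x y : F).

Definition series_rel u x w := exists P Q : {mpoly K[n]},
  [/\ Q != 0, x = P%:F / Q%:F & ofp Q * u = ofp P * w].

Lemma ofp_neq0 (Q : {mpoly K[n]}) : Q != 0 -> ofp Q <> 0.
Proof. by move=> Q0 /eqP; rewrite ofp_eq0 (negbTE Q0). Qed.

(** Series form a domain, so the nonzero denominator of one representation can be cancelled to pass
    to any other. *)
Lemma series_rel_rep u x w P Q : series_rel u x w -> Q != 0 -> x = P%:F / Q%:F ->
  ofp Q * u = ofp P * w.
Proof.
move=> [P' [Q' [Q0' -> E']]] Q0 /frac_eq -/(_ Q0' Q0) E.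
apply: (mps_mulfI (ofp_neq0 Q0')).
by rewrite mulrCA E' !mulrA -!rmorphM [Q * P']mulrC E [P * Q']mulrC.
Qed.

Lemma series_relM u x w u' x' w' : series_rel u x w -> series_rel u' x' w' ->
  series_rel (u * u') (x * x') (w * w').
Proof.
move=> [P [Q [Q0 -> E]]] [P' [Q' [Q0' -> E']]]; exists (P * P'), (Q * Q').
split; [exact: mulf_neq0|by rewrite mulf_div !tofracM|].
by rewrite !rmorphM mulrACA E E' mulrACA.
Qed.

Lemma series_relD u x u' x' w : series_rel u x w -> series_rel u' x' w ->
  series_rel (u + u') (x + x') w.
Proof.
move=> [P [Q [Q0 -> E]]] [P' [Q' [Q0' -> E']]]; exists (P * Q' + P' * Q), (Q * Q').
split; [exact: mulf_neq0| |].
  by rewrite addf_div ?tofrac_eq0 // tofracD !tofracM.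
rewrite rmorphD !rmorphM /= mulrDr mulrDl; congr (_ + _).
  by rewrite mulrAC E mulrAC.
by rewrite -mulrA E' mulrCA mulrA.
Qed.

Lemma series_relZ c u x w : series_rel u x w -> series_rel (cst n c * u) (fcst n c * x) w.
Proof.
move=> [P [Q [Q0 -> E]]]; exists (c%:MP * P), Q; split=> //; first by rewrite tofracM mulrA.
by rewrite mulrCA E rmorphM mulrA.
Qed.

Lemma series_rel0 w : series_rel 0 0 w.
Proof. by exists 0, 1; rewrite oner_neq0 !rmorph0 !mul0r mulr0. Qed.

Lemma series_rel_sum (I : Type) (r : seq I) (P : pred I) (u : I -> mps K n) (x : I -> F) w :
  (forall i, P i -> series_rel (u i) (x i) w) ->
  series_rel (\sum_(i <- r | P i) u i) (\sum_(i <- r | P i) x i) w.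
Proof.
move=> h; elim: r => [|i r IH]; first by rewrite !big_nil; exact: series_rel0.
by rewrite !big_cons; case: ifP => // Pi; apply: series_relD => //; exact: h.
Qed.

Lemma series_rel1 : series_rel 1 1 1.
Proof. by exists 1, 1; rewrite oner_neq0 !rmorph1 divr1. Qed.

Lemma series_relX u x w j : series_rel u x w -> series_rel (u ^+ j) (x ^+ j) (w ^+ j).
Proof.
move=> h; elim: j => [|j IH]; first by rewrite !expr0; exact: series_rel1.
by rewrite !exprS; exact: series_relM.
Qed.

Lemma series_rel_prod (I : Type) (r : seq I) (u w : I -> mps K n) (x : I -> F) : (forall i, series_rel (u i) (x i) (w i)) ->
  series_rel (\prod_(i <- r) u i) (\prod_(i <- r) x i) (\prod_(i <- r) w i).
Proof.
move=> h; elim: r => [|i r IH]; first by rewrite !big_nil; exact: series_rel1.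
by rewrite !big_cons; exact: series_relM.
Qed.
End RelSeries.

Section Conclusion.
Variables (K : numFieldType) (n : nat) (act : expoMap n).
Local Notation F := {fraction {mpoly K[n]}}.
Variables (l m r : nat) (d : 'I_l -> nat).
Variables (f : forall i : 'I_l, 'I_(d i).+1 -> mps K n) (g : 'I_m -> mps K n).
Variables (A : forall i : 'I_l, 'M[K]_((d i).+1)) (a : 'I_l -> K).
Variables (b : forall i : 'I_l, 'I_(d i).+1 -> F) (e : 'I_m -> F) (at_ : 'I_r -> K).
Hypothesis A_unit : forall i, A i \in unitmx.
Hypothesis A_trig : forall i (s t : 'I_(d i).+1), (s < t)%N -> A i s t = 0.
Hypothesis A_diag : forall i s, A i s s = a i.
Hypothesis a_neq0 : forall i, a i != 0.
Hypothesis A_sub : forall i (s t : 'I_(d i).+1), s = t.+1 :> nat -> A i s t != 0.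
Hypothesis hf : forall i s,
  series_rel (f s - \sum_t cst n (A i s t) * sub act (f t)) (b s) 1.
Hypothesis hg : forall h, series_rel (g h) (e h) (sub act (g h)).
Hypothesis g_neq0 : forall h, g h <> 0.
Hypothesis e_neq0 : forall h, e h != 0.
Hypothesis at_indep : forall D : 'I_r -> int, \prod_j at_ j ^ D j = 1 -> forall j, D j = 0.
Hypothesis at_neq0 : forall j, at_ j != 0.

(** The unit stands for the iteration count, ['I_r] for the powers of independent numbers, and
    ['I_m] for values of the [g h] or partial products of the [e h]. *)
Definition vars := ({i : 'I_l & 'I_(d i).+1} + (unit + ('I_r + 'I_m)))%type.
Definition vkey (x : vars) : nat := if x is inl u then tagged u else 0%N.
Definition vx : vars := inr (inl tt).
Local Notation vf s := (inl (Tagged (fun i => 'I_(d i).+1) s) : vars).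
Local Notation vy j := (inr (inr (inl j)) : vars).
Local Notation vg h := (inr (inr (inr h)) : vars).
Local Notation N := #|{: vars}|.
Local Notation vt := (vt vkey vx).
Local Notation tv := (tv vkey).

Definition vlin (x : vars) : bool := match x with inl _ | inr (inl _) => true | _ => false end.
(** The equations are solved for the shifted functions: f(Omega z) is the inverse of A applied to
    f(z) - b(z). Hence the inverse matrix here and the sign in [vbe]. *)
Definition vM (x y : vars) : K := match x, y with
  | inl u, inl u' => if tag u == tag u' then invmx (A (tag u)) (tagged u) (tagged_as u u') else 0
  | inr (inl _), inr (inl _) => 1
  | _, _ => 0 end.
Definition vbe (x : vars) : F := match x with
  | inl u => - \sum_t fcst n (invmx (A (tag u)) (tagged u) t) * b t
  | inr (inl _) => 1
  | _ => 0 end.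
(** Two kinds of sequences are covered: partial products of the [e h] are multiplied by [e h] at
    each step, values of the [g h] along the orbit by its inverse. *)
Definition ve (inv : bool) (x : vars) : F := match x with
  | inr (inr (inl j)) => fcst n (at_ j)
  | inr (inr (inr h)) => if inv then (e h)^-1 else e h
  | _ => 1 end.

Definition wlin : pred 'I_N := fun v => vlin (vt v).
Definition wM : 'M[K]_N := \matrix_(v, w) vM (vt v) (vt w).
Definition wbe (v : 'I_N) := vbe (vt v).
Definition we inv (v : 'I_N) := ve inv (vt v).

Lemma big_vars (V : Type) (idx : V) (op : Monoid.com_law idx) (G : vars -> V) :
  \big[op/idx]_(x : vars) G x =
  op (\big[op/idx]_i \big[op/idx]_(s < (d i).+1) G (vf s))
     (op (G vx) (op (\big[op/idx]_j G (vy j)) (\big[op/idx]_h G (vg h)))).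
Proof.
rewrite !big_sumType /=; congr (op _ (op _ _)); last by rewrite (big_pred1 tt) // => -[].
rewrite (@sig_big_dep _ _ op 'I_l (fun i => 'I_(d i).+1) xpredT (fun _ => xpredT) (fun i s => G (vf s))).
by apply: eq_bigr => -[i s].
Qed.

Lemma invA_trig i (s t : 'I_(d i).+1) : (s < t)%N -> invmx (A i) s t = 0.
Proof.
move: {2}(val s).+1 (ltnSn s) => x; elim: x s => // x IH s; rewrite ltnS => sx st.
have /matrixP /(_ s t) := mulmxV (A_unit i); rewrite !mxE (bigD1 s) //= A_diag.
rewrite big1 => [|u nu].
  have -> : (s == t) = false by apply: contraTF st => /eqP ->; rewrite ltnn.
  by rewrite addr0 => /eqP; rewrite mulf_eq0 (negbTE (a_neq0 i)) => /eqP.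
case: (ltngtP s u) => [su|us|/val_inj E]; last by rewrite E eqxx in nu.
  by rewrite A_trig // mul0r.
by rewrite (IH u) ?mulr0 //; [apply: leq_trans us sx|apply: ltn_trans us st].
Qed.

Lemma invA_diag i (s : 'I_(d i).+1) : invmx (A i) s s = (a i)^-1.
Proof.
have /matrixP /(_ s s) := mulmxV (A_unit i); rewrite !mxE (bigD1 s) //= A_diag eqxx.
rewrite big1 ?addr0 => [E|u nu]; first by apply: (mulfI (a_neq0 i)); rewrite E mulfV.
case: (ltngtP s u) => [su|us|/val_inj E]; last by rewrite E eqxx in nu.
  by rewrite A_trig // mul0r.
by rewrite invA_trig ?mulr0.
Qed.

Lemma wM_tri (v w : 'I_N) : (w < v)%N -> wM v w = 0.
Proof.
move=> wv; rewrite mxE; have := vt_key vkey vx (ltnW wv).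
have : vt v <> vt w by move=> /(can_inj (vtK _ _)) E; rewrite E ltnn in wv.
case: (vt v) (vt w) => [[i s]|[[]|y]] [[i' t]|[[]|y']] //=.
case: eqP => // Ei; subst i'; rewrite tagged_asE => ne le; apply: invA_trig.
by rewrite ltn_neqAle le andbT; apply/eqP => /val_inj E; apply: ne; rewrite E.
Qed.

Lemma wM_diag v : wlin v -> wM v v != 0.
Proof.
rewrite /wlin mxE; case: (vt v) => [[i s]|[[]|]] //= _; last exact: oner_neq0.
by rewrite eqxx tagged_asE invA_diag invr_eq0.
Qed.

Lemma wM_lin v w : wM v w != 0 -> wlin v && wlin w.
Proof. by rewrite mxE /wlin; case: (vt v) (vt w) => [?|[[]|?]] [?|[[]|?]] //=; rewrite eqxx. Qed.

Lemma wlin_x0 : wlin (tv vx). Proof. by rewrite /wlin tvK. Qed.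

Lemma wM_x0 v : wM v (tv vx) = (v == tv vx)%:R.
Proof.
rewrite mxE tvK -(can_eq (vtK vkey vx)) tvK; by case: (vt v) => [?|[[]|?]] //=; rewrite eqxx.
Qed.
Lemma wM_x0' v : wM (tv vx) v = (v == tv vx)%:R.
Proof.
rewrite mxE tvK -(can_eq (vtK vkey vx)) tvK; by case: (vt v) => [?|[[]|?]] //=; rewrite eqxx.
Qed.
Lemma wbe_x0 : wbe (tv vx) = 1. Proof. by rewrite /wbe tvK. Qed.
Lemma we_neq0 inv v : we inv v != 0.
Proof.
rewrite /we; case: (vt v) => [?|[[]|[j|h]]] /=; [exact: oner_neq0|exact: oner_neq0| |].
  by rewrite fmorph_eq0 at_neq0.
by case: inv; rewrite ?invr_eq0 e_neq0.
Qed.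

Definition linear_conclusion := exists (I : {set 'I_l}) (c : 'I_l -> K) (S : F),
  [/\ I != set0, forall i, i \in I -> c i <> 0,
      forall i i', i \in I -> i' \in I -> a i = a i',
      series_rel (\sum_(i in I) cst n (c i) * f (ord0 : 'I_(d i).+1)) S 1
    & forall i0, i0 \in I -> S = fcst n (a i0) * ratsub act S
               + \sum_(i in I) fcst n (c i) * b (ord0 : 'I_(d i).+1)].

Definition mult_conclusion := exists (D : 'I_m -> int) (S : F),
  [/\ exists h, D h <> 0, S <> 0 & S = ratsub act S * \prod_(h < m) e h ^ D h].

(** Divide [q] by the product of the [g h] to the powers [Dh h]: substitution multiplies the
    quotient by a constant, so the quotient is constant and [cc] is 1. By independence the [at_ j]
    then have exponent 0, so some [Dh h] is nonzero. *)
Lemma mult_case inv : mult_alternative (ratsub act) wlin (we inv) -> mult_conclusion.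
Proof.
move=> [D [q [q0 [v0 Dv0] Dlin Eq]]].
pose Dj j := D (tv (vy j)); pose Dh h := if inv then - D (tv (vg h)) else D (tv (vg h)).
pose cc := \prod_j at_ j ^ Dj j.
have Eprod : \prod_(v < N) we inv v ^ D v = fcst n cc * \prod_h e h ^ Dh h.
  transitivity (\prod_(v < N) (fun x => ve inv x ^ D (tv x)) (vt v)).
    by apply: eq_bigr => v _; rewrite /we vtK.
  rewrite (@big_vt _ vkey vx _ _ _ (fun x => ve inv x ^ D (tv x))) big_vars /= big1 => [|i _]; last by rewrite big1 // => s _; rewrite exp1rz.
  rewrite exp1rz !mul1r; congr (_ * _).
    by rewrite rmorph_prod; apply: eq_bigr => j _ /=; rewrite fmorphXz.
  apply: eq_bigr => h _; rewrite /Dh; case: (inv) => //.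
  by rewrite exprz_inv.
have cc0 : cc != 0 by apply/prodf_neq0 => j _; rewrite expfz_neq0.
have {}Eq : q = ratsub act q * (fcst n cc * \prod_h e h ^ Dh h) by rewrite -Eprod; exact: Eq.
suff [cc1 Dn] : cc = 1 /\ exists h, Dh h <> 0.
  exists Dh, q; split=> //; first by apply/eqP.
  by rewrite {1}Eq cc1 rmorph1 mul1r.
have [[P [Q [Q0 EQ]]]] := (fracP q, tt).
have P0 : P != 0 by apply: contraNneq q0 => Z; rewrite EQ Z tofrac0 mul0r.
(* Series need not be invertible, so the exponents are split into positive and negative parts. *)
pose pos h := if 0 <= Dh h then `|Dh h|%N else 0%N.
pose neg h := if 0 <= Dh h then 0%N else `|Dh h|%N.
have eD h : e h ^ Dh h = e h ^+ pos h / e h ^+ neg h.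
  rewrite /pos /neg; case: (Dh h) => j /=; first by rewrite expr0 divr1 -exprnP.
  by rewrite NegzE expr0 mul1r -exprnN.
pose Gp := \prod_h g h ^+ pos h; pose Gm := \prod_h g h ^+ neg h.
have Rp : series_rel Gp (\prod_h e h ^+ pos h) (sub act Gp).
  rewrite [sub act Gp]rmorph_prod; apply: series_rel_prod => h; rewrite rmorphXn; exact: series_relX.
have Rm : series_rel Gm (\prod_h e h ^+ neg h) (sub act Gm).
  rewrite [sub act Gm]rmorph_prod; apply: series_rel_prod => h; rewrite rmorphXn; exact: series_relX.
have prodn0 (I : finType) (u : I -> mps K n) : (forall i, u i <> 0) -> \prod_i u i <> 0.
  move=> hu; elim/big_rec: _ => [|i x _ nx /mps_mulf[/hu|]//].
  by move/eqP; rewrite oner_eq0.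
have expn0 (u : mps K n) j : u <> 0 -> u ^+ j <> 0.
  move=> hu; elim: j => [|j IH]; first by rewrite expr0 => /eqP; rewrite oner_eq0.
  by rewrite exprS => /mps_mulf[].
have Gp0 : Gp <> 0 by apply: prodn0 => h; apply: expn0.
have Gm0 : Gm <> 0 by apply: prodn0 => h; apply: expn0.
have [Pp [Qp [Qp0 Ep Rp']]] := Rp; have [Pm [Qm [Qm0 Em Rm']]] := Rm.
have ep0 : \prod_h e h ^+ neg h != 0 by exact: prodX_neq0.
have Pm0 : Pm != 0 by apply: contraNneq ep0 => Z; rewrite Em Z tofrac0 mul0r.
have Efrac : P * psub act Q * (Qp * Pm) = cc%:MP * (psub act P * Q) * (Pp * Qm).
  have E2 : \prod_h e h ^ Dh h = (Pp%:F / Qp%:F) / (Pm%:F / Qm%:F).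
    by rewrite (eq_bigr _ (fun h _ => eD h)) big_split prodfV /= Ep Em.
  have E3 : ratsub act q = (psub act P)%:F / (psub act Q)%:F by rewrite EQ; exact: ratsubE.
  rewrite E2 E3 {1}EQ in Eq.
  have sQ0 : psub act Q != 0 by rewrite psub_eq0.
  exact: (frac_balance Q0 sQ0 Qp0 Pm0 Qm0 Eq).
pose G := ofp P * Gm; pose H := ofp Q * Gp.
have H0 : H <> 0 by case/mps_mulf => //; apply: ofp_neq0.
have EGH : sub act G * H = cst n cc^-1 * (G * sub act H) + cst n 0 * (H * sub act H).
  rewrite rmorph0 mul0r addr0; apply: (mps_mulfI (ofp_neq0 (mulf_neq0 Qp0 Pm0))).
  have ccK : cst n cc^-1 * cst n cc = 1 by rewrite -rmorphM mulVf // rmorph1.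
  have Ef := congr1 (@ofp _ n) Efrac; rewrite !rmorphM /= -![ofp _%:MP]/(cst n _) in Ef.
  rewrite /G /H !rmorphM /= !sub_ofp.
  transitivity (cst n cc^-1 * cst n cc * (ofp (psub act P) * ofp Q) * (ofp Qp * Gp) * (ofp Pm * sub act Gm)).
    by rewrite ccK; ring.
  rewrite Rp' -Rm'.
  transitivity (cst n cc^-1 * (cst n cc * (ofp (psub act P) * ofp Q) * (ofp Pp * ofp Qm)) * (sub act Gp * Gm)); first by ring.
  by rewrite -Ef; ring.
have [gam EG] := affine_const H0 (invr_neq0 cc0) EGH.
have G0 : G <> 0 by case/mps_mulf => //; apply: ofp_neq0.
have gam0 : gam != 0 by apply/eqP => Z; apply: G0; rewrite EG Z rmorph0 mul0r.
have sH0 : sub act H <> 0 by move=> Z; apply: H0; apply: (@sub_inj _ _ act); rewrite Z rmorph0.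
have cc1 : cc = 1.
  have Z : cst n gam * (H * sub act H) = cst n gam * (H * sub act H) * cst n cc^-1.
    move: EGH; rewrite EG rmorphM /= sub_cst rmorph0 mul0r addr0 => Z.
    transitivity (cst n gam * sub act H * H); first by ring.
    by rewrite Z; ring.
  have nz : cst n gam * (H * sub act H) <> 0.
    by case/mps_mulf => [/eqP|/mps_mulf[]//]; rewrite cst_eq0 (negbTE gam0).
  rewrite -[LHS]mulr1 in Z; have := mps_mulfI nz Z.
  move/(congr1 (fun u : mps K n => u 0%MM)); rewrite -(rmorph1 (@cst K n)) /cst /= !mcoeffC eqxx !mulr1.
  by move=> E; rewrite -[cc]invrK -E invr1.
split=> //; apply: boolp.contrapT => /boolp.forallNP Dn.
have {}Dn h : Dh h = 0 by apply: boolp.contrapT; exact: Dn.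
have Dj0 := at_indep cc1.
case/eqP: Dv0; rewrite -[v0](vtK vkey vx).
case E : (vt v0) => [x|[[]|[j|h]]]; [by apply: Dlin; rewrite /wlin tvK|by apply: Dlin; rewrite /wlin tvK|exact: Dj0|].
by have := Dn h; rewrite /Dh; case: (inv) => // /eqP; rewrite oppr_eq0 => /eqP.
Qed.

(** The coefficients are left eigenvectors of the blocks [invmx (A i)]. The nonzero subdiagonal
    makes each block a single Jordan cell, so a nonzero part is supported on the first coordinate
    and [kap] is the inverse of [a i]. The resulting combination of first components, with [Rr]
    added, satisfies an affine equation and is therefore constant. *)
Lemma linear_case : linear_alternative (fcst n) (ratsub act) wlin (tv vx) wM wbe ->
  linear_conclusion.
Proof.
move=> [q [kap [c [Rr [k0 [v0 nv0 qv0] qlin qM ER]]]]].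
pose qf i (s : 'I_(d i).+1) := q (tv (vf s)).
have qM' i : \row_s qf i s *m invmx (A i) = kap *: \row_s qf i s.
  apply/rowP => t; rewrite !mxE; have := qM (tv (vf t)); rewrite /qf => <-.
  transitivity (\sum_v (fun x => q (tv x) * vM x (vf t)) (vt v)); last first.
    by apply: eq_bigr => v _; rewrite mxE tvK vtK.
  rewrite (@big_vt _ vkey vx _ _ _ (fun x => q (tv x) * vM x (vf t))) big_vars /=.
  rewrite mulr0 add0r [X in _ + (X + _)]big1 => [|j _]; last by rewrite mulr0.
  rewrite [X in _ + (_ + X)]big1 => [|h _]; last by rewrite mulr0.
  rewrite !addr0 (bigD1 i) //= [X in _ + X]big1 ?addr0 => [|i' ni].
    by apply: eq_bigr => s _; rewrite mxE eqxx tagged_asE.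
  by rewrite big1 // => s _; rewrite (negbTE ni) mulr0.
have qA i u : qf i u = kap * \sum_t qf i t * A i t u.
  have := congr1 (mulmx^~ (A i)) (qM' i); rewrite mulmxKV ?A_unit // => /rowP /(_ u).
  rewrite -scalemxAl !mxE => ->; congr (_ * _); by apply: eq_bigr => t _; rewrite mxE.
have claim i s : qf i s != 0 -> s = ord0 /\ kap * a i = 1.
  (* The last nonzero coordinate [s0] determines the eigenvalue; if it were not the first, the
     equation in the preceding column would contradict [A_sub]. *)
  move=> qs; pose s0 := [arg max_(t > s | qf i t != 0) (t : nat)].
  have [qs0 maxs] : qf i s0 != 0 /\ forall t, qf i t != 0 -> (t <= s0)%N.
    by rewrite /s0; case: arg_maxnP => // t qt mt; split=> // t' /mt.
  have big0 (t : 'I_(d i).+1) : (s0 < t)%N -> qf i t = 0.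
    by move=> lt; apply/eqP/negPn/negP => /maxs; rewrite leqNgt lt.
  have ka : kap * a i = 1.
    have := qA i s0; rewrite (bigD1 s0) //= A_diag big1 ?addr0 => [E|t nt].
      by apply: (mulIf qs0); rewrite mul1r -mulrA [a i * _]mulrC -E.
    case: (ltngtP s0 t) => [/big0 ->|lt|/val_inj E]; first by rewrite mul0r.
      by rewrite A_trig // mulr0.
    by rewrite E eqxx in nt.
  have s00 : s0 = ord0.
    apply: val_inj => /=; apply/eqP; rewrite -leqn0 leqNgt; apply/negP => pos.
    have ltu : (s0.-1 < (d i).+1)%N by apply: leq_ltn_trans (leq_pred _) (ltn_ord s0).
    pose u := Ordinal ltu; have su : s0 = u.+1 :> nat by rewrite /= prednK.
    have nus : s0 != u by apply/eqP => E; have := su; rewrite E => /eqP; rewrite eqn_leq ltnn andbF.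
    have := qA i u; rewrite (bigD1 s0) //= (bigD1 u) //= ?A_diag; last by rewrite eq_sym.
    rewrite big1 ?addr0 => [|t /andP[nt nu]].
      rewrite mulrDr mulrCA [kap * _ in X in _ + X]mulrCA ka mulr1 => /eqP.
      rewrite -[X in X == _]add0r (inj_eq (addIr _)) eq_sym !mulf_eq0 (negbTE qs0) (negbTE k0) /=.
      by rewrite (negbTE (A_sub su)).
    case: (ltngtP s0 t) => [/big0 ->|lt|/val_inj E]; first by rewrite mul0r.
      case: (ltngtP u t) => [ut|tu|/val_inj E]; first by lia.
        by rewrite A_trig // mulr0.
      by rewrite E eqxx in nu.
    by rewrite E eqxx in nt.
  split=> //; apply: val_inj => /=; apply/eqP; rewrite -leqn0.
  by have := maxs s qs; rewrite s00.
pose ci i := qf i ord0.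
have cka i : ci i != 0 -> kap * a i = 1 by case/claim.
pose I := [set i | ci i != 0].
have I0 : I != set0.
  have l0 : wlin v0 by apply/negPn/negP => /qlin Z; rewrite Z eqxx in qv0.
  move: l0 qv0; rewrite -[v0](vtK vkey vx) /wlin tvK; case E : (vt v0) => [[i s]|[[]|]] //= _.
    move=> h; have [s0 _] := claim i s h.
    by apply/set0Pn; exists i; rewrite inE /ci -s0.
  by move=> _; case/eqP: nv0; rewrite -[v0](vtK vkey vx) E.
pose B := \sum_i fcst n (ci i) * b (ord0 : 'I_(d i).+1).
have Ebe : \sum_v fcst n (q v) * wbe v = fcst n (q (tv vx)) - fcst n kap * B.
  transitivity (\sum_v (fun x => fcst n (q (tv x)) * vbe x) (vt v)).
    by apply: eq_bigr => v _; rewrite vtK.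
  rewrite (@big_vt _ vkey vx _ _ _ (fun x => fcst n (q (tv x)) * vbe x)) big_vars /=.
  rewrite mulr1 [X in _ + (_ + (X + _))]big1 => [|j _]; last by rewrite mulr0.
  rewrite [X in _ + (_ + (_ + X))]big1 => [|h _]; last by rewrite mulr0.
  rewrite !addr0 addrC; congr (_ + _).
  rewrite mulr_sumr -sumrN; apply: eq_bigr => i _.
  rewrite (bigD1 ord0) //= [X in _ + X = _]big1 ?addr0 => [|s ns]; last first.
    have -> : q (tv (vf s)) = 0.
      by apply/eqP/negPn/negP => nz; have [E _] := claim i s nz; case/eqP: ns.
    by rewrite rmorph0 mul0r.
  rewrite -/(qf i ord0) -/(ci i) mulrN; congr (- _).
  rewrite (bigD1 ord0) //= big1 ?addr0 => [|t nt]; last first.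
    by rewrite invA_trig ?rmorph0 ?mul0r // lt0n.
  rewrite invA_diag; have [->|nz] := eqVneq (ci i) 0; first by rewrite rmorph0 !mul0r mulr0.
  have -> : (a i)^-1 = kap by apply: (mulIf (a_neq0 i)); rewrite mulVf // cka.
  by rewrite mulrCA.
pose c' := c - q (tv vx).
have {}ER : ratsub act Rr = fcst n kap * (Rr + B) + fcst n c'.
  have E1 : ratsub act Rr + (fcst n (q (tv vx)) - fcst n kap * B) = fcst n kap * Rr + fcst n c.
    by rewrite -Ebe; exact: ER.
  by rewrite /c' rmorphB; exact: solve_affine.
clearbody c'; pose fi i := f (ord0 : 'I_(d i).+1).
have hf0 i : series_rel (fi i - cst n (a i) * sub act (fi i)) (b (ord0 : 'I_(d i).+1)) 1.
  have := hf (ord0 : 'I_(d i).+1); rewrite (bigD1 ord0) //= A_diag big1 ?addr0 // => t nt.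
  by rewrite A_trig ?rmorph0 ?mul0r // lt0n.
pose u := \sum_i cst n (ci i) * fi i.
have Ru : series_rel (cst n kap * u - sub act u) (fcst n kap * B) 1.
  have := series_relZ kap (series_rel_sum (index_enum 'I_l) (P := xpredT) (fun i _ => series_relZ (ci i) (hf0 i))).
  rewrite -/B; congr (series_rel _ _ _).
  rewrite /u (raddf_sum (sub act : {rmorphism _ -> _})) /= !mulr_sumr -sumrB.
  apply: eq_bigr => i _; rewrite rmorphM /= sub_cst !mulrBr; congr (_ - _).
  have [->|nz] := eqVneq (ci i) 0; first by rewrite rmorph0 !mul0r mulr0.
  rewrite !mulrA -!rmorphM; congr (cst n _ * _).
  by rewrite mulrAC cka // mul1r.
have [P [Q [Q0 EQ]]] := fracP Rr.
have [PB [QB [QB0 EB RB]]] : exists P Q : {mpoly K[n]},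
    [/\ Q != 0, B = P%:F / Q%:F & ofp Q * (cst n kap * u - sub act u) = cst n kap * ofp P].
  have [PB [QB [QB0 EB]]] := fracP B.
  exists PB, QB; split=> //.
  have Ek : fcst n kap * B = (kap%:MP * PB)%:F / QB%:F by rewrite EB tofracM mulrA.
  by rewrite (series_rel_rep Ru QB0 Ek) mulr1 rmorphM.
have sQ0 : psub act Q != 0 by rewrite psub_eq0.
have Epol : psub act P * (Q * QB) = kap%:MP * (P * QB + PB * Q) * psub act Q + c'%:MP * (Q * QB * psub act Q).
  apply: (frac_affine_sum Q0 sQ0 QB0); rewrite -EB -EQ -ER EQ.
  by apply/esym; exact: ratsubE.
(* The series [u] plus [Rr], multiplied by the denominator [Q]. *)
pose G := ofp Q * u + ofp P.
have H0 := ofp_neq0 Q0.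
have EGH : sub act G * ofp Q = cst n kap * (G * sub act (ofp Q)) + cst n c' * (ofp Q * sub act (ofp Q)).
  apply: (mps_mulfI (ofp_neq0 QB0)).
  have Ef := congr1 (@ofp _ n) Epol; rewrite !(rmorphM, rmorphD) /= -[ofp kap%:MP]/(cst n kap) -[ofp c'%:MP]/(cst n c') in Ef.
  rewrite /G rmorphD rmorphM /= !sub_ofp.
  exact: (balance_linear RB Ef).
have [gam EG] := affine_const H0 k0 EGH.
have Egam : gam = kap * gam + c'.
  have sH0 : sub act (ofp Q) <> 0 by rewrite sub_ofp; exact: ofp_neq0.
  have HH0 : ofp Q * sub act (ofp Q) <> 0 by case/mps_mulf.
  move: EGH; rewrite EG rmorphM /= sub_cst => Z.
  have : ofp Q * sub act (ofp Q) * cst n gam = ofp Q * sub act (ofp Q) * cst n (kap * gam + c').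
    rewrite rmorphD rmorphM /=.
    transitivity (cst n gam * sub act (ofp Q) * ofp Q); first by ring.
    by rewrite Z; ring.
  move/(mps_mulfI HH0)/(congr1 (fun u : mps K n => u 0%MM)).
  by rewrite /cst /= !mcoeffC eqxx !mulr1.
exists I, ci, (fcst n gam - Rr); split=> //.
- by move=> i; rewrite inE => /eqP.
- move=> i i'; rewrite !inE => /cka E /cka E'.
  by apply: (mulfI k0); rewrite E E'.
- have -> : \sum_(i in I) cst n (ci i) * f (ord0 : 'I_(d i).+1) = u.
    rewrite /u big_mkcond; apply: eq_bigr => i _; rewrite inE; case: eqP => // ->.
    by rewrite rmorph0 mul0r.
  exists (gam%:MP * Q - P), Q; split=> //.
    by rewrite tofracB tofracM mulrBl mulfK ?tofrac_eq0 // -EQ.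
  by rewrite mulr1 rmorphB rmorphM /= -[ofp gam%:MP]/(cst n gam) -EG /G addrK.
move=> i0; rewrite inE => /cka Ea.
have -> : \sum_(i in I) fcst n (ci i) * b (ord0 : 'I_(d i).+1) = B.
  rewrite /B big_mkcond; apply: eq_bigr => i _; rewrite inE; case: eqP => // ->.
  by rewrite rmorph0 mul0r.
have -> : ratsub act (fcst n gam - Rr) = fcst n gam - ratsub act Rr.
  by rewrite raddfB /=; congr (_ - _); exact: ratsub_cst.
rewrite ER.
have E1 : fcst n (a i0) * fcst n kap = 1 by rewrite -rmorphM mulrC Ea rmorph1.
have E2 : fcst n gam = fcst n kap * fcst n gam + fcst n c' by rewrite -rmorphM -rmorphD -Egam.
exact: recombine.
Qed.
End Conclusion.

Lemma ler_expn (R : numDomainType) (x y : R) k : 0 <= x -> x <= y -> x ^+ k <= y ^+ k.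
Proof. by move=> x0 xy; apply: lerXn2r; rewrite ?nnegrE //; exact: le_trans xy. Qed.

(** * Absolute values, heights and Liouville's inequality *)

Section AbsValue.
Variables (R : realType) (C : fieldType) (v : C -> R).
Hypothesis hv : is_absolute_value v.

Lemma abs_ge0 x : 0 <= v x. Proof. by case: hv. Qed.
Lemma abs_eq0 x : (v x == 0) = (x == 0).
Proof. by case: hv => _ h _ _; apply/eqP/eqP => /h. Qed.
Lemma abs_gt0 x : (0 < v x) = (x != 0).
Proof. by rewrite lt_def abs_ge0 andbT abs_eq0. Qed.
Lemma absM x y : v (x * y) = v x * v y. Proof. by case: hv. Qed.
Lemma absD x y : v (x + y) <= v x + v y. Proof. by case: hv. Qed.
Lemma abs0 : v 0 = 0. Proof. by apply/eqP; rewrite abs_eq0. Qed.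
Lemma abs1 : v 1 = 1.
Proof.
have n0 : v 1 != 0 by rewrite abs_eq0 oner_neq0.
by apply: (mulfI n0); rewrite -absM !mulr1.
Qed.
Lemma absN1 : v (-1) = 1.
Proof.
apply/eqP; rewrite -(@eqrXn2 _ 2) ?abs_ge0 //; apply/eqP.
by rewrite !expr2 -absM mulrNN !mulr1 abs1.
Qed.
Lemma absN x : v (- x) = v x. Proof. by rewrite -mulN1r absM absN1 mul1r. Qed.
Lemma absB x y : v (x - y) <= v x + v y.
Proof. by rewrite -(absN y); exact: absD. Qed.
Lemma absV x : v x^-1 = (v x)^-1.
Proof.
have [->|nz] := eqVneq x 0; first by rewrite invr0 abs0 invr0.
have n0 : v x != 0 by rewrite abs_eq0.
by apply: (mulfI n0); rewrite -absM !divff // abs1.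
Qed.
Lemma absX x k : v (x ^+ k) = v x ^+ k.
Proof. by elim: k => [|k IH]; rewrite ?expr0 ?abs1 // !exprS absM IH. Qed.
Lemma abs_prod (I : Type) (r : seq I) (P : pred I) (F : I -> C) :
  v (\prod_(i <- r | P i) F i) = \prod_(i <- r | P i) v (F i).
Proof. by rewrite (big_morph v absM abs1). Qed.
Lemma abs_sum (I : Type) (r : seq I) (P : pred I) (F : I -> C) :
  v (\sum_(i <- r | P i) F i) <= \sum_(i <- r | P i) v (F i).
Proof.
elim/big_rec2: _ => [|i y x _ le]; first by rewrite abs0.
by apply: le_trans (absD _ _) _; rewrite lerD2l.
Qed.
Lemma abs_nat k : v k%:R <= k%:R.
Proof.
elim: k => [|k IH]; first by rewrite abs0.
by rewrite -!natr1; apply: le_trans (absD _ _) _; rewrite abs1 lerD2r.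
Qed.
Lemma abs_int (z : int) : v z%:~R <= `|z%:~R|.
Proof.
case: z => k.
  by rewrite -[X in v X]/(k%:R) -[X in `|X|]/(k%:R) normr_nat abs_nat.
by rewrite -[X in v X]/(- k.+1%:R) -[X in `|X|]/(- k.+1%:R) absN normrN normr_nat abs_nat.
Qed.
End AbsValue.

Section Heights.
Variables (R : realType) (L : numFieldType) (D : nat) (w : 'cV[L]_D.+1).

(** [Z] is the matrix of multiplication by [x] in the basis [w] of a number field, so that [w] is an
    eigenvector. Determinant and adjugate of [Z] will replace the norm and the conjugates of [x]. *)
Definition int_repr (x : L) (Z : 'M[int]_D.+1) (H : R) : Prop :=
  map_mx intr Z *m w = x *: w /\ forall i j, `|(Z i j)%:~R| <= H.

(** One bound serves both the denominator and the matrix entries of a whole family; the joint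
    denominator keeps sums of many terms under control. *)
Definition height_le (I : Type) (x : I -> L) (H : R) : Prop :=
  exists d : nat, [/\ (0 < d)%N, d%:R <= H &
    forall i, exists Z, int_repr (d%:R * x i) Z H].

Lemma int_reprM x y Z Z' H H' : int_repr x Z H -> int_repr y Z' H' ->
  int_repr (x * y) (Z *m Z') (D.+1%:R * (H * H')).
Proof.
move=> [E hZ] [E' hZ']; split.
  rewrite map_mxM -mulmxA E' -scalemxAr E scalerA mulrC //.
move=> i j; rewrite mxE rmorph_sum /=.
apply: le_trans (ler_norm_sum _ _ _) _.
apply: le_trans (_ : \sum_(k < D.+1) H * H' <= _).
  by apply: ler_sum => k _; rewrite rmorphM normrM; apply: ler_pM (hZ _ _) (hZ' _ _).
by rewrite sumr_const card_ord mulr_natl.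
Qed.

Lemma int_reprS (I : finType) (x : I -> L) Z H : (forall i, int_repr (x i) (Z i) H) ->
  int_repr (\sum_i x i) (\sum_i Z i) (#|I|%:R * H).
Proof.
move=> h; split.
  rewrite raddf_sum mulmx_suml scaler_suml; by apply: eq_bigr => i _; case: (h i).
move=> i j; rewrite summxE rmorph_sum /=; apply: le_trans (ler_norm_sum _ _ _) _.
apply: le_trans (_ : \sum_(k : I) H <= _); first by apply: ler_sum => k _; case: (h k).
by rewrite sumr_const mulr_natl.
Qed.

Lemma int_repr_nat (k : nat) : int_repr k%:R k%:R%:M k%:R.
Proof.
split; first by rewrite map_scalar_mx /= mul_scalar_mx rmorph_nat.
by move=> i j; rewrite !mxE; case: eqP => _; rewrite ?mulr1n ?mulr0n ?normr0 // rmorph_nat normr_nat.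
Qed.

Lemma int_repr_le x Z H H' : H <= H' -> int_repr x Z H -> int_repr x Z H'.
Proof. by move=> le [E h]; split=> // i j; apply: le_trans (h i j) le. Qed.

Lemma int_reprZ (k : nat) x Z H : int_repr x Z H -> int_repr (k%:R * x) (k%:R *: Z) (k%:R * H).
Proof.
move=> [E h]; split.
  by rewrite map_mxZ -scalemxAl E scalerA /= rmorph_nat.
by move=> i j; rewrite mxE rmorphM normrM /= rmorph_nat normr_nat ler_wpM2l.
Qed.

Lemma height_ge1 (I : Type) (x : I -> L) H : height_le x H -> 1 <= H.
Proof. by move=> [d [d0 dH _]]; apply: le_trans dH; rewrite ler1n. Qed.

Lemma height_mono (I : Type) (x : I -> L) H H' : H <= H' -> height_le x H -> height_le x H'.
Proof.
move=> le [d [d0 dH h]]; exists d; split=> //; first exact: le_trans le.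
by move=> i; have [Z hZ] := h i; exists Z; apply: int_repr_le hZ.
Qed.

Lemma height_sub (I J : Type) (x : I -> L) (y : J -> L) H : (forall j, exists i, y j = x i) ->
  height_le x H -> height_le y H.
Proof.
move=> s [d [d0 dH h]]; exists d; split=> // j; have [i ->] := s j; exact: h.
Qed.

Lemma height_nat (k : nat) : height_le (fun _ : unit => k%:R) (k.+1)%:R.
Proof.
exists 1%N; split=> //; first by rewrite ler_nat.
by move=> _; exists k%:R%:M; rewrite mul1r; apply: int_repr_le (int_repr_nat k); rewrite ler_nat.
Qed.

Lemma height_union (I J : Type) (x : I -> L) (y : J -> L) H H' :
  height_le x H -> height_le y H' ->
  height_le (fun u : I + J => match u with inl i => x i | inr j => y j end) (H * H').
Proof.
move=> [d [d0 dH h]] [d' [d0' dH' h']]; exists (d * d')%N; split; first by rewrite muln_gt0 d0.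
  by rewrite natrM ler_pM.
have H1 : 1 <= H by apply: le_trans dH; rewrite ler1n.
have H1' : 1 <= H' by apply: le_trans dH'; rewrite ler1n.
move=> [i|j].
  have [Z hZ] := h i; exists (d'%:R *: Z); rewrite natrM [d%:R * _]mulrC -mulrA.
  apply: int_repr_le (int_reprZ d' hZ); rewrite mulrC ler_wpM2l //; exact: le_trans H1.
have [Z hZ] := h' j; exists (d%:R *: Z); rewrite natrM -mulrA.
by apply: int_repr_le (int_reprZ d hZ); rewrite ler_wpM2r //; exact: le_trans H1'.
Qed.

Lemma heightM (I J : Type) (x : I -> L) (y : J -> L) H H' :
  height_le x H -> height_le y H' ->
  height_le (fun u : I * J => x u.1 * y u.2) (D.+1%:R * (H * H')).
Proof.
move=> [d [d0 dH h]] [d' [d0' dH' h']]; exists (d * d')%N; split; first by rewrite muln_gt0 d0.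
  rewrite natrM -[leLHS]mul1r ler_pM ?ler1n // ?mulr_ge0 // ler_pM //.
move=> [i j] /=; have [Z hZ] := h i; have [Z' hZ'] := h' j; exists (Z *m Z').
by rewrite natrM mulrACA; apply: int_reprM.
Qed.

Lemma height_lin (I J : finType) (c : J * I -> L) (y : I -> L) H H' :
  height_le c H -> height_le y H' ->
  height_le (fun j => \sum_i c (j, i) * y i) (#|I|.+1%:R * (D.+1%:R * (H * H'))).
Proof.
move=> [d [d0 dH h]] [d' [d0' dH' h']]; exists (d * d')%N; split; first by rewrite muln_gt0 d0.
  rewrite natrM -[leLHS]mul1r ler_pM ?ler1n // ?mulr_ge0 //.
  by rewrite -[leLHS]mul1r ler_pM ?ler1n // ?mulr_ge0 // ler_pM.
have [f hf] := boolp.choice h; have [f' hf'] := boolp.choice h'.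
move=> j; exists (\sum_i f (j, i) *m f' i); rewrite mulr_sumr.
have := int_reprS (fun i => int_reprM (hf (j, i)) (hf' i)).
rewrite natrM; under eq_bigr do rewrite mulrACA.
apply: int_repr_le; rewrite ler_wpM2r ?ler_nat // mulr_ge0 // mulr_ge0 //.
  exact: le_trans (ler0n _ d) dH.
exact: le_trans (ler0n _ d') dH'.
Qed.

(** [d ^ E] is a common denominator for all monomials of degree at most [E], and each matrix product
    costs a factor [D.+1]. *)
Lemma height_mnm N (x : 'I_N -> L) H E : height_le x H ->
  height_le (fun m : 'X_{1..N < E.+1} => \prod_i x i ^+ m i) ((D.+1%:R * H) ^+ E.+1).
Proof.
move=> hx; have H1 := height_ge1 hx; case: hx => d [d0 dH h].
have H0 : 0 <= H by exact: le_trans H1.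
have DH1 : 1 <= D.+1%:R * H by rewrite -[leLHS]mul1r ler_pM ?ler1n.
exists (d ^ E)%N; split; first by rewrite expn_gt0 d0.
  rewrite natrX; apply: le_trans (_ : (D.+1%:R * H) ^+ E <= _); last by rewrite ler_weXn2l.
  by apply: ler_expn => //; rewrite -[leLHS]mul1r ler_pM ?ler1n.
have main (m : 'X_{1..N}) : exists Z, int_repr (d%:R ^+ mdeg m * \prod_i x i ^+ m i) Z ((D.+1%:R * H) ^+ (mdeg m).+1).
  move: {2}(mdeg m) (erefl (mdeg m)) => j; elim: j m => [|j IH] m Em.
    move/eqP: (Em); rewrite mdeg_eq0 => /eqP ->; rewrite mdeg0 expr0 mul1r big1 => [|i _]; last by rewrite mnm0E.
    exists 1%:R%:M; apply: int_repr_le (int_repr_nat 1); by rewrite expr1.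
  have [i mi] : exists i, m i != 0%N.
    apply: boolp.contrapT => /boolp.forallNP z; suff : m = 0%MM by move=> Z; rewrite Z mdeg0 in Em.
    by apply/mnmP => i; rewrite mnm0E; apply/eqP/negPn/negP => /z.
  have Um : (U_(i) <= m)%MM by rewrite lep1mP.
  have Ed : mdeg (m - U_(i))%MM = j.
    have := congr1 mdeg (submK Um); rewrite mdegD mdeg1 addn1 Em => -[] //.
  have [Z hZ] := IH _ Ed; have [Z' hZ'] := h i.
  exists (Z' *m Z); rewrite Em exprS.
  have -> : d%:R * d%:R ^+ j * \prod_i0 x i0 ^+ m i0 = d%:R * x i * (d%:R ^+ j * \prod_i0 x i0 ^+ (m - U_(i))%MM i0).
    rewrite mulrACA; congr (_ * _); rewrite (bigD1 i) //= [in RHS](bigD1 i) //= mulrA -exprS; congr (_ * _).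
      by rewrite mnmBE mnm1E eqxx subn1 prednK // lt0n.
    by apply: eq_bigr => i' ne; rewrite mnmBE mnm1E eq_sym (negbTE ne) subn0.
  rewrite Ed in hZ; apply: int_repr_le (int_reprM hZ' hZ).
  by rewrite [leRHS]exprS mulrA.
move=> m; have [Z hZ] := main m; have mE := bmdeg m; rewrite ltnS in mE.
exists ((d ^ (E - mdeg m))%:R *: Z); rewrite -{1}(subnK mE) expnD natrM -mulrA.
have -> : (d ^ mdeg m)%:R = d%:R ^+ mdeg m :> L by rewrite natrX.
apply: int_repr_le (int_reprZ _ hZ).
rewrite [leRHS](_ : _ = (D.+1%:R * H) ^+ (E - mdeg m) * (D.+1%:R * H) ^+ (mdeg m).+1); last first.
  by rewrite -exprD addnS subnK.
rewrite ler_wpM2r ?exprn_ge0 ?(le_trans _ DH1) // natrX; apply: ler_expn => //.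
by rewrite -[leLHS]mul1r ler_pM ?ler1n.
Qed.

Hypothesis w_indep : forall z : 'rV[int]_D.+1, map_mx intr z *m w = 0 -> z = 0.

(** A nonzero integer row killed by [Z] would give an integer relation between the entries of
    [w]. *)
Lemma int_repr_det x Z H : x != 0 -> int_repr x Z H -> \det Z != 0.
Proof.
move=> x0 [E _]; apply/negP => /eqP dZ.
have /det0P[z z0 zZ] : \det Z == 0 by rewrite dZ.
case/eqP: z0; apply: w_indep; apply: (scalerI x0).
by rewrite scaler0 scalemxAr -E mulmxA -map_mxM zZ map_mx0 mul0mx.
Qed.

Lemma int_det_bound m (Z : 'M[int]_m) (H : R) : (forall i j, `|(Z i j)%:~R| <= H) ->
  `|(\det Z)%:~R| <= (factorial m)%:R * H ^+ m.
Proof.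
move=> h; rewrite rmorph_sum /=; apply: le_trans (ler_norm_sum _ _ _) _.
apply: le_trans (_ : \sum_(s : {perm 'I_m}) H ^+ m <= _); last by rewrite sumr_const card_Sn mulr_natl.
apply: ler_sum => s _; rewrite rmorphM normrM rmorphXn normrX rmorphN1 normrN1 expr1n mul1r.
have -> : H ^+ m = \prod_(i < m) H by rewrite prodr_const card_ord.
rewrite rmorph_prod normr_prod /=; by apply: ler_prod => i _; rewrite normr_ge0 h.
Qed.

(** The inverse is represented by the adjugate over the determinant. Both are bounded by the Leibniz
    expansion, in sizes [D] and [D.+1], whence the two factorials. *)
Lemma height_inv : exists2 c : R, 1 <= c & forall (x : L) H, x != 0 ->
  height_le (fun _ : unit => x) H -> height_le (fun _ : unit => x^-1) (c * H ^+ D.+2).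
Proof.
pose c0 : R := (factorial D.+1)%:R + (factorial D)%:R.
have c0p : 1 <= c0.
  by rewrite -[leLHS]addr0 lerD // ler1n fact_gt0.
exists c0 => // x H x0 hx; have H1 := height_ge1 hx; case: hx => d [d0 dH /(_ tt) [Z hZ]].
have H0 : 0 <= H by exact: le_trans H1.
have dx0 : d%:R * x != 0 by rewrite mulf_neq0 // pnatr_eq0 -lt0n.
have dZ := int_repr_det dx0 hZ.
have adjE : map_mx intr (\adj Z) *m w = ((\det Z)%:~R / (d%:R * x)) *: w.
  apply: (scalerI dx0); rewrite scalerA [_ * (_ / _)]mulrC divfK //.
  case: hZ => E _; rewrite scalemxAr -E mulmxA -map_mxM mul_adj_mx map_scalar_mx mul_scalar_mx //.
have bdet : `|(\det Z)%:~R| <= c0 * H ^+ D.+2.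
  apply: le_trans (int_det_bound (proj2 hZ)) _; apply: ler_pM; rewrite ?exprn_ge0 //.
    by rewrite lerDl.
  by rewrite ler_weXn2l.
have badj i j : `|(d%:Z * (\adj Z) i j)%:~R| <= c0 * H ^+ D.+2.
  rewrite rmorphM normrM mxE /cofactor rmorphM normrM rmorphXn normrX rmorphN1 normrN1 expr1n mul1r.
  apply: le_trans (_ : H * ((factorial D)%:R * H ^+ D) <= _).
    rewrite ler_pM //; first by rewrite /= -pmulrn normr_nat.
    by apply: int_det_bound => i' j'; rewrite !mxE; case: hZ.
  rewrite mulrCA -exprS ler_pM ?exprn_ge0 //; first by rewrite lerDr.
  by rewrite ler_weXn2l.
exists `|\det Z|%N; split; first by rewrite absz_gt0.
  apply: le_trans bdet; rewrite -intr_norm -abszE //.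
(* The denominator must be a natural number, so the sign of the determinant is moved to the
   matrix. *)
move=> _; pose sg := if 0 <= \det Z then 1 else -1 : int.
exists (sg *: (d%:Z *: \adj Z)).
have Esg : sg * \det Z = `|\det Z|%N%:Z by rewrite abszE /sg; case: ger0P => _; rewrite ?mul1r ?mulN1r.
split.
  rewrite map_mxZ map_mxZ -!scalemxAl adjE !scalerA; congr (_ *: _).
  rewrite -[(`|\det Z|%N)%:R]/((`|\det Z|%N%:Z)%:~R) -Esg rmorphM /= -pmulrn.
  by field; rewrite x0 pnatr_eq0 -lt0n.
move=> i j; rewrite !mxE rmorphM normrM.
have -> : `|sg%:~R| = 1 :> R by rewrite /sg; case: ifP => _; rewrite ?rmorphN1 ?normrN1 ?normr1.
by rewrite mul1r; have := badj i j; rewrite mxE.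
Qed.
End Heights.

Section Liouville.
Variables (R : realType) (L : numFieldType) (D : nat) (w : 'cV[L]_D.+1).
Hypothesis w_indep : forall z : 'rV[int]_D.+1, map_mx intr z *m w = 0 -> z = 0.
Variables (C : fieldType) (emb : {rmorphism L -> C}) (v : C -> R).
Hypothesis hv : is_absolute_value v.
Hypothesis v_nat : forall k : nat, (0 < k)%N -> 1 <= k%:R * v k%:R.

(** The first row of the matrix bounds [d * x]; division by [d] costs at most another factor [H],
    because [v d%:R] is at least [1 / d]. *)
Lemma height_abs : exists2 c : R, 0 < c & forall (x : L) H,
  height_le w (fun _ : unit => x) H -> v (emb x) <= c * H ^+ 2.
Proof.
have w0 : w ord0 ord0 != 0.
  apply/negP => /eqP Z; have /w_indep/rowP/(_ ord0) : map_mx intr (delta_mx 0 ord0 : 'rV[int]_D.+1) *m w = 0.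
    rewrite map_delta_mx -rowE; apply/rowP => j; rewrite !mxE [j]ord1 //.
  by rewrite !mxE !eqxx.
have vw0 : 0 < v (emb (w ord0 ord0)) by rewrite (abs_gt0 hv) fmorph_eq0.
pose c := (\sum_j v (emb (w j ord0))) / v (emb (w ord0 ord0)) + 1.
have c0 : 0 < c.
  by rewrite ltr_wpDl // divr_ge0 ?(ltW vw0) // sumr_ge0 // => j _; exact: abs_ge0.
exists c => // x H hx; have H1 := height_ge1 hx; case: hx => d [d0 dH /(_ tt) [Z [E hZ]]].
have H0 : 0 <= H by exact: le_trans H1.
have : emb (d%:R * x * w ord0 ord0) = \sum_j (Z ord0 j)%:~R * emb (w j ord0).
  have /matrixP/(_ ord0 ord0) := E; rewrite !mxE => <-.
  by rewrite rmorph_sum; apply: eq_bigr => j _; rewrite mxE rmorphM rmorph_int.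
move=> /(congr1 v) E1.
have le1 : v d%:R * v (emb x) * v (emb (w ord0 ord0)) <= H * \sum_j v (emb (w j ord0)).
  rewrite -!(absM hv) -(rmorph_nat emb) -!rmorphM E1; apply: le_trans (abs_sum hv _ _ _) _.
  rewrite mulr_sumr; apply: ler_sum => j _; rewrite (absM hv) ler_wpM2r ?(abs_ge0 hv) //.
  exact: le_trans (abs_int hv _) (hZ _ _).
have le2 : v (emb x) <= d%:R * (v d%:R * v (emb x)).
  by rewrite mulrA ler_peMl ?(abs_ge0 hv) // v_nat.
have le3 : v d%:R * v (emb x) <= H * c.
  apply: le_trans (_ : H * ((\sum_j v (emb (w j ord0))) / v (emb (w ord0 ord0))) <= _).
    by rewrite mulrA ler_pdivlMr.
  by rewrite ler_wpM2l // lerDl.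
apply: le_trans le2 _; apply: le_trans (_ : H * (H * c) <= _).
  by rewrite ler_pM // mulr_ge0 // abs_ge0.
by rewrite expr2 mulrA mulrC.
Qed.

(** The upper bound of [height_abs], applied to the inverse. *)
Lemma liouville : exists2 c : R, 0 < c & exists E : nat, forall (x : L) H, x != 0 ->
  height_le w (fun _ : unit => x) H -> 1 <= c * H ^+ E * v (emb x).
Proof.
have [c c0 hc] := height_abs; have [c' c1 hinv] := height_inv R w_indep.
exists (c * c' ^+ 2); first by rewrite mulr_gt0 // exprn_gt0 //; exact: lt_le_trans c1.
exists (D.+2 * 2)%N => x H x0 hx.
have vx : 0 < v (emb x) by rewrite (abs_gt0 hv) fmorph_eq0.
rewrite -ler_pdivrMr // div1r -(absV hv) -fmorphV.
by apply: le_trans (hc _ _ (hinv _ _ x0 hx)) _; rewrite exprMn -exprM mulrA.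
Qed.
End Liouville.

(** * The combination of high order *)

Lemma linear_system (K : fieldType) (X Y : finType) (M : X -> Y -> K) : (#|Y| < #|X|)%N ->
  exists c : X -> K, (exists x, c x != 0) /\ forall y, \sum_x c x * M x y = 0.
Proof.
move=> lt; pose A : 'M[K]_(#|X|, #|Y|) := \matrix_(i, j) M (enum_val i) (enum_val j).
have ker0 : kermx A != 0.
  rewrite -mxrank_eq0 mxrank_ker subn_eq0 -ltnNge.
  by apply: leq_ltn_trans (rank_leq_col A) lt.
have [i nz] : exists i, row i (kermx A) != 0.
  apply: boolp.contrapT => /boolp.forallNP h; case/eqP: ker0; apply/row_matrixP => i.
  by rewrite row0; apply/eqP/negPn/negP; exact: h.
have rA : row i (kermx A) *m A = 0 by rewrite -row_mul mulmx_ker row0.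
pose r := row i (kermx A); exists (fun x => r ord0 (enum_rank x)); split.
  apply: boolp.contrapT => /boolp.forallNP h; case/eqP: nz; apply/rowP => j; rewrite [RHS]mxE.
  by have := h (enum_val j); rewrite enum_valK => /negP/negPn/eqP.
move=> y; have /rowP/(_ (enum_rank y)) := rA; rewrite !mxE => E.
rewrite -[RHS]E (reindex (fun i : 'I_#|X| => enum_val i)) /=; last first.
  by exists enum_rank => x _; [exact: enum_valK|exact: enum_rankK].
by apply: eq_bigr => j _; rewrite enum_valK !mxE !enum_rankK.
Qed.

Section Order.
Variables (R : idomainType) (n : nat).
Implicit Types (u w : mps R n).

(** Lowest exponents add up under products, and the monomial order compares degrees first, so [o]
    can be the degree of the lowest exponent of [F]. *)
Lemma order_div (F : mps R n) : F <> 0 -> exists o, forall I u,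
  (forall l, (mdeg l < I)%N -> (F * u) l = 0) -> forall l, (mdeg l < I - o)%N -> u l = 0.
Proof.
move=> /(@exists_low _ _ id)[a [Fa la]]; exists (mdeg a) => I u hFu l hl.
apply/eqP/negPn/negP => ul.
have u0 : u <> 0 by move=> Z; rewrite Z eqxx in ul.
have [b [ub lb]] := exists_low id u0.
have bl : (mdeg b <= mdeg l)%N.
  apply: lemc_mdeg; rewrite leNgt; apply/negP => /lb E; by rewrite E eqxx in ul.
have := @mps_lowM R n id F u a b (fun _ _ => erefl) (fun _ _ => id) la lb.
rewrite hFu => [/esym/eqP|]; first by rewrite mulf_eq0 (negbTE Fa) (negbTE ub).
by rewrite mdegD; lia.
Qed.

Lemma order_divX (F : mps R n) : F <> 0 -> exists o, forall r I u,
  (forall l, (mdeg l < I)%N -> (F ^+ r * u) l = 0) -> forall l, (mdeg l < I - r * o)%N -> u l = 0.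
Proof.
move=> /order_div [o ho]; exists o; elim=> [|r IH] I u h l hl.
  by have := h l; rewrite expr0 mul1r; apply; move: hl; rewrite mul0n subn0.
apply: (ho (I - r * o)%N); last by rewrite -subnDA addnC -mulSn.
by apply: IH; move=> l' hl'; rewrite mulrA -exprSr h.
Qed.
End Order.

Section Degree.
Variables (K : fieldType) (n N : nat).
Local Notation S := {mpoly K[N]}.
Implicit Types (u w : mps S n).

(** A degree in the variables s that is bounded uniformly over all coefficients makes the conditions
    of vanishing up to a given order finite in number. *)
Definition deg_le (D : nat) u := forall l m, (D < mdeg m)%N -> (u l)@_m = 0.

Lemma deg_leD D u w : deg_le D u -> deg_le D w -> deg_le D (u + w).
Proof. by move=> hu hw l m h; rewrite mpsD mcoeffD hu // hw // addr0. Qed.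

Lemma deg_leW D D' u : (D <= D')%N -> deg_le D u -> deg_le D' u.
Proof. by move=> le hu l m h; apply: hu; apply: leq_ltn_trans h. Qed.

Lemma deg_leM D D' u w : deg_le D u -> deg_le D' w -> deg_le (D + D') (u * w).
Proof.
move=> hu hw l m h; rewrite mpsM raddf_sum big1 //= => x _.
rewrite mcoeffM big1 // => y /eqP E.
have := congr1 mdeg E; rewrite mdegD => Ed.
case: (leqP (mdeg y.1) D) => [le|lt]; last by rewrite hu // mul0r.
by rewrite [X in _ * X]hw ?mulr0 // -(ltn_add2l D); apply: leq_trans h _; apply: leq_trans (_ : mdeg y.1 + mdeg y.2 <= _)%N; rewrite ?leq_add2r // -Ed.
Qed.

Lemma deg_le1 : deg_le 0 (1 : mps S n).
Proof.
move=> l m h; rewrite mps1E; case: eqP => _; rewrite ?mcoeff0 // mcoeff1.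
by case: eqP => // E; rewrite E mdeg0 in h.
Qed.

Lemma deg_leX D u r : deg_le D u -> deg_le (r * D) (u ^+ r).
Proof.
move=> hu; elim: r => [|r IH]; first by rewrite expr0 mul0n; exact: deg_le1.
by rewrite exprS mulSn; apply: deg_leM.
Qed.

Definition box_mnm k q (x : {ffun 'I_k -> 'I_q}) : 'X_{1..k} := [multinom (x i : nat) | i < k].

Lemma box_mnm_inj k q : injective (@box_mnm k q).
Proof. by move=> x y /mnmP E; apply/ffunP => i; apply: val_inj; have := E i; rewrite !mnmE. Qed.

Lemma box_mnmP k q (m : 'X_{1..k}) : (mdeg m < q)%N -> exists x, m = @box_mnm k q x.
Proof.
move=> h; have hi i : (m i < q)%N.
  by apply: leq_ltn_trans h; rewrite mdegE (bigD1 i) //= leq_addr.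
by exists [ffun i => Ordinal (hi i)]; apply/mnmP => i; rewrite mnmE ffunE.
Qed.

Lemma mdeg_box k q (x : {ffun 'I_k -> 'I_q}) : (mdeg (box_mnm x) <= k * q)%N.
Proof.
rewrite mdegE; apply: leq_trans (_ : \sum_(i < k) q <= _)%N; last by rewrite sum_nat_const card_ord.
by apply: leq_sum => i _; rewrite mnmE ltnW.
Qed.

Definition bimon q (x : {ffun 'I_n -> 'I_q}) (y : {ffun 'I_N -> 'I_q}) : mps S n :=
  ofp ('X_[box_mnm y] *: 'X_[box_mnm x]).

Lemma bimonE q (x : {ffun 'I_n -> 'I_q}) y l :
  bimon x y l = if box_mnm x == l then 'X_[box_mnm y] else 0.
Proof. by rewrite /= mcoeffZ mcoeffX; case: eqP => _; rewrite ?mulr1 ?mulr0. Qed.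

Lemma deg_le_bimon q (x : {ffun 'I_n -> 'I_q}) y : deg_le (N * q) (bimon x y).
Proof.
move=> l m h; rewrite bimonE; case: eqP => _; rewrite ?mcoeff0 // mcoeffX.
by case: eqP => // E; rewrite -E ltnNge mdeg_box in h.
Qed.

Definition bipoly q (c : {ffun 'I_n -> 'I_q} -> {ffun 'I_N -> 'I_q} -> K) : mps S n :=
  \sum_x \sum_y cst n (c x y)%:MP * bimon x y.

Lemma deg_le_bipoly q (c : {ffun 'I_n -> 'I_q} -> {ffun 'I_N -> 'I_q} -> K) : deg_le (N * q) (bipoly c).
Proof.
rewrite /bipoly; elim/big_ind: _ => [l m _|u w|x _]; [by rewrite mcoeff0|exact: deg_leD|].
elim/big_ind: _ => [l m _|u w|y _]; [by rewrite mcoeff0|exact: deg_leD|].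
by move=> l m h'; rewrite cstM mcoeffCM deg_le_bimon ?mulr0.
Qed.

(* Siegel's lemma without size bounds: only the number of unknowns and of
   equations matters, since the height of the solution is absorbed as k grows. *)
Lemma pade (F : mps S n) (D : nat) : deg_le D F -> F <> 0 ->
  exists o, forall J, exists q (c : 'I_q -> {ffun 'I_n -> 'I_q} -> {ffun 'I_N -> 'I_q} -> K) (r : 'I_q),
    [/\ (0 < q)%N, exists x y, c r x y != 0
      & forall l, (mdeg l < (J - o) * q)%N ->
          (\sum_(h < q | (r <= h)%N) bipoly (c h) * F ^+ (h - r)) l = 0].
Proof.
move=> dF /order_divX [o ho]; exists o => J.
(* There are [q * q ^ n * q ^ N] unknowns against [(J * q) ^ n * (Dt * q) ^ N] equations, so [q]
   only has to exceed [J ^ n * Dt ^ N]; [Dt * q] exceeds the degree of the combination in the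
   variables s. *)
pose Dt := (N + D).+1; pose q := (J ^ n * Dt ^ N).+1.
pose X := ('I_q * ({ffun 'I_n -> 'I_q} * {ffun 'I_N -> 'I_q}))%type.
pose Y := ({ffun 'I_n -> 'I_(J * q)} * {ffun 'I_N -> 'I_(Dt * q)})%type.
pose M (x : X) (y : Y) := ((bimon x.2.1 x.2.2 * F ^+ x.1) (box_mnm y.1))@_(box_mnm y.2).
have lt : (#|{: Y}| < #|{: X}|)%N.
  rewrite !card_prod !card_ffun !card_ord !expnMn.
  rewrite (_ : _ * _ = (J ^ n * Dt ^ N) * (q ^ n * q ^ N))%N; last by ring.
  by rewrite ltn_mul2r muln_gt0 !expn_gt0 /= ltnS leqnn.
have [c0 [[x0 cx0] hc]] := linear_system M lt.
pose c h x y := c0 (h, (x, y)).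
pose E := \sum_(h < q) bipoly (c h) * F ^+ h.
have dE : deg_le (N * q + q * D) E.
  rewrite /E; elim/big_ind: _ => [l m _|u w|h _]; [by rewrite mcoeff0|exact: deg_leD|].
  have hX : deg_le (q * D) (F ^+ h).
    by apply: (@deg_leW (h * D)%N); [rewrite leq_mul2r ltnW ?orbT|exact: deg_leX].
  apply: deg_leM hX; exact: deg_le_bipoly.
have ordE l : (mdeg l < J * q)%N -> E l = 0.
  move=> hl; apply/mpolyP => m; rewrite mcoeff0.
  case: (ltnP (mdeg m) (Dt * q)) => [hm|hm]; last first.
    by apply: dE; apply: leq_trans hm; rewrite /Dt; lia.
  have [x Ex] := box_mnmP hl; have [y Ey] := box_mnmP hm.
  rewrite -[RHS](hc (x, y)) /E mps_sumE raddf_sum.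
  transitivity (\sum_h \sum_x' \sum_y' c0 (h, (x', y')) * M (h, (x', y')) (x, y)); last first.
    rewrite (eq_bigr (fun h => \sum_(p : {ffun 'I_n -> 'I_q} * {ffun 'I_N -> 'I_q})
      c0 (h, (p.1, p.2)) * M (h, (p.1, p.2)) (x, y))) => [|h _]; last first.
      by rewrite (pair_bigA _ (fun x' y' => c0 (h, (x', y')) * M (h, (x', y')) (x, y))).
    rewrite (pair_bigA _ (fun h (p : {ffun 'I_n -> 'I_q} * {ffun 'I_N -> 'I_q}) =>
      c0 (h, (p.1, p.2)) * M (h, (p.1, p.2)) (x, y))).
    by apply: eq_bigr => -[h [x' y']].
  apply: eq_bigr => h _.
  rewrite /bipoly mulr_suml mps_sumE raddf_sum; apply: eq_bigr => x' _.
  rewrite mulr_suml mps_sumE raddf_sum; apply: eq_bigr => y' _.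
  have -> : cst n (c h x' y')%:MP * bimon x' y' * F ^+ h = cst n (c h x' y')%:MP * (bimon x' y' * F ^+ h).
    by rewrite mulrA.
  rewrite cstM; transitivity (c h x' y' * ((bimon x' y' * F ^+ h) l)@_m); first exact: mcoeffCM.
  by rewrite /M Ex Ey.
(* The first index with a nonzero coefficient polynomial; dividing by [F ^+ r] loses [o] orders for
   each of its fewer than [q] factors. *)
have [r [[x [y crxy]] minr]] : exists r : 'I_q, (exists x y, c r x y != 0) /\
    forall h : 'I_q, (h < r)%N -> forall x y, c h x y = 0.
  have ex : exists i : nat, [exists h : 'I_q, (val h == i) && [exists x, [exists y, c h x y != 0]]].
    exists (val x0.1); apply/existsP; exists x0.1; rewrite eqxx /=.
    by apply/existsP; exists x0.2.1; apply/existsP; exists x0.2.2; rewrite /c -!surjective_pairing.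
  case: (ex_minnP ex) => i /existsP[r /andP[/eqP Er /existsP[x /existsP[y h]]]] mini.
  exists r; split; first by exists x, y.
  move=> h' lt' x' y'; apply/eqP/negPn/negP => nz.
  have : (i <= h')%N.
    by apply: mini; apply/existsP; exists h'; rewrite eqxx; apply/existsP; exists x'; apply/existsP; exists y'.
  by rewrite -Er leqNgt lt'.
exists q, c, r; split=> //; first by exists x, y.
move=> l hl; apply: (ho r (J * q)%N) => [l' hl'|]; last first.
  apply: leq_trans hl _; rewrite mulnBl leq_sub2l // mulnC leq_mul2l.
  by rewrite ltnW ?orbT.
rewrite -(ordE _ hl') /E; congr (mpsf _ l').
rewrite mulr_sumr [RHS](bigID (fun h : 'I_q => (r <= h)%N)) /= [X in _ + X]big1 ?addr0 => [|h].
  by apply: eq_bigr => h rh; rewrite mulrCA -exprD subnKC.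
rewrite -ltnNge => hr; rewrite /bipoly big1 ?mul0r // => x' _; rewrite big1 // => y' _.
by rewrite minr // mpolyC0 rmorph0 mul0r.
Qed.
End Degree.

(** * Upper bounds through majorants and truncations *)

Section Map.
Variables (A B : comNzRingType) (n : nat) (h : {rmorphism A -> B}).

Definition mpsmap (u : mps A n) : mps B n := MPS (fun m => h (u m)).

Lemma mpsmap_is_zmod_morphism : zmod_morphism mpsmap.
Proof. by move=> u w; apply: mpsP => m /=; rewrite rmorphB. Qed.
Lemma mpsmap_is_monoid_morphism : monoid_morphism mpsmap.
Proof.
split; first by apply: mpsP => m /=; rewrite rmorph_nat.
move=> u w; apply: mpsP => m; rewrite mpsM /= rmorph_sum.
by apply: eq_bigr => x _; rewrite rmorphM.
Qed.
HB.instance Definition _ := GRing.isZmodMorphism.Build (mps A n) (mps B n) mpsmap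
  mpsmap_is_zmod_morphism.
HB.instance Definition _ := GRing.isMonoidMorphism.Build (mps A n) (mps B n) mpsmap
  mpsmap_is_monoid_morphism.

Lemma mpsmap_ofp p : mpsmap (ofp p) = ofp (map_mpoly h p).
Proof. by apply: mpsP => m /=; rewrite mcoeff_map_mpoly. Qed.
End Map.

Section Agree.
Variables (R : comNzRingType) (n : nat) (d : nat).
Implicit Types (u w : mps R n).

Definition agree u w := forall m, (mdeg m < d)%N -> u m = w m.

Lemma agreeD u u' w w' : agree u u' -> agree w w' -> agree (u + w) (u' + w').
Proof. by move=> hu hw m hm; rewrite !mpsD hu ?hw. Qed.

Lemma agreeM u u' w w' : agree u u' -> agree w w' -> agree (u * w) (u' * w').
Proof.
move=> hu hw m hm; rewrite !mpsM; apply: eq_bigr => x /eqP E.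
have := congr1 mdeg E; rewrite mdegD => Ed.
by rewrite hu ?hw //; lia.
Qed.

Lemma agreeX u u' k : agree u u' -> agree (u ^+ k) (u' ^+ k).
Proof. by move=> h; elim: k => [|k IH]; rewrite ?expr0 // !exprS; apply: agreeM. Qed.

Lemma agree_sum (I : Type) (r : seq I) (P : pred I) (F G : I -> mps R n) :
  (forall i, P i -> agree (F i) (G i)) ->
  agree (\sum_(i <- r | P i) F i) (\sum_(i <- r | P i) G i).
Proof. by move=> h; elim/big_rec2: _ => // i x y Pi; apply: agreeD; exact: h. Qed.

Lemma agree_mmap M (P : {mpoly R[M]}) (u : 'I_M -> mps R n) :
  agree (mmap (@cst R n) u P) (ofp (mmap (@mpolyC n R) (fun i => trunc d (u i)) P)).
Proof.
elim/mpoly_ring_ind: P => [c|v|p q hp hq|p q hp hq].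
- by rewrite !mmapC.
- by rewrite !mmapX !mmap1U => m hm; rewrite /= truncE.
- by rewrite !rmorphD; exact: agreeD.
- by rewrite !rmorphM; exact: agreeM.
Qed.
End Agree.

Section Majorant.
Variables (R : realType) (C : fieldType) (v : C -> R).
Hypothesis hv : is_absolute_value v.

Definition maj n (p : {mpoly C[n]}) (q : {mpoly R[n]}) := forall m, v p@_m <= q@_m.

Lemma maj_coef_ge0 n (p : {mpoly C[n]}) q m : maj p q -> 0 <= q@_m.
Proof. by move=> h; apply: le_trans (h m); exact: (abs_ge0 hv). Qed.

Lemma majC n (c : C) : maj (c%:MP_[n]) (v c)%:MP.
Proof. by move=> m; rewrite !mcoeffC; case: eqP; rewrite ?mulr1 // !mulr0 (abs0 hv). Qed.

Lemma majD n (p p' : {mpoly C[n]}) q q' : maj p q -> maj p' q' -> maj (p + p') (q + q').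
Proof. by move=> h h' m; rewrite !mcoeffD; apply: le_trans (absD hv _ _) _; apply: lerD. Qed.

Lemma majM n (p p' : {mpoly C[n]}) q q' : maj p q -> maj p' q' -> maj (p * p') (q * q').
Proof.
move=> h h' m; rewrite !mcoeffM; apply: le_trans (abs_sum hv _ _ _) _; apply: ler_sum => x _.
by rewrite (absM hv) ler_pM ?(abs_ge0 hv).
Qed.

Lemma majX n (p : {mpoly C[n]}) q k : maj p q -> maj (p ^+ k) (q ^+ k).
Proof.
move=> h; elim: k => [|k IH]; last by rewrite !exprS; apply: majM.
by have := @majC n 1; rewrite (abs1 hv) !mpolyC1 !expr0.
Qed.

Lemma maj_sum n (I : Type) (r : seq I) (P : pred I) (F : I -> {mpoly C[n]}) G :
  (forall i, P i -> maj (F i) (G i)) ->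
  maj (\sum_(i <- r | P i) F i) (\sum_(i <- r | P i) G i).
Proof.
move=> h; elim/big_rec2: _ => [|i x y Pi]; last by apply: majD; exact: h.
by move=> m; rewrite !mcoeff0 (abs0 hv).
Qed.

Lemma maj_mmap n M (P : {mpoly C[M]}) Q (x : 'I_M -> {mpoly C[n]}) y :
  maj P Q -> (forall i, maj (x i) (y i)) ->
  maj (mmap (@mpolyC n C) x P) (mmap (@mpolyC n R) y Q).
Proof.
move=> hPQ hxy; have [k [kP kQ]] : exists k, (msize P <= k /\ msize Q <= k)%N.
  by exists (maxn (msize P) (msize Q)); rewrite leq_maxl leq_maxr.
rewrite (mmapE _ kP) (mmapE _ kQ); apply: maj_sum => m _; apply: majM.
  by move=> m'; rewrite !mcoeffC; case: eqP => _; rewrite ?mulr1 // !mulr0 (abs0 hv).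
rewrite /mmap1; elim/big_rec2: _ => [|i p q _ h]; last by apply: majM h; exact: majX.
by rewrite -(expr0 (0 : {mpoly C[n]})) -(expr0 (0 : {mpoly R[n]})); apply: majX => m'; rewrite !mcoeff0 (abs0 hv).
Qed.

(** Every monomial that survives has degree at least [I] and so brings a factor [t ^+ I]. *)
Lemma maj_eval n (p : {mpoly C[n]}) q (z : 'I_n -> C) (be : 'I_n -> R) t I :
  maj p q -> (forall m, (mdeg m < I)%N -> p@_m = 0) -> (forall j, 0 <= be j) -> 0 <= t <= 1 ->
  (forall j, v (z j) <= t * be j) -> v p.@[z] <= t ^+ I * q.@[be].
Proof.
move=> hpq low be0 /andP[t0 t1] hz.
have [k [kP kQ]] : exists k, (msize p <= k /\ msize q <= k)%N.
  by exists (maxn (msize p) (msize q)); rewrite leq_maxl leq_maxr.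
rewrite /meval (mmapE _ kP) (mmapE _ kQ) mulr_sumr.
apply: le_trans (abs_sum hv _ _ _) _; apply: ler_sum => m _ /=.
have q0 : 0 <= q@_m := maj_coef_ge0 m hpq.
have be1 : 0 <= mmap1 be m by rewrite /mmap1; apply: prodr_ge0 => i _; rewrite exprn_ge0.
rewrite (absM hv); case: (ltnP (mdeg m) I) => [/low ->|ge].
  by rewrite (abs0 hv) mul0r mulr_ge0 ?exprn_ge0 // mulr_ge0.
rewrite mulrCA; apply: ler_pM; rewrite ?(abs_ge0 hv) //.
apply: le_trans (_ : t ^+ mdeg m * mmap1 be m <= _); last by rewrite ler_wpM2r // ler_wiXn2l.
rewrite /mmap1 (abs_prod hv) mdegE expr_sum -big_split /=; apply: ler_prod => i _.
by rewrite (abs_ge0 hv) (absX hv) -exprMn ler_expn ?(abs_ge0 hv).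
Qed.
End Majorant.

Lemma mpoly_rmorph_eq (A B : comNzRingType) M (f g : {rmorphism {mpoly A[M]} -> B}) :
  (forall c, f c%:MP = g c%:MP) -> (forall i, f 'X_i = g 'X_i) -> f =1 g.
Proof.
by move=> hC hX; elim/mpoly_ring_ind => [c|i|p q hp hq|p q hp hq] //; rewrite ?rmorphD ?rmorphM hp hq.
Qed.

Lemma meval_mmapC (A : comNzRingType) n M (P : {mpoly A[M]}) (x : 'I_M -> {mpoly A[n]}) z :
  (mmap (@mpolyC n A) x P).@[z] = P.@[fun i => (x i).@[z]].
Proof.
apply: (mpoly_rmorph_eq (f := meval z \o mmap (@mpolyC n A) x)) => [c|i] /=.
  by rewrite mmapC !mevalC.
by rewrite mmapX mmap1U mevalXU.
Qed.

Lemma mevalXn (A : comNzRingType) n (p : {mpoly A[n]}) z k : (p ^+ k).@[z] = p.@[z] ^+ k.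
Proof. exact: rmorphXn. Qed.

Section Limit.
Variables (R : realType) (C : fieldType) (v : C -> R).
Hypothesis hv : is_absolute_value v.

Definition tends (x : nat -> C) y := forall eps : R, 0 < eps -> exists N0, forall N, (N0 <= N)%N -> v (x N - y) < eps.

Lemma tends_cst y : tends (fun _ => y) y.
Proof. by move=> eps e0; exists 0%N => N _; rewrite subrr (abs0 hv). Qed.

Lemma tendsD x y x' y' : tends x y -> tends x' y' -> tends (fun N => x N + x' N) (y + y').
Proof.
move=> h h' eps e0; have e2 : 0 < eps / 2 by rewrite divr_gt0.
have [N hN] := h _ e2; have [N' hN'] := h' _ e2; exists (maxn N N') => k; rewrite geq_max => /andP[k1 k2].
rewrite opprD addrACA; apply: le_lt_trans (absD hv _ _) _; rewrite [eps]splitr.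
by apply: ltrD; [exact: hN|exact: hN'].
Qed.

Lemma tends_bounded x y : tends x y -> exists2 B, 0 < B & exists N0, forall N, (N0 <= N)%N -> v (x N) <= B.
Proof.
move=> h; exists (v y + 1); first by rewrite ltr_wpDl ?(abs_ge0 hv).
have [N hN] := h 1 ltr01; exists N => k /hN lt.
rewrite -[x k](addrNK y) addrC; apply: le_trans (absD hv _ _) _; by rewrite lerD2l ltW.
Qed.

Lemma tendsM x y x' y' : tends x y -> tends x' y' -> tends (fun N => x N * x' N) (y * y').
Proof.
move=> h h' eps e0; have [B B0 [N1 hB]] := tends_bounded h.
have e1 : 0 < eps / (B + v y') / 2 by rewrite !divr_gt0 // ltr_wpDr ?(abs_ge0 hv).
have [N hN] := h _ e1; have [N' hN'] := h' _ e1.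
exists (maxn N1 (maxn N N')) => k; rewrite !geq_max => /and3P[k0 k1 k2].
have -> : x k * x' k - y * y' = x k * (x' k - y') + (x k - y) * y' by ring.
apply: le_lt_trans (absD hv _ _) _; rewrite !(absM hv).
apply: le_lt_trans (_ : B * (eps / (B + v y') / 2) + eps / (B + v y') / 2 * v y' < _).
  by apply: lerD; apply: ler_pM; rewrite ?(abs_ge0 hv) ?hB // ltW ?hN ?hN'.
have Bp : 0 < B + v y' by rewrite ltr_wpDr ?(abs_ge0 hv).
by rewrite [_ * v y']mulrC -mulrDl mulrA mulrCA mulfV ?gt_eqF // mulr1; lra.
Qed.

Lemma tendsX x y k : tends x y -> tends (fun N => x N ^+ k) (y ^+ k).
Proof.
move=> h; elim: k => [|k IH]; first exact: tends_cst.
by rewrite exprS => eps /(tendsM h IH)[N hN]; exists N => j /hN; rewrite exprS.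
Qed.

Lemma tends_sum (I : Type) (r : seq I) (P : pred I) (x : I -> nat -> C) y :
  (forall i, P i -> tends (x i) (y i)) ->
  tends (fun N => \sum_(i <- r | P i) x i N) (\sum_(i <- r | P i) y i).
Proof.
move=> h; elim: r => [|i r IH].
  by rewrite big_nil => eps /(tends_cst 0)[N hN]; exists N => j /hN; rewrite big_nil.
rewrite big_cons; case Pi: (P i); last first.
  by move=> eps /IH[N hN]; exists N => j /hN; rewrite big_cons Pi.
by move=> eps /(tendsD (h i Pi) IH)[N hN]; exists N => j /hN; rewrite big_cons Pi.
Qed.

Lemma tends_meval M (P : {mpoly C[M]}) x y : (forall i, tends (fun N => x N i) (y i)) ->
  tends (fun N => P.@[x N]) P.@[y].
Proof.
move=> h; elim/mpoly_ring_ind: P => [c|i|p q hp hq|p q hp hq].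
- by rewrite mevalC => eps /(tends_cst c)[N hN]; exists N => j /hN; rewrite mevalC.
- by rewrite mevalXU => eps /(h i)[N hN]; exists N => j /hN; rewrite mevalXU.
- by rewrite mevalD => eps /(tendsD hp hq)[N hN]; exists N => j /hN; rewrite mevalD.
- by rewrite mevalM => eps /(tendsM hp hq)[N hN]; exists N => j /hN; rewrite mevalM.
Qed.

Lemma tends_le x y B : tends x y -> (exists N0, forall N, (N0 <= N)%N -> v (x N) <= B) -> v y <= B.
Proof.
move=> h [N0 hB]; rewrite leNgt; apply/negP => lt.
have vB : 0 < v y - B by rewrite subr_gt0.
have [N hN] := h _ vB; have := hN _ (leq_maxr N0 N).
have := hB _ (leq_maxl N0 N); move: (x _) => z; have := absD hv (y - z) z.
rewrite addrNK -(absN hv (y - z)) opprB => a b c.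
by lra.
Qed.

Definition mabs n d (u : mps C n) : {mpoly R[n]} := \sum_(m : 'X_{1..n < d}) v (u m) *: 'X_[m].

Lemma maj_trunc n d (u : mps C n) : maj v (trunc d u) (mabs d u).
Proof.
apply: maj_sum => // m _ m'; rewrite !mcoeffZ !mcoeffX.
by case: eqP => _; rewrite ?mulr1 // !mulr0 (abs0 hv).
Qed.

(** [P] vanishes at the values [y], so only the term of index [r] survives in the value of the
    combination, while as a series the combination starts in degree [I]. Majorants apply to
    polynomials, hence the truncations, with the limit taken at the end. *)
Lemma limit_bound n M (P : {mpoly C[M]}) (P' : {mpoly R[M]}) (u : 'I_M -> mps C n) (y : 'I_M -> C)
    (Bd : 'I_M -> R) (z : 'I_n -> C) (be : 'I_n -> R) (t : R) (I q : nat) (r : 'I_q)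
    (p : 'I_q -> {mpoly C[n]}) (p' : 'I_q -> {mpoly R[n]}) :
  maj v P P' -> (forall h, maj v (p h) (p' h)) -> (forall j, 0 <= be j) -> 0 <= t <= 1 ->
  (forall j, v (z j) <= t * be j) ->
  (forall i d, (mabs d (u i)).@[be] <= Bd i) ->
  (forall i, tends (fun d => (trunc d (u i)).@[z]) (y i)) -> P.@[y] = 0 ->
  (forall m, (mdeg m < I)%N ->
     (\sum_(h < q | (r <= h)%N) ofp (p h) * mmap (@cst C n) u P ^+ (h - r)) m = 0) ->
  v (p r).@[z] <= t ^+ I * \sum_(h < q | (r <= h)%N) (p' h).@[be] * P'.@[Bd] ^+ (h - r).
Proof.
move=> hP hp be0 t01 hz hBd hy Py low.
pose Pd d := mmap (@mpolyC n C) (fun i => trunc d (u i)) P.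
pose Pd' d := mmap (@mpolyC n R) (fun i => mabs d (u i)) P'.
pose E d := \sum_(h < q | (r <= h)%N) p h * Pd d ^+ (h - r).
pose E' d := \sum_(h < q | (r <= h)%N) p' h * Pd' d ^+ (h - r).
have hE d : maj v (E d) (E' d).
  apply: (maj_sum hv) => h _; apply: (majM hv) => //; apply: (majX hv).
  by apply: (maj_mmap hv) => // i; exact: maj_trunc.
have lowE d m : (I <= d)%N -> (mdeg m < I)%N -> (E d)@_m = 0.
  move=> Id mI; rewrite -(low m mI) -[LHS]/(ofp (E d) m).
  apply/esym; move: (leq_trans mI Id); rewrite raddf_sum; move: m {mI}; apply: agree_sum => h _.
  have E1 : ofp (p h * Pd d ^+ (h - r)) = ofp (p h) * ofp (Pd d) ^+ (h - r) by rewrite rmorphM rmorphXn.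
  rewrite -[X in agree _ _ X]/(ofp (p h * Pd d ^+ (h - r))) E1.
  by apply: agreeM => //; apply: agreeX; exact: agree_mmap.
have evE d : (E d).@[z] = \sum_(h < q | (r <= h)%N) (p h).@[z] * P.@[fun i => (trunc d (u i)).@[z]] ^+ (h - r).
  by rewrite raddf_sum /=; apply: eq_bigr => h _; rewrite mevalM mevalXn meval_mmapC.
have evE' d : (E' d).@[be] = \sum_(h < q | (r <= h)%N) (p' h).@[be] * P'.@[fun i => (mabs d (u i)).@[be]] ^+ (h - r).
  by rewrite raddf_sum /=; apply: eq_bigr => h _; rewrite mevalM mevalXn meval_mmapC.
have t0 : 0 <= t by case/andP: t01.
have meval_le k (Q : {mpoly R[k]}) (a b : 'I_k -> R) : (forall m, 0 <= Q@_m) -> (forall i, 0 <= a i <= b i) -> 0 <= Q.@[a] <= Q.@[b].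
  move=> Q0 ab; have a0 i : 0 <= a i by case/andP: (ab i).
  rewrite !mevalE sumr_ge0 /=; last first.
    by move=> m _; rewrite mulr_ge0 // prodr_ge0 // => i _; rewrite exprn_ge0.
  apply: ler_sum => m _; rewrite ler_wpM2l //; apply: ler_prod => i _.
  by rewrite exprn_ge0 //= ler_expn //; case/andP: (ab i).
have mabs0 i d : 0 <= (mabs d (u i)).@[be] <= Bd i.
  have b1 j : 0 <= be j <= be j by rewrite be0 lexx.
  rewrite hBd andbT; have := @meval_le _ (mabs d (u i)) be be (fun m => maj_coef_ge0 hv m (maj_trunc d (u i))) b1.
  by case/andP.
have lim : tends (fun d => (E d).@[z]) (p r).@[z].
  have -> : (p r).@[z] = \sum_(h < q | (r <= h)%N) (p h).@[z] * P.@[y] ^+ (h - r).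
    rewrite (bigD1 r) //= subnn expr0 mulr1 big1 ?addr0 // => h /andP[rh nh].
    by rewrite Py expr0n subn_eq0 leqNgt ltn_neqAle rh andbT eq_sym nh mulr0.
  move=> eps e0; have [|N hN] := @tends_sum _ (index_enum 'I_q) (fun h => (r <= h)%N)
    (fun h d => (p h).@[z] * P.@[fun i => (trunc d (u i)).@[z]] ^+ (h - r)) (fun h => (p h).@[z] * P.@[y] ^+ (h - r)) _ eps e0.
    move=> h _; apply: tendsM; first exact: tends_cst.
    by apply: tendsX; exact: tends_meval.
  by exists N => d /hN; rewrite evE.
apply: (tends_le lim); exists I => d Id.
apply: le_trans (maj_eval hv (hE d) (fun m => lowE d m Id) be0 t01 hz) _.
rewrite ler_wpM2l ?exprn_ge0 // evE'; apply: ler_sum => h _.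
have be2 j : 0 <= be j <= be j by rewrite be0 lexx.
have := @meval_le _ (p' h) be be (fun m => maj_coef_ge0 hv m (hp h)) be2; case/andP=> p0 _.
rewrite ler_wpM2l //.
have := @meval_le _ P' _ _ (fun m => maj_coef_ge0 hv m hP) (fun i => mabs0 i d).
by case/andP=> a b; apply: ler_expn.
Qed.
End Limit.

Section Growth.
Variables (R : realType) (C : fieldType) (v : C -> R).
Hypothesis hv : is_absolute_value v.
Variables (L : comNzRingType) (emb : {rmorphism L -> C}) (n N : nat).
Local Notation S := {mpoly L[N]}.

Lemma eval_growth (c : S) : exists2 B : R, 0 <= B & exists D : nat, forall (x : R) s, 1 <= x ->
  (forall j, v (s j) <= x) -> v (mmap emb s c) <= x ^+ D * B.
Proof.
elim/mpoly_ring_ind: c => [c|j|p q [B B0 [D hD]] [B' B0' [D' hD']]|p q [B B0 [D hD]] [B' B0' [D' hD']]].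
- by exists (v (emb c)); rewrite ?(abs_ge0 hv) //; exists 0%N => x s _ _; rewrite mmapC mul1r.
- by exists 1; rewrite ?ler01 //; exists 1%N => x s x1 hs; rewrite mmapX mmap1U mulr1 hs.
- exists (B + B'); rewrite ?addr_ge0 //; exists (maxn D D') => x s x1 hs; rewrite rmorphD mulrDr.
  apply: le_trans (absD hv _ _) _; apply: lerD.
    apply: le_trans (hD x s x1 hs) _; apply: ler_wpM2r => //; apply: ler_weXn2l => //; exact: leq_maxl.
  apply: le_trans (hD' x s x1 hs) _; apply: ler_wpM2r => //; apply: ler_weXn2l => //; exact: leq_maxr.
- exists (B * B'); rewrite ?mulr_ge0 //; exists (D + D')%N => x s x1 hs; rewrite rmorphM (absM hv) exprD mulrACA.
  by apply: ler_pM; rewrite ?(abs_ge0 hv) ?hD ?hD'.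
Qed.

Lemma maj_growth k (p : {mpoly S[k]}) : exists2 p' : {mpoly R[k]}, (forall m, 0 <= p'@_m) & exists D : nat,
  forall (x : R) s, 1 <= x -> (forall j, v (s j) <= x) ->
  maj v (map_mpoly (mmap emb s) p) (x ^+ D *: p').
Proof.
elim/mpoly_ring_ind: p => [c|j|p q [B B0 [D hD]] [B' B0' [D' hD']]|p q [B B0 [D hD]] [B' B0' [D' hD']]].
- have [B B0 [D hD]] := eval_growth c; exists B%:MP.
    by move=> m; rewrite mcoeffC; case: eqP; rewrite ?mulr1 ?mulr0.
  exists D => x s x1 hs m; rewrite map_mpolyC mcoeffZ !mcoeffC.
  by case: eqP => _; rewrite ?mulr1 ?hD // !mulr0 (abs0 hv).
- exists 'X_j; first by move=> m; rewrite mcoeffX ler0n.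
  exists 0%N => x s x1 hs m; rewrite scale1r map_mpolyX !mcoeffX.
  by case: eqP => _; rewrite ?(abs1 hv) ?(abs0 hv).
- exists (B + B'); first by move=> m; rewrite mcoeffD addr_ge0.
  exists (maxn D D') => x s x1 hs m; rewrite rmorphD mcoeffZ !mcoeffD mulrDr.
  apply: le_trans (absD hv _ _) _; apply: lerD.
    apply: le_trans (hD x s x1 hs m) _; rewrite mcoeffZ; apply: ler_wpM2r => //; apply: ler_weXn2l => //; exact: leq_maxl.
  apply: le_trans (hD' x s x1 hs m) _; rewrite mcoeffZ; apply: ler_wpM2r => //; apply: ler_weXn2l => //; exact: leq_maxr.
- exists (B * B'); first by move=> m; rewrite mcoeffM sumr_ge0 // => i _; rewrite mulr_ge0.
  exists (D + D')%N => x s x1 hs; rewrite rmorphM.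
  have -> : x ^+ (D + D') *: (B * B') = (x ^+ D *: B) * (x ^+ D' *: B').
    by rewrite exprD -scalerAl -scalerAr scalerA.
  by apply: majM; [exact: hv|exact: hD|exact: hD'].
Qed.

Lemma meval_ge0 k (p : {mpoly R[k]}) (x : 'I_k -> R) : (forall m, 0 <= p@_m) -> (forall i, 0 <= x i) -> 0 <= p.@[x].
Proof.
by move=> p0 x0; rewrite mevalE sumr_ge0 // => m _; rewrite mulr_ge0 // prodr_ge0 // => i _; rewrite exprn_ge0.
Qed.

Lemma degree_growth (c : S) (D : nat) : (forall m, (D < mdeg m)%N -> c@_m = 0) ->
  exists2 B : R, 0 <= B & forall (x : R) s, 1 <= x ->
  (forall j, v (s j) <= x) -> v (mmap emb s c) <= x ^+ D * B.
Proof.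
move=> hD; exists (\sum_(m <- msupp c) v (emb c@_m)).
  by apply: sumr_ge0 => m _; exact: (abs_ge0 hv).
move=> x s x1 hs; apply: le_trans (abs_sum hv _ _ _) _; rewrite mulr_sumr !big_seq; apply: ler_sum => m mc.
rewrite (absM hv) mulrC ler_wpM2r ?(abs_ge0 hv) //.
apply: le_trans (_ : x ^+ mdeg m <= _); last first.
  by rewrite ler_weXn2l // leqNgt; apply: contraL mc => /hD E; rewrite -mcoeff_eq0 E.
rewrite /mmap1 (abs_prod hv) mdegE expr_sum; apply: ler_prod => j _.
by rewrite (absX hv) exprn_ge0 ?(abs_ge0 hv) //= ler_expn ?(abs_ge0 hv).
Qed.

Lemma maj_degree k (p : {mpoly S[k]}) (D : nat) : (forall m m', (D < mdeg m')%N -> (p@_m)@_m' = 0) ->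
  exists2 p' : {mpoly R[k]}, (forall m, 0 <= p'@_m) &
  forall (x : R) s, 1 <= x -> (forall j, v (s j) <= x) ->
  maj v (map_mpoly (mmap emb s) p) (x ^+ D *: p').
Proof.
move=> hD; have /boolp.choice [B hB] : forall m, exists B : R, 0 <= B /\ forall (x : R) s, 1 <= x ->
  (forall j, v (s j) <= x) -> v (mmap emb s p@_m) <= x ^+ D * B.
  by move=> m; have [B B0 hB] := degree_growth (hD m); exists B.
have E m : (\sum_(m <- msupp p) B m *: 'X_[m] : {mpoly R[k]})@_m = if m \in msupp p then B m else 0.
  rewrite raddf_sum /=; case: ifP => mp.
    rewrite (bigD1_seq m) //= mcoeffZ mcoeffX eqxx mulr1 big1 ?addr0 // => m' /negbTE h.
    by rewrite mcoeffZ mcoeffX h mulr0.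
  rewrite big_seq big1 // => m' m'p; rewrite mcoeffZ mcoeffX.
  by case: eqP => [E|]; rewrite ?mulr0 //; rewrite -E m'p in mp.
exists (\sum_(m <- msupp p) B m *: 'X_[m]) => [m|x s x1 hs m].
  by rewrite E; case: ifP => // _; case: (hB m).
rewrite mcoeffZ E mcoeff_map_mpoly /=; case: ifP => mp; first by case: (hB m) => _; apply.
by move/negbT: mp; rewrite -mcoeff_eq0 => /eqP ->; rewrite rmorph0 (abs0 hv) mulr0.
Qed.

(** The order of the quantifiers matters: [D0] depends on [P] alone, which keeps the exponent of [x]
    linear in [q], while [B] may depend on everything but the point at which the combination is
    evaluated. *)
Lemma approx_bound M (P : {mpoly S[M]}) : exists D0 : nat,
  forall (u : 'I_M -> mps L n) (be : 'I_n -> R) (Bd : 'I_M -> R)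
    (q I D1 : nat) (r : 'I_q) (p : 'I_q -> {mpoly S[n]}),
  (forall h m m', (D1 < mdeg m')%N -> ((p h)@_m)@_m' = 0) ->
  (forall j, 0 <= be j) ->
  (forall i d, (mabs v d (mpsmap emb (u i))).@[be] <= Bd i) ->
  (forall m, (mdeg m < I)%N ->
     (\sum_(h < q | (r <= h)%N)
        ofp (p h) * mmap (@cst S n) (fun i => mpsmap (@mpolyC N L) (u i)) P ^+ (h - r)) m = 0) ->
  exists2 B : R, 0 <= B & forall z s (t x : R) y,
    0 <= t <= 1 -> 1 <= x -> (forall j, v (s j) <= x) -> (forall j, v (z j) <= t * be j) ->
    (forall i, tends v (fun d => (trunc d (mpsmap emb (u i))).@[z]) (y i)) ->
    mmap (mmap emb s) y P = 0 ->
    v (mmap (mmap emb s) z (p r)) <= x ^+ (D1 + q * D0) * B * t ^+ I.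
Proof.
have [P' P0' [D0 hP]] := maj_growth P; exists D0 => u be Bd q I D1 r p hD1 be0 hBd low.
have /boolp.choice [p' hp] : forall h, exists p' : {mpoly R[n]}, (forall m, 0 <= p'@_m) /\
  forall (x : R) s, 1 <= x -> (forall j, v (s j) <= x) -> maj v (map_mpoly (mmap emb s) (p h)) (x ^+ D1 *: p').
  by move=> h; have [p' h1 h2] := maj_degree (hD1 h); exists p'.
have hDh h := (hp h).2.
have p0' h m : 0 <= (p' h)@_m by case: (hp h).
have Bd0 i : 0 <= Bd i.
  by apply: le_trans (hBd i 0%N); apply: meval_ge0 => // m; apply: (maj_coef_ge0 hv); exact: maj_trunc.
have b0 h : 0 <= (p' h).@[be] * P'.@[Bd] ^+ (h - r) by rewrite mulr_ge0 ?exprn_ge0 ?meval_ge0.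
exists (\sum_(h < q | (r <= h)%N) (p' h).@[be] * P'.@[Bd] ^+ (h - r)); first exact: sumr_ge0.
move=> z s t x y t01 x1 hs hz hy Py.
have Emmap k (c : {mpoly S[k]}) w : mmap (mmap emb s) w c = (map_mpoly (mmap emb s) c).@[w].
  apply: (mpoly_rmorph_eq (f := mmap (mmap emb s) w) (g := meval w \o map_mpoly (mmap emb s))) => [a|j] /=.
    by rewrite mmapC map_mpolyC mevalC.
  by rewrite mmapX mmap1U map_mpolyX mevalXU.
have low' m : (mdeg m < I)%N ->
  (\sum_(h < q | (r <= h)%N) ofp (map_mpoly (mmap emb s) (p h)) *
    mmap (@cst C n) (fun i => mpsmap emb (u i)) (map_mpoly (mmap emb s) P) ^+ (h - r)) m = 0.
  move=> /low /(congr1 (mmap emb s)); rewrite rmorph0 => <-.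
  transitivity (mpsmap (mmap emb s) (\sum_(h < q | (r <= h)%N)
        ofp (p h) * mmap (@cst S n) (fun i => mpsmap (@mpolyC N L) (u i)) P ^+ (h - r)) m); last by [].
  congr (mpsf _ m); rewrite [RHS]rmorph_sum; apply: eq_bigr => h _.
  rewrite rmorphM rmorphXn /= mpsmap_ofp; congr (_ * _ ^+ _).
  apply: (mpoly_rmorph_eq
    (f := mmap (@cst C n) (fun i => mpsmap emb (u i)) \o map_mpoly (mmap emb s))
    (g := mpsmap (mmap emb s) \o mmap (@cst S n) (fun i => mpsmap (@mpolyC N L) (u i)))) => [c|j] /=.
    by rewrite map_mpolyC !mmapC /cst mpsmap_ofp map_mpolyC.
  by rewrite map_mpolyX !mmapX !mmap1U; apply: mpsP => m' /=; rewrite mmapC.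
have := limit_bound hv (hP x s x1 hs) (fun h => hDh h x s x1 hs) be0 t01 hz hBd hy _ low'.
rewrite -!Emmap => /(_ Py) le; apply: le_trans le _; rewrite mulrC ler_wpM2r //.
  by rewrite exprn_ge0 //; case/andP: t01.
rewrite mulr_sumr; apply: ler_sum => h _.
rewrite !mevalZ exprMn mulrACA ler_wpM2r // -exprM -exprD ler_weXn2l //.
rewrite leq_add2l mulnC leq_mul2r; apply/orP; right.
exact: leq_trans (leq_subr _ _) (ltnW (ltn_ord h)).
Qed.
End Growth.

(** * Unconditional sums and values of series *)

Section Sums.
Variables (R : realType) (C : fieldType) (v : C -> R).
Hypothesis hv : is_absolute_value v.

Definition usum (T : choiceType) (x : T -> C) (s : C) : Prop :=
  forall eps : R, 0 < eps -> exists J0 : {fset T}, forall J : {fset T}, (J0 `<=` J)%fset ->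
    v (\sum_(k <- J) x k - s) < eps.

(** Terms off the image of [phi] vanish, so a finite index set may be replaced by its preimage. *)
Lemma usum_reindex (T T' : choiceType) (phi : T' -> T) (x : T -> C) s : injective phi ->
  (forall h, (forall k, h <> phi k) -> x h = 0) -> usum (x \o phi) s -> usum x s.
Proof.
move=> phiI off hx eps e0; have [J0 hJ] := hx eps e0.
have /boolp.choice [psi hpsi] : forall h, exists o : option T', (forall k, o = Some k <-> h = phi k).
  move=> h; case: (boolp.EM (exists k, h = phi k)) => [[k Ek]|/boolp.forallNP no].
    by exists (Some k) => k'; split=> [[<-]//|]; rewrite Ek => /phiI ->.
  by exists None => k; split=> // /no.
have psiK : ocancel psi phi.
  by move=> h; case E : (psi h) => [k|] //=; apply/esym/hpsi.
exists (seq_fset tt (map phi J0)) => J sub.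
have -> : \sum_(k <- J) x k = \sum_(k <- seq_fset tt (pmap psi J)) (x \o phi) k.
  rewrite (perm_big _ (seq_fset_perm _ _)) undup_id; last by rewrite (pmap_uniq psiK).
  elim: (enum_fset J) => [|h l IH]; rewrite ?big_nil // big_cons IH /=.
  case E : (psi h) => [k|] /=; first by rewrite big_cons /=; congr (x _ + _); exact/hpsi.
  by rewrite off ?add0r // => k /hpsi; rewrite E.
apply: hJ; apply/fsubsetP => k kJ0; rewrite seq_fsetE mem_pmap; apply/mapP.
exists (phi k); last by apply/esym/hpsi.
by apply: (fsubsetP sub); rewrite seq_fsetE map_f.
Qed.

Lemma usumD (T : choiceType) (x y : T -> C) s t : usum x s -> usum y t -> usum (fun k => x k + y k) (s + t).
Proof.
move=> hx hy eps e0; have e2 : 0 < eps / 2 by rewrite divr_gt0.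
have [J hJ] := hx _ e2; have [J' hJ'] := hy _ e2; exists (J `|` J')%fset => K.
rewrite fsubUset => /andP[k1 k2]; rewrite big_split /= opprD addrACA.
apply: le_lt_trans (absD hv _ _) _; rewrite [eps]splitr.
by apply: ltrD; [exact: hJ|exact: hJ'].
Qed.

Lemma usum0 (T : choiceType) : usum (fun _ : T => 0) 0.
Proof. by move=> eps e0; exists fset0 => J _; rewrite big1 // subrr (abs0 hv). Qed.

Lemma usumZ (T : choiceType) c (x : T -> C) s : usum x s -> usum (fun k => c * x k) (c * s).
Proof.
move=> hx eps e0; have [->|c0] := eqVneq c 0.
  exists fset0 => J _; rewrite big1 => [|k _]; last by rewrite mul0r.
  by rewrite mul0r subrr (abs0 hv).
have vc : 0 < v c by rewrite (abs_gt0 hv).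
have [|J hJ] := hx (eps / v c); first by rewrite divr_gt0.
by exists J => K /hJ lt; rewrite -mulr_sumr -mulrBr (absM hv) mulrC -ltr_pdivlMr.
Qed.

Lemma usum_uniq (T : choiceType) (x : T -> C) s t : usum x s -> usum x t -> s = t.
Proof.
move=> hs ht; apply/eqP; rewrite -subr_eq0 -(abs_eq0 hv) eq_le (abs_ge0 hv) andbT leNgt; apply/negP => lt.
have e2 : 0 < v (s - t) / 2 by rewrite divr_gt0.
have [J hJ] := hs _ e2; have [J' hJ'] := ht _ e2.
have := hJ (J `|` J')%fset (fsubsetUl _ _); have := hJ' (J `|` J')%fset (fsubsetUr _ _).
move: (\sum_(k <- _) _) => z a b; have := absB hv (z - t) (z - s).
have -> : z - t - (z - s) = s - t by ring.
by lra.
Qed.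

(** Adding one index to a large enough finite set changes the partial sum by less than 2. *)
Lemma usum_bounded (T : choiceType) (x : T -> C) s : usum x s -> exists B : R, forall k, v (x k) <= B.
Proof.
move=> hx; have [J hJ] := hx 1 ltr01.
exists (2 + \sum_(k <- J) v (x k)) => k.
have s0 : 0 <= \sum_(k <- J) v (x k) by apply: sumr_ge0 => i _; exact: (abs_ge0 hv).
case kJ : (k \in J).
  rewrite (big_fsetD1 k) //= addrCA lerDl addr_ge0 //.
  by apply: sumr_ge0 => i _; exact: (abs_ge0 hv).
have kJ' : k \notin J by rewrite kJ.
have := hJ (k |` J)%fset (fsubsetUr _ _); have := hJ J (fsubset_refl _).
rewrite big_fsetU1 //=; move: (\sum_(_ <- _) x _) => z a b.
have := absB hv (x k + z - s) (z - s).
have -> : x k + z - s - (z - s) = x k by ring.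
by lra.
Qed.
End Sums.

Section SeriesSum.
Variables (R : realType) (C : fieldType) (v : C -> R).
Hypothesis hv : is_absolute_value v.
Variable n : nat.
Implicit Types (u w : mps C n) (z : 'I_n -> C).

Lemma mmap1D z (a b : 'X_{1..n}) : mmap1 z (a + b)%MM = mmap1 z a * mmap1 z b :> C.
Proof. by rewrite /mmap1 -big_split /=; apply: eq_bigr => i _; rewrite mnmDE exprD. Qed.

Lemma mps_sumD u w z s t : mps_sum v u z s -> mps_sum v w z t -> mps_sum v (u + w) z (s + t).
Proof.
move=> /usumD h /h{}h eps /(h hv)[J hJ]; exists J => K /hJ.
by rewrite (eq_bigr (fun k => (u + w) k * (\prod_(j < n) z j ^+ k j))) // => k _; rewrite -mulrDl.
Qed.

Lemma mps_sumMX u z s (a : 'X_{1..n}) : mps_sum v u z s -> mps_sum v (ofp 'X_[a] * u) z (mmap1 z a * s).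
Proof.
move=> h.
have low (m : 'X_{1..n}) : (forall k, m <> (a + k)%MM) -> (ofp 'X_[a] * u) m = 0.
  move=> no; rewrite mpsM big1 // => x /eqP E /=; rewrite mcoeffX.
  by case: eqP => [Ea|]; rewrite ?mul0r //; case: (no x.2); apply: etrans E _; rewrite Ea.
have shift k : (ofp 'X_[a] * u) (a + k)%MM = u k.
  set d := (mdeg (a + k)).+1.
  rewrite (mpsM_trunc (d := d)) //.
  have Ek : u k = (trunc d u)@_k by rewrite truncE // ltnS mdegD leq_addl.
  have Ex : trunc d u * 'X_[a] = 'X_[a] * trunc d u by rewrite mulrC.
  rewrite Ek -(mcoeffMX _ a k) Ex; apply: eqdM (fun _ _ => erefl) _ (ltnSn _) => m hm.
  by rewrite truncE.
apply: (@usum_reindex _ _ _ _ _ (fun k => (a + k)%MM)); first by move=> x y /addmI.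
  by move=> m /low ->; rewrite mul0r.
move=> eps /(usumZ hv (mmap1 z a) h)[J hJ]; exists J => K /hJ.
set lhs := \sum_(_ <- _) _ => hlt; set rhs := \sum_(_ <- _) _; suff -> : rhs = lhs by [].
apply: eq_bigr => k _.
change ((ofp 'X_[a] * u) (a + k)%MM * mmap1 z (a + k)%MM = mmap1 z a * (u k * mmap1 z k)).
by rewrite shift mmap1D mulrCA.
Qed.

Lemma mps_sum0 z : mps_sum v (0 : mps C n) z 0.
Proof. by move=> eps /(usum0 hv 'X_{1..n})[J hJ]; exists J => K /hJ; rewrite !big1 // => k _; rewrite mul0r. Qed.

Lemma mps_sumZ c u z s : mps_sum v u z s -> mps_sum v (cst n c * u) z (c * s).
Proof.
move=> h eps /(usumZ hv c h)[J hJ]; exists J => K /hJ.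
set lhs := \sum_(_ <- _) _ => hlt; set rhs := \sum_(_ <- _) _; suff -> : rhs = lhs by [].
by apply: eq_bigr => k _; rewrite ofpCM mulrA.
Qed.

Lemma mps_sum_sum (I : Type) (r : seq I) (P : pred I) (F : I -> mps C n) (s : I -> C) z :
  (forall i, P i -> mps_sum v (F i) z (s i)) ->
  mps_sum v (\sum_(i <- r | P i) F i) z (\sum_(i <- r | P i) s i).
Proof.
move=> h; elim/big_rec2: _ => [|i x y Pi hxy]; first exact: mps_sum0.
by apply: mps_sumD hxy; exact: h.
Qed.

Lemma mps_sum_ofpM p u z s : mps_sum v u z s -> mps_sum v (ofp p * u) z (p.@[z] * s).
Proof.
move=> h; have -> : ofp p * u = \sum_(m <- msupp p) cst n p@_m * (ofp 'X_[m] * u).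
  rewrite {1}[p]mpolyE rmorph_sum mulr_suml; apply: eq_bigr => m _.
  by rewrite -mul_mpolyC rmorphM mulrA.
have -> : p.@[z] * s = \sum_(m <- msupp p) p@_m * (mmap1 z m * s).
  by rewrite mevalE mulr_suml; apply: eq_bigr => m _; rewrite mulrA.
by apply: mps_sum_sum => m _; apply: mps_sumZ; exact: mps_sumMX.
Qed.

Lemma mps_sum1 z : mps_sum v (1 : mps C n) z 1.
Proof.
move=> eps e0; exists [fset 0%MM]%fset => J; rewrite fsub1set => h0.
have E0 : mmap1 z 0%MM = 1 by rewrite /mmap1 big1 // => i _; rewrite mnm0E expr0.
suff -> : \sum_(k <- J) (1 : mps C n) k * (\prod_(j < n) z j ^+ k j) = 1 by rewrite subrr (abs0 hv).
rewrite (big_fsetD1 0%MM) //= -/(mmap1 z 0%MM) E0 eqxx mul1r [X in 1 + X]big1_seq ?addr0 // => k.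
by rewrite !inE => /andP[_ /andP[/negbTE -> _]]; rewrite mul0r.
Qed.

Lemma mps_sum_uniq u z s t : mps_sum v u z s -> mps_sum v u z t -> s = t.
Proof. exact: usum_uniq. Qed.

(** Both multiple series have the same terms, at [k] for one and at [act k] for the other, and zeros
    elsewhere. *)
Lemma mps_sum_sub (act : expoMap n) u z (w : 'I_n -> C) s :
  (forall k, mmap1 z (act k) = mmap1 w k) -> mps_sum v u w s -> mps_sum v (sub act u) z s.
Proof.
move=> E h; apply: (@usum_reindex _ _ _ _ _ act); first by case: (expoMapP act).
  by move=> m hm; rewrite sub_coef0 ?mul0r // => k Ek; apply: (hm k).
move=> eps /h[J hJ]; exists J => K /hJ.
set lhs := \sum_(_ <- _) _ => hlt; set rhs := \sum_(_ <- _) _; suff -> : rhs = lhs by [].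
apply: eq_bigr => k _; change (sub act u (act k) * mmap1 z (act k) = u k * mmap1 w k).
by rewrite sub_coef E.
Qed.

(** The exponents of degree below [d] eventually contain any given finite set. *)
Lemma mps_sum_tends u z s : mps_sum v u z s -> tends v (fun d => (trunc d u).@[z]) s.
Proof.
move=> h eps /h[J0 hJ]; exists (\max_(k <- J0) (mdeg k).+1)%N => d hd.
pose J := seq_fset tt [seq bmnm m | m <- enum [set: 'X_{1..n < d}]].
have -> : (trunc d u).@[z] = \sum_(k <- J) u k * (\prod_(j < n) z j ^+ k j).
  rewrite (perm_big _ (seq_fset_perm _ _)) undup_id; last by rewrite map_inj_uniq ?enum_uniq //; exact: val_inj.
  rewrite big_map big_enum /= raddf_sum; apply: eq_big => [m|m _ /=]; first by rewrite inE.
  by rewrite mevalZ mevalX.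
apply: hJ; apply/fsubsetP => k kJ; rewrite seq_fsetE; apply/mapP.
have kd : (mdeg k < d)%N by apply: leq_trans hd; rewrite (big_fsetD1 k) //= leq_maxl.
by exists (BMultinom kd); rewrite ?mem_enum ?inE.
Qed.

(** Exponents of degree below [d] embed in a product of [n] intervals, so the sum is at most the
    [n]-th power of a geometric sum. *)
Lemma geom_mnm (d : nat) : \sum_(m : 'X_{1..n < d}) (2^-1 : R) ^+ mdeg m <= 2 ^+ n.
Proof.
have geom : \sum_(i < d) (2^-1 : R) ^+ i <= 2.
  suff -> : \sum_(i < d) (2^-1 : R) ^+ i = 2 - 2 * 2^-1 ^+ d.
    by rewrite gerBl mulr_ge0 // exprn_ge0 // invr_ge0.
  elim: d => [|d IH]; first by rewrite big_ord0 expr0 mulr1 subrr.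
  by rewrite big_ord_recr /= IH exprS; field.
apply: le_trans (_ : \prod_(j < n) \sum_(i < d) (2^-1 : R) ^+ i <= _); last first.
  have -> : 2 ^+ n = \prod_(j < n) (2 : R) by rewrite prodr_const card_ord.
  apply: ler_prod => j _; rewrite geom andbT.
  by apply: sumr_ge0 => i _; rewrite exprn_ge0 // invr_ge0.
have md (m : 'X_{1..n < d}) j : (m j < d)%N.
  by apply: leq_ltn_trans (bmdeg m); rewrite mdegE (bigD1 j) //= leq_addr.
rewrite bigA_distr_bigA /=; pose e (m : 'X_{1..n < d}) : {ffun 'I_n -> 'I_d} := [ffun j => Ordinal (md m j)].
have eI : injective e.
  move=> a b /ffunP E; apply: val_inj; apply/mnmP => j.
  by have := congr1 val (E j); rewrite !ffunE.
rewrite [X in _ <= X](bigID (mem [set e m | m in setT])) /=.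
rewrite big_imset /=; last by move=> ? ? _ _; exact: eI.
rewrite [X in X + _](_ : _ = \sum_(m : 'X_{1..n < d}) 2^-1 ^+ mdeg m).
  by rewrite lerDl sumr_ge0 // => i _; apply: prodr_ge0 => j _; rewrite exprn_ge0 // invr_ge0.
apply: eq_big => [m|m _]; first by rewrite inE.
by rewrite mdegE expr_sum; apply: eq_bigr => j _; rewrite ffunE.
Qed.

(** The terms of a convergent series are bounded; at half the radii they are dominated by the sum in
    [geom_mnm], which gives absolute convergence there. *)
Lemma mabs_bound u z s : mps_sum v u z s ->
  exists B, forall d, (mabs v d u).@[fun j => v (z j) / 2] <= B.
Proof.
move=> /(usum_bounded hv)[B hB]; exists (B * 2 ^+ n) => d.
have B0 : 0 <= B by apply: le_trans (hB 0%MM); exact: (abs_ge0 hv).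
apply: le_trans (_ : B * \sum_(m : 'X_{1..n < d}) (2^-1 : R) ^+ mdeg m <= _); last by rewrite ler_wpM2l // geom_mnm.
rewrite raddf_sum mulr_sumr /=; apply: ler_sum => m _.
rewrite mevalZ mevalX (_ : \prod_i _ = (\prod_i v (z i) ^+ (bmnm m) i) * 2^-1 ^+ mdeg m).
  rewrite mulrA ler_wpM2r ?exprn_ge0 ?invr_ge0 //.
  apply: le_trans (hB m); rewrite (absM hv) (abs_prod hv) ler_wpM2l ?(abs_ge0 hv) //.
  by rewrite le_eqVlt; apply/orP; left; apply/eqP; apply: eq_bigr => i _; rewrite (absX hv).
by rewrite mdegE expr_sum -big_split /=; apply: eq_bigr => i _; rewrite exprMn.
Qed.
End SeriesSum.

(** * Finitely many denominators, independent numbers, one number field, powers of a Jordan cell *)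

Section Noether.
Variables (K : fieldType) (n : nat) (D : {mpoly K[n]} -> Prop).
Hypothesis D_red : forall p q c m, D p -> D q -> D (p - c *: ('X_[m] * q)).

(** If this failed, there would be an infinite sequence whose members, chosen with least leading
    monomial, are each nonzero at some common zero of the preceding ones. By Dickson's lemma a
    leading monomial divides a later one, and reducing the later polynomial keeps its value at that
    zero but lowers its leading monomial. *)
Lemma finite_nonvanishing : exists s : seq {mpoly K[n]}, (forall q, q \in s -> D q) /\
  forall z q, D q -> q.@[z] != 0 -> exists2 q', q' \in s & q'.@[z] != 0.
Proof.
apply: boolp.contrapT => /boolp.forallNP no.
pose bad (s : seq {mpoly K[n]}) q := D q /\ exists z, q.@[z] != 0 /\ forall q', q' \in s -> q'.@[z] = 0.
have ex s : (forall q, q \in s -> D q) -> exists q, bad s q /\ forall q', bad s q' -> (mlead q <= mlead q')%O.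
  move=> hs; have [q0 b0] : exists q, bad s q.
    apply: boolp.contrapT => /boolp.forallNP nb; apply: (no s); split=> // z q Dq qz.
    apply: boolp.contrapT => h; apply: (nb q); split=> //; exists z; split=> // q' qs.
    by apply/eqP/negPn/negP => nz; apply: h; exists q'.
  suff: forall x : 'X_{1..n}, forall q, mlead q = x -> bad s q -> exists q, bad s q /\ forall q', bad s q' -> (mlead q <= mlead q')%O.
    by move=> /(_ _ q0 erefl b0).
  apply: (well_founded_ind (@ltom_wf n)) => x IH q Ex bq.
  case: (boolp.EM (exists q', bad s q' /\ (mlead q' < mlead q)%O)) => [[q' [b' lt]]|/boolp.forallNP h].
    by apply: (IH (mlead q')) b' => //; rewrite -Ex.
  by exists q; split=> // q' b'; rewrite leNgt; apply/negP => lt; apply: (h q').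
have /boolp.choice [nx hnx] : forall s, exists q, (forall q, q \in s -> D q) ->
    bad s q /\ forall q', bad s q' -> (mlead q <= mlead q')%O.
  move=> s; case: (boolp.EM (forall q, q \in s -> D q)) => [/ex[q hq]|h]; last by exists 0.
  by exists q.
pose L := fix L j := if j is j'.+1 then nx (L j') :: L j' else [::].
have DL j q : q \in L j -> D q.
  elim: j q => //= j IH q; rewrite inE => /orP[/eqP ->|/IH //].
  by case: (hnx (L j) IH) => -[].
pose Q j := nx (L j).
have QL i j : (i < j)%N -> Q i \in L j.
  elim: j => // j IH; rewrite ltnS leq_eqVlt => /orP[/eqP ->|/IH h]; first by rewrite /= mem_head.
  by rewrite /= inE h orbT.
have [i [j [ij le]]] := @dickson n (fun j x => mlead (Q j) x).
have [[DQj [z [Qz Lz]]] minj] := hnx (L j) (DL j).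
have [[DQi [zi [Qzi _]]] _] := hnx (L i) (DL i).
have Qj0 : Q j != 0 by apply: contraNneq Qz => Z; rewrite -/(Q j) Z meval0.
have Qi0 : Q i != 0 by apply: contraNneq Qzi => Z; rewrite -/(Q i) Z meval0.
pose m := (mlead (Q j) - mlead (Q i))%MM.
have Em : (m + mlead (Q i))%MM = mlead (Q j) by rewrite submK //; apply/mnm_lepP.
pose c := mleadc (Q j) / mleadc (Q i).
pose q := Q j - c *: ('X_[m] * Q i).
have qz : q.@[z] != 0 by rewrite mevalB mevalZ mevalM (Lz _ (QL _ _ ij)) !mulr0 subr0.
have q0 : q != 0 by apply: contraNneq qz => ->; rewrite meval0.
have lq : (mlead q < mlead (Q j))%O.
  rewrite lt_neqAle; apply/andP; split.
    have Ec : ('X_[m] * Q i)@_(mlead (Q j)) = mleadc (Q i) by rewrite -Em mulrC mcoeffMX.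
    apply: contraNneq q0 => E; rewrite -mleadc_eq0 E /q mcoeffB mcoeffZ Ec /c.
    by rewrite divfK ?subrr ?mleadc_eq0.
  apply: le_trans (mleadB_le _ _) _; rewrite leEjoin -leEjoin.
  rewrite ge_max lexx /=; apply: le_trans (mleadZ_le _ _) _.
  apply: le_trans (mleadM_le _ _) _; by rewrite mleadXm Em.
have : (mlead (Q j) <= mlead q)%O.
  by apply: minj; split; [exact: D_red|exists z; split].
by rewrite leNgt lq.
Qed.
End Noether.

(** If [x] depends on [t], replace the members of [t] by roots whose order is the exponent of [x] in
    the relation: then [x] is a monomial in them up to a root of unity. The exponent [T] absorbs
    these roots of unity. *)
Lemma mult_indep_basis (s : seq algC) : (forall x, x \in s -> x != 0) ->
  exists t : seq algC, [/\ forall x, x \in t -> x != 0,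
    forall D : nat -> int, \prod_(j < size t) t`_j ^ D j = 1 -> forall j, (j < size t)%N -> D j = 0
    & exists2 T : nat, (0 < T)%N & forall x, x \in s -> exists D : nat -> int,
        x ^+ T = (\prod_(j < size t) t`_j ^ D j) ^+ T].
Proof.
elim: s => [|x s IH] hs.
  by exists [::]; split=> //; exists 1%N.
have [|t [t0 ti [T T0 hT]]] := IH; first by move=> y ys; apply: hs; rewrite inE ys orbT.
have x0 : x != 0 by apply: hs; rewrite mem_head.
case: (boolp.EM (forall D : nat -> int, \prod_(j < (size t).+1) (x :: t)`_j ^ D j = 1 ->
    forall j, (j < (size t).+1)%N -> D j = 0)) => [ti'|/boolp.existsNP [D /boolp.not_implyP [ED nD]]].
  exists (x :: t); split=> //.
    by move=> y; rewrite inE => /orP[/eqP ->|/t0].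
  exists T => // y; rewrite inE => /orP[/eqP ->|/hT [D ED]].
    exists (fun j => if j is 0%N then 1 else 0); rewrite big_ord_recl /= expr1z big1 ?mulr1 //.
  exists (fun j => if j is j'.+1 then D j' else 0); rewrite big_ord_recl ED /= expr0z mul1r //.
rewrite big_ord_recl /= in ED.
have D0 : D 0%N != 0.
  apply/negP => /eqP Z; apply: nD; rewrite Z expr0z mul1r in ED.
  by have hD := ti (fun j => D j.+1) ED; case=> [//|j] /hD.
pose K := `|D 0%N|%N; have K0 : (0 < K)%N by rewrite absz_gt0.
pose rt y := K.-root (y : algC); have rtK y : rt y ^+ K = y by rewrite rootCK.
pose t' := map rt t; have st' : size t' = size t by rewrite size_map.
have t'E (j : nat) : (j < size t)%N -> t'`_j ^+ K = t`_j by move=> jt; rewrite (nth_map 0) // rtK.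
have t'0 y : y \in t' -> y != 0.
  by move=> /mapP[z zt ->]; apply: contraTneq (t0 z zt) => Z; rewrite -(rtK z) Z expr0n gtn_eqF // eqxx.
have EK (E : nat -> int) : \prod_(j < size t) t`_j ^ E j = (\prod_(j < size t') t'`_j ^ E j) ^+ K.
  rewrite st' -prodrXl; apply: eq_bigr => j _.
  by rewrite -(t'E j) // exprnP exprnP !exprz_exp mulrC.
have EK' (E : nat -> int) (k : int) : \prod_(j < size t') t'`_j ^ (E j * k) = (\prod_(j < size t') t'`_j ^ E j) ^ k.
  elim/big_rec2: _ => [|j u z _ ->]; first by rewrite exp1rz.
  by rewrite expfzMl -exprz_exp.
exists t'; split=> //.
  by move=> E EE; rewrite st'; apply: ti; rewrite EK EE expr1n.
exists (T * K)%N; first by rewrite muln_gt0 T0.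
move=> y; rewrite inE => /orP[/eqP ->|/hT [E EE]].
  exists (fun j => D j.+1 * - sgz (D 0%N)); rewrite (EK' (fun j => D j.+1) (- sgz (D 0%N))) mulnC !exprM; congr (_ ^+ T).
  rewrite (EK (fun j => D j.+1)) in ED; set P := \prod_(j < size t') _ in ED *.
  move: ED; rewrite -/K /K; case: (D 0%N) D0 => k nk /=.
    rewrite gtr0_sgz ?ltz_nat ?lt0n // exprN1 exprVn => ED.
    have Pk0 : P ^+ k != 0 by apply: contra_eq_neq ED => ->; rewrite mulr0 eq_sym oner_eq0.
    by apply: (mulIf Pk0); rewrite mulVf.
  rewrite NegzE -exprnN => ED; have xk0 : x ^+ k.+1 != 0 by rewrite expf_neq0.
  rewrite ltr0_sgz // opprK expr1z; have := congr1 (fun a => x ^+ k.+1 * a) ED.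
  by rewrite mulr1 mulVKf // => <-.
exists (fun j => E j * K%:Z); rewrite (EK' E K%:Z) -exprnP [in LHS]exprM [in RHS]mulnC [in RHS]exprM.
by rewrite EE EK exprAC.
Qed.

(** For a prime, [v k%:R] is the inverse of the largest power of [p] dividing [k], and this power is
    at most [k]. *)
Lemma Cp_abs (R : realType) (p : place) (C : fieldType) (v : C -> R) : is_Cp p v ->
  is_absolute_value v /\ forall k : nat, (0 < k)%N -> 1 <= k%:R * v k%:R.
Proof.
case: p => [[phi [bij hv]]|p pp [Qp [vQ [jQ [L [vL [jL [jC [cQ _ _ hL cL]]]]]]]]].
  have vE x : v x = ComplexField.Normc.normc (phi x) by [].
  split; last first.
    move=> k k0; rewrite hv rmorph_nat.
    have -> : ComplexField.Normc.normc (k%:R : R[i]) = k%:R.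
      rewrite -[k%:R in LHS](rmorph_nat (@real_complex R)) /= expr0n addr0 sqrtr_sqr.
      by rewrite normr_nat.
    by rewrite -natrM ler1n muln_gt0 k0.
  split=> [x|x|x y|x y]; rewrite !hv.
  - by case: (phi x) => a b /=; exact: sqrtr_ge0.
  - split=> [/ComplexField.Normc.eq0_normc /eqP|->]; last by rewrite rmorph0 ComplexField.Normc.normc0.
    by rewrite fmorph_eq0 => /eqP.
  - by rewrite rmorphM ComplexField.Normc.normcM.
  - by rewrite rmorphD le_normcD.
case: cL => hv vC _ _; case: cQ => _ vQE _ _.
split=> // k k0.
have -> : v k%:R = padic_abs R p k%:R.
  by rewrite -(rmorph_nat jC) vC -(rmorph_nat jL) hL -(rmorph_nat jQ) vQE.
rewrite /padic_abs pnatr_eq0 eqn0Ngt k0 /= -[k%:R : rat]/((k%:Z)%:~R).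
rewrite denq_int numq_int /= logn1 expr0 mul1r ler_pdivlMr ?mul1r; last by rewrite exprn_gt0 // ltr0n prime_gt0.
by rewrite -natrX ler_nat; apply: dvdn_leq => //; exact: pfactor_dvdnn.
Qed.

Lemma common_denominator (I : finType) (c : I -> rat) :
  exists2 d : nat, (0 < d)%N & forall i, exists z : int, d%:R * c i = z%:~R.
Proof.
exists (\prod_i `|denq (c i)|)%N; first by rewrite prodn_gt0 // => i; rewrite absz_gt0 denq_neq0.
move=> i; rewrite (bigD1 i) //=; set r := (\prod_(j | _) _)%N.
have E : (`|denq (c i)|%N%:R : rat) = (denq (c i))%:~R by rewrite -[in RHS]absz_denq.
exists (r%:Z * numq (c i)); transitivity (r%:R * (c i * (denq (c i))%:~R)).
  by rewrite natrM E; ring.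
by rewrite -numqE intrM.
Qed.

(** Heights come from the multiplication matrices in a basis of [Q] over the rationals, with
    denominators cleared. The image of [kappa] is included for the sake of the coefficients of the
    series. *)
Lemma number_field (K : fieldExtType rat) (kappa : {rmorphism K -> algC}) (s : seq algC) :
  exists (Q : fieldExtType rat) (h : {rmorphism Q -> algC}) (D : nat) (w : 'cV[algC]_D.+1),
  [/\ forall x, x \in s -> exists y, h y = x,
      forall x, exists y, h y = kappa x,
      forall z : 'rV[int]_D.+1, map_mx intr z *m w = 0 -> z = 0
    & forall (R : realType) (I : finType) (x : I -> Q), exists H : R, height_le w (h \o x) H].
Proof.
pose bs := vbasis (fullv : {vspace K}).
have [Q [h [s1 Es1 _]]] := num_field_exists (s ++ map kappa bs).
have lift x : x \in s ++ map kappa bs -> exists y, h y = x.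
  by rewrite -Es1 => /mapP[y _ ->]; exists y.
have [D ED] : exists D, \dim (fullv : {vspace Q}) = D.+1.
  by case E : (\dim _) (adim_gt0 (fullv : {aspace Q})) => [|D] // _; exists D.
move: (vbasisP (fullv : {vspace Q})); move: (vbasis _); rewrite ED => X bX.
have fX := basis_free bX.
have cX (x : Q) : x = \sum_i coord X i x *: X`_i.
  by rewrite -coord_span // (span_basis bX) memvf.
exists Q, h, D, (\col_i h X`_i); split=> [x xs|x|z Ez|R I x].
- by apply: lift; rewrite mem_cat xs.
- have /boolp.choice [y hy] : forall i : 'I_(\dim (fullv : {vspace K})), exists y, h y = kappa bs`_i.
    by move=> i; apply: lift; rewrite mem_cat map_f ?orbT // mem_nth // size_tuple.
  exists (\sum_i coord bs i x *: y i).
  rewrite {2}(coord_vbasis (memvf x)) !rmorph_sum; apply: eq_bigr => i _.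
  by rewrite !rmorphZ_num hy.
- apply/rowP => i; rewrite mxE.
  have := congr1 (fun M : 'M[algC]_(1,1) => M 0 0) Ez; rewrite !mxE => E.
  have E2 : \sum_i (z 0 i)%:~R *: X`_i = 0 :> Q.
    apply: (fmorph_inj h); rewrite rmorph0 rmorph_sum -[RHS]E; apply: eq_bigr => j _.
    by rewrite rmorphZ_num !mxE ratr_int.
  have := freeP fX _ E2 i => /eqP; by rewrite intr_eq0 => /eqP.
pose c (u : I * ('I_D.+1 * 'I_D.+1)) := coord X u.2.2 (x u.1 * X`_(u.2.1)).
have [d d0 /boolp.choice [Z hZ]] := common_denominator c.
exists (d%:R + \sum_u `|(Z u)%:~R|); exists d; split=> //.
  by rewrite lerDl sumr_ge0.
move=> i; exists (\matrix_(j, k) Z (i, (j, k))); split; last first.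
  move=> j k; rewrite mxE (bigD1 (i, (j, k))) //= addrCA lerDl addr_ge0 ?ler0n //.
  exact: sumr_ge0.
apply/colP => j; rewrite !mxE.
have -> : d%:R * (h \o x) i * h X`_j = h (d%:R * (x i * X`_j)) by rewrite !rmorphM rmorph_nat mulrA.
rewrite (cX (x i * X`_j)) mulr_sumr rmorph_sum; apply: eq_bigr => k _.
rewrite !mxE -ratr_int -hZ /c /= -rmorphZ_num -scalerA; congr (h _).
by rewrite scaler_nat mulr_natl.
Qed.

Section Homogenise.
Variables (K0 B : comNzRingType) (phi : {rmorphism K0 -> B}) (M : nat) (tau : {mpoly K0[M]}).
Variables (num den : 'I_M -> B).

(** [tau] evaluated at the quotients of [num i] by [den i], times [den i ^+ msize tau] for every
    [i]. *)
Definition cleared : B :=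
  \sum_(m <- msupp tau) phi tau@_m * \prod_i (num i ^+ m i * den i ^+ (msize tau - m i)).

Lemma clearedE (C : comNzRingType) (h : {rmorphism B -> C}) (x : 'I_M -> C) :
  (forall i, h (num i) = h (den i) * x i) ->
  h cleared = \prod_i h (den i) ^+ msize tau * mmap (h \o phi) x tau.
Proof.
move=> hx; rewrite rmorph_sum /mmap mulr_sumr; apply: eq_big_seq => m mt.
rewrite rmorphM mulrCA; congr (_ * _); rewrite rmorph_prod /mmap1 -big_split /=.
apply: eq_bigr => i _; rewrite rmorphM !rmorphXn hx exprMn mulrAC -exprD subnKC //.
by apply: leq_trans (ltnW (msize_mdeg_lt mt)); rewrite mdegE (bigD1 i) //= leq_addr.
Qed.
End Homogenise.

(** The binomial coefficient as a polynomial in the iteration count, through which the powers of a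
    unipotent matrix depend polynomially on that count. *)
Definition binom_pol (K : fieldType) N (x : {mpoly K[N]}) j : {mpoly K[N]} :=
  (j`!%:R^-1)%:MP * \prod_(i < j) (x - i%:R).

Lemma binom_polE (K : fieldType) N (x : {mpoly K[N]}) j (C : comNzRingType) (h : {rmorphism {mpoly K[N]} -> C}) k :
  j`!%:R != 0 :> K -> h x = k%:R -> h (binom_pol x j) = 'C(k, j)%:R.
Proof.
move=> j0 hx; rewrite rmorphM rmorph_prod /=.
have -> : \prod_(i < j) h (x - i%:R) = (k ^_ j)%:R :> C.
  rewrite ffact_prod natr_prod; case: (leqP j k) => [jk|kj].
    by apply: eq_bigr => i _; rewrite rmorphB hx rmorph_nat natrB //; apply: leq_trans (ltnW (ltn_ord i)) jk.
  rewrite (bigD1 (Ordinal kj)) //= rmorphB hx rmorph_nat subrr mul0r.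
  by rewrite (bigD1 (Ordinal kj)) //= subnn mul0r.
rewrite -bin_ffact natrM mulrCA -[in X in _ * X](rmorph_nat h) -rmorphM.
by rewrite -(rmorph_nat (@mpolyC N K)) -mpolyCM mulVf // mpolyC1 rmorph1 mulr1.
Qed.

Section Unipotent.
Variables (K : fieldType) (d : nat) (A : 'M[K]_d.+1) (a : K).
Hypothesis A_trig : forall s t : 'I_d.+1, (s < t)%N -> A s t = 0.
Hypothesis A_diag : forall s, A s s = a.
Hypothesis a0 : a != 0.

Definition nilpart := a^-1 *: A - 1.

Lemma nilpart_pow j (s t : 'I_d.+1) : (s < t + j)%N -> (nilpart ^+ j) s t = 0.
Proof.
elim: j s => [|j IH] s st; first by rewrite addn0 in st; rewrite expr0 mxE; case: eqP st => // ->; rewrite ltnn.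
rewrite exprS mxE big1 // => u _; case: (ltnP u (t + j)) => [/IH ->|le]; first by rewrite mulr0.
have su : (s <= u)%N by rewrite addnS ltnS in st; exact: leq_trans st le.
rewrite !mxE; case: (ltngtP s u) => [lt|gt|/val_inj ->].
- rewrite A_trig // mulr0; have -> : (s == u) = false by apply: contraTF lt => /eqP ->; rewrite ltnn.
  by rewrite subr0 mul0r.
- by rewrite leqNgt gt in su.
by rewrite A_diag mulVf // eqxx subrr mul0r.
Qed.

(** Binomial expansion around the scalar part; the length of the sum does not depend on [k] because
    [nilpart] is strictly lower triangular. *)
Lemma unip_pow k : A ^+ k = a ^+ k *: \sum_(j < d.+1) 'C(k, j)%:R *: nilpart ^+ j.
Proof.
have EA : A = a *: (1 + nilpart) by rewrite /nilpart addrC subrK scalerA mulfV // scale1r.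
rewrite {1}EA exprZn; congr (_ *: _); rewrite exprDn_comm; last by apply: commr_sym; exact: commr1.
have nil0 j : (d < j)%N -> nilpart ^+ j = 0.
  by move=> dj; apply/matrixP => s t; rewrite nilpart_pow ?mxE //; apply: leq_trans (ltn_ord s) (leq_trans dj (leq_addl _ _)).
pose F j := 'C(k, j)%:R *: nilpart ^+ j.
have big0 (x y : nat) : (x <= y)%N -> (forall j, (x <= j)%N -> F j = 0) -> \sum_(j < y) F j = \sum_(j < x) F j.
  move=> xy F0; rewrite -!(big_mkord xpredT) (big_cat_nat (n := x)) //= [X in _ + X]big1_seq ?addr0 // => j.
  by rewrite mem_index_iota => /andP[_ /andP[xj _]]; exact: F0.
transitivity (\sum_(j < k.+1) F j).
  by apply: eq_bigr => j _; rewrite expr1n mul1r -scaler_nat.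
rewrite -(big0 _ (maxn k.+1 d.+1)) ?leq_maxl // => [|j kj]; last by rewrite /F bin_small // scale0r.
by rewrite (big0 d.+1) ?leq_maxr // => j dj; rewrite /F nil0 // scaler0.
Qed.
End Unipotent.

Lemma mpsmap_sub (A B : comNzRingType) n (h : {rmorphism A -> B}) (act : expoMap n) u :
  mpsmap h (sub act u) = sub act (mpsmap h u).
Proof. by apply: mpsP => m /=; rewrite rmorph_sum. Qed.

Lemma mevalC1 (A : comNzRingType) n (z : 'I_n -> A) : (1 : {mpoly A[n]}).@[z] = 1.
Proof. exact: rmorph1. Qed.

(** * Iterated functional equations, formally and at points *)

Section ValRel.
Variables (K : numFieldType) (n : nat) (act : expoMap n).
Implicit Types (u w : mps K n) (z : 'I_n -> K).

(** A formal identity whose denominator is nonzero at [z]: such identities can be composed and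
    pulled back before any convergence is known. *)
Definition val_rel z u x w := exists P Q : {mpoly K[n]},
  [/\ Q.@[z] != 0, ofp Q * u = ofp P * w & x = P.@[z] / Q.@[z]].

Lemma val_rel_ratfun z u q w y : series_rel u q w -> ratfun_value q z y -> val_rel z u y w.
Proof.
move=> rel [P [Q [Qz Eq ->]]]; exists P, Q; split=> //.
by apply: series_rel_rep rel _ Eq; apply: contraNneq Qz => ->; rewrite meval0.
Qed.

Lemma val_relD z u x u' x' w : val_rel z u x w -> val_rel z u' x' w -> val_rel z (u + u') (x + x') w.
Proof.
move=> [P [Q [Qz E ->]]] [P' [Q' [Qz' E' ->]]]; exists (P * Q' + P' * Q), (Q * Q'); split.
- by rewrite mevalM mulf_neq0.
- rewrite rmorphD !rmorphM /= mulrDr mulrDl; congr (_ + _); first by rewrite mulrAC E mulrAC.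
  by rewrite -mulrA E' mulrCA mulrA.
by rewrite mevalD !mevalM addf_div.
Qed.

Lemma val_relZ z u x w c : val_rel z u x w -> val_rel z (cst n c * u) (c * x) w.
Proof.
move=> [P [Q [Qz E ->]]]; exists (c%:MP * P), Q; split=> //.
  by rewrite mulrCA E rmorphM mulrA.
by rewrite mevalM mevalC mulrA.
Qed.

Lemma val_rel0 z w : val_rel z 0 0 w.
Proof. by exists 0, 1; rewrite mevalC1 oner_neq0 meval0 mul0r rmorph0 mulr0 mul0r. Qed.

Lemma val_rel_sum z (I : Type) (r : seq I) (P : pred I) (u : I -> mps K n) (x : I -> K) w :
  (forall i, P i -> val_rel z (u i) (x i) w) ->
  val_rel z (\sum_(i <- r | P i) u i) (\sum_(i <- r | P i) x i) w.
Proof.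
move=> h; elim: r => [|i r IH]; first by rewrite !big_nil; exact: val_rel0.
by rewrite !big_cons; case: ifP => // Pi; apply: val_relD => //; exact: h.
Qed.

Lemma val_rel_trans z u x w x' w' : val_rel z u x w -> val_rel z w x' w' -> val_rel z u (x * x') w'.
Proof.
move=> [P [Q [Qz E ->]]] [P' [Q' [Qz' E' ->]]]; exists (P * P'), (Q * Q'); split.
- by rewrite mevalM mulf_neq0.
- transitivity (ofp Q' * (ofp Q * u)); first by rewrite rmorphM /= mulrAC mulrA [ofp Q' * _]mulrC mulrAC.
  by rewrite E mulrCA E' mulrA rmorphM.
by rewrite !mevalM mulf_div.
Qed.

Variable zk : nat -> 'I_n -> K.
Hypothesis zkE : forall k m, mmap1 (zk k) (act m) = mmap1 (zk k.+1) m :> K.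

Lemma psub_zk k (p : {mpoly K[n]}) : (psub act p).@[zk k] = p.@[zk k.+1].
Proof.
rewrite /psub comp_mpoly_meval; apply: meval_eq => i.
by rewrite tnth_mktuple mevalX -/(mmap1 (zk k) _) zkE mmap1U.
Qed.

Lemma val_rel_sub k u x w : val_rel (zk k.+1) u x w -> val_rel (zk k) (sub act u) x (sub act w).
Proof.
move=> [P [Q [Qz E ->]]]; exists (psub act P), (psub act Q); rewrite !psub_zk; split=> //.
by rewrite -!sub_ofp -!rmorphM E.
Qed.

Lemma val_rel_iter k j u x w : val_rel (zk (j + k)) u x w ->
  val_rel (zk j) (iter k (sub act) u) x (iter k (sub act) w).
Proof. by elim: k j => [|k IH] j; rewrite ?addn0 // addnS -addSn => /IH; rewrite !iterS; exact: val_rel_sub. Qed.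

Lemma iter_subD k u w : iter k (sub act) (u + w) = iter k (sub act) u + iter k (sub act) w.
Proof. by elim: k => //= k ->; rewrite rmorphD. Qed.
Lemma iter_subN k u : iter k (sub act) (- u) = - iter k (sub act) u.
Proof. by elim: k => //= k ->; rewrite rmorphN. Qed.
Lemma iter_subZ k c u : iter k (sub act) (cst n c * u) = cst n c * iter k (sub act) u.
Proof. by elim: k => //= k ->; rewrite rmorphM /= sub_cst. Qed.
Lemma iter_sub1 k : iter k (sub act) (1 : mps K n) = 1.
Proof. by elim: k => //= k ->; rewrite rmorph1. Qed.
Lemma iter_sub_sum k (I : finType) (u : I -> mps K n) :
  iter k (sub act) (\sum_i u i) = \sum_i iter k (sub act) (u i).
Proof. by elim: k => //= k ->; rewrite (raddf_sum (sub act : {rmorphism _ -> _})). Qed.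

(** At the point this reads f(z_0) = A^k (f(z_k) - X_k). The partial sum is kept on the side of z_k,
    where it obeys the same recursion as the values f(z_k) themselves. *)
Lemma linear_orbit d (F : 'I_d.+1 -> mps K n) (A : 'M[K]_d.+1) (b : nat -> 'I_d.+1 -> K) (X : nat -> 'I_d.+1 -> K) k s :
  A \in unitmx ->
  (forall k s, val_rel (zk k) (F s - \sum_t cst n (A s t) * sub act (F t)) (b k s) 1) ->
  X 0%N =1 (fun _ => 0) ->
  (forall k s, X k.+1 s = \sum_t invmx A s t * (X k t - b k t)) ->
  val_rel (zk 0) (F s - \sum_t cst n ((A ^+ k) s t) * iter k (sub act) (F t))
     (- \sum_t (A ^+ k) s t * X k t) 1.
Proof.
move=> uA hb X0 XS.
have XA k' (u : 'I_d.+1) : X k' u - b k' u = \sum_t A u t * X k'.+1 t.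
  transitivity ((A *m (\col_t X k'.+1 t)) u 0); last by rewrite mxE; apply: eq_bigr => t _; rewrite mxE.
  have -> : \col_t X k'.+1 t = invmx A *m \col_t (X k' t - b k' t).
    by apply/colP => t; rewrite !mxE XS; apply: eq_bigr => t' _; rewrite mxE.
  by rewrite mulKVmx // mxE.
elim: k s => [|k IH] s.
  have -> : F s - \sum_t cst n ((A ^+ 0) s t) * iter 0 (sub act) (F t) = 0.
    rewrite (bigD1 s) //= expr0 mxE eqxx rmorph1 mul1r big1 ?addr0 ?subrr // => t nt.
    by rewrite mxE eq_sym (negbTE nt) rmorph0 mul0r.
  by rewrite big1 ?oppr0 => [|t _]; [exact: val_rel0|rewrite X0 mulr0].
have step (u : 'I_d.+1) : val_rel (zk 0) (iter k (sub act) (F u) - \sum_t cst n (A u t) * iter k.+1 (sub act) (F t)) (b k u) 1.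
  have := @val_rel_iter k 0 _ _ _ (hb k u); rewrite iter_sub1 iter_subD iter_subN iter_sub_sum.
  congr (val_rel _ (_ - _) _ _); apply: eq_bigr => t _; by rewrite iter_subZ -iterSr.
have := val_relD (IH s) (val_rel_sum (index_enum 'I_d.+1) (P := xpredT) (fun (i : 'I_d.+1) _ => val_relZ ((A ^+ k) s i) (step i))).
congr (val_rel _ _ _ _).
  transitivity (F s - \sum_(u < d.+1) \sum_t cst n ((A ^+ k) s u) * (cst n (A u t) * iter k.+1 (sub act) (F t))).
    rewrite -addrA; congr (_ + _); rewrite -!sumrN -big_split /=; apply: eq_bigr => u _.
    by rewrite mulrBr addKr mulr_sumr.
  congr (_ - _); rewrite exchange_big; apply: eq_bigr => t _.
  rewrite exprSr mxE rmorph_sum mulr_suml; apply: eq_bigr => u _.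
  by rewrite rmorphM mulrA.
transitivity (- \sum_(u < d.+1) (A ^+ k) s u * (X k u - b k u)).
  by rewrite -!sumrN -big_split /=; apply: eq_bigr => u _; rewrite mulrBr opprB addrC.
congr (- _); transitivity (\sum_(u < d.+1) \sum_t (A ^+ k) s u * (A u t * X k.+1 t)).
  by apply: eq_bigr => u _; rewrite XA mulr_sumr.
rewrite exchange_big; apply: eq_bigr => t _; rewrite exprSr mxE mulr_suml.
by apply: eq_bigr => u _; rewrite mulrA.
Qed.

Lemma mult_orbit (g : mps K n) (e G : nat -> K) k :
  (forall k, val_rel (zk k) g (e k) (sub act g)) -> G 0%N = 1 -> (forall k, G k.+1 = e k * G k) ->
  val_rel (zk 0) g (G k) (iter k (sub act) g).
Proof.
move=> he G0 GS; elim: k => [|k IH].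
  by exists 1, 1; rewrite mevalC1 oner_neq0 G0 divr1.
by rewrite GS mulrC iterSr; apply: val_rel_trans IH _; exact: (@val_rel_iter k 0).
Qed.

Variables (R : realType) (C : fieldType) (v : C -> R) (emb : {rmorphism K -> C}).
Hypothesis hv : is_absolute_value v.

Lemma emb_meval (p : {mpoly K[n]}) z : (map_mpoly emb p).@[emb \o z] = emb p.@[z].
Proof.
apply: (mpoly_rmorph_eq (A := K) (B := C) (f := meval (emb \o z) \o map_mpoly emb) (g := emb \o meval z)) => [c|i] /=.
  by rewrite map_mpolyC !mevalC.
by rewrite map_mpolyX !mevalXU.
Qed.

Lemma val_rel_sum_eq z u x w s t : val_rel z u x w ->
  mps_sum v (mpsmap emb u) (emb \o z) s -> mps_sum v (mpsmap emb w) (emb \o z) t -> s = emb x * t.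
Proof.
move=> [P [Q [Qz E ->]]] hs ht.
have := mps_sum_uniq hv (mps_sum_ofpM hv (map_mpoly emb Q) hs).
have -> : ofp (map_mpoly emb Q) * mpsmap emb u = ofp (map_mpoly emb P) * mpsmap emb w.
  by rewrite -!mpsmap_ofp -!rmorphM E.
move=> /(_ _ (mps_sum_ofpM hv (map_mpoly emb P) ht)); rewrite !emb_meval => E'.
have Qz' : emb Q.@[z] != 0 by rewrite fmorph_eq0.
by apply: (mulfI Qz'); rewrite E' rmorphM fmorphV mulrA; congr (_ * _); rewrite mulrC divfK.
Qed.

(** Convergence is asked for only at the far end of the segment of the orbit. *)
Lemma mps_sum_iter u k j s : mps_sum v (mpsmap emb u) (emb \o zk (j + k)) s ->
  mps_sum v (mpsmap emb (iter k (sub act) u)) (emb \o zk j) s.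
Proof.
elim: k j => [|k IH] j; rewrite ?addn0 // addnS -addSn => /IH; rewrite iterS mpsmap_sub.
apply: mps_sum_sub => m; have := congr1 emb (zkE j m).
by rewrite /mmap1 !rmorph_prod; congr (_ = _); apply: eq_bigr => i _; rewrite rmorphXn.
Qed.
End ValRel.

(** * Growth of heights along the orbit *)

Section HeightGrowth.
Variables (R : realType) (L : numFieldType) (D : nat) (w : 'cV[L]_D.+1).
Hypothesis w_indep : forall z : 'rV[int]_D.+1, map_mx intr z *m w = 0 -> z = 0.
Variable rho : R.
Hypothesis rho1 : 1 < rho.

(** The scale exp(c rho^k), on which heights along the orbit grow and the coordinates of its points
    decay. *)
Definition dexp (c : R) k : R := sequences.expR (c * rho ^+ k).

Lemma rhoX_ge1 k : 1 <= rho ^+ k.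
Proof. by rewrite exprn_ege1 // ltW. Qed.

Lemma dexp_gt0 c k : 0 < dexp c k. Proof. exact: exp.expR_gt0. Qed.

Lemma dexp_c0 k : dexp 0 k = 1. Proof. by rewrite /dexp mul0r exp.expR0. Qed.

Lemma dexp_mono c c' k : c <= c' -> dexp c k <= dexp c' k.
Proof. by move=> le; rewrite exp.ler_expR ler_wpM2r //; exact: le_trans ler01 (rhoX_ge1 k). Qed.

Lemma dexpD c c' k : dexp c k * dexp c' k = dexp (c + c') k.
Proof. by rewrite /dexp mulrDl exp.expRD. Qed.

Lemma dexpX c k m : dexp c k ^+ m = dexp (c * m%:R) k.
Proof. by rewrite /dexp -exp.expRM_natr mulrAC. Qed.

Lemma le_dexp (K : R) : exists2 c, 0 <= c & forall k, K <= dexp c k.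
Proof.
exists `|K| => // k; apply: le_trans (ler_norm _) _; apply: le_trans (_ : 1 + `|K| <= _); first by rewrite lerDr.
apply: le_trans (exp.expR_ge1Dx _) _; rewrite exp.ler_expR.
by rewrite -[leLHS]mulr1 ler_wpM2l // rhoX_ge1.
Qed.

Definition hgrow (I : Type) (x : nat -> I -> L) := exists2 c, 0 <= c & forall k, height_le w (x k) (dexp c k).

Lemma hgrow_const (I : Type) (x : I -> L) (H : R) : height_le w x H -> hgrow (fun _ => x).
Proof. by move=> h; have [c c0 hc] := le_dexp H; exists c => // k; apply: height_mono (hc k) h. Qed.

Lemma hgrow_sub (I J : Type) (x : nat -> I -> L) (y : nat -> J -> L) :
  (forall k j, exists i, y k j = x k i) -> hgrow x -> hgrow y.
Proof. by move=> s [c c0 h]; exists c => // k; apply: height_sub (h k); exact: s. Qed.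

Lemma hgrow_union (I J : Type) (x : nat -> I -> L) (y : nat -> J -> L) : hgrow x -> hgrow y ->
  hgrow (fun k (u : I + J) => match u with inl i => x k i | inr j => y k j end).
Proof.
move=> [c c0 h] [c' c0' h']; exists (c + c'); first exact: addr_ge0.
by move=> k; rewrite -dexpD; apply: height_union.
Qed.

Lemma hgrow_lin (I J : finType) (c : nat -> J * I -> L) (y : nat -> I -> L) : hgrow c -> hgrow y ->
  hgrow (fun k j => \sum_i c k (j, i) * y k i).
Proof.
move=> [a a0 h] [a' a0' h']; have [b b0 hb] := le_dexp (#|I|.+1%:R * D.+1%:R).
exists (b + (a + a')); first by rewrite !addr_ge0.
move=> k; apply: height_mono (height_lin (h k) (h' k)); rewrite mulrA -!dexpD.
by rewrite ler_wpM2r // mulr_ge0 // ltW // dexp_gt0.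
Qed.

Lemma hgrowM (I J : Type) (x : nat -> I -> L) (y : nat -> J -> L) : hgrow x -> hgrow y ->
  hgrow (fun k (u : I * J) => x k u.1 * y k u.2).
Proof.
move=> [a a0 h] [a' a0' h']; have [b b0 hb] := le_dexp (D.+1%:R).
exists (b + (a + a')); first by rewrite !addr_ge0.
move=> k; apply: height_mono (heightM (h k) (h' k)); rewrite -!dexpD.
by rewrite ler_wpM2r // mulr_ge0 // ltW // dexp_gt0.
Qed.

(** Meant for the coordinates of Omega^k(alpha), which are monomials in alpha of degree O(rho^k) by
    condition (II). *)
Lemma hgrow_mnm N (x : 'I_N -> L) (H B : R) (mu : nat -> 'I_N -> 'X_{1..N}) : height_le w x H ->
  (forall k i, (mdeg (mu k i))%:R <= B * rho ^+ k) ->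
  hgrow (fun k i => \prod_j x j ^+ mu k i j).
Proof.
move=> hx hB; have H1 := height_ge1 hx.
pose H' := D.+1%:R * H.
have H1' : 1 <= H' by rewrite /H' -[leLHS]mul1r ler_pM ?ler1n.
have B0 : 0 <= `|B| by [].
have l0 : 0 <= exp.ln H' by rewrite exp.ln_ge0.
exists (exp.ln H' * (`|B| + 1)); first by rewrite mulr_ge0 // addr_ge0.
move=> k; pose E := Num.truncn (`|B| * rho ^+ k).
have E0 : 0 <= `|B| * rho ^+ k by rewrite mulr_ge0 //; exact: le_trans ler01 (rhoX_ge1 k).
have [E1 E2] := andP (truncn_itv E0).
have muE i : (mdeg (mu k i) < E.+1)%N.
  rewrite ltnS /E truncn_ge_nat //.
  by apply: le_trans (hB k i) _; rewrite ler_wpM2r ?ler_norm //; exact: le_trans ler01 (rhoX_ge1 k).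
have := height_mnm E hx; rewrite -/H' => hm.
have le : H' ^+ E.+1 <= dexp (exp.ln H' * (`|B| + 1)) k.
  rewrite -[in leLHS](exp.lnK (x := H')) ?posrE ?(lt_le_trans ltr01) // /dexp -exp.expRM_natr exp.ler_expR -mulrA.
  rewrite ler_wpM2l // -natr1 mulrDl mul1r; apply: lerD => //; exact: rhoX_ge1.
apply: height_mono le _; apply: height_sub hm => i; by exists (BMultinom (muE i)).
Qed.

Lemma hgrow_seq (T : eqType) (s : seq T) (x : nat -> T -> L) :
  (forall i, i \in s -> hgrow (fun k (_ : unit) => x k i)) ->
  hgrow (fun k (i : {i | i \in s}) => x k (val i)).
Proof.
elim: s => [|i s IH] h.
  exists 0 => // k; exists 1%N; split=> //; first by rewrite /dexp mul0r exp.expR0.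
  by case.
have hi := h i (mem_head _ _); have hs := IH (fun j js => h j (mem_behead (s := i :: s) js)).
apply: hgrow_sub (hgrow_union hi hs) => k [j js]; have := js; rewrite inE => /orP[/eqP E|js'].
  by exists (inl tt); rewrite /= E.
by exists (inr (exist _ j js')).
Qed.

Lemma hgrow_fin (I : finType) (x : nat -> I -> L) :
  (forall i, hgrow (fun k (_ : unit) => x k i)) -> hgrow x.
Proof.
move=> h; have := @hgrow_seq I (index_enum I) x (fun i _ => h i); apply: hgrow_sub => k i.
by exists (exist _ i (mem_index_enum i)).
Qed.

(** Allows the representation of a rational function to change with [k] among finitely many. *)
Lemma hgrow_choose (T : eqType) (s : seq T) (x : nat -> T -> L) (y : nat -> unit -> L) :
  (forall i, i \in s -> hgrow (fun k (_ : unit) => x k i)) ->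
  (forall k, exists2 i, i \in s & y k tt = x k i) -> hgrow y.
Proof.
move=> /hgrow_seq h hy; apply: hgrow_sub h => k []; have [i is_ E] := hy k.
by exists (exist _ i is_).
Qed.

Lemma hgrow_inv (x : nat -> unit -> L) : hgrow x -> hgrow (fun k u => (x k u)^-1).
Proof.
move=> [a a0 h]; have [c c1 hinv] := height_inv R w_indep; have [b b0 hb] := le_dexp c.
exists (b + a * D.+2%:R); first by rewrite addr_ge0 // mulr_ge0.
have le1 k : 1 <= dexp a k := height_ge1 (h k).
move=> k; have lek : c * dexp a k ^+ D.+2 <= dexp (b + a * D.+2%:R) k.
  by rewrite -dexpD -dexpX ler_wpM2r // exprn_ge0 // ltW // dexp_gt0.
have [Z|nz] := eqVneq (x k tt) 0.
  apply: (@height_mono _ _ _ _ _ _ (dexp a k)).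
    apply: le_trans lek; rewrite -[leLHS]mul1r ler_pM //; first by rewrite ltW // dexp_gt0.
    by rewrite exprS ler_peMr ?exprn_ege1 // ltW // dexp_gt0.
  by apply: height_sub (h k) => -[]; exists tt; rewrite Z invr0.
apply: height_mono lek _.
have := hinv (x k tt) (dexp a k) nz.
have hk : height_le w (fun _ : unit => x k tt) (dexp a k) by apply: height_sub (h k) => _; exists tt.
by move=> /(_ hk); apply: height_sub => -[]; exists tt.
Qed.

Lemma hgrow_poly N (P : {mpoly L[N]}) (x : nat -> 'I_N -> L) (H : R) :
  height_le w (fun m : 'X_{1..N < msize P} => P@_m) H -> hgrow x ->
  hgrow (fun k (_ : unit) => P.@[x k]).
Proof.
move=> hP [a a0 hx]; move: hP; case E: (msize P) => [|d] hP.
  move/eqP: E; rewrite msize_poly_eq0 => /eqP ->.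
  have h0 : hgrow (fun _ (_ : unit) => 0).
    apply: (@hgrow_const _ _ 1); exists 1%N; split=> // _; exists 0; rewrite mulr0; split.
      by rewrite map_mx0 mul0mx scale0r.
    by move=> i j; rewrite mxE normr0.
  by apply: hgrow_sub h0 => k u; exists u; rewrite meval0.
have hm : hgrow (fun k (m : 'X_{1..N < d.+1}) => \prod_i x k i ^+ m i).
  have [b b0 hb] := le_dexp (D.+1%:R).
  exists ((b + a) * d.+1%:R); first by rewrite mulr_ge0 // addr_ge0.
  move=> k; apply: height_mono (height_mnm d (hx k)); rewrite -dexpX.
  apply: ler_expn; last by rewrite -dexpD ler_wpM2r // ltW // dexp_gt0.
  by rewrite mulr_ge0 // ltW // dexp_gt0.
have hc : hgrow (fun k (u : unit * 'X_{1..N < d.+1}) => P@_(u.2)).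
  by have hH := hgrow_const hP; apply: hgrow_sub hH => k [a1 m]; exists m.
apply: hgrow_sub (hgrow_lin hc hm) => k u; exists u.
by rewrite /meval (mmapE d.+1) ?E.
Qed.

(** The logarithms of the factors grow geometrically, so for [rho] above 1 their sum has the order
    of the last one; [C] is chosen so that [C * rho] is at least [C + a + b]. *)
Lemma hgrow_rec (I : finType) (x : nat -> I -> L) (c : nat -> I * I -> L) (H : R) :
  height_le w (x 0%N) H -> hgrow c -> (forall k i, x k.+1 i = \sum_j c k (i, j) * x k j) -> hgrow x.
Proof.
move=> h0 [a a0 hc] hx; have [b b0 hb] := le_dexp (#|I|.+1%:R * D.+1%:R); have [h h0' hh] := le_dexp H.
have r1 : 0 < rho - 1 by rewrite subr_gt0.
pose C := h + (b + a) / (rho - 1); have C0 : 0 <= C by rewrite /C addr_ge0 // (divr_ge0 (addr_ge0 b0 a0)) // ltW.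
exists C => //; elim=> [|k IH].
  apply: height_mono h0; apply: le_trans (hh 0%N) _; apply: dexp_mono.
  by rewrite lerDl (divr_ge0 (addr_ge0 b0 a0)) // ltW.
have := height_lin (hc k) IH => hl.
have {hl} : height_le w (x k.+1) (#|I|.+1%:R * (D.+1%:R * (dexp a k * dexp C k))).
  by apply: height_sub hl => i; exists i.
apply: height_mono; rewrite mulrA; apply: le_trans (_ : dexp b k * (dexp a k * dexp C k) <= _).
  by rewrite ler_wpM2r // mulr_ge0 // ltW // dexp_gt0.
rewrite !dexpD /dexp exp.ler_expR exprS mulrA ler_wpM2r //; first exact: le_trans ler01 (rhoX_ge1 k).
have : b + a <= C * (rho - 1).
  by rewrite /C mulrDl divfK ?gt_eqF // lerDr mulr_ge0 // ltW.
by rewrite mulrBr mulr1 lerBrDr -addrA.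
Qed.
End HeightGrowth.

(** * The upper bound against Liouville's inequality *)

Lemma deg_le_mmap (Q : fieldType) n N M (P : {mpoly {mpoly Q[N]}[M]}) (u : 'I_M -> mps Q n) :
  exists D, deg_le D (mmap (@cst {mpoly Q[N]} n) (fun i => mpsmap (@mpolyC N Q) (u i)) P).
Proof.
elim/mpoly_ring_ind: P => [c|i|p q [D hp] [D' hq]|p q [D hp] [D' hq]].
- exists (msize c); rewrite mmapC => l m h; rewrite -[X in X@_ _]/((cst n c) l) /cst /= mcoeffC.
  case: eqP => _; rewrite ?mulr0 ?mcoeff0 // mulr1; apply: memN_msupp_eq0.
  by apply: contraL h => /msize_mdeg_lt; rewrite -leqNgt => /ltnW.
- exists 0%N; rewrite mmapX mmap1U => l m h; rewrite /= mcoeffC.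
  by case: eqP => [E|]; rewrite ?mulr0 //; have := congr1 mdeg E; rewrite mdeg0; lia.
- exists (maxn D D'); rewrite rmorphD; apply: deg_leD.
    by apply: deg_leW hp; exact: leq_maxl.
  by apply: deg_leW hq; exact: leq_maxr.
- exists (D + D')%N; rewrite rmorphM; exact: deg_leM hp hq.
Qed.

Definition bip (Q : fieldType) n N q (c : {ffun 'I_n -> 'I_q} -> {ffun 'I_N -> 'I_q} -> Q) : {mpoly {mpoly Q[N]}[n]} :=
  \sum_x \sum_y (c x y)%:MP%:MP * ('X_[box_mnm y] *: 'X_[box_mnm x]).

Lemma bipE (Q : fieldType) n N q (c : {ffun 'I_n -> 'I_q} -> {ffun 'I_N -> 'I_q} -> Q) :
  ofp (bip c) = bipoly c.
Proof.
rewrite /bip (raddf_sum (@ofp {mpoly Q[N]} n)); apply: eq_bigr => x _.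
rewrite (raddf_sum (@ofp {mpoly Q[N]} n)); apply: eq_bigr => y _.
exact: rmorphM.
Qed.

Lemma mmap2_bimon (A B : comNzRingType) n N (h : {rmorphism A -> B}) (s : 'I_N -> B) (z : 'I_n -> B) (c : A) x y :
  mmap (mmap h s) z ((c%:MP_[N])%:MP_[n] * ('X_[y] *: 'X_[x])) = h c * (mmap1 z x * mmap1 s y).
Proof.
rewrite -mul_mpolyC; set ev := mmap _ _.
transitivity (ev (c%:MP_[N])%:MP_[n] * (ev ('X_[y])%:MP_[n] * ev 'X_[x])).
  by rewrite -[ev (_ * (_ * _))]/((ev : {rmorphism _ -> _}) _) !rmorphM.
by rewrite /ev !(mmapC, mmapX) /= !(mmapC, mmapX); congr (_ * _); exact: mulrC.
Qed.

Lemma mmap_mulCX (A B : comNzRingType) N (h : {rmorphism A -> B}) (s : 'I_N -> B) (p : A) m :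
  mmap h s (p%:MP_[N] * 'X_[m]) = h p * mmap1 s m.
Proof. by rewrite rmorphM /= mmapC mmapX. Qed.

Lemma mmap1_map (A B : comNzRingType) n (h : {rmorphism A -> B}) (z : 'I_n -> A) m :
  h (mmap1 z m) = mmap1 (h \o z) m.
Proof. by rewrite /mmap1 rmorph_prod; apply: eq_bigr => i _; rewrite rmorphXn. Qed.

Section Contradiction.
Variables (R : realType) (Q : fieldType) (L : numFieldType) (kap : {rmorphism Q -> L}).
Variables (D : nat) (w : 'cV[L]_D.+1).
Hypothesis w_indep : forall z : 'rV[int]_D.+1, map_mx intr z *m w = 0 -> z = 0.
Hypothesis heights : forall (I : finType) (x : I -> Q), exists H : R, height_le w (kap \o x) H.
Variables (C : fieldType) (emb : {rmorphism L -> C}) (v : C -> R).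
Hypothesis hv : is_absolute_value v.
Hypothesis v_nat : forall k : nat, (0 < k)%N -> 1 <= k%:R * v k%:R.
Variables (rho : R) (n N M : nat).
Hypothesis rho1 : 1 < rho.
Variables (zk : nat -> 'I_n -> L) (sk : nat -> 'I_N -> L).
Local Notation zs k := (fun i : 'I_(n + N) => match split i with inl j => zk k j | inr j => sk k j end).
Hypothesis zs_grow : hgrow w rho (fun k => zs k).
Variables (P : {mpoly {mpoly Q[N]}[M]}) (u : 'I_M -> mps Q n).
Local Notation F := (mmap (@cst {mpoly Q[N]} n) (fun i => mpsmap (@mpolyC N Q) (u i)) P).
Hypothesis F_neq0 : F <> 0.
Let emb' := GRing.RMorphism.clone _ _ (emb \o kap) _.
Variables (good : pred nat) (be : 'I_n -> R) (Bd : 'I_M -> R) (cz : R).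
Hypothesis be_ge0 : forall j, 0 <= be j.
Hypothesis bounded : forall i d, (mabs v d (mpsmap emb' (u i))).@[be] <= Bd i.
Hypothesis cz0 : 0 < cz.
Hypothesis zk_small : exists k0, forall k j, (k0 <= k)%N -> v (emb (zk k j)) <= dexp rho (- cz) k * be j.
Hypothesis P_vanish : exists k0, forall k, (k0 <= k)%N -> good k -> exists y,
  (forall i, tends v (fun d => (trunc d (mpsmap emb' (u i))).@[emb \o zk k]) (y i)) /\
  mmap (mmap emb' (emb \o sk k)) y P = 0.
Hypothesis nonvanish : forall G : {mpoly {mpoly L[n]}[N]}, G != 0 -> forall k1, exists k,
  [/\ (k1 <= k)%N, good k & mmap (meval (zk k)) (sk k) G != 0].

(** [q] and the combination are fixed before [k]. Up to factors independent of [k], the value of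
    [p r] is at most exp of (Cx (N + D0) - cz (J - o)) q rho^k and, when nonzero, at least exp of
    -(b + a) N1 E q rho^k. All exponents are linear in [q], so a large [J] decides. *)
Lemma auxiliary_contradiction : False.
Proof.
have [Df dF] := deg_le_mmap P u.
have [o ho] := pade dF F_neq0.
have [D0 hD0] := approx_bound hv emb' n P.
have [c1 c10 habs] := height_abs w_indep emb hv v_nat.
have [c0 c00 [E liou]] := liouville w_indep emb hv v_nat.
have [a a0 hgz] := zs_grow; have [b b0 hb] := le_dexp rho1 (D.+1%:R : R).
have [b1 b10 hb1] := le_dexp rho1 c1.
pose Cx := b1 + a * 2; pose N1 := (n + N).+1.
(* [tot] collects what is lost to the heights and to the size of the points, per unit of
   [q * rho ^+ k]; [J] makes the gain [cz * (J - o)%:R] exceed it by at least 1. *)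
pose tot := (b + a) * N1%:R * E%:R + Cx * (N + D0)%:R.
pose J := (o + Num.truncn ((tot + 1) / cz)).+1.
have [q [c [r [q0 [x0 [y0 cxy0]] low]]]] := ho J.
have q1 : 1 <= q%:R :> R by rewrite ler1n.
pose p (h : 'I_q) := bip (c h).
have hD1 (h : 'I_q) m m' : (N * q < mdeg m')%N -> ((p h)@_m)@_m' = 0.
  by move=> lt; have := deg_le_bipoly (c h) m lt; rewrite -bipE.
have low' m : (mdeg m < (J - o) * q)%N -> (\sum_(h < q | (r <= h)%N) ofp (p h) * F ^+ (h - r)) m = 0.
  move=> /low <-; congr (mpsf _ m); apply: eq_bigr => h _; by rewrite /p bipE.
have [B B0 hB] := hD0 u be Bd q ((J - o) * q)%N (N * q)%N r p hD1 be_ge0 bounded low'.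
pose X := ({ffun 'I_n -> 'I_q} * {ffun 'I_N -> 'I_q})%type.
pose val k := \sum_(i : X) kap (c r i.1 i.2) * (mmap1 (zk k) (box_mnm i.1) * mmap1 (sk k) (box_mnm i.2)).
have valE k : emb (val k) = mmap (mmap emb' (emb \o sk k)) (emb \o zk k) (p r).
  rewrite /p /bip (raddf_sum (mmap _ _)) /val rmorph_sum -(pair_bigA _ (fun x y =>
    emb (kap (c r x y) * (mmap1 (zk k) (box_mnm x) * mmap1 (sk k) (box_mnm y))))) /=.
  apply: eq_bigr => x _; rewrite (raddf_sum (mmap _ _)); apply: eq_bigr => y _ /=.
  by rewrite mmap2_bimon !rmorphM /= !mmap1_map.
(* The polynomial [p r] with its two sets of variables exchanged, the form that [nonvanish]
   takes. *)
pose G : {mpoly {mpoly L[n]}[N]} := \sum_(i : X) (kap (c r i.1 i.2) *: 'X_[box_mnm i.1])%:MP * 'X_[box_mnm i.2].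
have G0 : G != 0.
  have Gc : (G@_(box_mnm y0))@_(box_mnm x0) = kap (c r x0 y0).
    rewrite /G (raddf_sum (mcoeff _)) /= (raddf_sum (mcoeff _)) /= (bigD1 (x0, y0)) //= big1 ?addr0.
      by rewrite mcoeffCM mcoeffX eqxx mulr1 mcoeffZ mcoeffX eqxx mulr1.
    move=> [x y] /= ne; rewrite mcoeffCM mcoeffX; case: eqP => [/box_mnm_inj Ey|]; last by rewrite mulr0 mcoeff0.
    rewrite mulr1 mcoeffZ mcoeffX; case: eqP => [/box_mnm_inj Ex|]; last by rewrite mulr0.
    by rewrite Ex Ey eqxx in ne.
  by apply: contraNneq cxy0 => Z; rewrite Z !mcoeff0 in Gc; rewrite -(fmorph_eq0 kap) -Gc.
have GE k : mmap (meval (zk k)) (sk k) G = val k.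
  rewrite (raddf_sum (mmap _ _)) /=; apply: eq_bigr => i _.
  apply: etrans (mmap_mulCX _ _ _ _) _.
  rewrite -[X in X * _]/((kap (c r i.1 i.2) *: 'X_[box_mnm i.1]).@[zk k]) mevalZ mevalX mulrA //.
have [Hc hHc] := heights (fun i : X => c r i.1 i.2).
pose K2 : R := #|{: X}|.+1%:R * (D.+1%:R * Hc).
pose e := ((n + N) * q)%N.
have hval k : height_le w (fun _ : unit => val k) (K2 * dexp rho ((b + a) * (N1 * q)%:R) k).
  have Hc1 : 1 <= Hc := height_ge1 hHc.
  have K20 : 0 <= K2 by rewrite /K2 mulr_ge0 // mulr_ge0 //; exact: le_trans ler01 Hc1.
  have hm := height_mnm e (hgz k).
  pose mx (i : X) : 'X_{1..(n + N)} := [multinom (match split j with inl j => box_mnm i.1 j | inr j => box_mnm i.2 j end) | j < n + N].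
  have mxd i : (mdeg (mx i) < e.+1)%N.
    rewrite ltnS mdegE big_split_ord /=.
    rewrite (eq_bigr (fun j => box_mnm i.1 j)) => [|j _]; last by rewrite mnmE (unsplitK (inl j)).
    rewrite -mdegE [X in (_ + X)%N](eq_bigr (fun j => box_mnm i.2 j)) => [|j _]; last by rewrite mnmE (unsplitK (inr j)).
    by rewrite -mdegE /e mulnDl leq_add // mdeg_box.
  have hmon : height_le w (fun i : X => mmap1 (zk k) (box_mnm i.1) * mmap1 (sk k) (box_mnm i.2)) ((D.+1%:R * dexp rho a k) ^+ e.+1).
    apply: height_sub hm => i; exists (BMultinom (mxd i)).
    rewrite big_split_ord /=; congr (_ * _); apply: eq_bigr => j _.
      by rewrite [X in _ = _ ^+ X]mnmE (unsplitK (inl j)).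
    by rewrite [X in _ = _ ^+ X]mnmE (unsplitK (inr j)).
  have hc' : height_le w (fun t : unit * X => kap (c r t.2.1 t.2.2)) Hc.
    by apply: height_sub hHc => -[[] i]; exists i.
  have := height_lin hc' hmon; rewrite [X in height_le _ _ X](_ : _ = K2 * (D.+1%:R * dexp rho a k) ^+ e.+1); last first.
    by rewrite /K2 !mulrA.
  move=> hl; have {hl} : height_le w (fun _ : unit => val k) (K2 * (D.+1%:R * dexp rho a k) ^+ e.+1).
    by apply: height_sub hl => _; exists tt.
  apply: height_mono; rewrite ler_wpM2l // -dexpX; apply: le_trans (_ : (dexp rho (b + a) k) ^+ e.+1 <= _).
    apply: ler_expn; last by rewrite -dexpD ler_wpM2r // ltW // dexp_gt0.
    by rewrite mulr_ge0 // ltW // dexp_gt0.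
  apply: ler_weXn2l; last by rewrite /e /N1 mulSn -add1n leq_add2r.
  rewrite -(dexp_c0 rho k); apply: dexp_mono => //; exact: addr_ge0.
have dexp1 c' k : 0 <= c' -> 1 <= dexp rho c' k.
  by move=> h; rewrite -(dexp_c0 rho k); exact: dexp_mono.
have Cx0 : 0 <= Cx by rewrite /Cx addr_ge0 // mulr_ge0.
have vs k j : v (emb (sk k j)) <= dexp rho Cx k.
  apply: le_trans (habs _ (dexp rho a k) _) _.
    apply: height_sub (hgz k) => _; exists (rshift n j); by rewrite (unsplitK (inr j)).
  rewrite dexpX /Cx -dexpD ler_wpM2r //; exact/ltW/dexp_gt0.
have [k0 hz] := zk_small; have [k1 hP] := P_vanish.
pose K3 := c0 * K2 ^+ E * B.
have Hc1 : 1 <= Hc := height_ge1 hHc.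
have K20 : 0 <= K2 by rewrite /K2 mulr_ge0 // mulr_ge0 //; exact: le_trans ler01 Hc1.
have K30 : 0 <= K3 by rewrite /K3 !mulr_ge0 ?exprn_ge0 // ltW.
have [k2 hk2] : exists k2, forall k, (k2 <= k)%N -> K3 < rho ^+ k.
  have r1 : 0 < rho - 1 by rewrite subr_gt0.
  exists (Num.truncn (K3 / (rho - 1))).+1 => k hk.
  have bern : 1 + (rho - 1) * k%:R <= rho ^+ k.
    elim: (k) => [|i IH]; first by rewrite mulr0 addr0 expr0.
    rewrite exprS -natr1 mulrDr mulr1; move: IH; have := rhoX_ge1 rho1 i; move: (rho ^+ i) => z z1 IH.
    have : (rho - 1) * z >= rho - 1 by rewrite ler_peMr // ltW.
    by move: IH; move: ((rho - 1) * i%:R) => y; rewrite mulrBl mul1r; lra.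
  apply: lt_le_trans bern; apply: lt_trans (_ : (rho - 1) * k%:R < _); last by rewrite ltrDr.
  rewrite mulrC -ltr_pdivrMr //; apply: lt_le_trans (_ : (Num.truncn (K3 / (rho - 1))).+1%:R <= _).
    by rewrite truncnS_gt // divr_ge0 // ltW.
  by rewrite ler_nat.
have [k [kk gk nz]] := nonvanish G0 (maxn k0 (maxn k1 k2)).
move: kk; rewrite !geq_max => /and3P[kk0 kk1 kk2]; rewrite GE in nz.
have [y [hy Py]] := hP k kk1 gk.
have t01 : 0 <= dexp rho (- cz) k <= 1.
  rewrite (ltW (dexp_gt0 _ _ _)) -(dexp_c0 rho k); apply: dexp_mono => //.
  by rewrite oppr_le0 ltW.
have up := hB _ _ _ _ y t01 (dexp1 _ k Cx0) (vs k) (fun j => hz k j kk0) hy Py.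
rewrite -valE !dexpX in up; have lo := liou _ _ nz (hval k).
have pos : 0 <= c0 * (K2 * dexp rho ((b + a) * (N1 * q)%:R) k) ^+ E.
  apply: mulr_ge0; first exact: ltW.
  by apply: exprn_ge0; apply: mulr_ge0 => //; exact/ltW/dexp_gt0.
have := le_trans lo (ler_wpM2l pos up).
rewrite exprMn dexpX.
set d1 := dexp _ _ k; set d2 := dexp _ _ k; set d3 := dexp _ _ k.
rewrite (_ : c0 * (K2 ^+ E * d1) * (d2 * B * d3) = K3 * (d1 * d2 * d3)); last by rewrite /K3; ring.
rewrite /d1 /d2 /d3 !dexpD => hfin.
have : K3 * dexp rho (-1) k < 1.
  rewrite /dexp mulN1r exp.expRN ltr_pdivrMr ?exp.expR_gt0 // mul1r.
  apply: lt_le_trans (hk2 k kk2) _; apply: le_trans (exp.expR_ge1Dx _); by rewrite lerDr.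
rewrite ltNge => /negP; apply; apply: le_trans hfin _; rewrite ler_wpM2l //; apply: dexp_mono => //.
have tot0 : 0 <= tot + 1.
  by rewrite addr_ge0 // addr_ge0 // !mulr_ge0 // addr_ge0.
have hJ : tot + 1 <= cz * (J - o)%:R.
  rewrite /J -addnS addKn mulrC -ler_pdivrMr //; apply/ltW/truncnS_gt.
rewrite (_ : _ + _ + _ = (tot - cz * (J - o)%:R) * q%:R); last first.
  by rewrite /tot !natrM !natrD !natrM; ring.
apply: le_trans (_ : (-1) * q%:R <= _); last by rewrite mulN1r lerN2.
by rewrite ler_wpM2r //; lra.
Qed.
End Contradiction.

(** * Nonvanishing of polynomials along the orbit *)

Section RatfunValue.
Variables (K : fieldType) (n : nat) (z : 'I_n -> K).
Local Notation F := {fraction {mpoly K[n]}}.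

(** This holds even where the chosen denominator vanishes, because the numerator then vanishes
    too. *)
Lemma ratfun_value_rep (x : F) y p q : ratfun_value x z y -> q != 0 -> x = p%:F / q%:F ->
  q.@[z] * y = p.@[z].
Proof.
move=> [P [Q [Qz -> ->]]] q0 E.
have Q0 : Q != 0 by apply: contraNneq Qz => ->; rewrite meval0.
have /(congr1 (meval z)) : P * q = p * Q by apply/frac_eq.
rewrite !mevalM => E'; apply: (mulIf Qz).
by rewrite -E' -mulrA divfK // mulrC.
Qed.

Lemma ratfun_valueD (x x' : F) y y' : ratfun_value x z y -> ratfun_value x' z y' ->
  ratfun_value (x + x') z (y + y').
Proof.
move=> [P [Q [Qz -> ->]]] [P' [Q' [Qz' -> ->]]]; exists (P * Q' + P' * Q), (Q * Q').
have Q0 : Q != 0 by apply: contraNneq Qz => ->; rewrite meval0.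
have Q0' : Q' != 0 by apply: contraNneq Qz' => ->; rewrite meval0.
split; [by rewrite mevalM mulf_neq0| |by rewrite mevalD !mevalM addf_div].
by rewrite addf_div ?tofrac_eq0 // tofracD !tofracM.
Qed.

Lemma ratfun_valueZ (x : F) y c : ratfun_value x z y -> ratfun_value ((c%:MP)%:F * x) z (c * y).
Proof.
move=> [P [Q [Qz -> ->]]]; exists (c%:MP * P), Q; split=> //; first by rewrite tofracM mulrA.
by rewrite mevalM mevalC mulrA.
Qed.

Lemma ratfun_value_cst c : ratfun_value ((c%:MP)%:F : F) z c.
Proof. by exists c%:MP, 1; rewrite mevalC1 mevalC oner_neq0 tofrac1 !divr1. Qed.

Lemma ratfun_value_sum (I : Type) (r : seq I) (x : I -> F) y : (forall i, ratfun_value (x i) z (y i)) ->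
  ratfun_value (\sum_(i <- r) x i) z (\sum_(i <- r) y i).
Proof.
move=> h; elim: r => [|i r IH]; last by rewrite !big_cons; apply: ratfun_valueD.
by rewrite !big_nil; have := ratfun_value_cst 0; rewrite mpolyC0 tofrac0.
Qed.

Lemma ratfun_valueV (x : F) y : ratfun_value x z y -> y != 0 -> ratfun_value x^-1 z y^-1.
Proof.
move=> [P [Q [Qz -> ->]]]; rewrite mulf_eq0 negb_or => /andP[Pz _]; exists Q, P.
by rewrite !invf_div.
Qed.
End RatfunValue.

Section Orbit.
Variables (K : numFieldType) (n : nat) (act : expoMap n).
Local Notation F := {fraction {mpoly K[n]}}.
Variables (l m r : nat) (d : 'I_l -> nat).
Variables (f : forall i : 'I_l, 'I_(d i).+1 -> mps K n) (g : 'I_m -> mps K n).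
Variables (A : forall i : 'I_l, 'M[K]_((d i).+1)) (a : 'I_l -> K).
Variables (b : forall i : 'I_l, 'I_(d i).+1 -> F) (e : 'I_m -> F) (at_ : 'I_r -> K).
Hypothesis A_unit : forall i, A i \in unitmx.
Hypothesis A_trig : forall i (s t : 'I_(d i).+1), (s < t)%N -> A i s t = 0.
Hypothesis A_diag : forall i s, A i s s = a i.
Hypothesis a_neq0 : forall i, a i != 0.
Hypothesis A_sub : forall i (s t : 'I_(d i).+1), s = t.+1 :> nat -> A i s t != 0.
Hypothesis hf : forall i (s : 'I_(d i).+1),
  series_rel (f s - \sum_t cst n (A i s t) * sub act (f t)) (b s) 1.
Hypothesis hg : forall h, series_rel (g h) (e h) (sub act (g h)).
Hypothesis g_neq0 : forall h, g h <> 0.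
Hypothesis at_indep : forall D : 'I_r -> int, \prod_j at_ j ^ D j = 1 -> forall j, D j = 0.
Hypothesis at_neq0 : forall j, at_ j != 0.
Variable zk : nat -> 'I_n -> K.
Hypothesis zkE : forall k x, mmap1 (zk k) (act x) = mmap1 (zk k.+1) x :> K.
Hypothesis poly_nonvanishing : forall c : {mpoly K[n]}, c != 0 -> forall k1, exists2 k, (k1 <= k)%N & c.@[zk k] != 0.
Variables (bval : nat -> forall i : 'I_l, 'I_(d i).+1 -> K) (eval : nat -> 'I_m -> K).
Hypothesis bvalP : forall k i (s : 'I_(d i).+1), ratfun_value (b s) (zk k) (bval k s).
Hypothesis evalP : forall k h, ratfun_value (e h) (zk k) (eval k h).
Hypothesis eval_neq0 : forall k h, eval k h != 0.
Hypothesis no_linear : ~ linear_conclusion act f a b.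
Hypothesis no_mult : ~ mult_conclusion act e.
Variables (C : fieldType) (emb : {rmorphism K -> C}).
Local Notation vars := (vars m r d).
Local Notation vf s := (inl (Tagged (fun i => 'I_(d i).+1) s) : vars).
Local Notation vx := (vx m r d).
Local Notation vy j := (inr (inr (inl j)) : vars).
Local Notation vg h := (inr (inr (inr h)) : vars).
Local Notation N := #|{: vars}|.
Local Notation vt := (vt (@vkey l m r d) vx).
Local Notation tv := (tv (@vkey l m r d)).

Lemma e_neq0 h : e h != 0.
Proof.
have [P [Q [Qz E Ey]]] := evalP 0 h; apply/eqP => Z.
have Q0 : Q != 0 by apply: contraNneq Qz => ->; rewrite meval0.
have Z' : e h = (0 : {mpoly K[n]})%:F / Q%:F by rewrite Z tofrac0 mul0r.
have := ratfun_value_rep (evalP 0 h) Q0 Z'; rewrite meval0 => /eqP.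
by rewrite mulf_eq0 (negbTE Qz) (negbTE (eval_neq0 0 h)).
Qed.

(** A polynomial vanishing at all late multiples of [T] would produce one of the excluded
    alternatives. [S], [C] and [inv] are left open because the lemma serves both the values of the
    functions and the partial sums and products. *)
Lemma orbit_nonvanishing (inv : bool) (S : nat -> vars -> C) k1 T :
  (forall k i (s : 'I_(d i).+1), (k1 <= k)%N -> S k.+1 (vf s) =
     \sum_t emb (invmx (A i) s t) * (S k (vf t) - emb (bval k t))) ->
  (forall k, S k.+1 vx = S k vx + 1) ->
  (forall k j, S k.+1 (vy j) = emb (at_ j) * S k (vy j)) ->
  (forall k h, (k1 <= k)%N -> S k.+1 (vg h) = emb (if inv then (eval k h)^-1 else eval k h) * S k (vg h)) ->
  (forall k j, S k (vy j) != 0) -> (forall k h, (k1 <= k)%N -> S k (vg h) != 0) ->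
  (0 < T)%N -> forall G : {mpoly {mpoly K[n]}[N]}, G != 0 -> forall k2, exists k,
    [/\ (k2 <= k)%N, (T %| k)%N & mmap (emb \o meval (zk k)) (fun v => S k (vt v)) G != 0].
Proof.
move=> Sf Sx Sy Sg y0 g0 T0 G G0 k2; apply: boolp.contrapT => /boolp.forallNP no.
pose bv k (v : 'I_N) : C := match vt v with
  | inl u => - \sum_t emb (invmx (A (tag u)) (tagged u) t) * emb (bval k t)
  | inr (inl _) => 1 | _ => 0 end.
pose ev k (v : 'I_N) : C := match vt v with
  | inr (inr (inl j)) => emb (at_ j)
  | inr (inr (inr h)) => emb (if inv then (eval k h)^-1 else eval k h)
  | _ => 1 end.
have E_rep (x : F) k y p q : ratfun_value x (zk k) y -> q != 0 -> x = p%:F / q%:F ->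
    emb q.@[zk k] * emb y = emb p.@[zk k].
  by move=> h q0 Ex; rewrite -rmorphM (ratfun_value_rep h q0 Ex).
have [] := @seq_alternative K {mpoly K[n]} (psub act) (@mpolyC n K) (@psub_inj _ _ act)
  (fcst n) (ratsub act) (fun _ => erefl) (ratsub_tofrac act) (ratsub_cst act) (@ratsub_affine _ _ act)
  N (@wlin l m r d) (tv vx) (wM m r A) (wbe A b) (we e at_ inv)
  (fun v w => @wM_tri _ _ _ _ _ _ _ A_unit A_trig A_diag a_neq0 v w)
  (fun v => @wM_diag _ _ _ _ _ _ _ A_unit A_trig A_diag a_neq0 v)
  (@wM_lin _ _ _ _ _ A) (@wlin_x0 _ _ _ _) (wM_x0 A) (wM_x0' A) (wbe_x0 _ _ A b) (we_neq0 e_neq0 at_neq0 inv)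
  C emb (fun k => emb \o meval (zk k)) _ _ _ bv ev (fun k v => S k (vt v)) k1 _ _ _ _ _ T G T0 G0.
- by move=> j c /=; rewrite mevalC.
- by move=> j c /=; rewrite (psub_zk zkE).
- by move=> c c0 j1; have [k hk nz] := poly_nonvanishing c0 j1; exists k; rewrite //= fmorph_eq0.
- move=> v k p q; rewrite /wlin /wbe /bv; case: (vt v) => [[i s]|[[]|x]] //= _ _ q0 Ex.
    have h : ratfun_value (- \sum_t fcst n (invmx (A i) s t) * b t) (zk k) (- \sum_t invmx (A i) s t * bval k t).
      rewrite -mulN1r -[- \sum_t invmx _ _ _ * _]mulN1r.
      have := ratfun_valueZ (-1) (ratfun_value_sum (index_enum 'I_(d i).+1) (fun t => ratfun_valueZ (invmx (A i) s t) (bvalP k t))).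
      by rewrite mpolyCN mpolyC1 tofracN tofrac1.
    rewrite -(E_rep _ _ _ _ _ h q0 Ex); congr (_ * _); rewrite rmorphN rmorph_sum; congr (- _).
    by apply: eq_bigr => t _; rewrite rmorphM.
  have h : ratfun_value (1 : F) (zk k) 1 by have := ratfun_value_cst (zk k) 1; rewrite mpolyC1 tofrac1.
  by have := E_rep _ _ _ _ _ h q0 Ex; rewrite rmorph1.
- move=> v k p q; rewrite /wlin /we /ev; case: (vt v) => [[i s]|[[]|[j|h]]] //= _ _ q0 Ex.
    exact: E_rep (ratfun_value_cst _ _) q0 Ex.
  case: (inv) Ex => Ex; last exact: E_rep (evalP k h) q0 Ex.
  exact: E_rep (ratfun_valueV (evalP k h) (eval_neq0 k h)) q0 Ex.
- move=> v k lv kk; have Esum : \sum_w emb (wM m r A v w) * S k (vt w) = \sum_x emb (vM A (vt v) x) * S k x.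
    rewrite -(@big_vt _ (@vkey l m r d) vx _ _ _ (fun x => emb (vM A (vt v) x) * S k x)).
    by apply: eq_bigr => w _; rewrite mxE.
  rewrite Esum big_vars /bv; move: lv; rewrite /wlin; case: (vt v) => [[i s]|[[]|x]] //= _.
    rewrite rmorph0 mul0r add0r [X in _ + (X + _) + _]big1 => [|j _]; last by rewrite ?rmorph0 mul0r.
    rewrite [X in _ + (_ + X) + _]big1 => [|j _]; last by rewrite ?rmorph0 mul0r.
    rewrite !addr0 (bigD1 i) //= [X in (_ + X) - _]big1 ?addr0 => [|i' ni]; last first.
      by rewrite big1 // => t _; rewrite eq_sym (negbTE ni) ?rmorph0 mul0r.
    rewrite Sf // -sumrB; apply: eq_bigr => t _; by rewrite eqxx tagged_asE mulrBr.
  rewrite Sx big1 => [|i _]; last by rewrite big1 // => t _; rewrite ?rmorph0 mul0r.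
  rewrite add0r rmorph1 mul1r big1 => [|j _]; last by rewrite ?rmorph0 mul0r.
  by rewrite add0r big1 ?addr0 // => j _; rewrite ?rmorph0 mul0r.
- move=> v k; rewrite /wlin /ev; case: (vt v) => [[i s]|[[]|[j|h]]] //= _ kk; exact: Sg.
- move=> v k; rewrite /wlin; case: (vt v) => [[i s]|[[]|[j|h]]] //= _ kk; exact: g0.
- exists k2 => k kk Tk; apply/eqP/negPn/negP => nz; apply: (no k); split=> //.
- by move=> /(linear_case A_unit A_trig A_diag a_neq0 A_sub hf).
- by move=> /(mult_case hg g_neq0 e_neq0 at_indep at_neq0).
Qed.
End Orbit.

(** Subtracting its value [c] from [P] gives a relation that vanishes at [y] while its series is the
    constant [- c]. Then [limit_bound], for the combination of [c] and this series, which is zero to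
    every order [I], bounds [v c] by a multiple of 2^-I. *)
Lemma zero_series_value (R : realType) (C : fieldType) (v : C -> R) (hv : is_absolute_value v) n M
    (P : {mpoly C[M]}) (u : 'I_M -> mps C n) (y : 'I_M -> C) (Bd : 'I_M -> R) (z : 'I_n -> C) (be : 'I_n -> R) :
  (forall j, 0 <= be j) -> (forall j, v (z j) <= 2^-1 * be j) ->
  (forall i d, (mabs v d (u i)).@[be] <= Bd i) ->
  (forall i, tends v (fun d => (trunc d (u i)).@[z]) (y i)) ->
  mmap (@cst C n) u P = 0 -> P.@[y] = 0.
Proof.
move=> be0 hz hBd hy P0; set c := P.@[y].
pose Pc := P - c%:MP; pose p (h : 'I_2) : {mpoly C[n]} := if h == ord0 then c%:MP else 1.
have abs_maj k (q : {mpoly C[k]}) : exists q', maj v q q'.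
  exists (\sum_(x <- msupp q) v q@_x *: 'X_[x]) => x; rewrite raddf_sum /=.
  case xq : (x \in msupp q); last first.
    move/negbT: xq; rewrite -mcoeff_eq0 => /eqP ->; rewrite (abs0 hv); apply: sumr_ge0 => x' _.
    by rewrite mcoeffZ mulr_ge0 ?(abs_ge0 hv) // mcoeffX ler0n.
  rewrite (bigD1_seq x) //= mcoeffZ mcoeffX eqxx mulr1 lerDl; apply: sumr_ge0 => x' _.
  by rewrite mcoeffZ mulr_ge0 ?(abs_ge0 hv) // mcoeffX ler0n.
have [P' hP'] := abs_maj _ Pc; have /boolp.choice [p' hp'] := fun h => abs_maj _ (p h).
have t01 : 0 <= (2^-1 : R) <= 1 by rewrite invr_ge0 ler0n invf_le1 ?ler1n.
have PcE : mmap (@cst C n) u Pc = - cst n c by rewrite /Pc rmorphB /= P0 sub0r mmapC.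
have low I m : (mdeg m < I)%N ->
  (\sum_(h < 2 | (@ord0 1 <= h)%N) ofp (p h) * mmap (@cst C n) u Pc ^+ (h - @ord0 1)) m = 0.
  move=> _; rewrite PcE (eq_bigl xpredT) // big_ord_recl big_ord1.
  have -> : ofp (p ord0) = cst n c by [].
  have -> : ofp (p (lift ord0 ord0)) = 1 by exact: rmorph1.
  by rewrite mul1r (_ : (ord0 - ord0 = 0)%N) // expr0 mulr1 (_ : (_ - _ = 1)%N) // expr1 subrr.
have bound I := limit_bound hv hP' hp' be0 t01 hz hBd hy _ (low I).
have Pcy : Pc.@[y] = 0 by rewrite mevalB mevalC subrr.
apply/eqP/negPn/negP => c0; have vc : 0 < v c by rewrite (abs_gt0 hv).
set K : R := \sum_(h < 2 | _) _ in bound.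
pose I := (Num.truncn (K / v c)).+1.
have := bound Pcy I; rewrite /p eqxx mevalC leNgt => /negP; apply.
rewrite exprVn mulrC ltr_pdivrMr ?exprn_gt0 // mulrC -ltr_pdivrMr //.
apply: lt_le_trans (truncnS_gt _) _; rewrite -natrX ler_nat; exact/ltnW/ltn_expl.
Qed.

(** * The auxiliary polynomial and the passage to the stated definitions *)

Section Auxiliary.
Variables (Q : fieldType) (l m r : nat) (d : 'I_l -> nat).
Hypothesis char0 : forall j, j`!%:R != 0 :> Q.
Local Notation vars := (vars m r d).
Local Notation vx := (vx m r d).
Local Notation vy j := (inr (inr (inl j)) : vars).
Local Notation vg h := (inr (inr (inr h)) : vars).
Local Notation N := #|{: vars}|.
Local Notation tv := (tv (@vkey l m r d)).
Definition fvars := ({i : 'I_l & 'I_(d i).+1} + 'I_m)%type.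
Local Notation M := #|{: fvars}|.
Local Notation S := {mpoly Q[N]}.
Local Notation ff s := (inl (Tagged (fun i => 'I_(d i).+1) s) : fvars).
Variables (A : forall i : 'I_l, 'M[Q]_((d i).+1)) (a : 'I_l -> Q) (mu : 'I_l -> 'I_r -> int).
Hypothesis A_trig : forall i (s t : 'I_(d i).+1), (s < t)%N -> A i s t = 0.
Hypothesis A_diag : forall i s, A i s s = a i.
Hypothesis a_neq0 : forall i, a i != 0.
Variable tau : {mpoly rat[M]}.

Definition posp (z : int) : nat := if z is Posz k then k else 0%N.
Definition negp (z : int) : nat := if z is Negz k then k.+1 else 0%N.

(** [Wpos i] over [Wneg i] is the monomial that equals [a i ^+ k] at the admissible [k]; the integer
    exponents are split to stay among polynomials. *)
Definition Wpos i : S := \prod_j 'X_(tv (vy j)) ^+ posp (mu i j).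
Definition Wneg i : S := \prod_j 'X_(tv (vy j)) ^+ negp (mu i j).
(** The entries of the [k]-th power of [A i] divided by [a i], as polynomials in the variable that
    stands for [k]. *)
Definition Upol i (s t : 'I_(d i).+1) : S :=
  \sum_(j < (d i).+1) ((nilpart (A i) (a i) ^+ j) s t)%:MP * binom_pol 'X_(tv vx) j.

(** The closed forms f(alpha) = A^k (f(z_k) - X_k) and g(alpha) = G_k g(z_k), with the variables of
    the outer polynomial ring in place of the values at z_k. *)
Definition num (x : fvars) : {mpoly S[M]} := match x with
  | inl u => (Wpos (tag u))%:MP * \sum_t (Upol (tagged u) t)%:MP *
       ('X_(enum_rank (ff t)) - ('X_(tv (inl (Tagged (fun i => 'I_(d i).+1) t))))%:MP)
  | inr h => ('X_(tv (vg h)))%:MP * 'X_(enum_rank (inr h : fvars)) end.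
Definition den (x : fvars) : {mpoly S[M]} := match x with
  | inl u => (Wneg (tag u))%:MP | inr _ => 1 end.

Variable ratQ : {rmorphism rat -> Q}.

Definition Phi : {mpoly S[M]} :=
  cleared (GRing.RMorphism.clone _ _ (@mpolyC M S \o (@mpolyC N Q \o ratQ)) _) tau (fun i => num (enum_val i)) (fun i => den (enum_val i)).

(** Stated for any ring morphism [H], since it is needed at the points of the orbit and at the
    formal specialisation that shows the series to be nonzero. *)
Lemma PhiE (B : comNzRingType) (H : {rmorphism {mpoly S[M]} -> B}) (iota : {rmorphism Q -> B})
    (k : nat) (sigma : vars -> B) (y x : fvars -> B) (ak : 'I_l -> B) :
  (forall c, H ((c%:MP)%:MP) = iota c) -> (forall t, H (('X_(tv t))%:MP) = sigma t) ->
  (forall t, H 'X_(enum_rank t) = y t) -> sigma vx = k%:R ->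
  (forall i, \prod_j sigma (vy j) ^+ posp (mu i j) = ak i * \prod_j sigma (vy j) ^+ negp (mu i j)) ->
  (forall i (s : 'I_(d i).+1), x (ff s) = ak i * \sum_t
     iota ((\sum_(j < (d i).+1) 'C(k, j)%:R *: nilpart (A i) (a i) ^+ j) s t) *
       (y (ff t) - sigma (inl (Tagged (fun i => 'I_(d i).+1) t)))) ->
  (forall h, x (inr h) = sigma (vg h) * y (inr h)) ->
  H Phi = (\prod_(i < M) H (den (enum_val i)) ^+ msize tau) *
     mmap (iota \o ratQ) (fun i : 'I_M => x (enum_val i)) tau.
Proof.
move=> HC Hs Hy Hk HW Hf Hg.
pose HS := GRing.RMorphism.clone _ _ (H \o @mpolyC M S) _.
have HSE p : H p%:MP = HS p by [].
rewrite /Phi (@clearedE _ _ _ _ _ _ _ _ H (fun i : 'I_M => x (enum_val i))) => [|i].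
  congr (_ * _); rewrite /mmap; apply: eq_bigr => c _; by rewrite /= HC.
case: (enum_val i) => [[i0 s]|h] /=; last by rewrite rmorph1 mul1r rmorphM Hs Hy Hg.
have Wp : H (Wpos i0)%:MP = \prod_j sigma (vy j) ^+ posp (mu i0 j).
  by rewrite HSE rmorph_prod; apply: eq_bigr => j _; rewrite rmorphXn -HSE Hs.
have Wn : H (Wneg i0)%:MP = \prod_j sigma (vy j) ^+ negp (mu i0 j).
  by rewrite HSE rmorph_prod; apply: eq_bigr => j _; rewrite rmorphXn -HSE Hs.
rewrite rmorphM Wp Wn HW Hf mulrAC [in RHS]mulrC; congr (_ * _ * _); rewrite rmorph_sum.
apply: eq_bigr => t _; rewrite rmorphM rmorphB Hy Hs; congr (_ * _).
rewrite HSE rmorph_sum summxE rmorph_sum; apply: eq_bigr => j _.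
rewrite (rmorphM HS) -HSE HC [X in _ = iota X]mxE (rmorphM iota) rmorph_nat [RHS]mulrC; congr (_ * _).
by apply: binom_polE => //; rewrite -HSE Hs.
Qed.
End Auxiliary.

(** An affine recursion becomes linear once a coordinate constantly equal to 1 is adjoined. *)
Lemma hgrow_aff (R : realType) (L : numFieldType) (D : nat) (w : 'cV[L]_D.+1) (rho : R) (rho1 : 1 < rho)
    (I : finType) (x : nat -> I -> L) (c : nat -> I * I -> L) (be : nat -> I -> L) (H : R) :
  height_le w (x 0%N) H -> hgrow w rho c -> hgrow w rho be ->
  (forall k i, x k.+1 i = \sum_j c k (i, j) * x k j + be k i) -> hgrow w rho x.
Proof.
move=> h0 hc hb hx.
have h01 : height_le w (fun _ : unit => 0 : L) (1 : R).
  by exists 1%N; split=> // _; exists 0; rewrite mulr0; split=> [|i j]; rewrite ?map_mx0 ?mul0mx ?scale0r // mxE normr0.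
have h11 := hgrow_const rho1 (height_nat R w 1).
pose y k (u : I + unit) := if u is inl i then x k i else 1.
pose c' k (u : (I + unit) * (I + unit)) := match u with
  | (inl i, inl j) => c k (i, j) | (inl i, inr _) => be k i | (inr _, inl _) => 0 | (inr _, inr _) => 1 end.
have hy : hgrow w rho y.
  apply: (@hgrow_rec _ _ _ _ _ rho1 _ y c' (H * 2%:R)).
  - have := height_union h0 (height_nat R w 1); apply: height_sub => -[i|[]]; first by exists (inl i).
    by exists (inr tt).
  - have := hgrow_union (hgrow_union hc hb) (hgrow_union (hgrow_const rho1 h01) h11).
    apply: hgrow_sub => k [[i|[]] [j|[]]]; [by exists (inl (inl (i, j)))|by exists (inl (inr i))| |].
      by exists (inr (inl tt)).
    by exists (inr (inr tt)).
  move=> k [i|[]]; rewrite big_sumType /= (big_pred1 tt) /=; try (by case).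
    by rewrite mulr1 hx.
  by rewrite big1 ?add0r ?mulr1 // => j _; rewrite mul0r.
by apply: hgrow_sub hy => k i; exists (inl i).
Qed.

(** The possible denominators of [x] form an ideal, so finitely many of them suffice at all points
    where [x] is defined. *)
Lemma finite_reps (K : fieldType) n (x : {fraction {mpoly K[n]}}) : exists s : seq ({mpoly K[n]} * {mpoly K[n]}),
  forall z y, ratfun_value x z y -> exists2 pq, pq \in s & y = pq.1.@[z] * (pq.2.@[z])^-1.
Proof.
pose D (q : {mpoly K[n]}) := exists p : {mpoly K[n]}, q%:F * x = p%:F.
have Dred p q c m : D p -> D q -> D (p - c *: ('X_[m] * q)).
  move=> [p' Ep] [q' Eq]; exists (p' - c *: ('X_[m] * q')).
  by rewrite !tofracB mulrBl Ep -!mul_mpolyC !tofracM -!mulrA Eq.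
have [s [sD hs]] := finite_nonvanishing Dred.
have /boolp.choice [num hnum] : forall q, exists p : {mpoly K[n]}, D q -> q%:F * x = p%:F.
  by move=> q; case: (boolp.EM (D q)) => [[p Ep]|h]; [exists p|exists 0].
exists [seq (num q, q) | q <- s] => z y hy.
have [P [Q [Qz E _]]] := hy.
have Q0 : Q != 0 by apply: contraNneq Qz => ->; rewrite meval0.
have DQ : D Q by exists P; rewrite E mulrC divfK // tofrac_eq0.
have [q qs qz] := hs z Q DQ Qz.
have q0 : q != 0 by apply: contraNneq qz => ->; rewrite meval0.
exists (num q, q) => /=; first exact: map_f.
have Ex : x = (num q)%:F / q%:F by rewrite -(hnum q (sD q qs)) mulrAC mulfV ?mul1r // tofrac_eq0.
by rewrite -(ratfun_value_rep hy q0 Ex) mulrAC mulfV ?mul1r.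
Qed.

Lemma pt_act_mnm (K : fieldType) n (Omega : 'M[nat]_n) (z : 'I_n -> K) m :
  mmap1 z (mnm_act Omega m) = mmap1 (pt_act Omega z) m :> K.
Proof.
rewrite /mmap1 /pt_act (eq_bigr (fun j => \prod_i z j ^+ (m i * Omega i j))) => [|j _]; last first.
  by rewrite mnmE expr_sum.
rewrite exchange_big /=; apply: eq_bigr => i _; rewrite -prodrXl; apply: eq_bigr => j _.
by rewrite mulnC exprM.
Qed.

Lemma pt_act_neq0 (K : fieldType) n (Omega : 'M[nat]_n) (z : 'I_n -> K) k j :
  (forall i, z i != 0) -> iter k (pt_act Omega) z j != 0.
Proof.
move=> z0; elim: k j => [|k IH] j //=; apply/prodf_neq0 => i _; exact: expf_neq0.
Qed.

Lemma mpoly_substE (R : realType) (K : numFieldType) n (Omega : 'M[nat]_n) (hI : condI R Omega) (p : {mpoly K[n]}) :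
  mpoly_subst Omega p = psub (ExpoMap (expo_map_act hI)) p.
Proof.
rewrite /mpoly_subst /psub; congr (_ \mPo _); apply: eq_from_tnth => i; rewrite !tnth_mktuple mpolyXE_id /=.
by apply: eq_bigr => j _; rewrite mnm_actU.
Qed.

Lemma ratfun_substE (R : realType) (K : numFieldType) n (Omega : 'M[nat]_n) (hI : condI R Omega) (q : {fraction {mpoly K[n]}}) :
  ratfun_subst Omega q = ratsub (ExpoMap (expo_map_act hI)) q.
Proof.
rewrite /ratfun_subst !(mpoly_substE hI) -ratsubE; last exact: denom_ratioP.
by congr (ratsub _ _); apply/esym; exact: frac_numden.
Qed.

Lemma series_relP (K : numFieldType) n (u w : mps K n) x :
  mps_eq_ratfun_mul u x w <-> series_rel u x w.
Proof.
split=> -[P [Q [Q0 E EQ]]]; exists P, Q; split=> //; first by apply: mpsP => k; exact: EQ.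
by move=> k; exact: (congr1 (fun s : mps K n => s k) EQ).
Qed.

Lemma mps_eq_ratfunP (K : numFieldType) n (u : mps K n) x : mps_eq_ratfun u x <-> series_rel u x 1.
Proof.
have E : ofp 1 = 1 :> mps K n by exact: rmorph1.
by rewrite -E; exact: (series_relP u (ofp 1) x).
Qed.

Lemma dexp_small (R : realType) (rho c : R) n (eps : 'I_n -> R) : 1 < rho -> 0 < c -> (forall j, 0 < eps j) ->
  exists k0, forall k j, (k0 <= k)%N -> dexp rho (- c) k < eps j.
Proof.
move=> rho1 c0 e0.
have one (e : R) : 0 < e -> exists k0, forall k, (k0 <= k)%N -> dexp rho (- c) k < e.
  move=> he; have r1 : 0 < rho - 1 by rewrite subr_gt0.
  have cr : 0 < c * (rho - 1) by rewrite mulr_gt0.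
  exists (Num.truncn (e^-1 / (c * (rho - 1)))).+1 => k hk.
  have bern : (rho - 1) * k%:R <= rho ^+ k.
    apply: le_trans (_ : 1 + (rho - 1) * k%:R <= _); first by rewrite lerDr.
    elim: (k) => [|i IH]; first by rewrite mulr0 addr0 expr0.
    rewrite exprS -natr1 mulrDr mulr1; move: IH; have := rhoX_ge1 rho1 i; move: (rho ^+ i) => z z1 IH.
    have : (rho - 1) * z >= rho - 1 by rewrite ler_peMr // ltW.
    by move: IH; move: ((rho - 1) * i%:R) => y; rewrite mulrBl mul1r; lra.
  have big : e^-1 < c * rho ^+ k.
    apply: lt_le_trans (_ : c * ((rho - 1) * k%:R) <= _); last by rewrite ler_wpM2l // ltW.
    rewrite mulrA mulrC -ltr_pdivrMr //; apply: lt_le_trans (truncnS_gt _) _; by rewrite ler_nat.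
  rewrite /dexp mulNr exp.expRN -[e]invrK ltf_pV2 ?posrE ?invr_gt0 ?exp.expR_gt0 //.
  by apply: lt_le_trans big _; apply: le_trans (exp.expR_ge1Dx _); rewrite lerDr.
have /boolp.choice [k0 hk0] := fun j => one (eps j) (e0 j).
exists (\max_j k0 j)%N => k j hk; apply: hk0; apply: leq_trans hk; exact: leq_bigmax.
Qed.

Lemma lin_val (K : numFieldType) n (R : realType) (C : fieldType) (v : C -> R) (emb : {rmorphism K -> C})
    (hv : is_absolute_value v) z (F : mps K n) d (c : 'I_d -> K) (G : 'I_d -> mps K n) x s y :
  val_rel z (F - \sum_t cst n (c t) * G t) x 1 ->
  mps_sum v (mpsmap emb F) (emb \o z) s -> (forall t, mps_sum v (mpsmap emb (G t)) (emb \o z) (y t)) ->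
  s - \sum_t emb (c t) * y t = emb x.
Proof.
move=> rel hs hy; rewrite -[RHS]mulr1.
have -> : s - \sum_t emb (c t) * y t = s + \sum_t emb (- c t) * y t.
  by rewrite -sumrN; congr (_ + _); apply: eq_bigr => t _; rewrite rmorphN mulNr.
apply: (val_rel_sum_eq hv rel); last by rewrite rmorph1; exact: mps_sum1.
have -> : mpsmap emb (F - \sum_t cst n (c t) * G t) = mpsmap emb F + \sum_t cst n (emb (- c t)) * mpsmap emb (G t).
  rewrite rmorphB rmorph_sum -sumrN; congr (_ + _); apply: eq_bigr => t _.
  rewrite rmorphM rmorphN (rmorphN (@cst C n)) mulNr; congr (- (_ * _)).
  by rewrite /cst /= mpsmap_ofp map_mpolyC.
by apply: mps_sumD => //; apply: mps_sum_sum => // t _; exact: (mps_sumZ hv).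
Qed.

Lemma solve_inv (K C : fieldType) (phi : {rmorphism K -> C}) d (A : 'M[K]_d.+1) (y y' x : 'I_d.+1 -> C) :
  A \in unitmx -> (forall s, y s - \sum_t phi (A s t) * y' t = x s) ->
  forall s, y' s = \sum_t phi (invmx A s t) * (y t - x t).
Proof.
move=> uA h s; have E : map_mx phi A *m (\col_t y' t) = \col_t (y t - x t).
  apply/colP => u; rewrite !mxE -(h u) opprB addrC subrK.
  by apply: eq_bigr => t _; rewrite !mxE.
have uA' : map_mx phi A \in unitmx by rewrite map_unitmx.
have : \col_t y' t = invmx (map_mx phi A) *m \col_t (y t - x t) by rewrite -E mulKmx.
move=> /colP /(_ s); rewrite !mxE => ->; apply: eq_bigr => t _.
by rewrite -map_invmx !mxE.
Qed.

Lemma posp_negp (K : fieldType) (x : K) z : x != 0 -> x ^+ posp z = x ^ z * x ^+ negp z.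
Proof.
move=> x0; case: z => k; first by rewrite /= expr0 mulr1 -exprnP.
by rewrite -[x ^ Negz k]/((x ^+ k.+1)^-1) mulVf // expf_neq0.
Qed.

Section Rename.
Variables (l m r : nat) (d : 'I_l -> nat) (A1 : comNzRingType) (iota : {rmorphism rat -> A1}).
Local Notation vars := (vars m r d).
Local Notation vx := (vx m r d).
Local Notation N := #|{: vars}|.
Local Notation tv := (tv (@vkey l m r d)).
Local Notation vt := (vt (@vkey l m r d) vx).
Local Notation fvars := (fvars m d).
Local Notation M := #|{: fvars}|.
Variable tau : {mpoly rat[M]}.

Definition incl (x : fvars) : vars := match x with inl u => inl u | inr h => inr (inr (inr h)) end.

(** The relation rewritten in the variables of the difference operator, where its vanishing along
    the orbit can be tested. *)
Definition rename : {mpoly A1[N]} :=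
  mmap (@mpolyC N A1 \o iota) (fun i : 'I_M => 'X_(tv (incl (enum_val i)))) tau.

(** Sending the additional variables to 0 recovers [tau]. *)
Lemma rename_neq0 : injective iota -> tau != 0 -> rename != 0.
Proof.
move=> iI tau0; pose back := mmap (@mpolyC M A1) (fun v : 'I_N => match vt v with
  | inl u => 'X_(enum_rank (inl u : fvars)) | inr (inr (inr h)) => 'X_(enum_rank (inr h : fvars)) | _ => 0 end).
have E : back rename = map_mpoly iota tau.
  apply: (mpoly_rmorph_eq (A := rat) (f := back \o mmap (@mpolyC N A1 \o iota) (fun i : 'I_M => 'X_(tv (incl (enum_val i)))))
    (g := map_mpoly iota)) => [c|i] /=.
    by rewrite /back mmapC map_mpolyC /= mmapC.
  rewrite /back mmapX mmap1U map_mpolyX mmapX mmap1U tvK.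
  by case E : (enum_val i) => [u|h] /=; rewrite -E enum_valK.
apply: contraNneq tau0 => Z; apply/eqP/mpolyP => x; rewrite mcoeff0; apply: iI.
have B0 : back 0 = 0 by exact: rmorph0.
by rewrite -mcoeff_map_mpoly -E Z B0 mcoeff0 rmorph0.
Qed.

Lemma rename_eval (B : comNzRingType) (h : {rmorphism A1 -> B}) (S : vars -> B) :
  mmap h (fun v => S (vt v)) rename = mmap (h \o iota) (fun i => S (incl (enum_val i))) tau.
Proof.
apply: (mpoly_rmorph_eq (A := rat) (f := mmap h (fun v => S (vt v)) \o mmap (@mpolyC N A1 \o iota) (fun i : 'I_M => 'X_(tv (incl (enum_val i)))))
    (g := mmap (h \o iota) (fun i => S (incl (enum_val i))))) => [c|i] /=.
  by rewrite !mmapC /= ?mmapC.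
by rewrite !mmapX !mmap1U ?mmapX ?mmap1U tvK.
Qed.
End Rename.

Section PhiSeries.
Variables (Q : fieldType) (n l m r : nat) (d : 'I_l -> nat).
Hypothesis char0 : forall j, j`!%:R != 0 :> Q.
Local Notation vars := (vars m r d).
Local Notation N := #|{: vars}|.
Local Notation vx := (vx m r d).
Local Notation tv := (tv (@vkey l m r d)).
Local Notation vt := (vt (@vkey l m r d) vx).
Local Notation fvars := (fvars m d).
Local Notation M := #|{: fvars}|.
Local Notation S := {mpoly Q[N]}.
Variables (A : forall i : 'I_l, 'M[Q]_((d i).+1)) (a : 'I_l -> Q) (mu : 'I_l -> 'I_r -> int).
Variables (tau : {mpoly rat[M]}) (ratQ : {rmorphism rat -> Q}) (u : fvars -> mps Q n).
Hypothesis tau_neq0 : mmap (@cst Q n \o ratQ) (fun i : 'I_M => u (enum_val i)) tau <> 0.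

(* The auxiliary series specialises to tau(f, g) at x = 0, X = 0, y = 1, G = 1. *)
Lemma Phi_series_neq0 :
  mmap (@cst S n) (fun i : 'I_M => mpsmap (@mpolyC N Q) (u (enum_val i))) (Phi A a mu tau ratQ) <> 0.
Proof.
pose s0 (x : vars) : Q := match x with inl _ => 0 | inr (inl _) => 0 | _ => 1 end.
pose sp := GRing.RMorphism.clone _ _ (mmap (@idfun Q) (fun v : 'I_N => s0 (vt v))) _.
pose H := GRing.RMorphism.clone _ _ (mmap (@cst Q n \o sp) (fun i : 'I_M => u (enum_val i))) _.
have HC c : H c%:MP = cst n (sp c) by exact: mmapC.
have spX t : sp 'X_(tv t) = s0 t by rewrite [LHS]mmapX mmap1U tvK.
have HF : mpsmap sp (mmap (@cst S n) (fun i : 'I_M => mpsmap (@mpolyC N Q) (u (enum_val i))) (Phi A a mu tau ratQ)) = H (Phi A a mu tau ratQ).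
  apply: (mpoly_rmorph_eq (A := S) (f := mpsmap sp \o mmap (@cst S n) (fun i : 'I_M => mpsmap (@mpolyC N Q) (u (enum_val i)))) (g := H)) => [c|i] /=.
    by rewrite mmapC HC /cst mpsmap_ofp map_mpolyC.
  rewrite [RHS]mmapX mmapX !mmap1U; apply: mpsP => k /=; exact: mmapC.
move=> Z; apply: tau_neq0; move: HF; rewrite Z rmorph0.
rewrite (@PhiE Q l m r d char0 A a mu tau ratQ _ H (@cst Q n) 0 (fun x => cst n (s0 x)) u u (fun _ => 1)).
- rewrite big1 ?mul1r => [/esym //|i _]; case: (enum_val i) => [w|h] /=; last by rewrite rmorph1 expr1n.
  rewrite HC /Wneg rmorph_prod big1 ?rmorph1 ?expr1n // => j _.
  by rewrite rmorphXn spX expr1n.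
- by move=> c; rewrite HC; congr (cst n _); exact: mmapC.
- by move=> t; rewrite HC spX.
- by move=> t; rewrite [LHS]mmapX mmap1U enum_rankK.
- by rewrite /= rmorph0.
- by move=> i; rewrite mul1r !big1 // => j _; rewrite rmorph1 expr1n.
- move=> i s; have -> : \sum_(j < (d i).+1) 'C(0, j)%:R *: nilpart (A i) (a i) ^+ j = 1.
    rewrite big_ord_recl bin0 scale1r expr0 big1 ?addr0 // => j _.
    by rewrite bin_small // scale0r.
  rewrite mul1r (bigD1 s) //= mxE eqxx rmorph1 mul1r rmorph0 subr0 big1 ?addr0 // => t nt.
  by rewrite mxE eq_sym (negbTE nt) rmorph0 mul0r.
- by move=> h; rewrite rmorph1 mul1r.
Qed.
End PhiSeries.

(** * From a relation between values to the two alternatives *)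

Theorem theorem3p3
    (R : realType) (p : place)
    (C : fieldType) (v : C -> R) (hC : is_Cp p v)
    (emb : {rmorphism algC -> C})
    (K : fieldExtType rat) (kappa : {rmorphism K -> algC})
    (n : nat) (Omega : 'M[nat]_n)
    (rho : R) (hrho : max_eigenvalue_modulus Omega rho)
    (l m : nat) (d : 'I_l -> nat)
    (f : forall i : 'I_l, 'I_(d i).+1 -> mpseries K n)
    (g : 'I_m -> mpseries K n)
    (r : 'I_n -> R) (hr : forall j, 0 < r j)
    (hg0 : forall h, g h 0%MM <> 0)
    (hf_conv : forall i j,
       mps_converges_on v r (mps_map emb (mps_map kappa (f i j))))
    (hg_conv : forall h,
       mps_converges_on v r (mps_map emb (mps_map kappa (g h))))
    (A : forall i : 'I_l, 'M[algC]_((d i).+1)) (a : 'I_l -> algC)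
    (b : forall i : 'I_l, 'I_(d i).+1 -> {fraction {mpoly algC[n]}})
    (e : 'I_m -> {fraction {mpoly algC[n]}})
    (hA_GL : forall i, A i \in unitmx)
    (hA_trig : forall i (s t : 'I_(d i).+1), (s < t)%N -> A i s t = 0)
    (hA_diag : forall i s, A i s s = a i)
    (ha : forall i, a i <> 0)
    (hA_sub : forall i (s t : 'I_(d i).+1), s = t.+1 :> nat -> A i s t <> 0)
    (hf : forall i j,
       mps_eq_ratfun
         (fun k => kappa (f i j k)
            - \sum_t A i j t * mps_subst Omega (mps_map kappa (f i t)) k)
         (b i j))
    (hg : forall h,
       mps_eq_ratfun_mul (mps_map kappa (g h)) (e h)
         (mps_subst Omega (mps_map kappa (g h))))
    (alpha : 'I_n -> algC)
    (halphaU : in_polydisc v r (emb \o alpha))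
    (halpha0 : forall j, alpha j <> 0)
    (hI : condI R Omega)
    (hII : condII Omega rho)
    (hIII : condIII Omega v (emb \o alpha) rho)
    (hIV : condIV Omega v (emb \o alpha) p)
    (hb_def : forall i j k,
       exists y, ratfun_value (b i j) (iter k (pt_act Omega) alpha) y)
    (he_def : forall h k,
       exists2 y, ratfun_value (e h) (iter k (pt_act Omega) alpha) y & y <> 0)
    (hdep : alg_dependent_over_Q emb
       (fun x : ({i : 'I_l & 'I_(d i).+1} + 'I_m)%type =>
          match x with
          | inl ij =>
              mps_eval v (mps_map emb (mps_map kappa (f (tag ij) (tagged ij))))
                (emb \o alpha)
          | inr h =>
              mps_eval v (mps_map emb (mps_map kappa (g h))) (emb \o alpha)
          end)) :
  (exists (I : {set 'I_l}) (c : 'I_l -> algC)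
          (S : {fraction {mpoly algC[n]}}),
     [/\ I != set0,
         forall i, i \in I -> c i <> 0,
         forall i i', i \in I -> i' \in I -> a i = a i',
         mps_eq_ratfun (fun k => \sum_(i in I) c i * kappa (f i ord0 k)) S
       & forall i0, i0 \in I ->
           S = ratfun_const n (a i0) * ratfun_subst Omega S
               + \sum_(i in I) ratfun_const n (c i) * b i ord0])
  \/
  (exists (D : 'I_m -> int) (S : {fraction {mpoly algC[n]}}),
     [/\ exists h, D h <> 0,
         S <> 0
       & S = ratfun_subst Omega S * \prod_(h < m) e h ^ D h]).
Proof.
pose act := ExpoMap (expo_map_act hI).
have [hv v_nat] := Cp_abs hC.
have rho1 := rho_gt1 hI hrho hII.
pose fL i (s : 'I_(d i).+1) : mps algC n := MPS (fun k => kappa (f i s k)).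
pose gL h : mps algC n := MPS (fun k => kappa (g h k)).
have rf i (s : 'I_(d i).+1) : series_rel (fL i s - \sum_t cst n (A i s t) * sub act (fL i t)) (b i s) 1.
  have E : (fun k => kappa (f i s k) - \sum_t A i s t * mps_subst Omega (mps_map kappa (f i t)) k)
      = mpsf (fL i s - \sum_t cst n (A i s t) * sub act (fL i t)).
    apply: boolp.funext => k; rewrite mpsB mps_sumE; congr (_ - _); apply: eq_bigr => t _.
    by rewrite ofpCM.
  by have := hf i s; rewrite E => /mps_eq_ratfunP.
have rg h : series_rel (gL h) (e h) (sub act (gL h)) by apply/series_relP; exact: hg.
have gL0 h : gL h <> 0.
  move=> /(congr1 (fun u : mps algC n => u 0%MM)) /= /eqP; rewrite fmorph_eq0 => /eqP; exact: hg0.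
have a0 i : a i != 0 by apply/eqP; exact: ha.
have As i (s t : 'I_(d i).+1) : s = t.+1 :> nat -> A i s t != 0 by move=> st; apply/eqP; exact: (hA_sub i).
apply: boolp.contrapT => neg.
have no_lin : ~ linear_conclusion act fL a b.
  move=> [I [c [S [I0 c0 aI rel HS]]]]; apply: neg; left; exists I, c, S; split=> //; last first.
    by move=> i0 i0I; rewrite (ratfun_substE hI); exact: HS.
  have E : (fun k => \sum_(i in I) c i * kappa (f i ord0 k)) = mpsf (\sum_(i in I) cst n (c i) * fL i ord0).
    by apply: boolp.funext => k; rewrite mps_sumE; apply: eq_bigr => i _; rewrite ofpCM.
  by rewrite E; apply/mps_eq_ratfunP.
have no_mul : ~ mult_conclusion act e.
  move=> [Dd [S [h0 S0 HS]]]; apply: neg; right; exists Dd, S; split=> //.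
  by rewrite (ratfun_substE hI).
pose zk k := iter k (pt_act Omega) alpha.
have zkE k x : mmap1 (zk k) (act x) = mmap1 (zk k.+1) x by exact: pt_act_mnm.
have alpha0 j : alpha j != 0 by apply/eqP; exact: halpha0.
have zkC k : iter k (pt_act Omega) (emb \o alpha) = emb \o zk k.
  elim: k => //= k ->; apply: boolp.funext => i; rewrite /pt_act /= rmorph_prod.
  by apply: eq_bigr => j _; rewrite rmorphXn.
have /boolp.choice [bv hbv] : forall u : nat * {i : 'I_l & 'I_(d i).+1}, exists y,
    ratfun_value (b (tag u.2) (tagged u.2)) (zk u.1) y by move=> u; exact: hb_def.
pose bval k i (s : 'I_(d i).+1) := bv (k, Tagged (fun i => 'I_(d i).+1) s).
have bvalP k i (s : 'I_(d i).+1) : ratfun_value (b i s) (zk k) (bval k i s) := hbv (k, Tagged _ s).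
have /boolp.choice [evl hev] : forall u : nat * 'I_m, exists y, ratfun_value (e u.2) (zk u.1) y /\ y != 0.
  by move=> u; have [y h /eqP y0] := he_def u.2 u.1; exists y.
pose eval k h := evl (k, h).
have evalP k h : ratfun_value (e h) (zk k) (eval k h) by case: (hev (k, h)).
have eval0 k h : eval k h != 0 by case: (hev (k, h)).
have IV1 : nonvanishing_along Omega v (emb \o alpha) 1 by move: hIV; case: (p) => [|q pq] //= /(_ 1%N isT).
(* Condition (IV) for a polynomial, which converges everywhere. *)
have poly_nv (c : {mpoly algC[n]}) : c != 0 -> forall k1, exists2 k, (k1 <= k)%N & c.@[zk k] != 0.
  move=> c0 k1; pose u := mpsmap emb (ofp c).
  have hs z : mps_sum v u z ((map_mpoly emb c).@[z] * 1).
    rewrite /u mpsmap_ofp -[ofp _]mulr1; apply: (mps_sum_ofpM hv); exact: mps_sum1.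
  have u0 : exists x, u x <> 0.
    have [x cx] : exists x, (ofp c) x != 0 by apply: mps_neq0 => /eqP; rewrite ofp_eq0 (negbTE c0).
    by exists x; apply/eqP; rewrite fmorph_eq0.
  have cv : mps_converges_near0 v u by exists (fun _ => 1) => // z _; exists ((map_mpoly emb c).@[z] * 1).
  have [k lt [s hs' s0]] := IV1 _ u0 cv k1; exists k; first exact: ltnW.
  move: hs'; rewrite mul1n zkC => /(mps_sum_uniq hv (hs _)); rewrite emb_meval mulr1 => E.
  by apply/negP => /eqP Z; apply: s0; rewrite -E Z rmorph0.
have [c c_gt0 [k3 hk3]] := hIII.
(* Half the absolute values at [alpha], the radii for which [mabs_bound] gives absolute
   convergence. *)
pose be j := v ((emb \o zk 0%N) j) / 2.
have be_gt0 j : 0 < be j by rewrite divr_gt0 // (abs_gt0 hv) fmorph_eq0.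
have small k j : (k3 <= k)%N -> v (emb (zk k j)) <= dexp rho (- c) k.
  move=> hk; have := hk3 k j hk; rewrite zkC /= => le.
  have pos : 0 < v (emb (zk k j)) by rewrite (abs_gt0 hv) fmorph_eq0 pt_act_neq0.
  by rewrite -[v _](exp.lnK (x := v _)) ?posrE // /dexp exp.ler_expR.
have c2 : 0 < c / 2 by rewrite divr_gt0.
have [k4 hk4] := dexp_small rho1 c_gt0 hr.
have [k5 hk5] := dexp_small rho1 c_gt0 (fun j => mulr_gt0 (x := 2^-1) (y := be j) (ltac:(by rewrite invr_gt0)) (be_gt0 j)).
have [k6 hk6] := dexp_small rho1 c2 be_gt0.
(* From [K0] on, the points lie in the polydisc and within half of the radii [be], and half of the
   decay rate [c] is left after the factor [be j] has been extracted. *)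
pose K0 := maxn k3 (maxn k4 (maxn k5 k6)).
have K0P k : (K0 <= k)%N -> [/\ (k3 <= k)%N, (k4 <= k)%N, (k5 <= k)%N & (k6 <= k)%N].
  by rewrite !geq_max => /and4P[].
have pdk k : (K0 <= k)%N -> in_polydisc v r (emb \o zk k).
  by move=> /K0P[h3 h4 _ _] j; apply: le_lt_trans (small k j h3) (hk4 k j h4).
have half k j : (K0 <= k)%N -> v ((emb \o zk k) j) <= 2^-1 * be j.
  by move=> /K0P[h3 _ h5 _]; apply: le_trans (small k j h3) (ltW (hk5 k j h5)).
have tiny k j : (K0 <= k)%N -> v (emb (zk k j)) <= dexp rho (- (c / 2)) k * be j.
  move=> /K0P[h3 _ _ h6]; apply: le_trans (small k j h3) _.
  rewrite [c in dexp rho (- c)]splitr opprD -dexpD ler_wpM2l ?(ltW (dexp_gt0 _ _ _)) //; exact/ltW/hk6.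
pose FV := fvars m d; pose M := #|{: FV}|.
pose ff i (s : 'I_(d i).+1) : FV := inl (Tagged (fun i => 'I_(d i).+1) s).
pose fg (x : FV) : mps algC n := match x with inl u => fL (tag u) (tagged u) | inr h => gL h end.
have fg_conv x z : in_polydisc v r z -> exists s, mps_sum v (mpsmap emb (fg x)) z s.
  by case: x => [[i s]|h] hz; [exact: (hf_conv i s z hz)|exact: (hg_conv h z hz)].
(* Values of the series along the orbit, with the default 0 while the point is outside the
   polydisc. *)
have /boolp.choice [Y hY] : forall u : nat * FV, exists y,
    in_polydisc v r (emb \o zk u.1) -> mps_sum v (mpsmap emb (fg u.2)) (emb \o zk u.1) y.
  move=> u; case: (boolp.EM (in_polydisc v r (emb \o zk u.1))) => [h|h]; last by exists 0.
  by have [y hy] := fg_conv u.2 _ h; exists y.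
have /boolp.choice [Bd hBd] : forall x, exists B, forall d', (mabs v d' (mpsmap emb (fg x))).@[be] <= B.
  by move=> x; exact: (mabs_bound hv (hY (0%N, x) halphaU)).
have [tau tau0 htau] := hdep.
have {htau} htau : mmap (emb \o @ratr algC) (fun i : 'I_M => Y (0%N, enum_val i)) tau = 0.
  rewrite -[RHS]htau /mmap; apply: eq_bigr => x _; congr (_ * _); rewrite /mmap1; apply: eq_bigr => i _; congr (_ ^+ _).
  have hy := hY (0%N, enum_val i) halphaU.
  have ex : exists s, mps_sum v (mpsmap emb (fg (enum_val i))) (emb \o zk 0%N) s by exists (Y (0%N, enum_val i)).
  have := mps_sum_uniq hv hy (classical_sets.xgetPex 0 ex).
  by case: (enum_val i) => [[i0 s]|h] ->.
have gstep k x s : mps_sum v (mpsmap emb x) (emb \o zk k.+1) s -> mps_sum v (mpsmap emb (sub act x)) (emb \o zk k) s.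
  by move=> h; apply: (mps_sum_iter zkE (k := 1)); rewrite addn1.
have Yf k i (s : 'I_(d i).+1) : (K0 <= k)%N -> Y (k.+1, ff i s) =
    \sum_t emb (invmx (A i) s t) * (Y (k, ff i t) - emb (bval k i t)).
  move=> hk; apply: (solve_inv (y' := fun s => Y (k.+1, ff i s))) => // u.
  apply: (lin_val hv (val_rel_ratfun (rf i u) (bvalP k i u))) => [|t].
    exact: (hY (k, ff i u) (pdk k hk)).
  exact/gstep/(hY (k.+1, ff i t) (pdk _ (leqW hk))).
have Yg k h : (K0 <= k)%N -> Y (k, inr h) = emb (eval k h) * Y (k.+1, inr h).
  move=> hk; apply: (val_rel_sum_eq hv (val_rel_ratfun (rg h) (evalP k h))).
    exact: (hY (k, inr h) (pdk k hk)).
  exact/gstep/(hY (k.+1, inr h) (pdk _ (leqW hk))).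
have Yg' k h : (K0 <= k)%N -> Y (k.+1, inr h) = emb (eval k h)^-1 * Y (k, inr h).
  by move=> hk; rewrite (Yg k h hk) fmorphV mulKf // fmorph_eq0.
(* A zero of [g h] at one late point would propagate to all later ones, against (IV) for the nonzero
   series [g h]. *)
have Yg0 k h : (K0 <= k)%N -> Y (k, inr h) != 0.
  move=> hk; apply/eqP => Z.
  have all0 j : Y ((k + j)%N, inr h) = 0.
    elim: j => [|j IH]; first by rewrite addn0.
    by rewrite addnS Yg' ?IH ?mulr0 //; exact: leq_trans hk (leq_addr _ _).
  have u0 : exists x, mpsmap emb (gL h) x <> 0.
    by exists 0%MM; apply/eqP; rewrite /= !fmorph_eq0; apply/eqP; exact: hg0.
  have cv : mps_converges_near0 v (mpsmap emb (gL h)) by exists r => //; exact: (hg_conv h).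
  have [k' lt [s hs s0]] := IV1 _ u0 cv k; apply: s0; rewrite -(all0 (k' - k)%N) (subnKC (ltnW lt)).
  move: hs; rewrite mul1n zkC => hs; apply: (mps_sum_uniq hv hs).
  exact: (hY (k', inr h) (pdk _ (leq_trans hk (ltnW lt)))).
(* Independent numbers in which every [a i] is a monomial up to a root of unity of order dividing
   [T]. *)
have [t [t0 ti [T T0 hT]]] : exists t : seq algC, [/\ forall x, x \in t -> x != 0,
    forall D : nat -> int, \prod_(j < size t) t`_j ^ D j = 1 -> forall j, (j < size t)%N -> D j = 0
    & exists2 T : nat, (0 < T)%N & forall x, x \in [seq a i | i <- enum 'I_l] -> exists D : nat -> int,
        x ^+ T = (\prod_(j < size t) t`_j ^ D j) ^+ T].
  by apply: mult_indep_basis => x /mapP[i _ ->].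
pose rr := size t; pose at_ (j : 'I_rr) := t`_j.
have at0 j : at_ j != 0 by apply: t0; exact: mem_nth.
have at_ind (D : 'I_rr -> int) : \prod_j at_ j ^ D j = 1 -> forall j, D j = 0.
  move=> E j; pose D' (k : nat) : int := if insub k is Some k' then D k' else 0.
  have D'E (k : 'I_rr) : D' k = D k by rewrite /D' valK.
  by rewrite -D'E; apply: ti => //; rewrite -[RHS]E; apply: eq_bigr => k _; rewrite D'E.
have nonvan := orbit_nonvanishing hA_GL hA_trig hA_diag a0 As rf rg gL0 at_ind at0 zkE poly_nv bvalP evalP eval0 no_lin no_mul.
pose T1 := mmap (@cst algC n \o @ratr algC) (fun i : 'I_M => fg (enum_val i)) tau.
(* If [tau] held between the series, it would hold between their values at all late points. These
   values obey the rules of the difference operator with [inv] true, so [nonvan] excludes it. *)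
have T1_neq0 : T1 <> 0.
  move=> Z.
  pose S k (x : vars m rr d) : C := match x with inl u => Y (k, inl u) | inr (inl _) => k%:R
    | inr (inr (inl j)) => emb (at_ j ^+ k) | inr (inr (inr h)) => Y (k, inr h) end.
  pose A1 := GRing.RMorphism.clone _ _ (@mpolyC n algC \o @ratr algC) _.
  have G0 : rename rr A1 tau != 0.
    by apply: rename_neq0 => // x y /(congr1 (mcoeff 0%MM)) /=; rewrite !mcoeffC eqxx !mulr1 => /fmorph_inj.
  have Sx k : S k.+1 (vx m rr d) = S k (vx m rr d) + 1 by rewrite /= natr1.
  have Sy k j : S k.+1 (inr (inr (inl j))) = emb (at_ j) * S k (inr (inr (inl j))) by rewrite /= exprS rmorphM.
  have Sy0 k j : S k (inr (inr (inl j))) != 0 by rewrite /= fmorph_eq0 expf_neq0.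
  have [k [hk _]] := nonvan C emb true S K0 1%N Yf Sx Sy Yg' Sy0 Yg0 isT _ G0 K0.
  rewrite rename_eval => /eqP; apply.
  pose P := map_mpoly (emb \o @ratr algC) tau.
  have := @zero_series_value R C v hv n M P (fun i => mpsmap emb (fg (enum_val i))) (fun i => Y (k, enum_val i))
    (fun i => Bd (enum_val i)) (emb \o zk k) be (fun j => ltW (be_gt0 j)) (fun j => half k j hk) (fun i => hBd (enum_val i))
    (fun i => mps_sum_tends (hY (k, enum_val i) (pdk k hk))).
  have EP : mmap (@cst C n) (fun i : 'I_M => mpsmap emb (fg (enum_val i))) P = mpsmap emb T1.
    apply: (mpoly_rmorph_eq (A := rat) (f := mmap (@cst C n) (fun i : 'I_M => mpsmap emb (fg (enum_val i))) \o map_mpoly (emb \o @ratr algC))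
      (g := mpsmap emb \o mmap (@cst algC n \o @ratr algC) (fun i : 'I_M => fg (enum_val i)))) => [q|i] /=.
      by rewrite map_mpolyC !mmapC /= /cst mpsmap_ofp map_mpolyC.
    by rewrite map_mpolyX !mmapX !mmap1U.
  rewrite EP Z rmorph0 => /(_ erefl) <-.
  rewrite /P; apply/esym; apply: (mpoly_rmorph_eq (A := rat) (f := meval (fun i : 'I_M => Y (k, enum_val i)) \o map_mpoly (emb \o @ratr algC))
      (g := mmap ((emb \o meval (zk k)) \o A1) (fun i : 'I_M => S k (incl rr (enum_val i))))) => [q|i] /=.
    by rewrite map_mpolyC mevalC mmapC /= mevalC.
  by rewrite map_mpolyX mevalXU mmapX mmap1U; case: (enum_val i).
pose FR := {fraction {mpoly algC[n]}}.
pose be_ (x : FV) : FR := match x with inl u => b (tag u) (tagged u) | inr h => e h end.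
have /boolp.choice [reps hreps] : forall x : FV, exists s : seq ({mpoly algC[n]} * {mpoly algC[n]}),
    forall z y, ratfun_value (be_ x) z y -> exists2 pq, pq \in s & y = pq.1.@[z] * (pq.2.@[z])^-1.
  by move=> x; exact: finite_reps.
pose coefs (P : {mpoly algC[n]}) := [seq P@_m | m <- msupp P].
pose UA := {i : 'I_l & ('I_(d i).+1 * 'I_(d i).+1)%type}.
(* One number field has to contain the point, the matrices, the independent numbers, and the
   coefficients of the finitely many representations of the [b] and [e]. *)
pose big := [seq alpha j | j <- enum 'I_n] ++ ([seq A (tag u) (tagged u).1 (tagged u).2 | u <- enum [set: UA]] ++ (t ++
  flatten [seq flatten [seq coefs pq.1 ++ coefs pq.2 | pq <- reps x] | x <- enum [set: FV]])).
have [Q [h [D [w [lift liftK w_ind hts]]]]] := number_field kappa big.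
pose inQ x := exists y, h y = x.
have fam (I : finType) (x : I -> algC) : (forall i, inQ (x i)) -> exists H : R, height_le w x H.
  move=> /boolp.choice [y hy]; have [H hH] := hts R I y; exists H; apply: height_sub hH => i.
  by exists i; rewrite /= hy.
have inA i s u : inQ (A i s u).
  apply: lift; rewrite !mem_cat; apply/orP; right; apply/orP; left.
  by apply/mapP; exists (Tagged (fun i => ('I_(d i).+1 * 'I_(d i).+1)%type) (s, u)); rewrite ?mem_enum ?inE.
have inal j : inQ (alpha j) by apply: lift; rewrite !mem_cat map_f ?mem_enum.
have inat j : inQ (at_ j) by apply: lift; rewrite !mem_cat /at_ mem_nth ?orbT.
have in0 : inQ 0 by exists 0; rewrite rmorph0.
have in1 : inQ 1 by exists 1; rewrite rmorph1.
have incoef x pq P k : pq \in reps x -> P = pq.1 \/ P = pq.2 -> inQ P@_k.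
  move=> pqr EP; case kP: (k \in msupp P); last first.
    by move/negbT: kP; rewrite -mcoeff_eq0 => /eqP ->.
  apply: lift; rewrite !mem_cat; do 3 (apply/orP; right).
  apply/flattenP; exists (flatten [seq coefs pq.1 ++ coefs pq.2 | pq <- reps x]).
    by apply: map_f; rewrite mem_enum inE.
  apply/flattenP; exists (coefs pq.1 ++ coefs pq.2); first exact: (map_f (fun pq => coefs pq.1 ++ coefs pq.2)).
  by rewrite mem_cat; case: EP => <-; rewrite (map_f (fun m => P@_m) kP) ?orbT.
have /boolp.choice [Ay hAy] : forall u : UA, exists y, h y = A (tag u) (tagged u).1 (tagged u).2 by move=> u; exact: inA.
(* The data are brought down to [Q], so that the coefficients of the combination of high order lie
   in the number field in which heights are measured. *)
pose A' i : 'M[Q]_((d i).+1) := \matrix_(s, u) Ay (Tagged (fun i => ('I_(d i).+1 * 'I_(d i).+1)%type) (s, u)).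
have hA' i : map_mx h (A' i) = A i by apply/matrixP => s u; rewrite !mxE hAy.
have hA'E i s u : h (A' i s u) = A i s u.
  by have := congr1 (fun B : 'M_((d i).+1) => B s u) (hA' i); rewrite [LHS]mxE.
pose a' i := A' i ord0 ord0.
have ha' i : h (a' i) = a i := etrans (hA'E i ord0 ord0) (hA_diag i ord0).
have A'_trig i (s u : 'I_(d i).+1) : (s < u)%N -> A' i s u = 0.
  by move=> su; apply: (fmorph_inj h); rewrite rmorph0; apply: etrans (hA'E i s u) (hA_trig i s u su).
have A'_diag i (s : 'I_(d i).+1) : A' i s s = a' i.
  by apply: (fmorph_inj h); rewrite ha'; apply: etrans (hA'E i s s) (hA_diag i s).
have a'0 i : a' i != 0 by rewrite -(fmorph_eq0 h) ha'.
have inv_in i s u : inQ (invmx (A i) s u).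
  by exists (invmx (A' i) s u); rewrite -hA' -map_invmx mxE.
have /boolp.choice [fy hfy] : forall u : FV * 'X_{1..n}, exists y, h y = fg u.1 u.2.
  by move=> [[[i s]|h0] k]; exact: liftK.
pose fQ x : mps Q n := MPS (fun k => fy (x, k)).
have hfQ x : mpsmap h (fQ x) = fg x by apply: mpsP => k; exact: (hfy (x, k)).
have gcst (I : finType) (x : I -> algC) : (forall i, inQ (x i)) -> hgrow w rho (fun _ => x).
  by move=> /fam [H hH]; exact: (hgrow_const rho1 hH).
have gz : hgrow w rho (fun k i => zk k i).
  have /boolp.choice [B hB] : forall u : 'I_n * 'I_n, exists B : R, forall k, ((Omega ^+ k) u.1 u.2)%:R <= B * rho ^+ k.
    move=> [i j]; have [B [k0 hB]] := hII i j.
    have s0 : 0 <= \sum_(k < k0) ((Omega ^+ k) i j)%:R :> R by apply: sumr_ge0.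
    (* The finitely many powers before [k0] are absorbed in the constant, since [rho ^+ k] is at
       least 1. *)
    exists (`|B| + \sum_(k < k0) ((Omega ^+ k) i j)%:R) => k; have r1 := rhoX_ge1 rho1 k.
    have r0 : 0 <= rho ^+ k by exact: le_trans ler01 r1.
    case: (leqP k0 k) => hk.
      apply: le_trans (hB k hk) _; rewrite ler_wpM2r //; apply: le_trans (ler_norm B) _; by rewrite lerDl.
    apply: le_trans (_ : \sum_(k < k0) ((Omega ^+ k) i j)%:R <= _).
      by rewrite (bigD1 (Ordinal hk)) //= lerDl; apply: sumr_ge0.
    rewrite mulrDl; apply: le_trans (_ : (\sum_(k < k0) ((Omega ^+ k) i j)%:R) * rho ^+ k <= _); last by rewrite lerDr mulr_ge0.
    by rewrite ler_peMr.
  have [H hH] := fam _ alpha inal.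
  have E k x : mmap1 (zk k) x = mmap1 alpha (iter k (mnm_act Omega) x) :> algC.
    by elim: k x => // k IH x; rewrite -zkE IH -iterSr.
  have hm k i : (mdeg (iter k (mnm_act Omega) U_(i)%MM))%:R <= (\sum_i \sum_j `|B (i, j)|) * rho ^+ k.
    have r0 : 0 <= rho ^+ k by exact: le_trans ler01 (rhoX_ge1 rho1 k).
    apply: le_trans (_ : (\sum_j `|B (i, j)|) * rho ^+ k <= _); last first.
      rewrite ler_wpM2r // [X in _ <= X](bigD1 i) //= lerDl; apply: sumr_ge0 => i' _; exact: sumr_ge0.
    rewrite mdegE natr_sum mulr_suml; apply: ler_sum => j _.
    rewrite mnm_act_exp (bigD1 i) //= mnm1E eqxx mul1n big1 ?addn0 => [|i' ni]; last by rewrite mnm1E eq_sym (negbTE ni).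
    by apply: le_trans (hB (i, j) k) _; rewrite ler_wpM2r // ler_norm.
  have := hgrow_mnm rho1 hH hm; apply: hgrow_sub => k i; exists i.
  by rewrite -[RHS]/(mmap1 alpha (iter k (mnm_act Omega) U_(i)%MM)) -E mmap1U.
have gpoly P : (forall k, inQ P@_k) -> hgrow w rho (fun k (_ : unit) => P.@[zk k]).
  move=> inP; have [H hH] := fam _ (fun k : 'X_{1..n < msize P} => P@_k) (fun k => inP k).
  exact: (hgrow_poly rho1 hH gz).
have gval x (y : nat -> algC) : (forall k, ratfun_value (be_ x) (zk k) (y k)) -> hgrow w rho (fun k (_ : unit) => y k).
  move=> hy; apply: (@hgrow_choose _ _ _ _ _ _ (reps x) (fun k pq => pq.1.@[zk k] * (pq.2.@[zk k])^-1)) => [pq pqr|k].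
    have g1 := gpoly pq.1 (fun k => incoef x pq _ k pqr (or_introl erefl)).
    have g2 := gpoly pq.2 (fun k => incoef x pq _ k pqr (or_intror erefl)).
    by have := hgrowM rho1 g1 (hgrow_inv w_ind rho1 g2); apply: hgrow_sub => k u; exists (tt, tt).
  exact: (hreps x _ _ (hy k)).
(* The partial sums and products exist from [k = 0] on, because the [b] and [e] are defined at every
   point of the orbit, including those outside the polydisc. *)
pose X := fix X k : forall i, 'I_(d i).+1 -> algC := fun i s =>
  if k is k'.+1 then \sum_u invmx (A i) s u * (X k' i u - bval k' i u) else 0.
pose Gk := fix Gk k (h0 : 'I_m) : algC := if k is k'.+1 then eval k' h0 * Gk k' h0 else 1.
pose sk k (x : vars m rr d) : algC := match x with inl u => X k (tag u) (tagged u) | inr (inl _) => k%:R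
    | inr (inr (inl j)) => at_ j ^+ k | inr (inr (inr h0)) => Gk k h0 end.
have gX i : hgrow w rho (fun k s => X k i s).
  have [H hH] := fam _ (fun _ : 'I_(d i).+1 => 0) (fun _ => in0).
  have gi := gcst _ (fun u : 'I_(d i).+1 * 'I_(d i).+1 => invmx (A i) u.1 u.2) (fun u => inv_in i u.1 u.2).
  have gni := gcst _ (fun u : 'I_(d i).+1 * 'I_(d i).+1 => - invmx (A i) u.1 u.2)
    (fun u => let: ex_intro y hy := inv_in i u.1 u.2 in ex_intro _ (- y) (etrans (rmorphN h y) (congr1 -%R hy))).
  have gb : hgrow w rho (fun k s => bval k i s) by apply: hgrow_fin => s; apply: (gval (ff i s)) => k; exact: bvalP.
  apply: (hgrow_aff rho1 hH gi (hgrow_lin rho1 gni gb)) => k s /=.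
  by rewrite -big_split; apply: eq_bigr => u _; rewrite mulNr mulrBr.
have [H0 hH0] := fam _ (fun _ : unit => 0) (fun _ => in0).
have [H1 hH1] := fam _ (fun _ : unit => 1) (fun _ => in1).
have g0 := gcst _ (fun _ : unit => 0) (fun _ => in0).
have g1 := gcst _ (fun _ : unit => 1) (fun _ => in1).
have gx : hgrow w rho (fun k (_ : unit) => k%:R).
  apply: (hgrow_aff rho1 hH0 (gcst _ (fun _ : unit * unit => 1) (fun _ => in1)) g1) => k u.
  by rewrite (big_pred1 tt) => [|[]//]; rewrite mul1r natr1.
have gy j : hgrow w rho (fun k (_ : unit) => at_ j ^+ k).
  apply: (hgrow_aff rho1 hH1 (gcst _ (fun _ : unit * unit => at_ j) (fun _ => inat j)) g0) => k u.
  by rewrite (big_pred1 tt) => [|[]//]; rewrite addr0 exprS.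
have gG h0 : hgrow w rho (fun k (_ : unit) => Gk k h0).
  have ge : hgrow w rho (fun k (_ : unit * unit) => eval k h0).
    by have := gval (inr h0) (eval^~ h0) (fun k => evalP k h0); apply: hgrow_sub => k u; exists tt.
  by apply: (hgrow_aff rho1 hH1 ge g0) => k u; rewrite (big_pred1 tt) => [|[]//]; rewrite addr0.
pose N := #|{: vars m rr d}|.
pose sv k (j : 'I_N) := sk k (vt (@vkey l m rr d) (vx m rr d) j).
have gs j : hgrow w rho (fun k (_ : unit) => sv k j).
  rewrite /sv; case: (vt _ _ j) => [[i s]|[[]|[j0|h0]]] /=; [|exact: gx|exact: gy|exact: gG].
  by have := gX i; apply: hgrow_sub => k u; exists s.
have zs : hgrow w rho (fun k (i : 'I_(n + N)) => match split i with inl j => zk k j | inr j => sv k j end).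
  apply: hgrow_fin => i; case: (split i) => j; last exact: gs.
  by have := gz; apply: hgrow_sub => k u; exists j.
pose ratQ : {rmorphism rat -> Q} := GRing.RMorphism.clone _ _ (in_alg Q) _.
have hratQ q : h (ratQ q) = ratr q by rewrite -[ratQ q]/(q%:A) alg_num_field fmorph_rat.
have char0 j : j`!%:R != 0 :> Q by rewrite -(fmorph_eq0 h) rmorph_nat pnatr_eq0 -lt0n fact_gt0.
have /boolp.choice [mu0 hmu] : forall i, exists Dd : nat -> int, a i ^+ T = (\prod_(j < size t) t`_j ^ Dd j) ^+ T.
  by move=> i; apply: hT; rewrite map_f ?mem_enum.
pose mu i (j : 'I_rr) := mu0 i j.
have T1Q : mmap (@cst Q n \o ratQ) (fun i : 'I_M => fQ (enum_val i)) tau <> 0.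
  move=> Z; apply: T1_neq0; have := congr1 (mpsmap h) Z; rewrite rmorph0 => <-.
  apply/esym; apply: (mpoly_rmorph_eq (A := rat) (f := mpsmap h \o mmap (@cst Q n \o ratQ) (fun i : 'I_M => fQ (enum_val i)))
    (g := mmap (@cst algC n \o @ratr algC) (fun i : 'I_M => fg (enum_val i)))) => [q|i] /=.
    by rewrite !mmapC /= /cst mpsmap_ofp map_mpolyC; congr (ofp _%:MP); exact: hratQ.
  by rewrite !mmapX !mmap1U hfQ.
have F0 := @Phi_series_neq0 Q n l m rr d char0 A' a' mu tau ratQ fQ T1Q.
apply: (@auxiliary_contradiction R Q algC h D w w_ind (hts R) C emb v hv v_nat rho n N M rho1 zk sv zs
  (Phi A' a' mu tau ratQ) (fun i => fQ (enum_val i)) F0 (fun k => (T %| k)%N) be (fun i => Bd (enum_val i)) (c / 2)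
  (fun j => ltW (be_gt0 j)) _ c2 _ _ _).
- by move=> i d'; have := hBd (enum_val i) d'; rewrite -hfQ.
- by exists K0 => k j; exact: tiny.
- exists K0 => k hk Tk; exists (fun i => Y (k, enum_val i)); split.
    by move=> i; have := mps_sum_tends (hY (k, enum_val i) (pdk k hk)); rewrite -hfQ.
  pose eh := GRing.RMorphism.clone _ _ (emb \o h) _.
  pose H := GRing.RMorphism.clone _ _ (mmap (mmap eh (emb \o sv k)) (fun i : 'I_M => Y (k, enum_val i))) _.
  change (H (Phi A' a' mu tau ratQ) = 0).
  have HCp q : H q%:MP = mmap eh (emb \o sv k) q by exact: mmapC.
  rewrite (@PhiE Q l m rr d char0 A' a' mu tau ratQ C H eh k (fun x => emb (sk k x))
    (fun x => Y (k, x)) (fun x => Y (0%N, x)) (fun i => emb (a i) ^+ k)).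
  + have -> : mmap (eh \o ratQ) (fun i : 'I_M => Y (0%N, enum_val i)) tau = 0; last by rewrite mulr0.
    by rewrite -[RHS]htau /mmap; apply: eq_bigr => x _; rewrite /= hratQ.
  + by move=> q; rewrite HCp; exact: mmapC.
  + by move=> x; rewrite HCp mmapX mmap1U /sv /= tvK.
  + by move=> x; rewrite [LHS]mmapX mmap1U enum_rankK.
  + by rewrite /= rmorph_nat.
  + move=> i /=.
    (* [T] divides [k], so raising to the power [k] removes the root of unity. *)
    have Ea : a i ^+ k = \prod_j (at_ j ^+ k) ^ mu i j.
      have [k' ->] := dvdnP Tk; rewrite mulnC exprM hmu -exprM -prodrXl; apply: eq_bigr => j _.
      by rewrite exprnP exprnP !exprz_exp mulrC.
    rewrite -rmorphXn Ea rmorph_prod -big_split /=; apply: eq_bigr => j _.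
    by rewrite -!rmorphXn /= (posp_negp _ (expf_neq0 k (at0 j))) rmorphM.
  + move=> i s.
    have X0 : X 0%N i =1 (fun _ => 0) by [].
    have rel := @linear_orbit algC n act zk zkE _ (fL i) (A i) (fun k s => bval k i s) (fun k s => X k i s) k s (hA_GL i)
      (fun k s => val_rel_ratfun (rf i s) (bvalP k i s)) X0 (fun _ _ => erefl).
    have hYk u : mps_sum v (mpsmap emb (iter k (sub act) (fL i u))) (emb \o zk 0%N) (Y (k, ff i u)).
      by apply: (mps_sum_iter zkE (j := 0%N)); exact: (hY (k, ff i u) (pdk k hk)).
    have := lin_val hv rel (hY (0%N, ff i s) halphaU) hYk; move/eqP; rewrite subr_eq => /eqP E.
    rewrite -[LHS]/(Y (0%N, ff i s)) E rmorphN rmorph_sum addrC -sumrB mulr_sumr; apply: eq_bigr => u _.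
    rewrite rmorphM -mulrBr mulrA; congr (_ * _).
    have EA : (A i ^+ k) s u = h ((A' i ^+ k) s u).
      have EAk j : map_mx h (A' i ^+ j) = A i ^+ j.
        elim: j => [|j IH]; first by rewrite !expr0; exact: map_mx1.
        rewrite !exprS -IH; have := map_mxM h (A' i) (A' i ^+ j); rewrite hA'; exact.
      by rewrite -EAk mxE.
    by rewrite EA (unip_pow (@A'_trig i) (@A'_diag i) (a'0 i)) mxE rmorphM rmorphXn ha' rmorphM rmorphXn.
  + move=> h0 /=; apply: (val_rel_sum_eq hv (@mult_orbit algC n act zk zkE (gL h0) (eval^~ h0) (Gk^~ h0) k
      (fun k => val_rel_ratfun (rg h0) (evalP k h0)) erefl (fun _ => erefl))).
      exact: (hY (0%N, inr h0) halphaU).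
    by apply: (mps_sum_iter zkE (j := 0%N)); exact: (hY (k, inr h0) (pdk k hk)).
move=> G G0 k1.
have Sx k : sk k.+1 (vx m rr d) = sk k (vx m rr d) + 1 by rewrite /= natr1.
have Sy k j : sk k.+1 (inr (inr (inl j))) = at_ j * sk k (inr (inr (inl j))) by rewrite /= exprS.
have Sy0 k j : sk k (inr (inr (inl j))) != 0 by rewrite /= expf_neq0.
have Sg0 k h0 : (0 <= k)%N -> sk k (inr (inr (inr h0))) != 0.
  by move=> _; elim: k => [|k IH] /=; rewrite ?oner_neq0 // mulf_neq0.
(* The second use of the criterion, inside [algC]: [inv] is false and the recursions hold by
   definition from the first step. *)
have [k [h1 h2 h3]] := nonvan algC (GRing.RMorphism.clone _ _ (@idfun algC) _) false sk 0%N T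
  (fun _ _ _ _ => erefl) Sx Sy (fun _ _ _ => erefl) Sy0 Sg0 T0 G G0 k1.
by exists k; split.
Qed.
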